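(* Let $\alpha>1$, $\beta\in\mathbb{C}$, and let $F_{\alpha,\beta}$ be the entire function defined in the context. For $0<\theta<\pi-\pi/\alpha$ put $\kappa=1/(\alpha-1)$, $\varphi=\theta-\frac{\pi}{2}+\frac{\pi}{2\alpha}$, $h(\zeta)=\mathrm{e}^{\mathrm{i}\varphi}\zeta-\zeta^\alpha$, $\zeta_0=\alpha^{-\kappa}\mathrm{e}^{\mathrm{i}\kappa\varphi}$, $\eta_{1,\theta}=\frac{\pi}{4}-\frac{\alpha-2\beta-2}{2(\alpha-1)}\theta$ and $\eta_{2,\theta}=\frac{\alpha}{\alpha-1}\theta-\frac{\pi}{2}$. Then, as $R\to\infty$, $$ \begin{aligned} F_{\alpha,\beta}(R\mathrm{e}^{\mathrm{i}\theta})\sim{}&\mathrm{e}^{\mathrm{i}((\beta+1)\pi/(2\alpha)+\pi/2)}R^{\frac{\beta+1-\alpha/2}{\alpha-1}}\exp\bigl(\mathrm{e}^{\mathrm{i}\eta_{2,\theta}}\alpha^{-1/(\alpha-1)}(1-1/\alpha)R^{\frac{\alpha}{\alpha-1}}\bigr)\\ &\times\sum_{n=0}^\infty\frac{(-1)^n\Gamma(n+1/2)\,\bigl\langle\delta^{(2n)}\bigl(\sqrt{h(\zeta)-h(\zeta_0)}\bigr),\zeta^\beta\bigr\rangle}{(2n)!\,R^{\frac{n\alpha}{\alpha-1}}}, \end{aligned} $$ and this asymptotic expansion holds uniformly for $\theta$ in closed subintervals of $(0,\pi-\pi/\alpha)$ (i.e. on closed subsectors). The first order approximation is $$ F_{\alpha,\beta}(R\mathrm{e}^{\mathrm{i}\theta})\sim\mathrm{e}^{\mathrm{i}\eta_{1,\theta}}\sqrt{\frac{2\pi}{\alpha-1}}\;\alpha^{\frac{-1/2-\beta}{\alpha-1}}R^{\frac{\beta+1-\alpha/2}{\alpha-1}}\exp\bigl(\mathrm{e}^{\mathrm{i}\eta_{2,\theta}}\alpha^{-1/(\alpha-1)}(1-1/\alpha)R^{\frac{\alpha}{\alpha-1}}\bigr).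 $$
   Context: For $\operatorname{Im}z<0$, $$ \begin{aligned} F_{\alpha,\beta}(z)=\mathrm{F.p.}\int_0^\infty t^\beta \mathrm{e}^{\mathrm{i}t^\alpha-\mathrm{i}zt}\,\mathrm{d}t:={}&\int_1^\infty t^\beta \mathrm{e}^{\mathrm{i}t^\alpha-\mathrm{i}zt}\,\mathrm{d}t+\int_0^1t^\beta\Bigl(\mathrm{e}^{\mathrm{i}t^\alpha-\mathrm{i}zt}-\sum_{m+n\alpha+\operatorname{Re}\beta\le-1}\frac{\mathrm{i}^n(-\mathrm{i}z)^m}{n!\,m!}t^{n\alpha+m}\Bigr)\mathrm{d}t\\ &+\sum'_{m+n\alpha+\operatorname{Re}\beta\le-1}\frac{\mathrm{i}^n(-\mathrm{i}z)^m}{n!\,m!}\,\frac{1}{\beta+n\alpha+m+1}, \end{aligned} $$ where the sums run over integers $m,n\ge0$ satisfying the condition and $\sum'$ omits terms with $\beta+n\alpha+m+1=0$ (Hadamard finite part; the ordinary integral if $\operatorname{Re}\beta>-1$). This function extends to an entire function, also denoted $F_{\alpha,\beta}$. Complex powers $\zeta^\alpha,\zeta^\beta$ use the principal branch on $\mathbb{C}\setminus(-\infty,0]$. The point $\zeta_0$ is a simple zero of $h'$; near $\zeta_0$, $\psi(\zeta)=\sqrt{h(\zeta)-h(\zeta_0)}$ denotes the holomorphic branch of the square root for which $\operatorname{Im}\psi$ is increasing along the ray $\{r\mathrm{e}^{\mathrm{i}\kappa\varphi}:r>0\}$ (in the direction of increasing $r$) near $\zeta_0$. It is locally invertible there with $\psi(\zeta_0)=0$,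 and $$\bigl\langle\delta^{(2n)}(\psi(\zeta)),\zeta^\beta\bigr\rangle:=\frac{\mathrm{d}^{2n}}{\mathrm{d}\omega^{2n}}\left.\left(\frac{(\psi^{-1}(\omega))^\beta}{\psi'(\psi^{-1}(\omega))}\right)\right|_{\omega=0}.$$ The first relation $\sim$ is that of an asymptotic series: for each $N\ge0$, after dividing both sides by the factor in front of the series, the left side minus the sum of the terms $n<N$ is $O(R^{-N\alpha/(\alpha-1)})$. In the first order approximation, $\sim$ means that the quotient tends to $1$. *)

(* Defs.v *)
From Stdlib Require Export Factorial Reals List.
From Coquelicot Require Export Coquelicot.
Open Scope R_scope.

Definition Cexp (z : C) : C :=
  (RtoC (exp (Re z)) * (cos (Im z), sin (Im z)))%C.

(* Principal argument, with values in (-PI, PI] for z <> 0. *)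
Definition Carg (z : C) : R :=
  if Rle_dec 0 (Im z) then acos (Re z / Cmod z) else - acos (Re z / Cmod z).

Definition Clog (z : C) : C := (ln (Cmod z), Carg z).

(* Principal branch of z^w with complex exponent w (junk value at z = 0);
   Coquelicot's own [Cpow] has exponents in nat. *)
Definition Cpower (z w : C) : C := Cexp (w * Clog z)%C.

Definition holomorphic_at (f : C -> C) (z : C) : Prop :=
  @ex_derive C_AbsRing C_NormedModule f z.

Definition holomorphic_near (f : C -> C) (z : C) : Prop :=
  @locally C_UniformSpace z (holomorphic_at f).

Definition entire (f : C -> C) : Prop := forall z : C, holomorphic_at f z.

Definition C_derive_n (n : nat) (f : C -> C) : C -> C := Nat.iter n C_derive f.

(* Strict upper bound n < N, so that the empty sum is available (Coquelicot's
   sum_n has N + 1 terms). *)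
Definition Csum (u : nat -> C) (N : nat) : C :=
  fold_right (fun n s => (u n + s)%C) (RtoC 0) (seq 0 N).

(* Euler's integral; meant for x > 0. *)
Definition Gamma (x : R) : R :=
  @RInt_gen R_CompleteNormedModule (fun t => Rpower t (x - 1) * exp (- t))
    (at_right 0) (Rbar_locally p_infty).

Section FinitePart.

Variables (alpha : R) (beta : C) (z : C).

(* Sum of u m n over all pairs (m, n) with m + n alpha + Re beta <= -1.  For
   alpha >= 1 such pairs satisfy m, n <= -1 - Re beta < up (-1 - Re beta), so
   that the truncation at K discards nothing. *)
Definition singular_sum (u : nat -> nat -> C) : C :=
  let K := Z.to_nat (up (-1 - Re beta)) in
  Csum (fun m => Csum (fun n =>
    if Rle_dec (INR m + INR n * alpha + Re beta) (-1)
    then u m n else RtoC 0) K) K.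

Definition taylor_coef (m n : nat) : C :=
  (Ci ^ n * (- (Ci * z)) ^ m / RtoC (INR (fact n) * INR (fact m)))%C.

Definition phase (t : R) : C :=
  Cexp (Ci * RtoC (Rpower t alpha) - Ci * z * RtoC t)%C.

Definition tail_integrand (t : R) : C := (Cpower (RtoC t) beta * phase t)%C.

Definition regularized_integrand (t : R) : C :=
  (Cpower (RtoC t) beta *
   (phase t - singular_sum (fun m n =>
      taylor_coef m n * RtoC (Rpower t (INR n * alpha + INR m)))))%C.

Definition exponent (m n : nat) : C :=
  (beta + RtoC (INR n * alpha) + RtoC (INR m) + 1)%C.

Definition finite_part_integral : C :=
  (@RInt_gen C_R_CompleteNormedModule tail_integrand
     (at_point 1) (Rbar_locally p_infty)
   + @RInt_gen C_R_CompleteNormedModule regularized_integrand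
     (at_right 0) (at_point 1)
   + singular_sum (fun m n =>
       if Ceq_dec (exponent m n) (RtoC 0) then RtoC 0
       else taylor_coef m n / exponent m n))%C.

End FinitePart.

(* F is the function F_{alpha,beta}: by the identity theorem there is at most
   one such F. *)
Definition is_entire_extension (alpha : R) (beta : C) (F : C -> C) : Prop :=
  entire F /\
  forall z : C, Im z < 0 -> F z = finite_part_integral alpha beta z.

Section Saddle.

Variables (alpha theta : R).

Definition kappa : R := 1 / (alpha - 1).

Definition phi : R := theta - PI / 2 + PI / (2 * alpha).

Definition h (zeta : C) : C :=
  (Cexp (Ci * RtoC phi) * zeta - Cpower zeta (RtoC alpha))%C.

Definition ray (r : R) : C := (RtoC r * Cexp (Ci * RtoC (kappa * phi)))%C.

Definition zeta0 : C := ray (Rpower alpha (- kappa)).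

(* psi is, near zeta0, the branch of sqrt (h zeta - h zeta0) whose imaginary
   part increases along the ray through zeta0; psi is arbitrary elsewhere. *)
Definition is_sqrt_branch (psi : C -> C) : Prop :=
  holomorphic_near psi zeta0 /\
  @locally C_UniformSpace zeta0
    (fun zeta => (psi zeta * psi zeta)%C = (h zeta - h zeta0)%C) /\
  exists eps : posreal, forall r1 r2 : R,
    Rpower alpha (- kappa) - eps < r1 -> r1 < r2 ->
    r2 < Rpower alpha (- kappa) + eps ->
    Im (psi (ray r1)) < Im (psi (ray r2)).

(* psi_inv is, near 0 = psi zeta0, the inverse of psi near zeta0. *)
Definition is_local_inverse (psi psi_inv : C -> C) : Prop :=
  holomorphic_near psi_inv (RtoC 0) /\
  @locally C_UniformSpace zeta0 (fun zeta => psi_inv (psi zeta) = zeta) /\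
  @locally C_UniformSpace (RtoC 0) (fun w => psi (psi_inv w) = w).

End Saddle.

(* The pairing < delta^(2n) (psi zeta), zeta^beta >; C_derive is Coquelicot's
   total complex derivative, correct for holomorphic functions. *)
Definition delta_pairing (beta : C) (psi psi_inv : C -> C) (n : nat) : C :=
  C_derive_n (2 * n)
    (fun w => (Cpower (psi_inv w) beta / C_derive psi (psi_inv w))%C) (RtoC 0).

Definition eta1 (alpha : R) (beta : C) (theta : R) : C :=
  (RtoC (PI / 4) -
   (RtoC alpha - 2 * beta - 2) / (2 * RtoC (alpha - 1)) * RtoC theta)%C.

Definition eta2 (alpha theta : R) : R := alpha / (alpha - 1) * theta - PI / 2.

(* R^((beta+1-alpha/2)/(alpha-1))
   * exp (e^(i eta2) alpha^(-1/(alpha-1)) (1-1/alpha) R^(alpha/(alpha-1))) *)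
Definition growth_factor (alpha : R) (beta : C) (theta r : R) : C :=
  (Cpower (RtoC r) ((beta + 1 - RtoC (alpha / 2)) / RtoC (alpha - 1)) *
   Cexp (Cexp (Ci * RtoC (eta2 alpha theta)) *
         RtoC (Rpower alpha (- (1 / (alpha - 1))) * (1 - 1 / alpha) *
               Rpower r (alpha / (alpha - 1)))))%C.

Definition series_prefactor (alpha : R) (beta : C) (theta r : R) : C :=
  (Cexp (Ci * ((beta + 1) * RtoC (PI / (2 * alpha)) + RtoC (PI / 2))) *
   growth_factor alpha beta theta r)%C.

Definition series_term (alpha : R) (beta : C) (psi psi_inv : C -> C)
    (r : R) (n : nat) : C :=
  (RtoC ((-1) ^ n * Gamma (INR n + 1 / 2)) * delta_pairing beta psi psi_inv n /
   RtoC (INR (fact (2 * n)) * Rpower r (INR n * alpha / (alpha - 1))))%C.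

Definition first_order (alpha : R) (beta : C) (theta r : R) : C :=
  (Cexp (Ci * eta1 alpha beta theta) * RtoC (sqrt (2 * PI / (alpha - 1))) *
   Cpower (RtoC alpha) ((- RtoC (1 / 2) - beta) / RtoC (alpha - 1)) *
   growth_factor alpha beta theta r)%C.

(* Main.v *)
Require Import Defs.
From Stdlib Require Import Lra Lia Psatz ZArith.
Open Scope R_scope.

(** In the variable v = log t the integrand t^beta exp(i t^alpha - i z t) dt becomes an
    entire function of v ([log_integrand]), and turning the ray of integration by an
    angle chi is a vertical translation by i chi. For Im z < 0 and 0 < alpha chi < PI
    Goursat's theorem on long rectangles ([tail_rotation]) moves the tail of the
    integral to the ray of angle chi, so that the finite part is the sum of a
    regularised integral over (0,1], finitely many residual terms, an integral over the
    arc from angle 0 to chi, and the integral over the ray from e^(i chi) to infinity.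
    On that ray exp(i t^alpha) decays faster than every exponential, so the sum makes
    sense for every z, is entire ([continuation_entire]), and by the identity theorem is
    F on the whole plane. The first three are O(exp(C |z|)) ([extension_decomposition]),
    which is negligible against the asserted growth exp(c R^(alpha/(alpha-1))), since
    alpha/(alpha-1) > 1.

    For z = R e^(i theta) take chi = kappa theta and scale t = R^kappa s e^(i chi): the
    exponent becomes lambda e^(i eta2) (s - s^alpha), where lambda = R^(alpha/(alpha-1))
    ([log_integrand_on_ray]). What remains is a Laplace integral over real s with the
    real profile s - s^alpha, maximal at rho0 = alpha^(-kappa), and a large parameter
    lambda e^(i eta2) whose real part is at least c0 lambda, uniformly for theta in
    [a,b] ([eta2_uniform]). Substituting u = q(s), with q the square root of (rho0 -
    rho0^alpha) - (s - s^alpha), turns it into the integral of K(u) exp(- lambda e^(i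
    eta2) u^2) with K(q(s)) q'(s) = s^beta. Taylor expansion of K at 0 and Gaussian
    moments give the series with coefficients Gamma(n+1/2) K^(2n)(0) / (2n)!
    ([laplace_symmetric], [laplace_expansion]), with constants that do not depend on
    theta.

    It remains to recognise the pairings with delta^(2n). Since h(e^(i kappa phi) w) = e^(i
    eta2) (w - w^alpha) ([h_rotate]), the prescribed branch satisfies psi(e^(i kappa
    phi) w) = i e^(i eta2 / 2) q(w) ([psi_from_q]); the monotonicity of Im psi along the
    ray fixes the sign. So every pairing is an explicit unimodular constant times
    rot_factor times the derivative K^(2n)(0) of one fixed amplitude
    ([delta_pairing_transfer]), and the stated prefactor times rot_factor times
    sqrt(lambda e^(i eta2)) is exactly the value pulled out at the saddle
    ([prefactor_saddle]). The leading coefficient follows from q'(rho0)^2 = (alpha-1) /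
    (2 rho0) ([q_slope]) and Gamma(1/2) = sqrt(PI).

    The complex analysis that this needs is developed below for rectangles and circles:
    Goursat's theorem, Cauchy's formula with its Taylor remainder, the identity theorem
    and the holomorphy of locally uniform limits. *)

(** * Continuity of complex-valued functions *)

(** The uniform structure of [C] as a ring with absolute value, whose balls are discs;
    the competing product structure has squares as balls. *)
Notation CT := (AbsRing_UniformSpace C_AbsRing).
Definition cont {U : UniformSpace} (f : U -> C) (x : U) : Prop :=
  @continuous U CT f x.

Lemma ball_CT (x y : C) (e : R) : @ball CT x e y <-> Cmod (y - x)%C < e.
Proof. reflexivity. Qed.

Section ContAlgebra.
Context {U : UniformSpace}.
Implicit Types f g : U -> C.

Lemma cont_const (c : C) x : cont (fun _ : U => c) x.
Proof. apply (@continuous_const U CT). Qed.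

Lemma cont_plus f g x : cont f x -> cont g x -> cont (fun t => f t + g t)%C x.
Proof.
intros; apply (@continuous_plus U C_AbsRing (AbsRing_NormedModule C_AbsRing)); assumption.
Qed.

Lemma cont_opp f x : cont f x -> cont (fun t => - f t)%C x.
Proof.
intros; apply (@continuous_opp U C_AbsRing (AbsRing_NormedModule C_AbsRing)); assumption.
Qed.

Lemma cont_minus f g x : cont f x -> cont g x -> cont (fun t => f t - g t)%C x.
Proof. intros; apply cont_plus; [|apply cont_opp]; assumption. Qed.

Lemma cont_mult f g x : cont f x -> cont g x -> cont (fun t => f t * g t)%C x.
Proof.
intros; apply (@continuous_mult U C_AbsRing); assumption.
Qed.

Lemma cont_comp (g : C -> C) f x :
  @cont CT g (f x) -> cont f x -> cont (fun t => g (f t)) x.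
Proof. intros Hg Hf; exact (@continuous_comp U CT CT f g x Hf Hg). Qed.

Lemma cont_ext_loc f g x : locally x (fun t => f t = g t) -> cont f x -> cont g x.
Proof.
intros H Hf.
apply (@continuous_ext_loc U CT g f x); [|exact Hf].
revert H; apply filter_imp; intros t Ht; exact Ht.
Qed.

Lemma cont_ext f g x : (forall t, f t = g t) -> cont f x -> cont g x.
Proof. intros H; apply cont_ext_loc; apply filter_forall; exact H. Qed.
End ContAlgebra.

Lemma cont_id (z : C) : @cont CT (fun w => w) z.
Proof. apply (@continuous_id CT). Qed.

Lemma ccont_eps (f : C -> C) z : @cont CT f z <->
  forall eps, 0 < eps -> exists d, 0 < d /\ forall w, Cmod (w - z)%C < d ->
    Cmod (f w - f z)%C < eps.
Proof.
unfold cont, continuous. rewrite (filterlim_locally (U := CT) f (f z)).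
split.
- intros H eps He. destruct (H (mkposreal eps He)) as [d Hd].
  exists d; split; [apply cond_pos|]. intros w Hw. exact (Hd w Hw).
- intros H eps. destruct (H eps (cond_pos eps)) as [d [Hd H']].
  exists (mkposreal d Hd). intros w Hw; exact (H' w Hw).
Qed.

Lemma RtoC_neq0 x : x <> 0 -> RtoC x <> RtoC 0.
Proof. intros H E. apply H, RtoC_inj, E. Qed.

Lemma Cmod_sub_self (c : C) : Cmod (c - c)%C = 0.
Proof. unfold Cminus. rewrite Cplus_opp_r. apply Cmod_0. Qed.

Lemma Cmod_Ci : Cmod Ci = 1.
Proof. transitivity (sqrt 1); [unfold Cmod, Ci; simpl; f_equal; ring|apply sqrt_1]. Qed.

Lemma Cmod_le_sum (z : C) : Cmod z <= Rabs (Re z) + Rabs (Im z).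
Proof.
destruct z as [x y]; simpl.
replace (x, y) with (RtoC x + Ci * RtoC y)%C
  by (apply injective_projections; simpl; ring).
eapply Rle_trans; [apply Cmod_triangle|].
rewrite Cmod_mult, !Cmod_R.
rewrite Cmod_Ci. lra.
Qed.

Lemma im_le_Cmod (z : C) : Rabs (Im z) <= Cmod z.
Proof. eapply Rle_trans; [|apply Rmax_Cmod]. apply Rmax_r. Qed.

Lemma ballC_CT (z w : C) (e : R) : Cmod (w - z)%C < e -> @ball C_UniformSpace z e w.
Proof. intros H; exact (C_NormedModule_mixin_compat1 z w e H). Qed.

Lemma cont_C {U : UniformSpace} (f : U -> C) x :
  cont f x <-> @continuous U C_UniformSpace f x.
Proof.
unfold cont, continuous.
rewrite (filterlim_locally (U := CT) f (f x)).
rewrite (filterlim_locally (U := C_UniformSpace) f (f x)).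
split; intros H eps.
- generalize (H eps). apply filter_imp. intros t Ht; apply ballC_CT; exact Ht.
- assert (He : 0 < eps / 2) by (generalize (cond_pos eps); lra).
  generalize (H (mkposreal _ He)). apply filter_imp. intros t Ht.
  destruct Ht as [H1 H2]. apply ball_CT.
  eapply Rle_lt_trans; [apply Cmod_le_sum|].
  unfold ball in H1, H2; simpl in H1, H2; unfold AbsRing_ball, abs, minus, plus, opp in H1, H2;
    simpl in H1, H2.
  destruct (f t) as [a b], (f x) as [c d]; simpl in *. unfold Rminus in *. lra.
Qed.

Lemma cont_re {U : UniformSpace} (f : U -> C) x :
  cont f x -> continuous (fun t => Re (f t)) x.
Proof.
intros H. apply cont_C in H.
exact (@continuous_comp U C_UniformSpace R_UniformSpace f fst x H (continuous_fst _ _)).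
Qed.

Lemma cont_im {U : UniformSpace} (f : U -> C) x :
  cont f x -> continuous (fun t => Im (f t)) x.
Proof.
intros H. apply cont_C in H.
exact (@continuous_comp U C_UniformSpace R_UniformSpace f snd x H (continuous_snd _ _)).
Qed.

Lemma cont_pair {U : UniformSpace} (f g : U -> R) x :
  continuous f x -> continuous g x -> cont (fun t => (f t, g t)) x.
Proof.
intros Hf Hg. apply cont_C.
apply (continuous_comp_2 f g (fun a b => (a, b)) x Hf Hg).
apply continuous_ext with (f := fun p => p); [intros [a b]; reflexivity|].
apply continuous_id.
Qed.

Lemma cont_RtoC {U : UniformSpace} (f : U -> R) x :
  continuous f x -> cont (fun t => RtoC (f t)) x.
Proof. intros H; apply cont_pair; [exact H|apply continuous_const]. Qed.

(** * The complex exponential *)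

Lemma Cexp_plus a b : Cexp (a + b)%C = (Cexp a * Cexp b)%C.
Proof.
unfold Cexp. destruct a as [a1 a2], b as [b1 b2]; simpl.
rewrite exp_plus, cos_plus, sin_plus.
unfold Cmult, RtoC; simpl. f_equal; ring.
Qed.

Lemma Cexp_R (x : R) : Cexp (RtoC x) = RtoC (exp x).
Proof. unfold Cexp; simpl. rewrite cos_0, sin_0. unfold Cmult, RtoC; simpl. f_equal; ring. Qed.

Lemma Cexp_0 : Cexp (RtoC 0) = RtoC 1.
Proof. rewrite Cexp_R, exp_0; reflexivity. Qed.

Lemma Cmod_Cexp z : Cmod (Cexp z) = exp (Re z).
Proof.
unfold Cexp. rewrite Cmod_mult, Cmod_R, Rabs_pos_eq by (left; apply exp_pos).
unfold Cmod; simpl.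
replace (cos (Im z) * (cos (Im z) * 1) + sin (Im z) * (sin (Im z) * 1)) with 1.
- rewrite sqrt_1; ring.
- generalize (sin2_cos2 (Im z)); unfold Rsqr; lra.
Qed.

Lemma Cexp_neq0 z : Cexp z <> RtoC 0.
Proof.
apply Cmod_gt_0. rewrite Cmod_Cexp. apply exp_pos.
Qed.

Lemma Cexp_opp z : Cexp (- z)%C = (/ Cexp z)%C.
Proof.
assert (H : (Cexp z * Cexp (- z) = 1)%C).
{ rewrite <- Cexp_plus. replace (z + - z)%C with (RtoC 0) by ring. apply Cexp_0. }
assert (Hz := Cexp_neq0 z).
replace (/ Cexp z)%C with (/ Cexp z * (Cexp z * Cexp (- z)))%C; [field; auto|rewrite H; ring].
Qed.

Lemma Cexp_Ci (t : R) : Cexp (Ci * RtoC t)%C = (cos t, sin t).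
Proof.
unfold Cexp; simpl.
replace (0 * t - 1 * 0) with 0 by ring. replace (0 * 0 + 1 * t) with t by ring.
rewrite exp_0. unfold Cmult, RtoC; simpl; f_equal; ring.
Qed.

Lemma cont_Cexp {U : UniformSpace} (f : U -> C) x : cont f x -> cont (fun t => Cexp (f t)) x.
Proof.
intros H. unfold Cexp. apply cont_mult.
- apply cont_RtoC. apply (continuous_comp (fun t => Re (f t)) exp); [apply cont_re, H|].
  apply continuity_pt_filterlim, derivable_continuous_pt, derivable_pt_exp.
- apply cont_pair.
  + apply (continuous_comp (fun t => Im (f t)) cos); [apply cont_im, H|].
    apply continuity_pt_filterlim, continuity_cos.
  + apply (continuous_comp (fun t => Im (f t)) sin); [apply cont_im, H|].
    apply continuity_pt_filterlim, continuity_sin.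
Qed.

Lemma ccont_inv (z : C) : z <> RtoC 0 -> @cont CT (fun w => / w)%C z.
Proof.
intros Hz. apply ccont_eps. intros eps He.
assert (Hm : 0 < Cmod z) by (apply Cmod_gt_0; exact Hz).
exists (Rmin (Cmod z / 2) (eps * (Cmod z * Cmod z) / 2)). split.
{ apply Rmin_glb_lt; [lra|]. apply Rdiv_lt_0_compat; [|lra]. apply Rmult_lt_0_compat; [lra|nra]. }
intros w Hw.
assert (H1 : Cmod (w - z)%C < Cmod z / 2) by (eapply Rlt_le_trans; [exact Hw|apply Rmin_l]).
assert (H2 : Cmod (w - z)%C < eps * (Cmod z * Cmod z) / 2) by (eapply Rlt_le_trans;
  [exact Hw|apply Rmin_r]).
assert (H3 : Cmod z / 2 < Cmod w).
{ assert (Cmod z <= Cmod w + Cmod (w - z)%C); [|lra].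
  rewrite <- (Cmod_opp (w - z)). replace z with (w + - (w - z))%C at 1 by ring.
    apply Cmod_triangle. }
assert (Hw0 : w <> RtoC 0) by (apply Cmod_gt_0; lra).
replace (/ w - / z)%C with (- (w - z) / (w * z))%C by (field; auto).
rewrite Cmod_div by (apply Cmult_neq_0; auto).
rewrite Cmod_opp, Cmod_mult.
assert (Hp : 0 < Cmod w * Cmod z) by (apply Rmult_lt_0_compat; lra).
apply Rmult_lt_reg_r with (Cmod w * Cmod z); [exact Hp|].
unfold Rdiv. rewrite Rmult_assoc, Rinv_l by (apply Rgt_not_eq; exact Hp).
rewrite Rmult_1_r. eapply Rlt_trans; [exact H2|].
replace (eps * (Cmod z * Cmod z) / 2) with (eps * (Cmod z / 2 * Cmod z)) by field.
apply Rmult_lt_compat_l; auto.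
Qed.

Lemma cont_inv {U : UniformSpace} (f : U -> C) x : f x <> RtoC 0 -> cont f x ->
  cont (fun t => / f t)%C x.
Proof. intros H1 H2. apply (cont_comp Cinv); [apply ccont_inv; exact H1|exact H2]. Qed.

Lemma cont_div {U : UniformSpace} (f g : U -> C) x : g x <> RtoC 0 -> cont f x -> cont g x ->
  cont (fun t => f t / g t)%C x.
Proof. intros; apply cont_mult; [|apply cont_inv]; assumption. Qed.

Lemma cont_pow {U : UniformSpace} (f : U -> C) n x : cont f x -> cont (fun t => f t ^ n)%C x.
Proof. intros H; induction n; simpl; [apply cont_const|apply cont_mult; assumption]. Qed.

(** The uniform structure of the domain is read off the goal: left to unification it
    would become the product structure on [C]. *)
Ltac cont_tac :=
  repeat match goal with
  | H : @cont ?U ?f ?x |- @cont ?U ?f ?x => exact H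
  | |- @cont ?U (fun _ => ?c) _ => apply (@cont_const U)
  | |- @cont _ (fun x => x) _ => apply cont_id
  | |- @cont ?U (fun x => Cplus (@?f x) (@?g x)) _ => apply (@cont_plus U f g)
  | |- @cont ?U (fun x => Cminus (@?f x) (@?g x)) _ => apply (@cont_minus U f g)
  | |- @cont ?U (fun x => Copp (@?f x)) _ => apply (@cont_opp U f)
  | |- @cont ?U (fun x => Cmult (@?f x) (@?g x)) _ => apply (@cont_mult U f g)
  | |- @cont ?U (fun x => Cdiv (@?f x) (@?g x)) _ => apply (@cont_div U f g)
  | |- @cont ?U (fun x => Cinv (@?f x)) _ => apply (@cont_inv U f)
  | |- @cont ?U (fun x => Cpow (@?f x) ?n) _ => apply (@cont_pow U f n)
  | |- @cont ?U (fun x => Cexp (@?f x)) _ => apply (@cont_Cexp U f)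
  end.

(** * Complex and real derivatives *)

(** Caratheodory's form of complex differentiability: the difference quotient extends
    continuously to z. It makes the product and chain rules algebraic, and the quotient
    p itself is the function to which Goursat's theorem is applied in the proof of
    Cauchy's formula. *)
Definition cder (f : C -> C) (z l : C) : Prop :=
  exists p : C -> C, @cont CT p z /\ p z = l /\ forall w, (f w - f z = p w * (w - z))%C.

Lemma cder_eps f z l : cder f z l <->
  forall eps, 0 < eps -> exists d, 0 < d /\ forall w, Cmod (w - z)%C < d ->
    Cmod (f w - f z - l * (w - z))%C <= eps * Cmod (w - z)%C.
Proof.
split.
- intros [p [Hc [Hp H]]] eps He.
  destruct (proj1 (ccont_eps p z) Hc eps He) as [d [Hd H']].
  exists d; split; auto. intros w Hw. rewrite H, <- Hp.
  replace (p w * (w - z) - p z * (w - z))%C with ((p w - p z) * (w - z))%C by ring.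
  rewrite Cmod_mult. apply Rmult_le_compat_r; [apply Cmod_ge_0|]. left; auto.
- intros H.
  exists (fun w => if Ceq_dec w z then l else ((f w - f z) / (w - z))%C).
  split; [|split].
  + apply ccont_eps. intros eps He. destruct (H (eps / 2)) as [d [Hd H']]; [lra|].
    exists d; split; auto. intros w Hw.
    destruct (Ceq_dec z z) as [_|]; [|congruence].
    destruct (Ceq_dec w z) as [->|Hn].
    * rewrite Cmod_sub_self. lra.
    * assert (Hwz : (w - z)%C <> RtoC 0) by (apply Cminus_eq_contra; auto).
      replace ((f w - f z) / (w - z) - l)%C with ((f w - f z - l * (w - z)) / (w - z))%C
        by (field; auto).
      rewrite Cmod_div by auto.
      assert (Hp : 0 < Cmod (w - z)%C) by (apply Cmod_gt_0; auto).
      apply Rle_lt_trans with (eps / 2); [|lra].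
      apply Rmult_le_reg_r with (Cmod (w - z)%C); auto.
      unfold Rdiv at 1. rewrite Rmult_assoc, Rinv_l by lra. rewrite Rmult_1_r. auto.
  + destruct (Ceq_dec z z); congruence.
  + intros w. destruct (Ceq_dec w z) as [->|Hn]; [ring|].
    field. apply Cminus_eq_contra; auto.
Qed.

Lemma is_derive_cder f z l : @is_derive C_AbsRing C_NormedModule f z l <-> cder f z l.
Proof.
rewrite cder_eps. split.
- intros [_ H] eps He.
  assert (Hz : @is_filter_lim (AbsRing_UniformSpace C_AbsRing) (@locally (AbsRing_UniformSpace
    C_AbsRing) z) z) by (intros P HP; exact HP).
  specialize (H z Hz (mkposreal eps He)). destruct H as [d Hd].
  exists d; split; [apply cond_pos|]. intros w Hw.
  specialize (Hd w Hw). unfold norm in Hd; simpl in Hd.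
  change (minus w z) with (w - z)%C in Hd.
  replace (f w - f z - l * (w - z))%C with (f w - f z - (w - z) * l)%C by ring. exact Hd.
- intros H. split; [apply is_linear_scal_l|].
  intros x Hx.
  assert (Hx' : z = x).
  { apply (is_filter_lim_locally_unique (V := AbsRing_NormedModule C_AbsRing)). exact Hx. }
  subst x. intros eps. destruct (H eps (cond_pos eps)) as [d [Hd H']].
  exists (mkposreal d Hd). intros w Hw. specialize (H' w Hw).
  unfold norm; simpl.
  replace (f w - f z - l * (w - z))%C with (f w - f z - (w - z) * l)%C in H' by ring. exact H'.
Qed.

Lemma hol_cder f z : holomorphic_at f z <-> exists l, cder f z l.
Proof.
unfold holomorphic_at, ex_derive. split; intros [l H]; exists l; apply is_derive_cder; exact H.
Qed.

Lemma C_derive_cder f z l : cder f z l -> C_derive f z = l.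
Proof. intros H. apply is_C_derive_unique, is_derive_cder, H. Qed.

Lemma cder_cont f z l : cder f z l -> @cont CT f z.
Proof.
intros [p [Hc [Hp H]]].
eapply (cont_ext (U := CT) (fun w => f z + p w * (w - z))%C).
- intros w. rewrite <- H. ring.
- cont_tac.
Qed.

Lemma cder_const c z : cder (fun _ => c) z (RtoC 0).
Proof. exists (fun _ => RtoC 0). split; [apply (@cont_const CT)|split;[reflexivity|intros; ring]].
  Qed.

Lemma cder_id z : cder (fun w => w) z (RtoC 1).
Proof. exists (fun _ => RtoC 1). split; [apply (@cont_const CT)|split;[reflexivity|intros; ring]].
  Qed.

Lemma cder_plus f g z l m : cder f z l -> cder g z m -> cder (fun w => f w + g w)%C z (l + m)%C.
Proof.
intros [p [Hc [Hp H]]] [q [Hd [Hq H']]]. exists (fun w => p w + q w)%C.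
split; [cont_tac|split; [congruence|]].
intros w. replace (f w + g w - (f z + g z))%C with ((f w - f z) + (g w - g z))%C by ring.
rewrite H, H'. ring.
Qed.

Lemma cder_mult f g z l m : cder f z l -> cder g z m -> cder (fun w => f w * g w)%C z (l * g z + f
  z * m)%C.
Proof.
intros Hf [q [Hd [Hq H']]]. assert (Hcf := cder_cont _ _ _ Hf).
destruct Hf as [p [Hc [Hp H]]]. exists (fun w => p w * g z + f w * q w)%C.
split; [cont_tac|split; [congruence|]].
intros w. replace (f w * g w - (f z * g z))%C with ((f w - f z) * g z + f w * (g w - g z))%C by
  ring.
rewrite H, H'. ring.
Qed.

Lemma cder_comp f g z l m : cder f (g z) l -> cder g z m -> cder (fun w => f (g w)) z (l * m)%C.
Proof.
intros [p [Hc [Hp H]]] Hg. assert (Hcg := cder_cont _ _ _ Hg).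
destruct Hg as [q [Hd [Hq H']]].
exists (fun w => p (g w) * q w)%C. split; [|split; [congruence|]].
- apply (@cont_mult CT); auto. apply (@cont_comp CT p); auto.
- intros w. rewrite H, H'. ring.
Qed.

Lemma cder_inv z : z <> RtoC 0 -> cder Cinv z (- / (z * z))%C.
Proof.
intros Hz. apply cder_eps. intros eps He.
assert (Hm : 0 < Cmod z) by (apply Cmod_gt_0; exact Hz).
assert (Hc : @cont CT (fun w => / z * (/ z - / w))%C z).
{ cont_tac; auto. }
destruct (proj1 (ccont_eps _ _) Hc eps He) as [d [Hd H]].
exists (Rmin d (Cmod z)). split; [apply Rmin_glb_lt; auto|].
intros w Hw.
assert (H1 : Cmod (w - z)%C < d) by (eapply Rlt_le_trans; [exact Hw|apply Rmin_l]).
assert (H2 : Cmod (w - z)%C < Cmod z) by (eapply Rlt_le_trans; [exact Hw|apply Rmin_r]).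
assert (Hw0 : w <> RtoC 0).
{ intros ->. replace (0 - z)%C with (- z)%C in H2 by ring. rewrite Cmod_opp in H2. lra. }
replace (/ w - / z - - / (z * z) * (w - z))%C with ((/ z * (/ z - / w) - / z * (/ z - / z)) * (w -
  z))%C
  by (field; auto).
rewrite Cmod_mult. apply Rmult_le_compat_r; [apply Cmod_ge_0|]. left. apply H; auto.
Qed.

Lemma cder_eq f z l l' : cder f z l -> l = l' -> cder f z l'.
Proof. intros H <-; exact H. Qed.

Lemma cder_ext f g z l : (forall w, f w = g w) -> cder f z l -> cder g z l.
Proof. intros H [p [Hc [Hp H']]]. exists p. split; [exact Hc|split; [exact Hp|]]. intros w.
  rewrite <- !H. auto. Qed.

Lemma cder_ext_loc f g z l d : 0 < d -> (forall w, Cmod (w - z)%C < d -> f w = g w) ->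
  cder f z l -> cder g z l.
Proof.
intros Hd H Hf. apply cder_eps. intros eps He.
destruct (proj1 (cder_eps _ _ _) Hf eps He) as [e [He' H']].
exists (Rmin d e). split; [apply Rmin_glb_lt; auto|]. intros w Hw.
rewrite <- !H.
- apply H'. eapply Rlt_le_trans; [exact Hw|apply Rmin_r].
- rewrite Cmod_sub_self. auto.
- eapply Rlt_le_trans; [exact Hw|apply Rmin_l].
Qed.

Lemma cder_scal c f z l : cder f z l -> cder (fun w => c * f w)%C z (c * l)%C.
Proof.
intros H. eapply cder_eq; [apply cder_mult; [apply cder_const|exact H]|]. cbv beta; ring.
Qed.

Lemma cder_minus f g z l m : cder f z l -> cder g z m -> cder (fun w => f w - g w)%C z (l - m)%C.
Proof.
intros Hf Hg. apply (cder_ext (fun w => f w + (- (1)) * g w)%C); [intros; ring|].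
eapply cder_eq; [apply cder_plus; [exact Hf|apply cder_scal; exact Hg]|]. ring.
Qed.

Lemma cder_pow n z : cder (fun w => w ^ n)%C z (RtoC (INR n) * z ^ pred n)%C.
Proof.
induction n.
- simpl. eapply cder_eq; [apply cder_const|]. ring.
- eapply cder_ext; [intros w; symmetry; apply Cpow_S|].
  eapply cder_eq; [apply cder_mult; [apply cder_id|exact IHn]|].
  rewrite S_INR, RtoC_plus. destruct n; [simpl; ring|]. simpl pred. rewrite Cpow_S. ring.
Qed.

Lemma cder_unique f z l l' : cder f z l -> cder f z l' -> l = l'.
Proof. intros H H'. apply C_derive_cder in H, H'. congruence. Qed.

Definition rder (f : R -> C) (t : R) (l : C) : Prop :=
  @is_derive R_AbsRing C_R_NormedModule f t l.

Lemma norm_C_R (z : C) : @norm R_AbsRing C_R_NormedModule z = Cmod z.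
Proof.
unfold norm; simpl. unfold prod_norm, Cmod, norm; simpl. unfold abs; simpl.
f_equal. rewrite !Rmult_1_r. unfold Rabs. destruct (Rcase_abs _), (Rcase_abs _); ring.
Qed.

Lemma rder_eps f t l : rder f t l <->
  forall eps, 0 < eps -> exists d, 0 < d /\ forall s, Rabs (s - t) < d ->
    Cmod (f s - f t - l * RtoC (s - t))%C <= eps * Rabs (s - t).
Proof.
assert (E : forall s, minus (minus (f s) (f t)) (scal (minus s t) l) = (f s - f t - l * RtoC (s -
  t))%C).
{ intros s. rewrite scal_R_Cmult. apply injective_projections;
  unfold minus, plus, opp; simpl; unfold plus, opp; simpl; ring. }
split.
- intros [_ H] eps He.
  specialize (H t (fun P HP => HP) (mkposreal eps He)). destruct H as [d Hd].
  exists d; split; [apply cond_pos|]. intros s Hs. specialize (Hd s Hs).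
  rewrite norm_C_R in Hd. eapply Rle_trans; [|exact Hd]. right; f_equal; symmetry; apply E.
- intros H. split; [apply is_linear_scal_l|].
  intros x Hx.
  assert (Hx' : t = x) by (apply (is_filter_lim_locally_unique (V := R_NormedModule)); exact Hx).
  subst x. intros eps. destruct (H eps (cond_pos eps)) as [d [Hd H']].
  exists (mkposreal d Hd). intros s Hs. rewrite norm_C_R. eapply Rle_trans; [|apply H'; exact Hs].
    right; f_equal; apply E.
Qed.

Lemma rder_comp f g t l m : cder f (g t) l -> rder g t m -> rder (fun s => f (g s)) t (l * m)%C.
Proof.
intros Hf Hg. apply rder_eps. intros eps He.
set (B := Cmod m + 1). assert (HB : 0 < B) by (unfold B; generalize (Cmod_ge_0 m); lra).
set (A := Cmod l + 1). assert (HA : 0 < A) by (unfold A; generalize (Cmod_ge_0 l); lra).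
destruct (proj1 (cder_eps _ _ _) Hf (eps / (2 * B))) as [d1 [Hd1 H1]].
{ apply Rdiv_lt_0_compat; lra. }
destruct (proj1 (rder_eps _ _ _) Hg (Rmin 1 (eps / (2 * A)))) as [d2 [Hd2 H2]].
{ apply Rmin_glb_lt; [lra|]. apply Rdiv_lt_0_compat; lra. }
exists (Rmin d2 (d1 / B)). split; [apply Rmin_glb_lt; auto; apply Rdiv_lt_0_compat; lra|].
intros s Hs.
assert (Hs1 : Rabs (s - t) < d2) by (eapply Rlt_le_trans; [exact Hs|apply Rmin_l]).
assert (Hs2 : Rabs (s - t) < d1 / B) by (eapply Rlt_le_trans; [exact Hs|apply Rmin_r]).
specialize (H2 s Hs1). set (r := Rabs (s - t)) in *.
assert (Hr : 0 <= r) by apply Rabs_pos.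
assert (H3 : Cmod (g s - g t - m * RtoC (s - t))%C <= 1 * r).
{ eapply Rle_trans; [exact H2|]. apply Rmult_le_compat_r; auto. apply Rmin_l. }
assert (H4 : Cmod (g s - g t - m * RtoC (s - t))%C <= eps / (2 * A) * r).
{ eapply Rle_trans; [exact H2|]. apply Rmult_le_compat_r; auto. apply Rmin_r. }
assert (H5 : Cmod (g s - g t)%C <= B * r).
{ replace (g s - g t)%C with ((g s - g t - m * RtoC (s - t)) + m * RtoC (s - t))%C by ring.
  eapply Rle_trans; [apply Cmod_triangle|]. rewrite Cmod_mult, Cmod_R. fold r. unfold B; nra. }
assert (H6 : Cmod (g s - g t)%C < d1).
{ eapply Rle_lt_trans; [exact H5|]. apply Rmult_lt_reg_r with (/ B); [apply Rinv_0_lt_compat;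
  auto|].
  replace (B * r * / B) with r by (field; lra). exact Hs2. }
specialize (H1 _ H6).
replace (f (g s) - f (g t) - l * m * RtoC (s - t))%C with
  ((f (g s) - f (g t) - l * (g s - g t)) + l * (g s - g t - m * RtoC (s - t)))%C by ring.
eapply Rle_trans; [apply Cmod_triangle|]. rewrite Cmod_mult.
assert (K1 : eps / (2 * B) * Cmod (g s - g t)%C <= eps / 2 * r).
{ replace (eps / 2 * r) with (eps / (2 * B) * (B * r)) by (field; lra).
  apply Rmult_le_compat_l; auto. left; apply Rdiv_lt_0_compat; lra. }
assert (K2 : Cmod l * Cmod (g s - g t - m * RtoC (s - t))%C <= eps / 2 * r).
{ replace (eps / 2 * r) with (A * (eps / (2 * A) * r)) by (field; lra).
  apply Rmult_le_compat; auto; try apply Cmod_ge_0. unfold A; lra. }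
lra.
Qed.

Lemma rder_lin (a b : C) t : rder (fun s => a + RtoC s * b)%C t b.
Proof.
apply rder_eps. intros eps He. exists 1; split; [lra|]. intros s _.
replace (a + RtoC s * b - (a + RtoC t * b) - b * RtoC (s - t))%C with (RtoC 0).
- rewrite Cmod_0. apply Rmult_le_pos; [lra|apply Rabs_pos].
- rewrite RtoC_minus; ring.
Qed.

Lemma rder_ext f g t l : (forall s, f s = g s) -> rder f t l -> rder g t l.
Proof. intros H. apply is_derive_ext. exact H. Qed.

Lemma rder_RtoC t : rder RtoC t (RtoC 1).
Proof.
apply rder_ext with (fun s => 0 + RtoC s * 1)%C; [intros; ring|]. apply rder_lin.
Qed.

Lemma rder_cont f t l : rder f t l -> @cont R_UniformSpace f t.
Proof.
intros H. apply cont_C. apply (@ex_derive_continuous R_AbsRing C_R_NormedModule). exists l; exact H.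
Qed.

(** * Integrals of complex-valued functions of a real variable *)

Definition rcont (f : R -> C) (t : R) : Prop := @cont R_UniformSpace f t.
Definition rcont_plus := @cont_plus R_UniformSpace.
Definition rcont_minus := @cont_minus R_UniformSpace.
Definition rcont_opp := @cont_opp R_UniformSpace.
Definition rcont_mult := @cont_mult R_UniformSpace.
Definition rcont_pow := @cont_pow R_UniformSpace.
Definition rcont_inv := @cont_inv R_UniformSpace.
Definition rcont_Cexp := @cont_Cexp R_UniformSpace.
Definition rcont_comp := @cont_comp R_UniformSpace.

Ltac smooth :=
  apply (ex_derive_continuous (V := R_NormedModule)); auto_derive; solve [auto | lra].

Definition contI (f : R -> C) (a b : R) : Prop :=
  forall t, Rmin a b <= t <= Rmax a b -> rcont f t.
Definition CInt (f : R -> C) (a b : R) : C :=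
  @RInt C_R_CompleteNormedModule f a b.
Definition is_CInt (f : R -> C) (a b : R) (l : C) : Prop :=
  @is_RInt C_R_NormedModule f a b l.

Lemma contI_forall f a b : (forall t, rcont f t) -> contI f a b.
Proof. intros H t _; apply H. Qed.

Lemma contI_swap f a b : contI f a b -> contI f b a.
Proof. unfold contI. rewrite Rmin_comm, Rmax_comm. auto. Qed.

Lemma CInt_ex f a b : contI f a b -> @ex_RInt C_R_NormedModule f a b.
Proof.
intros H. apply (@ex_RInt_continuous C_R_CompleteNormedModule).
intros t Ht. apply cont_C. exact (H t Ht).
Qed.

Lemma CInt_correct f a b : contI f a b -> is_CInt f a b (CInt f a b).
Proof. intros H. apply (@RInt_correct C_R_CompleteNormedModule), CInt_ex, H. Qed.

Lemma CInt_unique f a b l : is_CInt f a b l -> CInt f a b = l.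
Proof. apply (@is_RInt_unique C_R_CompleteNormedModule). Qed.

Lemma CInt_ext f g a b : (forall t, Rmin a b < t < Rmax a b -> f t = g t) ->
  CInt f a b = CInt g a b.
Proof. apply (@RInt_ext C_R_CompleteNormedModule). Qed.

Lemma CInt_Chasles f a b c : contI f a b -> contI f b c ->
  (CInt f a b + CInt f b c)%C = CInt f a c.
Proof. intros H1 H2. apply (@RInt_Chasles C_R_CompleteNormedModule); apply CInt_ex; assumption. Qed.

Lemma CInt_point f a : CInt f a a = RtoC 0.
Proof. apply (@RInt_point C_R_CompleteNormedModule). Qed.

Lemma CInt_plus f g a b : contI f a b -> contI g a b ->
  CInt (fun t => f t + g t)%C a b = (CInt f a b + CInt g a b)%C.
Proof. intros H1 H2. apply (@RInt_plus C_R_CompleteNormedModule); apply CInt_ex; assumption. Qed.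

Lemma is_CInt_scal f a b l k : is_CInt f a b l -> is_CInt (fun t => k * f t)%C a b (k * l)%C.
Proof.
intros H.
assert (H1 := is_RInt_fct_extend_fst f a b l H).
assert (H2 := is_RInt_fct_extend_snd f a b l H).
destruct k as [k1 k2], l as [l1 l2]. simpl in H1, H2.
apply (is_RInt_fct_extend_pair (U := R_NormedModule) (V := R_NormedModule)); simpl.
- apply (is_RInt_minus (V := R_NormedModule)); apply (is_RInt_scal (V := R_NormedModule));
  assumption.
- apply (is_RInt_plus (V := R_NormedModule)); apply (is_RInt_scal (V := R_NormedModule));
  assumption.
Qed.

Lemma CInt_scal f a b k : contI f a b -> CInt (fun t => k * f t)%C a b = (k * CInt f a b)%C.
Proof. intros H. apply CInt_unique, is_CInt_scal, CInt_correct, H. Qed.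

Lemma CInt_minus f g a b : contI f a b -> contI g a b ->
  CInt (fun t => f t - g t)%C a b = (CInt f a b - CInt g a b)%C.
Proof. intros H1 H2. apply (@RInt_minus C_R_CompleteNormedModule); apply CInt_ex; assumption. Qed.

Lemma CInt_const c a b : CInt (fun _ => c) a b = (RtoC (b - a) * c)%C.
Proof.
rewrite <- scal_R_Cmult. apply (@RInt_const C_R_CompleteNormedModule).
Qed.

Lemma CInt_swap f a b : contI f a b -> CInt f b a = (- CInt f a b)%C.
Proof.
intros H. assert (K := CInt_Chasles f a b a H (contI_swap _ _ _ H)).
rewrite CInt_point in K.
replace (CInt f b a) with (- CInt f a b + (CInt f a b + CInt f b a))%C by ring.
rewrite K; ring.
Qed.

Lemma CInt_le f (g : R -> R) a b : a <= b -> contI f a b ->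
  (forall t, a <= t <= b -> Cmod (f t) <= g t) -> ex_RInt g a b ->
  Cmod (CInt f a b) <= RInt g a b.
Proof.
intros Hab Hf Hle Hg. rewrite <- norm_C_R.
apply (norm_RInt_le (V := C_R_NormedModule) f g a b); auto.
- intros t Ht. rewrite norm_C_R. auto.
- apply CInt_correct; auto.
- apply (RInt_correct (V := R_CompleteNormedModule)); auto.
Qed.

Lemma CInt_bound f a b M : contI f a b ->
  (forall t, Rmin a b <= t <= Rmax a b -> Cmod (f t) <= M) ->
  Cmod (CInt f a b) <= M * Rabs (b - a).
Proof.
assert (W : forall a b, a <= b -> contI f a b -> (forall t, Rmin a b <= t <= Rmax a b ->
  Cmod (f t) <= M) ->
  Cmod (CInt f a b) <= M * Rabs (b - a)).
{ clear a b. intros a b Hab Hf H. rewrite Rabs_pos_eq by lra.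
  rewrite Rmult_comm, <- norm_C_R.
  apply (norm_RInt_le_const (V := C_R_NormedModule) f a b); auto.
  - intros t Ht. rewrite norm_C_R. apply H. rewrite Rmin_left, Rmax_right; auto.
  - apply CInt_correct; auto. }
intros Hf H. destruct (Rle_dec a b) as [L|L]; [auto|].
rewrite CInt_swap by (apply contI_swap; exact Hf).
rewrite Cmod_opp, <- Rabs_Ropp, Ropp_minus_distr.
apply W; [lra|apply contI_swap; auto|].
intros t. rewrite Rmin_comm, Rmax_comm. apply H.
Qed.

Lemma Rmin_max_in a b : Rmin a b <= a <= Rmax a b /\ Rmin a b <= b <= Rmax a b.
Proof. generalize (Rmin_l a b) (Rmin_r a b) (Rmax_l a b) (Rmax_r a b); lra. Qed.

Lemma rcont_Cmod f t : rcont f t -> continuous (fun s => Cmod (f s)) t.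
Proof.
intros H. apply cont_C in H.
assert (H2 := @continuous_comp R_UniformSpace C_R_NormedModule R_UniformSpace f norm t H
  (@filterlim_norm R_AbsRing C_R_NormedModule (f t))).
apply continuous_ext with (2 := H2). intros s. apply norm_C_R.
Qed.

Lemma contI_bounded f a b : contI f a b -> exists M, 0 < M /\ forall t,
  Rmin a b <= t <= Rmax a b -> Cmod (f t) <= M.
Proof.
intros H.
destruct (continuity_ab_maj (fun t => Cmod (f t)) (Rmin a b) (Rmax a b)) as [m [Hm _]].
- generalize (Rmin_max_in a b); lra.
- intros t Ht. apply continuity_pt_filterlim. apply rcont_Cmod, H, Ht.
- exists (Cmod (f m) + 1). split; [generalize (Cmod_ge_0 (f m)); lra|].
  intros t Ht. specialize (Hm t Ht). lra.
Qed.

(** The form in which line integrals are evaluated: a primitive composed with the path. *)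
Lemma CInt_FTC f df a b : (forall t, Rmin a b <= t <= Rmax a b -> rder f t (df t)) ->
  contI df a b -> CInt df a b = (f b - f a)%C.
Proof.
intros H Hc. apply CInt_unique.
apply (@is_RInt_derive C_R_CompleteNormedModule f df a b); auto.
intros t Ht. apply cont_C. apply Hc; auto.
Qed.

Lemma CInt_comp f (g dg : R -> R) a b :
  (forall t, Rmin a b <= t <= Rmax a b -> rcont f (g t)) ->
  (forall t, Rmin a b <= t <= Rmax a b -> is_derive g t (dg t) /\ continuous dg t) ->
  CInt f (g a) (g b) = CInt (fun t => RtoC (dg t) * f (g t))%C a b.
Proof.
intros H1 H2. symmetry.
rewrite (CInt_ext _ (fun t => scal (dg t) (f (g t) : C_R_NormedModule))).
2:{ intros t _. symmetry. apply scal_R_Cmult. }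
apply CInt_unique.
apply (@is_RInt_comp C_R_CompleteNormedModule f g dg a b); auto.
intros t Ht. apply cont_C. apply H1; auto.
Qed.

Lemma is_CInt_R (f : R -> R) a b l : is_RInt f a b l -> is_CInt (fun t => RtoC (f t)) a b (RtoC l).
Proof.
intros H. apply (is_RInt_fct_extend_pair (U := R_NormedModule) (V := R_NormedModule)); simpl; auto.
replace 0 with (scal (b - a) 0) at 1; [apply (is_RInt_const (V := R_NormedModule))|].
unfold scal; simpl; unfold mult; simpl; ring.
Qed.

(** * Taylor remainders of the exponential *)

Lemma rcont_lin (a b : C) t : rcont (fun s => a + RtoC s * b)%C t.
Proof. apply (rder_cont _ _ b), rder_lin. Qed.

Lemma rcont_RtoC t : rcont RtoC t.
Proof. apply (rder_cont _ _ (RtoC 1)), rder_RtoC. Qed.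

Lemma rder_Cexp_line z t : rder (fun s => Cexp (RtoC s * z)) t (z * Cexp (RtoC t * z))%C.
Proof.
assert (Dre : forall a b t, is_derive (fun s => exp (s * a) * cos (s * b)) t (a * (exp (t * a) *
  cos (t * b)) - b * (exp (t * a) * sin (t * b)))).
{ intros a b s. auto_derive; [auto|]. ring. }
assert (Dim : forall a b t, is_derive (fun s => exp (s * a) * sin (s * b)) t (a * (exp (t * a) *
  sin (t * b)) + b * (exp (t * a) * cos (t * b)))).
{ intros a b s. auto_derive; [auto|]. ring. }
destruct z as [a b].
assert (E : forall s, Cexp (RtoC s * (a, b)) = (exp (s * a) * cos (s * b),
  exp (s * a) * sin (s * b))).
{ intros s. unfold Cexp, Re, Im; simpl.
  replace (s * a - 0 * b) with (s * a) by ring. replace (s * b + 0 * a) with (s * b) by ring.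
  unfold Cmult, RtoC; simpl; f_equal; ring. }
apply rder_ext with (fun s => (exp (s * a) * cos (s * b), exp (s * a) * sin (s * b))).
{ intros s; symmetry; apply E. }
rewrite E.
apply rder_eps. intros eps He.
assert (He2 : 0 < eps / 2) by lra.
destruct (Dre a b t) as [_ H1]. specialize (H1 t (fun P HP => HP) (mkposreal _ He2)).
destruct (Dim a b t) as [_ H2]. specialize (H2 t (fun P HP => HP) (mkposreal _ He2)).
destruct H1 as [d1 H1], H2 as [d2 H2].
exists (Rmin d1 d2). split; [apply Rmin_glb_lt; apply cond_pos|].
intros s Hs.
specialize (H1 s (Rlt_le_trans _ _ _ Hs (Rmin_l _ _))).
specialize (H2 s (Rlt_le_trans _ _ _ Hs (Rmin_r _ _))).
eapply Rle_trans; [apply Cmod_le_sum|].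
unfold norm, minus, plus, opp, scal in H1, H2; simpl in H1, H2; unfold abs, mult in H1, H2;
  simpl in H1, H2.
replace (eps * Rabs (s - t)) with (eps / 2 * Rabs (s - t) + eps / 2 * Rabs (s - t)) by field.
apply Rplus_le_compat.
- eapply Rle_trans; [|exact H1]. right. f_equal. simpl. ring.
- eapply Rle_trans; [|exact H2]. right. f_equal. simpl. ring.
Qed.

Definition Cexp_rem (N : nat) (z : C) : C :=
  (Cexp z - Csum (fun n => z ^ n / RtoC (INR (fact n))) N)%C.

Lemma Csum_S u N : Csum u (S N) = (Csum u N + u N)%C.
Proof.
unfold Csum. rewrite seq_S, fold_right_app. simpl.
generalize (seq 0 N). induction l; simpl; [ring|]. rewrite IHl. ring.
Qed.

Lemma Csum_0 u : Csum u 0 = RtoC 0.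
Proof. reflexivity. Qed.

Lemma Csum_ext u v N : (forall n, (n < N)%nat -> u n = v n) -> Csum u N = Csum v N.
Proof. intros H. induction N; [reflexivity|]. rewrite !Csum_S, IHN, H; auto. Qed.

Lemma RtoC_fact_neq0 n : RtoC (INR (fact n)) <> RtoC 0.
Proof. intros H. apply RtoC_inj in H. exact (INR_fact_neq_0 n H). Qed.

Lemma fact_frac n : (RtoC (INR (S n)) / RtoC (INR (fact (S n))) = / RtoC (INR (fact n)))%C.
Proof.
rewrite fact_simpl, mult_INR, RtoC_mult. field.
split; [apply RtoC_fact_neq0|]. intros H; apply RtoC_inj in H. apply (not_0_INR (S n)); auto.
Qed.

Lemma rder_plus f g t l m : rder f t l -> rder g t m -> rder (fun s => f s + g s)%C t (l + m)%C.
Proof. intros; apply (@is_derive_plus R_AbsRing C_R_NormedModule); assumption. Qed.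
Lemma rder_minus f g t l m : rder f t l -> rder g t m -> rder (fun s => f s - g s)%C t (l - m)%C.
Proof. intros; apply (@is_derive_minus R_AbsRing C_R_NormedModule); assumption. Qed.
Lemma rder_eq f t l l' : rder f t l -> l = l' -> rder f t l'.
Proof. intros H <-; exact H. Qed.
Lemma rder_const c t : rder (fun _ => c) t (RtoC 0).
Proof. apply rder_ext with (fun s => c + RtoC s * 0)%C; [intros; ring|apply rder_lin]. Qed.

Lemma rder_rem N z t : rder (fun s => Cexp_rem (S N) (RtoC s * z)) t (z * Cexp_rem N (RtoC t *
  z))%C.
Proof.
unfold Cexp_rem.
eapply rder_eq; [apply rder_minus with (m := (z * Csum (fun n => (RtoC t * z) ^ n / RtoC (INR (fact
  n))) N)%C); [apply rder_Cexp_line|]|].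
2: ring.
induction N.
- rewrite Csum_0. apply rder_ext with (fun _ => RtoC 1).
  { intros s. rewrite Csum_S, Csum_0. simpl. field. }
  eapply rder_eq; [apply rder_const|]. ring.
- apply rder_ext with (fun s => Csum (fun n => (RtoC s * z) ^ n / RtoC (INR (fact n))) (S N) +
  (RtoC s * z) ^ (S N) / RtoC (INR (fact (S N))))%C.
  { intros s. symmetry. apply Csum_S. }
  rewrite (Csum_S _ N).
  eapply rder_eq; [apply rder_plus; [exact IHN|]|].
  + apply (rder_comp (fun w => w ^ (S N) / RtoC (INR (fact (S N))))%C (fun s => RtoC s * z)%C).
    * apply cder_mult; [apply cder_pow|apply cder_const].
    * apply rder_ext with (fun s => 0 + RtoC s * z)%C; [intros; ring|apply rder_lin].
  + simpl pred. cbv beta.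
    assert (K := fact_frac N). unfold Cdiv in *.
    replace (RtoC (INR (S N)) * (RtoC t * z) ^ N * / RtoC (INR (fact (S N))))%C with ((RtoC (INR (S
      N)) * / RtoC (INR (fact (S N)))) * (RtoC t * z) ^ N)%C by ring.
    rewrite K. ring.
Qed.

Lemma rcont_rem N z t : rcont (fun s => Cexp_rem N (RtoC s * z)) t.
Proof.
destruct N.
- unfold Cexp_rem. apply (rder_cont _ _ (z * Cexp (RtoC t * z))).
  apply rder_ext with (fun s => Cexp (RtoC s * z)); [intros; rewrite Csum_0; ring|].
    apply rder_Cexp_line.
- apply (rder_cont _ _ _ (rder_rem N z t)).
Qed.

(** Induction on the order: by the fundamental theorem the remainder of order N + 1 at z
    is the integral over [0,1] of z times the remainder of order N at t z. *)
Lemma Cexp_rem_bound N z : Cmod (Cexp_rem N z) <= Cmod z ^ N * exp (Cmod z).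
Proof.
revert z. induction N; intros z.
- unfold Cexp_rem. rewrite Csum_0. replace (Cexp z - 0)%C with (Cexp z) by ring.
  rewrite Cmod_Cexp. simpl.
  rewrite Rmult_1_l.
  assert (Re z <= Cmod z) by (eapply Rle_trans; [apply Rle_abs|apply re_le_Cmod]).
  destruct H as [H|H]; [left; apply exp_increasing; auto|right; rewrite H; auto].
- assert (E : Cexp_rem (S N) z = CInt (fun t => z * Cexp_rem N (RtoC t * z))%C 0 1).
  { rewrite (CInt_FTC (fun s => Cexp_rem (S N) (RtoC s * z))).
    - rewrite Cmult_1_l, Cmult_0_l.
      replace (Cexp_rem (S N) 0) with (RtoC 0); [cbv beta; ring|].
      unfold Cexp_rem. rewrite Cexp_0. clear IHN.
      replace (Csum (fun n => 0 ^ n / RtoC (INR (fact n)))%C (S N)) with (RtoC 1); [ring|].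
      induction N.
      + rewrite Csum_S, Csum_0. simpl. field.
      + rewrite Csum_S, <- IHN. rewrite Cpow_S. unfold Cdiv. ring.
    - intros t _. apply rder_rem.
    - intros t _. apply rcont_mult; [apply cont_const|apply rcont_rem]. }
  rewrite E.
  eapply Rle_trans; [apply (CInt_bound _ 0 1 (Cmod z * (Cmod z ^ N * exp (Cmod z))))|].
  + intros t _. apply rcont_mult; [apply cont_const|apply rcont_rem].
  + intros t. rewrite Rmin_left, Rmax_right by lra. intros Ht. rewrite Cmod_mult.
    apply Rmult_le_compat_l; [apply Cmod_ge_0|].
    eapply Rle_trans; [apply IHN|]. rewrite Cmod_mult, Cmod_R, Rabs_pos_eq by lra.
    assert (Hz := Cmod_ge_0 z).
    assert (L : t * Cmod z <= Cmod z) by nra.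
    apply Rmult_le_compat; [apply pow_le; nra|left; apply exp_pos|apply pow_incr; split; nra|].
    destruct L as [L|L]; [left; apply exp_increasing; auto|right; rewrite L; auto].
  + rewrite Rminus_0_r, Rabs_R1. simpl. lra.
Qed.

Lemma exp_le x y : x <= y -> exp x <= exp y.
Proof. intros [H|H]; [left; apply exp_increasing; auto|right; rewrite H; auto]. Qed.

Lemma cder_Cexp z : cder Cexp z (Cexp z).
Proof.
assert (H0 : cder Cexp 0 1).
{ apply cder_eps. intros eps He.
  exists (Rmin 1 (eps / exp 1)). split; [apply Rmin_glb_lt; [lra|apply Rdiv_lt_0_compat;
    [lra|apply exp_pos]]|].
  intros w Hw. replace (w - 0)%C with w in * by ring.
  assert (H1 : Cmod w < 1) by (eapply Rlt_le_trans; [exact Hw|apply Rmin_l]).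
  assert (H2 : Cmod w < eps / exp 1) by (eapply Rlt_le_trans; [exact Hw|apply Rmin_r]).
  replace (Cexp w - Cexp 0 - 1 * w)%C with (Cexp_rem 2 w).
  2:{ unfold Cexp_rem. rewrite !Csum_S, Csum_0, Cexp_0. simpl. field. }
  eapply Rle_trans; [apply Cexp_rem_bound|]. simpl.
  assert (Hp := Cmod_ge_0 w).
  assert (He1 := exp_pos 1).
  assert (H3 : exp (Cmod w) <= exp 1) by (apply exp_le; lra).
  assert (H4 : Cmod w * exp 1 <= eps).
  { apply Rmult_le_reg_r with (/ exp 1); [apply Rinv_0_lt_compat; auto|].
    rewrite Rmult_assoc, Rinv_r by lra. unfold Rdiv in H2. lra. }
  replace (Cmod w * (Cmod w * 1) * exp (Cmod w)) with (Cmod w * exp (Cmod w) * Cmod w) by ring.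
  apply Rmult_le_compat_r; auto.
  eapply Rle_trans; [|exact H4]. apply Rmult_le_compat_l; auto. }
apply cder_ext with (fun w => Cexp z * Cexp (w - z))%C.
{ intros w. rewrite <- Cexp_plus. f_equal; ring. }
eapply cder_eq.
- apply cder_scal. apply (cder_comp Cexp (fun w => w - z)%C z 1 (1 - 0)).
  + replace (z - z)%C with (RtoC 0) by ring. exact H0.
  + apply cder_minus; [apply cder_id|apply cder_const].
- ring.
Qed.

(** * Integrals over rectangles and Goursat's theorem *)

Definition square (c : C) (r : R) (z : C) : Prop :=
  Rabs (Re z - Re c) < r /\ Rabs (Im z - Im c) < r.

Definition hol_on (S : C -> Prop) (f : C -> C) : Prop :=
  forall z, S z -> exists l, cder f z l.

Definition rect_int (f : C -> C) (x1 x2 y1 y2 : R) : C :=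
  (CInt (fun s => f (s, y1)) x1 x2 + Ci * CInt (fun s => f (x2, s)) y1 y2
   - CInt (fun s => f (s, y2)) x1 x2 - Ci * CInt (fun s => f (x1, s)) y1 y2)%C.

(** Both orders of the endpoints are admitted, so that rectangles can be subtracted from
    each other without case distinctions. *)
Definition rect_in (S : C -> Prop) (x1 x2 y1 y2 : R) : Prop :=
  forall x y, Rmin x1 x2 <= x <= Rmax x1 x2 -> Rmin y1 y2 <= y <= Rmax y1 y2 -> S (x, y).

Lemma pair_hor s y : (s, y) = ((RtoC 0 + Ci * RtoC y) + RtoC s * RtoC 1)%C.
Proof. apply injective_projections; simpl; ring. Qed.
Lemma pair_ver x s : (x, s) = (RtoC x + RtoC s * Ci)%C.
Proof. apply injective_projections; simpl; ring. Qed.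

Lemma rder_hor y t : rder (fun s => (s, y)) t (RtoC 1).
Proof. apply (rder_ext (fun s => (RtoC 0 + Ci * RtoC y) + RtoC s * RtoC 1)%C); [intros; symmetry;
  apply pair_hor|apply rder_lin]. Qed.
Lemma rder_ver x t : rder (fun s => (x, s)) t Ci.
Proof. apply (rder_ext (fun s => RtoC x + RtoC s * Ci)%C); [intros; symmetry;
  apply pair_ver|apply rder_lin]. Qed.

Lemma rcont_hor f y t : @cont CT f (t, y) -> rcont (fun s => f (s, y)) t.
Proof. intros H. apply (rcont_comp f (fun s => (s, y))); auto.
  apply (rder_cont _ _ _ (rder_hor y t)). Qed.
Lemma rcont_ver f x t : @cont CT f (x, t) -> rcont (fun s => f (x, s)) t.
Proof. intros H. apply (rcont_comp f (fun s => (x, s))); auto.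
  apply (rder_cont _ _ _ (rder_ver x t)). Qed.

Definition rect_cont f x1 x2 y1 y2 := rect_in (fun z => @cont CT f z) x1 x2 y1 y2.

Lemma contI_hor f x1 x2 y1 y2 y : rect_cont f x1 x2 y1 y2 -> Rmin y1 y2 <= y <= Rmax y1 y2 ->
  contI (fun s => f (s, y)) x1 x2.
Proof. intros H Hy t Ht. apply rcont_hor, H; auto. Qed.
Lemma contI_ver f x1 x2 y1 y2 x : rect_cont f x1 x2 y1 y2 -> Rmin x1 x2 <= x <= Rmax x1 x2 ->
  contI (fun s => f (x, s)) y1 y2.
Proof. intros H Hy t Ht. apply rcont_ver, H; auto. Qed.

Lemma rect_cont_sides f x1 x2 y1 y2 : rect_cont f x1 x2 y1 y2 ->
  contI (fun s => f (s, y1)) x1 x2 /\ contI (fun s => f (s, y2)) x1 x2 /\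
  contI (fun s => f (x1, s)) y1 y2 /\ contI (fun s => f (x2, s)) y1 y2.
Proof.
intros H. destruct (Rmin_max_in x1 x2), (Rmin_max_in y1 y2).
split; [|split; [|split]].
- eapply contI_hor; eauto.
- eapply contI_hor; eauto.
- eapply contI_ver; eauto.
- eapply contI_ver; eauto.
Qed.

Lemma rect_in_sub S x1 x2 y1 y2 a1 a2 b1 b2 : rect_in S x1 x2 y1 y2 ->
  Rmin x1 x2 <= a1 <= Rmax x1 x2 -> Rmin x1 x2 <= a2 <= Rmax x1 x2 ->
  Rmin y1 y2 <= b1 <= Rmax y1 y2 -> Rmin y1 y2 <= b2 <= Rmax y1 y2 ->
  rect_in S a1 a2 b1 b2.
Proof.
intros H Ha1 Ha2 Hb1 Hb2 x y Hx Hy.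
assert (Rmin x1 x2 <= Rmin a1 a2) by (apply Rmin_glb; lra).
assert (Rmax a1 a2 <= Rmax x1 x2) by (apply Rmax_lub; lra).
assert (Rmin y1 y2 <= Rmin b1 b2) by (apply Rmin_glb; lra).
assert (Rmax b1 b2 <= Rmax y1 y2) by (apply Rmax_lub; lra).
apply H; lra.
Qed.

(** The two integrals over the common vertical side cancel. *)
Lemma rect_int_splitx f x1 x2 x3 y1 y2 : rect_cont f x1 x2 y1 y2 -> rect_cont f x2 x3 y1 y2 ->
  rect_int f x1 x3 y1 y2 = (rect_int f x1 x2 y1 y2 + rect_int f x2 x3 y1 y2)%C.
Proof.
intros H1 H2. apply rect_cont_sides in H1, H2.
destruct H1 as [A1 [A2 [A3 A4]]], H2 as [B1 [B2 [B3 B4]]].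
unfold rect_int. rewrite <- (CInt_Chasles (fun s => f (s, y1)) x1 x2 x3) by assumption.
rewrite <- (CInt_Chasles (fun s => f (s, y2)) x1 x2 x3) by assumption. ring.
Qed.

Lemma rect_int_splity f x1 x2 y1 y2 y3 : rect_cont f x1 x2 y1 y2 -> rect_cont f x1 x2 y2 y3 ->
  rect_int f x1 x2 y1 y3 = (rect_int f x1 x2 y1 y2 + rect_int f x1 x2 y2 y3)%C.
Proof.
intros H1 H2. apply rect_cont_sides in H1, H2.
destruct H1 as [A1 [A2 [A3 A4]]], H2 as [B1 [B2 [B3 B4]]].
unfold rect_int. rewrite <- (CInt_Chasles (fun s => f (x1, s)) y1 y2 y3) by assumption.
rewrite <- (CInt_Chasles (fun s => f (x2, s)) y1 y2 y3) by assumption. ring.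
Qed.

Lemma rect_in_swapx S x1 x2 y1 y2 : rect_in S x1 x2 y1 y2 -> rect_in S x2 x1 y1 y2.
Proof. intros H x y Hx Hy. apply H; auto. rewrite Rmin_comm, Rmax_comm; auto. Qed.
Lemma rect_in_swapy S x1 x2 y1 y2 : rect_in S x1 x2 y1 y2 -> rect_in S x1 x2 y2 y1.
Proof. intros H x y Hx Hy. apply H; auto. rewrite Rmin_comm, Rmax_comm; auto. Qed.

Lemma rect_int_swapx f x1 x2 y1 y2 : rect_cont f x1 x2 y1 y2 ->
  rect_int f x2 x1 y1 y2 = (- rect_int f x1 x2 y1 y2)%C.
Proof.
intros H1. apply rect_cont_sides in H1. destruct H1 as [A1 [A2 [A3 A4]]].
unfold rect_int. rewrite (CInt_swap (fun s => f (s, y1)) x1 x2), (CInt_swap (fun s => f (s,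
  y2)) x1 x2) by assumption. ring.
Qed.
Lemma rect_int_swapy f x1 x2 y1 y2 : rect_cont f x1 x2 y1 y2 ->
  rect_int f x1 x2 y2 y1 = (- rect_int f x1 x2 y1 y2)%C.
Proof.
intros H1. apply rect_cont_sides in H1. destruct H1 as [A1 [A2 [A3 A4]]].
unfold rect_int. rewrite (CInt_swap (fun s => f (x1, s)) y1 y2), (CInt_swap (fun s => f (x2,
  s)) y1 y2) by assumption. ring.
Qed.

Lemma rect_int_bound f x1 x2 y1 y2 M : rect_cont f x1 x2 y1 y2 ->
  rect_in (fun z => Cmod (f z) <= M) x1 x2 y1 y2 ->
  Cmod (rect_int f x1 x2 y1 y2) <= 2 * M * (Rabs (x2 - x1) + Rabs (y2 - y1)).
Proof.
intros Hc Hb. destruct (Rmin_max_in x1 x2), (Rmin_max_in y1 y2).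
apply rect_cont_sides in Hc. destruct Hc as [A1 [A2 [A3 A4]]].
assert (B1 := CInt_bound _ _ _ M A1 (fun t Ht => Hb t y1 Ht H1)).
assert (B2 := CInt_bound _ _ _ M A2 (fun t Ht => Hb t y2 Ht H2)).
assert (B3 := CInt_bound _ _ _ M A3 (fun t Ht => Hb x1 t H Ht)).
assert (B4 := CInt_bound _ _ _ M A4 (fun t Ht => Hb x2 t H0 Ht)).
unfold rect_int. unfold Cminus at 1 2.
eapply Rle_trans; [apply Cmod_triangle|]. rewrite Cmod_opp, Cmod_mult, Cmod_Ci.
eapply Rle_trans; [apply Rplus_le_compat_r, Cmod_triangle|]. rewrite Cmod_opp.
eapply Rle_trans; [apply Rplus_le_compat_r, Rplus_le_compat_r, Cmod_triangle|].
  rewrite Cmod_mult, Cmod_Ci.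
lra.
Qed.

Lemma rect_int_primitive f P x1 x2 y1 y2 : rect_cont f x1 x2 y1 y2 ->
  rect_in (fun z => cder P z (f z)) x1 x2 y1 y2 -> rect_int f x1 x2 y1 y2 = RtoC 0.
Proof.
intros Hc HP. destruct (Rmin_max_in x1 x2), (Rmin_max_in y1 y2).
apply rect_cont_sides in Hc. destruct Hc as [A1 [A2 [A3 A4]]].
assert (Hh : forall y, Rmin y1 y2 <= y <= Rmax y1 y2 -> contI (fun s => f (s, y)) x1 x2 ->
  CInt (fun s => f (s, y)) x1 x2 = (P (x2, y) - P (x1, y))%C).
{ intros y Hy Hcy. apply (CInt_FTC (fun s => P (s, y))); auto.
  intros t Ht. eapply rder_eq; [apply (rder_comp P (fun s => (s, y))); [apply HP;
    auto|apply rder_hor]|]. ring. }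
assert (Hv : forall x, Rmin x1 x2 <= x <= Rmax x1 x2 -> contI (fun s => f (x, s)) y1 y2 ->
  (Ci * CInt (fun s => f (x, s)) y1 y2)%C = (P (x, y2) - P (x, y1))%C).
{ intros x Hx Hcx. rewrite <- CInt_scal by auto.
  apply (CInt_FTC (fun s => P (x, s))).
  - intros t Ht. eapply rder_eq; [apply (rder_comp P (fun s => (x, s))); [apply HP;
    auto|apply rder_ver]|]. ring.
  - intros t Ht. apply rcont_mult; [apply cont_const|apply Hcx; auto]. }
unfold rect_int. rewrite !Hh, !Hv by auto. ring.
Qed.

Lemma rect_int_minus f g x1 x2 y1 y2 : rect_cont f x1 x2 y1 y2 -> rect_cont g x1 x2 y1 y2 ->
  rect_int (fun z => f z - g z)%C x1 x2 y1 y2 = (rect_int f x1 x2 y1 y2 - rect_int g x1 x2 y1 y2)%C.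
Proof.
intros H1 H2. apply rect_cont_sides in H1, H2.
destruct H1 as [A1 [A2 [A3 A4]]], H2 as [B1 [B2 [B3 B4]]].
unfold rect_int. rewrite !CInt_minus by assumption. ring.
Qed.

Section Goursat.
Variables (f : C -> C) (x0 y0 w h : R).
Hypothesis Hw : 0 <= w.
Hypothesis Hh : 0 <= h.
Hypothesis Hf : rect_in (fun z => exists l, cder f z l) x0 (x0 + w) y0 (y0 + h).
Variable e : R.
Hypothesis He : 0 < e.

Let W n := w / 2 ^ n.
Let H n := h / 2 ^ n.
Let Q n (p : R * R) := rect_int f (fst p) (fst p + W n) (snd p) (snd p + H n).
Let big n p := e * ((w + h) / 2 ^ n) ^ 2 < Cmod (Q n p).

Let step n (p : R * R) : R * R :=
  let a := p in
  let b := (fst p + W (S n), snd p) in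
  let c := (fst p, snd p + H (S n)) in
  let d := (fst p + W (S n), snd p + H (S n)) in
  let E := e * ((w + h) / 2 ^ (S n)) ^ 2 in
  if Rlt_dec E (Cmod (Q (S n) a)) then a else
  if Rlt_dec E (Cmod (Q (S n) b)) then b else
  if Rlt_dec E (Cmod (Q (S n) c)) then c else d.

Let inside n (p : R * R) := x0 <= fst p /\ fst p + W n <= x0 + w /\ y0 <= snd p /\ snd p + H n <=
  y0 + h.

Lemma width_halves n : W n = W (S n) + W (S n) /\ 0 <= W (S n).
Proof.
unfold W. assert (Hp : 0 < 2 ^ n) by (apply pow_lt; lra). simpl. split; [field; lra|].
apply Rmult_le_pos; auto. left; apply Rinv_0_lt_compat; lra.
Qed.
Lemma height_halves n : H n = H (S n) + H (S n) /\ 0 <= H (S n).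
Proof.
unfold H. assert (Hp : 0 < 2 ^ n) by (apply pow_lt; lra). simpl. split; [field; lra|].
apply Rmult_le_pos; auto. left; apply Rinv_0_lt_compat; lra.
Qed.

Lemma inside_cont x1 x2 y1 y2 : x0 <= x1 -> x1 <= x2 -> x2 <= x0 + w -> y0 <= y1 -> y1 <= y2 ->
  y2 <= y0 + h ->
  rect_cont f x1 x2 y1 y2.
Proof.
intros. intros x y Hx Hy. rewrite Rmin_left, Rmax_right in Hx, Hy by lra.
destruct (Hf x y) as [l Hl]; [rewrite Rmin_left, Rmax_right by lra; lra..|].
apply (cder_cont _ _ _ Hl).
Qed.

Lemma step_spec n p : inside n p -> big n p -> inside (S n) (step n p) /\ big (S n) (step n p) /\
  (fst p <= fst (step n p) <= fst p + W (S n)) /\ (snd p <= snd (step n p) <= snd p + H (S n)).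
Proof.
intros [I1 [I2 [I3 I4]]] Hb.
destruct (width_halves n) as [EW PW], (height_halves n) as [EH PH].
assert (Esum : Q n p = (Q (S n) p + Q (S n) (fst p + W (S n), snd p)%R + Q (S n) (fst p,
  snd p + H (S n))%R + Q (S n) (fst p + W (S n), snd p + H (S n))%R)%C).
{ unfold Q; cbn [fst snd]. rewrite EW, EH. rewrite <- !Rplus_assoc.
  rewrite (rect_int_splitx f (fst p) (fst p + W (S n)) (fst p + W (S n) + W (S n))) by (apply
    inside_cont; lra).
  rewrite (rect_int_splity f (fst p) (fst p + W (S n)) (snd p) (snd p + H (S n))) by (apply
    inside_cont; lra).
  rewrite (rect_int_splity f (fst p + W (S n)) (fst p + W (S n) + W (S n)) (snd p) (snd p + H (S
    n))) by (apply inside_cont; lra).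
  ring. }
unfold step.
destruct (Rlt_dec _ _) as [L1|L1].
{ split; [|split; [exact L1|]]; unfold inside; cbn [fst snd]; lra. }
destruct (Rlt_dec _ _) as [L2|L2].
{ split; [|split; [exact L2|]]; unfold inside; cbn [fst snd]; lra. }
destruct (Rlt_dec _ _) as [L3|L3].
{ split; [|split; [exact L3|]]; unfold inside; cbn [fst snd]; lra. }
split; [|split]; [unfold inside; cbn [fst snd]; lra| |cbn [fst snd]; lra].
apply Rnot_le_lt. intros L4. unfold big in Hb. apply Rlt_not_le in Hb. apply Hb.
rewrite Esum.
eapply Rle_trans; [apply Cmod_triangle|].
eapply Rle_trans; [apply Rplus_le_compat_r, Cmod_triangle|].
eapply Rle_trans; [apply Rplus_le_compat_r, Rplus_le_compat_r, Cmod_triangle|].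
apply Rnot_lt_le in L1, L2, L3.
assert (E4 : e * ((w + h) / 2 ^ n) ^ 2 = 4 * (e * ((w + h) / 2 ^ S n) ^ 2)).
{ simpl. field. apply pow_nonzero; lra. }
rewrite E4. lra.
Qed.

(** If the bound failed for the rectangle, it would fail, rescaled, for one of its four
    quarters, hence for a nested sequence of rectangles shrinking to a point c. Near c
    the function f differs from f c + l (z - c) by at most e/2 times the distance to c,
    and the affine function has a primitive, so its integral vanishes: the bound cannot
    fail for small rectangles. *)
Lemma goursat_eps : Cmod (rect_int f x0 (x0 + w) y0 (y0 + h)) <= e * (w + h) ^ 2.
Proof.
apply Rnot_lt_le. intros Hb.
set (p := fix p n := match n with O => (x0, y0) | S n => step n (p n) end).
assert (Hp : forall n, inside n (p n) /\ big n (p n)).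
{ induction n.
  - unfold inside, big, Q, W, H; simpl. rewrite !Rdiv_1_r. split; [lra|]. exact Hb.
  - simpl. destruct IHn as [I B]. destruct (step_spec n (p n) I B) as [A [A' _]]. auto. }
assert (Hs : forall n, (fst (p n) <= fst (p (S n)) <= fst (p n) + W (S n)) /\ (snd (p n) <= snd (p
  (S n)) <= snd (p n) + H (S n))).
{ intros n. destruct (Hp n) as [I B]. apply (step_spec n (p n) I B). }
assert (Hlim : forall k, is_lim_seq (fun n => k / 2 ^ n) 0).
{ intros k. apply is_lim_seq_ext with (fun n => k * (/ 2) ^ n).
  { intros n. unfold Rdiv. rewrite pow_inv. reflexivity. }
  replace (Finite 0) with (Rbar_mult k 0) by (simpl; f_equal; ring).
  apply is_lim_seq_scal_l. apply is_lim_seq_geom. rewrite Rabs_pos_eq; lra. }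
assert (Hx : exists cx, forall n, fst (p n) <= cx <= fst (p n) + W n).
{ destruct (ex_lim_seq_adj (fun n => fst (p n)) (fun n => fst (p n) + W n)) as [[l1 E1] [[l2 E2]
  E]].
  - intros n. apply Hs.
  - intros n. destruct (width_halves n) as [-> _]. destruct (Hs n) as [[_ HH] _]. lra.
  - apply is_lim_seq_ext with W; [intros; lra|]. apply Hlim.
  - assert (l1 = l2).
    { apply is_lim_seq_unique in E1, E2. rewrite E1, E2 in E. congruence. }
    subst l2. exists l1. intros n. split.
    + apply (is_lim_seq_incr_compare (fun n => fst (p n)) l1 E1). intros m; apply Hs.
    + apply (is_lim_seq_decr_compare (fun n => fst (p n) + W n) l1 E2).
      intros m. destruct (width_halves m) as [-> _]. destruct (Hs m) as [[_ HH] _]. lra. }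
assert (Hy : exists cy, forall n, snd (p n) <= cy <= snd (p n) + H n).
{ destruct (ex_lim_seq_adj (fun n => snd (p n)) (fun n => snd (p n) + H n)) as [[l1 E1] [[l2 E2]
  E]].
  - intros n. apply Hs.
  - intros n. destruct (height_halves n) as [-> _]. destruct (Hs n) as [_ [_ HH]]. lra.
  - apply is_lim_seq_ext with H; [intros; lra|]. apply Hlim.
  - assert (l1 = l2).
    { apply is_lim_seq_unique in E1, E2. rewrite E1, E2 in E. congruence. }
    subst l2. exists l1. intros n. split.
    + apply (is_lim_seq_incr_compare (fun n => snd (p n)) l1 E1). intros m; apply Hs.
    + apply (is_lim_seq_decr_compare (fun n => snd (p n) + H n) l1 E2).
      intros m. destruct (height_halves m) as [-> _]. destruct (Hs m) as [_ [_ HH]]. lra. }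
destruct Hx as [cx Hx], Hy as [cy Hy].
assert (Hc0 := Hx O). assert (Hc0' := Hy O). unfold W, H in Hc0, Hc0'. simpl in Hc0, Hc0'.
destruct (Hf cx cy) as [l Hl]; [rewrite Rmin_left, Rmax_right by lra; lra..|].
destruct (proj1 (cder_eps _ _ _) Hl (e / 2)) as [d [Hd Hd']]; [lra|].
assert (Hex : exists n, (w + h) / 2 ^ n < d).
{ assert (K := Hlim (w + h)). apply is_lim_seq_spec in K. destruct (K (mkposreal d Hd)) as [n Hn].
  exists n. specialize (Hn n (le_n _)). simpl in Hn. rewrite Rminus_0_r in Hn.
  eapply Rle_lt_trans; [apply Rle_abs|exact Hn]. }
destruct Hex as [n Hn]. destruct (Hp n) as [[I1 [I2 [I3 I4]]] B].
set (s := (w + h) / 2 ^ n) in *.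
assert (Es : s = W n + H n) by (unfold s, W, H; field; apply pow_nonzero; lra).
assert (PW := proj2 (width_halves n)). assert (PH := proj2 (height_halves n)).
  destruct (width_halves n) as [EW _], (height_halves n) as [EH _].
apply Rlt_not_le in B. apply B. fold s. unfold Q.
set (x := fst (p n)) in *. set (y := snd (p n)) in *.
specialize (Hx n). specialize (Hy n). fold x in Hx. fold y in Hy.
set (c := (cx, cy) : C) in *.
set (g := fun z => (f c + l * (z - c))%C).
assert (Cg : forall z, @cont CT g z) by (intros z; unfold g; cont_tac).
assert (Cf : rect_cont f x (x + W n) y (y + H n)) by (apply inside_cont; lra).
assert (Z : rect_int g x (x + W n) y (y + H n) = RtoC 0).
{ apply (rect_int_primitive g (fun z => f c * z + l / 2 * ((z - c) * (z - c)))%C).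
  - intros ? ? _ _. apply Cg.
  - intros u v _ _. eapply cder_eq.
    + apply cder_plus; [apply cder_scal, cder_id|]. apply cder_scal.
      apply cder_mult; (apply cder_minus; [apply cder_id|apply cder_const]).
    + unfold g. field. }
replace (rect_int f x (x + W n) y (y + H n)) with (rect_int (fun z => f z - g z)%C x (x + W n) y (y
  + H n)).
2:{ rewrite rect_int_minus by (auto; intros ? ? _ _; apply Cg). rewrite Z. ring. }
eapply Rle_trans; [apply (rect_int_bound _ _ _ _ _ (e / 2 * s))|].
- intros u v Hu Hv. apply (@cont_minus CT); [apply Cf; auto|apply Cg].
- intros u v Hu Hv. rewrite Rmin_left, Rmax_right in Hu, Hv by lra.
  assert (Hz : Cmod ((u, v) - c)%C <= s).
  { eapply Rle_trans; [apply Cmod_le_sum|]. simpl. rewrite Es.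
    apply Rplus_le_compat; apply Rabs_le; lra. }
  unfold g. replace (f (u, v) - (f c + l * ((u, v) - c)))%C with (f (u, v) - f c - l * ((u,
    v) - c))%C by ring.
  eapply Rle_trans; [apply Hd'; lra|]. apply Rmult_le_compat_l; lra.
- rewrite !Rabs_pos_eq by lra. right. rewrite Es. field.
Qed.
End Goursat.

Lemma goursat f x1 x2 y1 y2 : rect_in (fun z => exists l, cder f z l) x1 x2 y1 y2 ->
  rect_int f x1 x2 y1 y2 = RtoC 0.
Proof.
assert (W1 : forall x1 x2 y1 y2, x1 <= x2 -> y1 <= y2 -> rect_in (fun z => exists l,
  cder f z l) x1 x2 y1 y2 ->
  rect_int f x1 x2 y1 y2 = RtoC 0).
{ clear. intros x1 x2 y1 y2 Hx Hy Hf.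
  replace x2 with (x1 + (x2 - x1)) in * by ring. replace y2 with (y1 + (y2 - y1)) in * by ring.
  apply Cmod_eq_0. apply Rle_antisym; [|apply Cmod_ge_0].
  apply Rnot_lt_le. intros Hp.
  set (w := x2 - x1) in *. set (h := y2 - y1) in *.
  set (m := Cmod (rect_int f x1 (x1 + w) y1 (y1 + h))) in *.
  assert (Hw : 0 <= w) by lra. assert (Hh : 0 <= h) by lra.
  assert (Hs : 0 < 1 + (w + h) ^ 2) by (generalize (pow2_ge_0 (w + h)); lra).
  assert (K := goursat_eps f x1 y1 w h Hw Hh Hf (m / (1 + (w + h) ^ 2) / 2)).
  fold m in K.
  assert (Hm : 0 < m / (1 + (w + h) ^ 2)) by (apply Rdiv_lt_0_compat; auto).
  assert (K' := K ltac:(lra)).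
  assert (m = m / (1 + (w + h) ^ 2) * (1 + (w + h) ^ 2)) by (field; lra).
  nra. }
assert (Cf : forall x1 x2 y1 y2, rect_in (fun z => exists l, cder f z l) x1 x2 y1 y2 ->
  rect_cont f x1 x2 y1 y2).
{ clear. intros x1 x2 y1 y2 H x y Hx Hy. destruct (H x y Hx Hy) as [l Hl].
  apply (cder_cont _ _ _ Hl). }
assert (W2 : forall x1 x2 y1 y2, x1 <= x2 -> rect_in (fun z => exists l, cder f z l) x1 x2 y1 y2 ->
  rect_int f x1 x2 y1 y2 = RtoC 0).
{ clear x1 x2 y1 y2. intros x1 x2 y1 y2 Hx H. destruct (Rle_dec y1 y2); [auto|].
  assert (H' := rect_in_swapy _ _ _ _ _ H).
  rewrite rect_int_swapy by auto. rewrite W1 by (auto; lra). ring. }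
intros H. destruct (Rle_dec x1 x2); [auto|].
assert (H' := rect_in_swapx _ _ _ _ _ H).
rewrite rect_int_swapx by auto. rewrite W2 by (auto; lra). ring.
Qed.

(** Cutting off a rectangle similar to the given one at the exceptional corner leaves
    two rectangles to which [goursat] applies, and the integral over the small one is of
    the order of its diameter because f is bounded near the corner. *)
Lemma goursat_corner f (a b x y : R) : rect_cont f a x b y ->
  rect_in (fun z => z <> (a, b) -> exists l, cder f z l) a x b y ->
  rect_int f a x b y = RtoC 0.
Proof.
intros Hc Hd.
destruct (Req_dec x a) as [->|Hx].
{ unfold rect_int. rewrite !CInt_point. ring. }
destruct (Req_dec y b) as [->|Hy].
{ unfold rect_int. rewrite !CInt_point. ring. }
apply Cmod_eq_0. apply Rle_antisym; [|apply Cmod_ge_0].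
apply Rnot_lt_le. intros Hp.
destruct (Rmin_max_in a x) as [Ia Ix], (Rmin_max_in b y) as [Ib Iy].
assert (Hab : @cont CT f (a, b)) by (apply Hc; auto).
destruct (proj1 (ccont_eps _ _) Hab 1 Rlt_0_1) as [d [Hd0 Hd1]].
set (m := Cmod (rect_int f a x b y)) in *.
set (L := Rabs (x - a) + Rabs (y - b)).
assert (HL : 0 < L).
{ unfold L. assert (0 < Rabs (x - a)) by (apply Rabs_pos_lt; lra).
  generalize (Rabs_pos (y - b)); lra. }
(* M bounds f near the corner, and the integral over a rectangle of sides s |x - a|, s
    |y - b| is at most 2 M s L; s is chosen to make this at most half of m. *)
set (M := Cmod (f (a, b)) + 1). assert (HM : 0 < M) by (unfold M;
  generalize (Cmod_ge_0 (f (a, b))); lra).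
set (s := Rmin 1 (Rmin (d / (2 * L)) (m / (4 * M * L)))).
assert (Hs : 0 < s).
{ unfold s. repeat apply Rmin_glb_lt; [lra|apply Rdiv_lt_0_compat; lra|apply Rdiv_lt_0_compat;
  nra]. }
assert (Hs1 : s <= 1) by apply Rmin_l.
assert (Hs2 : s <= d / (2 * L)) by (unfold s; eapply Rle_trans; [apply Rmin_r|apply Rmin_l]).
assert (Hs3 : s <= m / (4 * M * L)) by (unfold s; eapply Rle_trans; [apply Rmin_r|apply Rmin_r]).
set (x' := a + s * (x - a)). set (y' := b + s * (y - b)).
assert (Ix' : Rmin a x <= x' <= Rmax a x).
{ unfold x'. destruct (Rle_dec a x); [rewrite Rmin_left, Rmax_right by lra|rewrite Rmin_right,
  Rmax_left by lra]; nra. }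
assert (Iy' : Rmin b y <= y' <= Rmax b y).
{ unfold y'. destruct (Rle_dec b y); [rewrite Rmin_left, Rmax_right by lra|rewrite Rmin_right,
  Rmax_left by lra]; nra. }
assert (SC : forall p q u v, Rmin a x <= p <= Rmax a x -> Rmin a x <= q <= Rmax a x ->
  Rmin b y <= u <= Rmax b y ->
   Rmin b y <= v <= Rmax b y -> rect_cont f p q u v).
{ intros. apply (rect_in_sub _ _ _ _ _ _ _ _ _ Hc); auto. }
assert (E : rect_int f a x b y = rect_int f a x' b y').
{ rewrite (rect_int_splitx f a x' x) by (apply SC; auto).
  rewrite (rect_int_splity f a x' b y' y) by (apply SC; auto).
  rewrite (goursat f x' x b y), (goursat f a x' y' y).
  - ring.
  - intros u v Hu Hv. apply Hd.
    + assert (Rmin a x <= Rmin a x') by (apply Rmin_glb; lra).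
      assert (Rmax a x' <= Rmax a x) by (apply Rmax_lub; lra). lra.
    + assert (Rmin b y <= Rmin y' y) by (apply Rmin_glb; lra).
      assert (Rmax y' y <= Rmax b y) by (apply Rmax_lub; lra). lra.
    + intros Eq. assert (E1 : v = b) by congruence. subst v. unfold y' in Hv. revert Hv.
      assert (s * (y - b) <> 0) by (apply Rmult_integral_contrapositive_currified; lra).
      unfold Rmin, Rmax. destruct (Rle_dec _ _); intros Hv; nra.
  - intros u v Hu Hv. apply Hd.
    + assert (Rmin a x <= Rmin x' x) by (apply Rmin_glb; lra).
      assert (Rmax x' x <= Rmax a x) by (apply Rmax_lub; lra). lra.
    + auto.
    + intros Eq. assert (E1 : u = a) by congruence. subst u. unfold x' in Hu. revert Hu.
      assert (s * (x - a) <> 0) by (apply Rmult_integral_contrapositive_currified; lra).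
      unfold Rmin, Rmax. destruct (Rle_dec _ _); intros Hu; nra. }
assert (Ex : x' - a = s * (x - a)) by (unfold x'; ring).
assert (Ey : y' - b = s * (y - b)) by (unfold y'; ring).
assert (K : m <= 2 * M * (Rabs (x' - a) + Rabs (y' - b))).
{ unfold m. rewrite E. apply rect_int_bound; [apply SC; auto|].
  intros u v Hu Hv.
  assert (Hz : Cmod ((u, v) - (a, b))%C < d).
  { eapply Rle_lt_trans; [apply Cmod_le_sum|]. simpl.
    assert (Rabs (u - a) <= s * Rabs (x - a)).
    { rewrite <- (Rabs_pos_eq s) by lra. rewrite <- Rabs_mult, <- Ex.
      unfold Rmin, Rmax in Hu. unfold Rabs. destruct (Rle_dec a x'), (Rcase_abs _), (Rcase_abs _);
        lra. }
    assert (Rabs (v - b) <= s * Rabs (y - b)).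
    { rewrite <- (Rabs_pos_eq s) by lra. rewrite <- Rabs_mult, <- Ey.
      unfold Rmin, Rmax in Hv. unfold Rabs. destruct (Rle_dec b y'), (Rcase_abs _), (Rcase_abs _);
        lra. }
    change (Rabs (u - a) + Rabs (v - b) < d).
    apply Rle_lt_trans with (s * L); [unfold L; lra|].
    apply Rle_lt_trans with (d / (2 * L) * L); [apply Rmult_le_compat_r; lra|].
    replace (d / (2 * L) * L) with (d / 2) by (field; lra). lra. }
  specialize (Hd1 _ Hz). unfold M.
  replace (f (u, v)) with (f (a, b) + (f (u, v) - f (a, b)))%C by ring.
  eapply Rle_trans; [apply Cmod_triangle|]. lra. }
rewrite Ex, Ey, !Rabs_mult, (Rabs_pos_eq s) in K by lra.
assert (K2 : s * (2 * M * L) <= m / (4 * M * L) * (2 * M * L)) by (apply Rmult_le_compat_r; nra).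
replace (m / (4 * M * L) * (2 * M * L)) with (m / 2) in K2 by (field; lra).
unfold L in K2. lra.
Qed.

Lemma square_rect c r x1 x2 y1 y2 : square c r (x1, y1) -> square c r (x2, y2) ->
  rect_in (square c r) x1 x2 y1 y2.
Proof.
intros [A1 A2] [B1 B2] x y Hx Hy. unfold square in *; simpl in *.
apply Rabs_def2 in A1, A2, B1, B2.
unfold Rmin, Rmax in *. destruct (Rle_dec x1 x2), (Rle_dec y1 y2); split; apply Rabs_def1; lra.
Qed.

(** The exceptional point w is made the common corner of four rectangles. It is needed
    because the difference quotient of a holomorphic function at w is a priori only
    continuous at w. *)
Lemma goursat_except f c r w : square c r w -> (forall z, square c r z -> @cont CT f z) ->
  hol_on (fun z => square c r z /\ z <> w) f ->
  forall x1 x2 y1 y2, square c r (x1, y1) -> square c r (x2, y2) -> rect_int f x1 x2 y1 y2 = RtoC 0.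
Proof.
intros Hw Hc Hh x1 x2 y1 y2 H1 H2. destruct w as [a b].
assert (RC : forall p q u v, square c r (p, u) -> square c r (q, v) -> rect_cont f p q u v).
{ intros p q u v A B x y Hx Hy. apply Hc. apply (square_rect c r p q u v); auto. }
assert (G : forall p q, square c r (p, q) -> rect_int f a p b q = RtoC 0).
{ intros p q A. apply goursat_corner; [apply RC; auto|].
  intros x y Hx Hy Hn. apply Hh. split; auto. apply (square_rect c r a p b q); auto. }
assert (Sq12 : square c r (x1, y2)) by (destruct H1, H2; split; auto).
assert (Sq21 : square c r (x2, y1)) by (destruct H1, H2; split; auto).
assert (Sa1 : square c r (a, y1)) by (destruct H1, Hw; split; auto).
assert (Sa2 : square c r (a, y2)) by (destruct H2, Hw; split; auto).
assert (S1b : square c r (x1, b)) by (destruct H1, Hw; split; auto).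
assert (S2b : square c r (x2, b)) by (destruct H2, Hw; split; auto).
rewrite (rect_int_splitx f x1 a x2) by (apply RC; auto).
rewrite (rect_int_splity f x1 a y1 b y2) by (apply RC; auto).
rewrite (rect_int_splity f a x2 y1 b y2) by (apply RC; auto).
rewrite (rect_int_swapx f a x1 y1 b), (rect_int_swapx f a x1 b y2) by (apply RC; auto).
rewrite (rect_int_swapy f a x1 b y1), (rect_int_swapy f a x2 b y1) by (apply RC; auto).
rewrite !G by auto. ring.
Qed.

(** P z is the integral of f along the L-shaped path from the centre to z, first
    horizontal, then vertical; vanishing of the rectangle integrals makes increments of
    P integrals along short L-shaped paths. *)
Lemma primitive_exists f c r : 0 < r -> (forall z, square c r z -> @cont CT f z) ->
  (forall x1 x2 y1 y2, square c r (x1, y1) -> square c r (x2, y2) ->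
    rect_int f x1 x2 y1 y2 = RtoC 0) ->
  exists P, forall z, square c r z -> cder P z (f z).
Proof.
intros Hr Hc HR. destruct c as [a b].
set (P := fun z => (CInt (fun s => f (s, b)) a (Re z) + Ci * CInt (fun s => f (Re z,
  s)) b (Im z))%C).
exists P. intros [x y] Hz.
assert (Sc : forall u v, square (a, b) r (u, v) -> square (a, b) r (u, b)).
{ intros u v [A B]. split; simpl in *; auto. rewrite Rminus_diag, Rabs_R0; auto. }
assert (Sc0 : square (a, b) r (a, b)) by (split; simpl; rewrite Rminus_diag, Rabs_R0; auto).
assert (RC : forall p q u v, square (a, b) r (p, u) -> square (a, b) r (q, v) ->
  rect_cont f p q u v).
{ intros p q u v A B s t Hs Ht. apply Hc. apply (square_rect _ r p q u v); auto. }
(* Path independence: moving the corner of the L-shaped path from height b to height y. *)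
assert (D : forall x' y', square (a, b) r (x', y') ->
  (P (x', y') - P (x, y) = CInt (fun s => f (s, y)) x x' + Ci * CInt (fun s => f (x', s)) y y')%C).
{ intros x' y' Hz'. assert (Hm : square (a, b) r (x', y)) by (destruct Hz, Hz'; split; auto).
  assert (R0 := HR x x' b y (Sc _ _ Hz) Hm). unfold rect_int in R0.
  unfold P; simpl.
  rewrite <- (CInt_Chasles (fun s => f (s, b)) a x x').
  2:{ destruct (rect_cont_sides _ _ _ _ _ (RC a x b y Sc0 Hz)) as [A _]; exact A. }
  2:{ destruct (rect_cont_sides _ _ _ _ _ (RC x x' b y (Sc _ _ Hz) Hm)) as [A _]; exact A. }
  rewrite <- (CInt_Chasles (fun s => f (x', s)) b y y').
  2:{ destruct (rect_cont_sides _ _ _ _ _ (RC x x' b y (Sc _ _ Hz) Hm)) as [_ [_ [_ A]]]; exact A. }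
  2:{ destruct (rect_cont_sides _ _ _ _ _ (RC x x' y y' Hz Hz')) as [_ [_ [_ A]]]; exact A. }
  match goal with |- ?L = ?R => replace L with (L - 0)%C by ring end.
  rewrite <- R0. ring. }
apply cder_eps. intros eps He.
destruct (proj1 (ccont_eps _ _) (Hc _ Hz) (eps / 2)) as [d [Hd Hd']]; [lra|].
set (rx := r - Rabs (x - a)). set (ry := r - Rabs (y - b)).
assert (Hrx : 0 < rx) by (destruct Hz as [A _]; simpl in A; unfold rx; lra).
assert (Hry : 0 < ry) by (destruct Hz as [_ A]; simpl in A; unfold ry; lra).
exists (Rmin (d / 2) (Rmin rx ry)). split; [repeat apply Rmin_glb_lt; lra|].
intros [x' y'] Hw.
assert (Hw1 : Cmod ((x', y') - (x, y))%C < d / 2) by (eapply Rlt_le_trans; [exact Hw|apply Rmin_l]).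
assert (Hw2 : Cmod ((x', y') - (x, y))%C < rx) by (eapply Rlt_le_trans;
  [exact Hw|eapply Rle_trans; [apply Rmin_r|apply Rmin_l]]).
assert (Hw3 : Cmod ((x', y') - (x, y))%C < ry) by (eapply Rlt_le_trans;
  [exact Hw|eapply Rle_trans; [apply Rmin_r|apply Rmin_r]]).
assert (Kx : Rabs (x' - x) <= Cmod ((x', y') - (x, y))%C) by apply (re_le_Cmod ((x', y') - (x,
  y))%C).
assert (Ky : Rabs (y' - y) <= Cmod ((x', y') - (x, y))%C) by apply (im_le_Cmod ((x', y') - (x,
  y))%C).
assert (Hz' : square (a, b) r (x', y')).
{ split; simpl.
  - replace (x' - a) with ((x' - x) + (x - a)) by ring. eapply Rle_lt_trans; [apply Rabs_triang|].
    unfold rx in *; lra.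
  - replace (y' - b) with ((y' - y) + (y - b)) by ring. eapply Rle_lt_trans; [apply Rabs_triang|].
    unfold ry in *; lra. }
assert (Hm : square (a, b) r (x', y)) by (destruct Hz, Hz'; split; auto).
rewrite D by auto.
assert (Cc : contI (fun s => f (s, y)) x x').
{ destruct (rect_cont_sides _ _ _ _ _ (RC x x' y y' Hz Hz')) as [A _]; exact A. }
assert (Cv : contI (fun s => f (x', s)) y y').
{ destruct (rect_cont_sides _ _ _ _ _ (RC x x' y y' Hz Hz')) as [_ [_ [_ A]]]; exact A. }
assert (CC : forall u v, contI (fun _ => f (x, y)) u v) by (intros u v t _; apply cont_const).
replace (CInt (fun s => f (s, y)) x x' + Ci * CInt (fun s => f (x', s)) y y' - f (x, y) * ((x',
  y') - (x, y)))%C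
  with (CInt (fun s => f (s, y) - f (x, y))%C x x' + Ci * CInt (fun s => f (x', s) - f (x,
    y))%C y y')%C.
2:{ rewrite !CInt_minus, !CInt_const by auto.
    replace ((x', y') - (x, y))%C with (RtoC (x' - x) + Ci * RtoC (y' - y))%C by (apply
      injective_projections; simpl; ring).
    ring. }
eapply Rle_trans; [apply Cmod_triangle|]. rewrite Cmod_mult, Cmod_Ci.
assert (B1 : Cmod (CInt (fun s => f (s, y) - f (x, y))%C x x') <= eps / 2 * Rabs (x' - x)).
{ apply CInt_bound; [intros t Ht; apply rcont_minus; [apply Cc; auto|apply cont_const]|].
  intros t Ht. left; apply Hd'. eapply Rle_lt_trans; [apply Cmod_le_sum|].
  assert (Rabs (t - x) <= Rabs (x' - x)).
  { unfold Rmin, Rmax in Ht. unfold Rabs. destruct (Rle_dec x x'), (Rcase_abs _), (Rcase_abs _);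
    lra. }
  change (Rabs (t - x) + Rabs (y - y) < d). rewrite Rminus_diag, Rabs_R0. lra. }
assert (B2 : Cmod (CInt (fun s => f (x', s) - f (x, y))%C y y') <= eps / 2 * Rabs (y' - y)).
{ apply CInt_bound; [intros t Ht; apply rcont_minus; [apply Cv; auto|apply cont_const]|].
  intros t Ht. left; apply Hd'. eapply Rle_lt_trans; [apply Cmod_le_sum|].
  assert (Rabs (t - y) <= Rabs (y' - y)).
  { unfold Rmin, Rmax in Ht. unfold Rabs. destruct (Rle_dec y y'), (Rcase_abs _), (Rcase_abs _);
    lra. }
  change (Rabs (x' - x) + Rabs (t - y) < d). lra. }
rewrite Rmult_1_l.
eapply Rle_trans; [apply Rplus_le_compat; [exact B1|exact B2]|].
nra.
Qed.

(** * Cauchy's integral formula *)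

(** The second-order remainder of the powers of the Cauchy kernel, uniform in a away
    from 0. *)
Lemma inv_pow_taylor (d : R) (n : nat) : 0 < d -> exists K, 0 <= K /\
  forall a h : C, d <= Cmod a -> Cmod h <= d / 2 ->
  Cmod ((/ (a - h)) ^ n - (/ a) ^ n - RtoC (INR n) * h * (/ a) ^ (S n))%C <= K * (Cmod h * Cmod h).
Proof.
intros Hd. assert (Hid : 0 < / d) by (apply Rinv_0_lt_compat; auto).
induction n as [|n [K [HK IH]]].
- exists 0. split; [lra|]. intros a h _ _.
  replace ((/ (a - h)) ^ 0 - (/ a) ^ 0 - RtoC (INR 0) * h * (/ a) ^ 1)%C with (RtoC 0) by (simpl;
    ring).
  rewrite Cmod_0. lra.
- exists (2 / d * K + INR (S n) * ((/ d) ^ (S (S n)) * (2 / d))).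
  assert (P1 : 0 <= INR (S n)) by apply pos_INR.
  assert (P2 : 0 <= (/ d) ^ (S (S n))) by (apply pow_le; lra).
  assert (P3 : 0 <= 2 / d) by (unfold Rdiv; lra).
  split.
  { apply Rplus_le_le_0_compat; [apply Rmult_le_pos; auto|]. apply Rmult_le_pos; auto.
    apply Rmult_le_pos; auto. }
  intros a h Ha Hh.
  assert (Ha0 : a <> RtoC 0) by (apply Cmod_gt_0; lra).
  assert (Hah : d / 2 <= Cmod (a - h)%C).
  { assert (Cmod a <= Cmod (a - h)%C + Cmod h); [|lra].
    replace a with ((a - h) + h)%C at 1 by ring. apply Cmod_triangle. }
  assert (Hah0 : (a - h)%C <> RtoC 0) by (apply Cmod_gt_0; lra).
  assert (Hv : Cmod (/ a)%C <= / d) by (rewrite Cmod_inv by auto; apply Rinv_le_contravar; auto).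
  assert (Hu : Cmod (/ (a - h))%C <= 2 / d).
  { rewrite Cmod_inv by auto. replace (2 / d) with (/ (d / 2)) by (field; lra).
    apply Rinv_le_contravar; lra. }
  assert (Huv : (/ (a - h) - / a = h * (/ a) * / (a - h))%C) by (field; auto).
  specialize (IH a h Ha Hh).
  set (u := (/ (a - h))%C) in *. set (v := (/ a)%C) in *.
  replace (u ^ S n - v ^ S n - RtoC (INR (S n)) * h * v ^ S (S n))%C with
    (u * (u ^ n - v ^ n - RtoC (INR n) * h * v ^ (S n)) + RtoC (INR (S n)) * h * v ^ (S n) * (u -
      v) + (u - v - h * v * u) * v ^ n)%C.
  2:{ rewrite S_INR, RtoC_plus. rewrite !Cpow_S. ring. }
  rewrite Huv.
  replace ((h * v * u - h * v * u) * v ^ n)%C with (RtoC 0) by ring. rewrite Cplus_0_r.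
  replace (RtoC (INR (S n)) * h * v ^ S n * (h * v * u))%C with (RtoC (INR (S n)) * (v ^ S (S n) *
    u) * (h * h))%C by (rewrite (Cpow_S v (S n)); ring).
  eapply Rle_trans; [apply Cmod_triangle|]. rewrite !Cmod_mult, Cmod_R, Rabs_pos_eq by auto.
    rewrite Cmod_pow.
  rewrite Rmult_plus_distr_r. apply Rplus_le_compat.
  + rewrite Rmult_assoc. apply Rmult_le_compat; auto; apply Cmod_ge_0.
  + apply Rmult_le_compat_r; [apply Rmult_le_pos; apply Cmod_ge_0|].
    apply Rmult_le_compat_l; auto.
    apply Rmult_le_compat; auto; try apply Cmod_ge_0; [apply pow_le, Cmod_ge_0|].
    apply pow_incr. split; [apply Cmod_ge_0|auto].
Qed.

Section Kernel.
Variables (phi g : R -> C) (a b : R).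
Hypothesis Hphi : forall t, rcont phi t.
Hypothesis Hg : forall t, rcont g t.

Definition kernel (k : nat) (w : C) : C := CInt (fun t => phi t * (/ (g t - w)) ^ (S k))%C a b.

Lemma kernel_cont k w : (forall t, g t <> w) -> forall t, rcont (fun t => phi t * (/ (g t - w)) ^
  (S k))%C t.
Proof.
intros H t. unfold rcont in *. apply rcont_mult; [apply Hphi|].
apply rcont_pow. apply rcont_inv.
- apply Cminus_eq_contra; auto.
- apply rcont_minus; [apply Hg|apply cont_const].
Qed.

(** Differentiation under the integral sign; the uniform second-order remainder of the
    kernel replaces a general theorem. *)
Lemma kernel_derive k w0 d : 0 < d -> (forall t, d <= Cmod (g t - w0)%C) ->
  cder (kernel k) w0 (RtoC (INR (S k)) * kernel (S k) w0)%C.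
Proof.
intros Hd Hdist.
destruct (inv_pow_taylor d (S k) Hd) as [K [HK HT]].
destruct (contI_bounded phi a b) as [M [HM Hb]]; [apply contI_forall; auto|].
apply cder_eps. intros eps He.
set (B := M * K * Rabs (b - a) + 1).
assert (HB : 0 < B). { unfold B. assert (0 <= M * K * Rabs (b - a)); [|lra].
  apply Rmult_le_pos; [nra|apply Rabs_pos]. }
exists (Rmin (d / 2) (eps / B)). split; [apply Rmin_glb_lt; [lra|apply Rdiv_lt_0_compat; auto]|].
intros w Hw. set (h := (w - w0)%C) in *.
assert (H1 : Cmod h < d / 2) by (eapply Rlt_le_trans; [exact Hw|apply Rmin_l]).
assert (H2 : Cmod h < eps / B) by (eapply Rlt_le_trans; [exact Hw|apply Rmin_r]).
assert (Hw0 : forall t, g t <> w0).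
{ intros t E. specialize (Hdist t). rewrite E in Hdist. rewrite Cmod_sub_self in Hdist. lra. }
assert (Hww : forall t, g t <> w).
{ intros t E. specialize (Hdist t). rewrite E in Hdist. fold h in Hdist. lra. }
assert (C1 := kernel_cont k w Hww). assert (C2 := kernel_cont k w0 Hw0).
  assert (C3 := kernel_cont (S k) w0 Hw0).
assert (C12 : forall t, rcont (fun t => phi t * (/ (g t - w)) ^ S k - phi t * (/ (g t - w0)) ^ S
  k)%C t).
{ intros t. apply rcont_minus; [apply C1|apply C2]. }
assert (C3' : forall t, rcont (fun t => (RtoC (INR (S k)) * h) * (phi t * (/ (g t - w0)) ^ S (S
  k)))%C t).
{ intros t. apply rcont_mult; [apply cont_const|apply C3]. }
replace (kernel k w - kernel k w0 - RtoC (INR (S k)) * kernel (S k) w0 * h)%C with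
  (CInt (fun t => (phi t * (/ (g t - w)) ^ S k - phi t * (/ (g t - w0)) ^ S k) - (RtoC (INR (S k))
    * h) * (phi t * (/ (g t - w0)) ^ S (S k)))%C a b).
2:{ rewrite CInt_minus by (apply contI_forall; auto). rewrite CInt_minus by (apply contI_forall;
  auto).
    rewrite CInt_scal by (apply contI_forall; auto). unfold kernel. ring. }
eapply Rle_trans; [apply (CInt_bound _ a b (M * (K * (Cmod h * Cmod h))))|].
- apply contI_forall. intros t. apply rcont_minus; [apply C12|apply C3'].
- intros t Ht.
  specialize (HT (g t - w0)%C h (Hdist t) (Rlt_le _ _ H1)).
  replace (g t - w0 - h)%C with (g t - w)%C in HT by (unfold h; ring).
  match goal with |- Cmod ?X <= _ => replace X with (phi t * ((/ (g t - w)) ^ S k - (/ (g t - w0))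
    ^ S k - RtoC (INR (S k)) * h * (/ (g t - w0)) ^ S (S k)))%C by ring end.
  rewrite Cmod_mult. apply Rmult_le_compat; auto; apply Cmod_ge_0.
- assert (Hh0 := Cmod_ge_0 h).
  assert (H3 : B * Cmod h <= eps).
  { replace eps with (B * (eps / B)) by (field; lra). apply Rmult_le_compat_l; lra. }
  replace (M * (K * (Cmod h * Cmod h)) * Rabs (b - a)) with ((M * K * Rabs (b - a)) * Cmod h * Cmod
    h) by ring.
  apply Rmult_le_compat_r; auto. unfold B in H3. lra.
Qed.
End Kernel.

Definition circ (c : C) (rho : R) (t : R) : C := (c + RtoC rho * Cexp (Ci * RtoC t))%C.
Definition dcirc (rho : R) (t : R) : C := (Ci * RtoC rho * Cexp (Ci * RtoC t))%C.

Lemma rder_circ c rho t : rder (circ c rho) t (dcirc rho t).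
Proof.
unfold circ, dcirc.
eapply rder_eq.
- apply (rder_comp (fun w => c + RtoC rho * Cexp (Ci * w))%C RtoC).
  + apply cder_plus; [apply cder_const|]. apply cder_scal.
    apply (cder_comp Cexp (fun w => Ci * w)%C); [apply cder_Cexp|]. apply cder_scal, cder_id.
  + apply rder_RtoC.
- ring.
Qed.

Lemma rcont_circ c rho t : rcont (circ c rho) t.
Proof. apply (rder_cont _ _ _ (rder_circ c rho t)). Qed.

Lemma rcont_dcirc rho t : rcont (dcirc rho) t.
Proof.
unfold rcont, dcirc. assert (H := rcont_RtoC t). unfold rcont in H. cont_tac.
Qed.

Lemma circ_dist c rho t : 0 < rho -> Cmod (circ c rho t - c)%C = rho.
Proof.
intros H. unfold circ. replace (c + RtoC rho * Cexp (Ci * RtoC t) - c)%C with (RtoC rho * Cexp (Ci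
  * RtoC t))%C by ring.
rewrite Cmod_mult, Cmod_R, Rabs_pos_eq by lra. rewrite Cmod_Cexp. simpl.
replace (0 * t - 1 * 0) with 0 by ring. rewrite exp_0. ring.
Qed.

Lemma circ_far c rho t w : 0 < rho -> rho - Cmod (w - c)%C <= Cmod (circ c rho t - w)%C.
Proof.
intros H. assert (rho <= Cmod (circ c rho t - w)%C + Cmod (w - c)%C); [|lra].
rewrite <- (circ_dist c rho t H) at 1.
replace (circ c rho t - c)%C with ((circ c rho t - w) + (w - c))%C by ring. apply Cmod_triangle.
Qed.

Lemma disc_in_square c r z : Cmod (z - c)%C < r -> square c r z.
Proof.
intros H. split.
- eapply Rle_lt_trans; [apply (re_le_Cmod (z - c)%C)|exact H].
- eapply Rle_lt_trans; [apply (im_le_Cmod (z - c)%C)|exact H].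
Qed.

Lemma Cexp_2PI : Cexp (Ci * RtoC (2 * PI))%C = RtoC 1.
Proof. rewrite Cexp_Ci, cos_2PI, sin_2PI. reflexivity. Qed.

Lemma circ_closed c rho : circ c rho (2 * PI) = circ c rho 0.
Proof. unfold circ. rewrite Cexp_2PI, Cmult_0_r, Cexp_0. reflexivity. Qed.

Lemma circ_FTC f P c rho : (forall t, cder P (circ c rho t) (f (circ c rho t))) ->
  (forall t, @cont CT f (circ c rho t)) ->
  CInt (fun t => f (circ c rho t) * dcirc rho t)%C 0 (2 * PI) = RtoC 0.
Proof.
intros HP Hf.
rewrite (CInt_FTC (fun t => P (circ c rho t))).
- rewrite circ_closed. ring.
- intros t _. apply rder_comp; [apply HP|apply rder_circ].
- intros t _. apply rcont_mult; [|apply rcont_dcirc].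
  apply (rcont_comp f); [apply Hf|apply rcont_circ].
Qed.

Definition cauchy_int (f : C -> C) (c : C) (rho : R) (k : nat) (w : C) : C :=
  kernel (fun t => f (circ c rho t) * dcirc rho t)%C (circ c rho) 0 (2 * PI) k w.

Lemma cder_zero_const f z0 z1 :
  (forall s, 0 <= s <= 1 -> cder f (z0 + RtoC s * (z1 - z0))%C 0) -> f z1 = f z0.
Proof.
intros H.
assert (E : CInt (fun _ => RtoC 0) 0 1 = (f z1 - f z0)%C).
{ rewrite (CInt_FTC (fun s => f (z0 + RtoC s * (z1 - z0))%C)).
  - f_equal; [|f_equal]; f_equal; ring.
  - intros t Ht. rewrite Rmin_left, Rmax_right in Ht by lra.
    eapply rder_eq; [apply (rder_comp f (fun s => z0 + RtoC s * (z1 - z0))%C); [apply H;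
      auto|apply rder_lin]|]. ring.
  - intros t _. apply cont_const. }
rewrite CInt_const, Cmult_0_r in E. symmetry in E. replace (f z1) with ((f z1 - f z0) + f z0)%C by
  ring. rewrite E; ring.
Qed.

(** The derivative in w is the integral of 1 / (u - w)^2, which has a primitive, so the
    value is that at the centre, where the integrand is constant. *)
Lemma winding c rho w : 0 < rho -> Cmod (w - c)%C < rho ->
  cauchy_int (fun _ => RtoC 1) c rho 0 w = (2 * PI * Ci)%C.
Proof.
intros Hr Hw.
assert (Cphi : forall t, rcont (fun t => 1 * dcirc rho t)%C t).
{ intros t. apply rcont_mult; [apply cont_const|apply rcont_dcirc]. }
rewrite (cder_zero_const (cauchy_int (fun _ => RtoC 1) c rho 0) c w).
- unfold cauchy_int, kernel.
  rewrite (CInt_ext _ (fun _ => Ci)).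
  + rewrite CInt_const. rewrite Rminus_0_r, RtoC_mult. ring.
  + intros t _. unfold circ, dcirc. rewrite Cpow_1_r.
    field. replace (c + RtoC rho * Cexp (Ci * RtoC t) - c)%C with (RtoC rho * Cexp (Ci * RtoC t))%C
      by ring.
    apply Cmult_neq_0; [|apply Cexp_neq0]. apply RtoC_neq0; lra.
- intros s Hs.
  assert (Hz : Cmod ((c + RtoC s * (w - c)) - c)%C < rho).
  { replace (c + RtoC s * (w - c) - c)%C with (RtoC s * (w - c))%C by ring.
    rewrite Cmod_mult, Cmod_R, Rabs_pos_eq by lra. generalize (Cmod_ge_0 (w - c)%C); nra. }
  set (z := (c + RtoC s * (w - c))%C) in *.
  assert (Hfar : forall t, rho - Cmod (z - c)%C <= Cmod (circ c rho t - z)%C) by (intros;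
    apply circ_far; auto).
  assert (Hne : forall t, (circ c rho t - z)%C <> RtoC 0).
  { intros t. apply Cmod_gt_0. specialize (Hfar t). lra. }
  eapply cder_eq.
  + apply (kernel_derive _ _ 0 (2 * PI) Cphi (rcont_circ c rho) 0 z (rho - Cmod (z - c)%C));
    [lra|exact Hfar].
  + unfold kernel.
    rewrite (CInt_ext _ (fun t => (/ (circ c rho t - z)) * (/ (circ c rho t - z)) * dcirc rho t)%C).
    2:{ intros t _. simpl. ring. }
    rewrite (circ_FTC (fun u => / (u - z) * / (u - z))%C (fun u => - / (u - z))%C).
    * ring.
    * intros t. apply (cder_ext (fun u => (- (1)) * / (u - z))%C); [intros; ring|].
      eapply cder_eq; [apply cder_scal; apply (cder_comp Cinv (fun u => u - z)%C);
        [apply cder_inv; auto|apply cder_minus; [apply cder_id|apply cder_const]]|].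
      field. auto.
    * intros t. cont_tac; auto.
Qed.

Lemma hol_cont S f z : hol_on S f -> S z -> @cont CT f z.
Proof. intros H Hz. destruct (H z Hz) as [l Hl]. apply (cder_cont _ _ _ Hl). Qed.

(** The difference quotient p of f at w is continuous, and holomorphic away from w, so
    it has a primitive and its integral over the circle vanishes. Since f u = f w + p u
    (u - w), the integral of f u / (u - w) is f w times the winding integral. *)
Lemma cauchy_formula f c r rho w : hol_on (square c r) f -> 0 < rho < r -> Cmod (w - c)%C < rho ->
  cauchy_int f c rho 0 w = (2 * PI * Ci * f w)%C.
Proof.
intros Hf Hr Hw.
assert (Sw : square c r w) by (apply disc_in_square; lra).
destruct (Hf w Sw) as [l Hl]. destruct Hl as [p [Hpc [Hpl Hp]]].
assert (Scirc : forall t, square c r (circ c rho t)) by (intros t; apply disc_in_square;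
  rewrite circ_dist by lra; lra).
assert (Hfar : forall t, rho - Cmod (w - c)%C <= Cmod (circ c rho t - w)%C) by (intros;
  apply circ_far; lra).
assert (Hne : forall t, (circ c rho t - w)%C <> RtoC 0).
{ intros t. apply Cmod_gt_0. specialize (Hfar t). lra. }
assert (Dp : forall z, z <> w -> square c r z -> exists l, cder p z l).
{ intros z Hzw Sz. destruct (Hf z Sz) as [m Hm].
  assert (Hzw' : (z - w)%C <> RtoC 0) by (apply Cminus_eq_contra; auto).
  eexists. apply (cder_ext_loc (fun u => (f u - f w) * / (u - w))%C p z _ (Cmod (z - w)%C)).
  - apply Cmod_gt_0; auto.
  - intros u Hu. rewrite Hp. field. intros E.
    assert (u = w) by (replace u with ((u - w) + w)%C by ring; rewrite E; ring). subst u.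
    rewrite <- Cmod_opp in Hu. replace (- (w - z))%C with (z - w)%C in Hu by ring. lra.
  - apply cder_mult; [apply cder_minus; [exact Hm|apply cder_const]|].
    apply (cder_comp Cinv (fun u => u - w)%C); [apply cder_inv; auto|apply cder_minus;
      [apply cder_id|apply cder_const]]. }
assert (Cp : forall z, square c r z -> @cont CT p z).
{ intros z Sz. destruct (Ceq_dec z w) as [->|Hn]; auto. destruct (Dp z Hn Sz) as [m Hm].
  apply (cder_cont _ _ _ Hm). }
assert (HR := goursat_except p c r w Sw Cp (fun z Hz => Dp z (proj2 Hz) (proj1 Hz))).
destruct (primitive_exists p c r) as [P HP]; [lra|auto|auto|].
assert (I0 : CInt (fun t => p (circ c rho t) * dcirc rho t)%C 0 (2 * PI) = RtoC 0).
{ apply (circ_FTC p P); intros t; auto. }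
assert (Cf : forall t, rcont (fun t => f (circ c rho t) * dcirc rho t)%C t).
{ intros t. apply rcont_mult; [|apply rcont_dcirc].
  apply (rcont_comp f); [apply (hol_cont _ _ _ Hf); auto|apply rcont_circ]. }
assert (C1 : forall t, rcont (fun t => 1 * dcirc rho t)%C t).
{ intros t. apply rcont_mult; [apply cont_const|apply rcont_dcirc]. }
assert (W := winding c rho w ltac:(lra) Hw). unfold cauchy_int in W |- *.
rewrite <- W. rewrite Cmult_comm. unfold kernel in *.
assert (Hne' : forall t, circ c rho t <> w).
{ intros t E. apply (Hne t). rewrite E. ring. }
assert (K1 := kernel_cont _ _ Cf (rcont_circ c rho) 0 w Hne').
assert (K2 := kernel_cont _ _ C1 (rcont_circ c rho) 0 w Hne').
rewrite <- CInt_scal by (apply contI_forall; exact K2).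
match goal with |- ?A = ?B => replace A with ((A - B) + B)%C by ring end.
rewrite <- CInt_minus.
- rewrite (CInt_ext _ (fun t => p (circ c rho t) * dcirc rho t)%C).
  + rewrite I0. ring.
  + intros t _. rewrite Cpow_1_r.
    replace (f (circ c rho t) * dcirc rho t * / (circ c rho t - w) - f w * (1 * dcirc rho t * /
      (circ c rho t - w)))%C
      with ((f (circ c rho t) - f w) * dcirc rho t * / (circ c rho t - w))%C by ring.
    rewrite Hp. field. auto.
- apply contI_forall; exact K1.
- apply contI_forall. intros t. apply rcont_mult; [apply cont_const|apply K2].
Qed.

(** * Taylor expansion, identity theorem, uniform limits *)

Lemma twopii_neq0 : (2 * PI * Ci)%C <> RtoC 0.
Proof.
apply Cmult_neq_0; [|apply Ci_nz]. apply Cmult_neq_0; intros E; apply RtoC_inj in E; [lra|].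
generalize PI_RGT_0; lra.
Qed.

Section LocalTheory.
Variables (f : C -> C) (c : C) (r rho : R).
Hypothesis Hf : hol_on (square c r) f.
Hypothesis Hr : 0 < rho < r.

Lemma circ_in_square t : square c r (circ c rho t).
Proof. apply disc_in_square; rewrite circ_dist by lra; lra. Qed.

Lemma circ_far' w t : Cmod (w - c)%C < rho -> rho - Cmod (w - c)%C <= Cmod (circ c rho t - w)%C.
Proof. intros; apply circ_far; lra. Qed.

Lemma circ_ne w t : Cmod (w - c)%C < rho -> circ c rho t <> w.
Proof. intros H E. assert (K := circ_far' w t H). rewrite E in K. rewrite Cmod_sub_self in K. lra.
  Qed.

Lemma rcont_density t : rcont (fun t => f (circ c rho t) * dcirc rho t)%C t.
Proof.
apply rcont_mult; [|apply rcont_dcirc].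
apply (rcont_comp f); [apply (hol_cont _ _ _ Hf), circ_in_square|apply rcont_circ].
Qed.

Lemma cauchy_int_derive k w : Cmod (w - c)%C < rho -> cder (cauchy_int f c rho k) w (RtoC (INR (S
  k)) * cauchy_int f c rho (S k) w)%C.
Proof.
intros Hw. apply (kernel_derive _ _ 0 (2 * PI) rcont_density (rcont_circ c rho) k w (rho - Cmod (w
  - c)%C)); [lra|].
intros t; apply circ_far'; auto.
Qed.

Lemma disc_room w : Cmod (w - c)%C < rho -> forall u, Cmod (u - w)%C < rho - Cmod (w - c)%C ->
  Cmod (u - c)%C < rho.
Proof.
intros Hw u Hu. replace (u - c)%C with ((u - w) + (w - c))%C by ring.
eapply Rle_lt_trans; [apply Cmod_triangle|]. lra.
Qed.

(** [C_derive] is a total operator, so the induction has to carry the differentiability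
    of the k-th derivative on the whole disc along with its formula. *)
Lemma derive_n_cauchy_int k w : Cmod (w - c)%C < rho ->
  C_derive_n k f w = (RtoC (INR (fact k)) / (2 * PI * Ci) * cauchy_int f c rho k w)%C /\
  cder (C_derive_n k f) w (C_derive_n (S k) f w).
Proof.
revert w. induction k as [|k IH]; intros w Hw.
- assert (E : forall u, Cmod (u - c)%C < rho -> f u = (/ (2 * PI * Ci) * cauchy_int f c rho 0 u)%C).
  { intros u Hu. rewrite (cauchy_formula f c r rho u) by auto. field.
    repeat split; first [apply Ci_nz|apply RtoC_neq0; generalize PI_RGT_0; lra]. }
  split.
  + simpl C_derive_n. rewrite (E w Hw). simpl. unfold Cdiv. ring.
  + assert (D : exists l, cder f w l) by (apply Hf, disc_in_square; lra). destruct D as [l D].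
    change (C_derive_n 1 f w) with (C_derive f w). rewrite (C_derive_cder _ _ _ D). exact D.
- assert (E : forall u, Cmod (u - c)%C < rho -> C_derive_n (S k) f u = (RtoC (INR (fact (S k))) /
  (2 * PI * Ci) * cauchy_int f c rho (S k) u)%C).
  { intros u Hu. destruct (IH u Hu) as [E1 D].
    assert (D2 : cder (C_derive_n k f) u (RtoC (INR (fact k)) / (2 * PI * Ci) * (RtoC (INR (S k)) *
      cauchy_int f c rho (S k) u))%C).
    { apply (cder_ext_loc (fun v => RtoC (INR (fact k)) / (2 * PI * Ci) * cauchy_int f c rho k v)%C
      _ _ _ (rho - Cmod (u - c)%C)); [lra| |].
      - intros v Hv. symmetry. apply IH. apply (disc_room u); auto.
      - apply cder_scal. apply cauchy_int_derive; auto. }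
    rewrite (cder_unique _ _ _ _ D D2). rewrite fact_simpl, mult_INR, RtoC_mult. unfold Cdiv.
      ring. }
  split; [apply E; auto|].
  assert (D2 : cder (C_derive_n (S k) f) w (RtoC (INR (fact (S k))) / (2 * PI * Ci) * (RtoC (INR (S
    (S k))) * cauchy_int f c rho (S (S k)) w))%C).
  { apply (cder_ext_loc (fun v => RtoC (INR (fact (S k))) / (2 * PI * Ci) * cauchy_int f c rho (S
    k) v)%C _ _ _ (rho - Cmod (w - c)%C)); [lra| |].
    - intros v Hv. symmetry. apply E. apply (disc_room w); auto.
    - apply cder_scal. apply cauchy_int_derive; auto. }
  change (C_derive_n (S (S k)) f w) with (C_derive (C_derive_n (S k) f) w).
  rewrite (C_derive_cder _ _ _ D2). exact D2.
Qed.

(** Summing N terms of the geometric series of 1 / (u - w) in powers of (w - c) / (u -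
    c) is exact up to a remainder integral, which is estimated on the circle. *)
Lemma taylor_bound : exists M, 0 < M /\ forall N w, Cmod (w - c)%C < rho ->
  Cmod (f w - Csum (fun k => C_derive_n k f c / RtoC (INR (fact k)) * (w - c) ^ k) N)%C
   <= M / (rho - Cmod (w - c)%C) * (Cmod (w - c)%C / rho) ^ N.
Proof.
destruct (contI_bounded (fun t => f (circ c rho t) * dcirc rho t)%C 0 (2 * PI)) as [M [HM Hb]].
{ apply contI_forall, rcont_density. }
assert (HPI := PI_RGT_0).
exists M. split; auto. intros N w Hw.
set (phi := fun t => (f (circ c rho t) * dcirc rho t)%C) in *.
assert (Hc0 : Cmod (c - c)%C < rho) by (rewrite Cmod_sub_self; lra).
assert (Cr : forall n t, rcont (fun t => phi t * ((/ (circ c rho t - c)) ^ n * / (circ c rho t -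
  w)))%C t).
{ intros n t. apply rcont_mult; [apply rcont_density|].
  apply rcont_mult.
  - apply rcont_pow, rcont_inv.
    + apply Cminus_eq_contra, circ_ne; auto.
    + apply rcont_minus; [apply rcont_circ|apply cont_const].
  - apply rcont_inv.
    + apply Cminus_eq_contra, circ_ne; auto.
    + apply rcont_minus; [apply rcont_circ|apply cont_const]. }
assert (Ck : forall k t, rcont (fun t => phi t * (/ (circ c rho t - c)) ^ S k)%C t).
{ intros k t. apply (kernel_cont phi (circ c rho)); [apply rcont_density|apply rcont_circ|].
  intros s; apply circ_ne; auto. }
(* The kernel identity 1 / (u - w) = 1 / (u - c) + (w - c) / ((u - c) (u - w)),
    iterated. *)
assert (E : forall n, (cauchy_int f c rho 0 w = Csum (fun k => (w - c) ^ k * cauchy_int f c rho k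
  c) n + (w - c) ^ n * CInt (fun t => phi t * ((/ (circ c rho t - c)) ^ n * / (circ c rho t - w)))
  0 (2 * PI))%C).
{ induction n.
  - rewrite Csum_0. replace ((w - c) ^ 0)%C with (RtoC 1) by reflexivity.
    rewrite Cplus_0_l, Cmult_1_l.
    apply CInt_ext. intros t _. unfold phi. simpl. ring.
  - rewrite IHn, Csum_S.
    replace (CInt (fun t => phi t * ((/ (circ c rho t - c)) ^ n * / (circ c rho t - w)))%C 0 (2 *
      PI)) with
      (cauchy_int f c rho n c + (w - c) * CInt (fun t => phi t * ((/ (circ c rho t - c)) ^ S n * /
        (circ c rho t - w)))%C 0 (2 * PI))%C.
    + rewrite (Cpow_S (w - c)). ring.
    + rewrite <- CInt_scal by (apply contI_forall, Cr). unfold cauchy_int, kernel.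
      rewrite <- CInt_plus.
      * apply CInt_ext. intros t _. fold (phi t). rewrite Cpow_S.
        field. split; apply Cminus_eq_contra, circ_ne; auto.
      * apply contI_forall, Ck.
      * apply contI_forall. intros t. apply rcont_mult; [apply cont_const|apply Cr]. }
assert (F0 : f w = (/ (2 * PI * Ci) * cauchy_int f c rho 0 w)%C).
{ rewrite (cauchy_formula f c r rho w) by auto. field.
  repeat split; first [apply Ci_nz|apply RtoC_neq0; lra]. }
assert (F1 : Csum (fun k => C_derive_n k f c / RtoC (INR (fact k)) * (w - c) ^ k)%C N = (/ (2 * PI
  * Ci) * Csum (fun k => (w - c) ^ k * cauchy_int f c rho k c) N)%C).
{ clear E. induction N; [rewrite !Csum_0; ring|]. rewrite !Csum_S, IHN.
  destruct (derive_n_cauchy_int N c Hc0) as [-> _].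
  replace (RtoC (INR (fact N)) / (2 * PI * Ci) * cauchy_int f c rho N c / RtoC (INR (fact N)) * (w
    - c) ^ N)%C with
   (/ (2 * PI * Ci) * ((w - c) ^ N * cauchy_int f c rho N c))%C; [ring|].
  field. repeat split; first [apply RtoC_fact_neq0|apply Ci_nz|apply RtoC_neq0; lra]. }
rewrite F1, F0, (E N).
match goal with |- Cmod ?X <= _ => replace X with (/ (2 * PI * Ci) * ((w - c) ^ N * CInt (fun t =>
  phi t * ((/ (circ c rho t - c)) ^ N * / (circ c rho t - w))) 0 (2 * PI)))%C by ring end.
assert (Em : Cmod (2 * PI * Ci)%C = 2 * PI).
{ rewrite !Cmod_mult, Cmod_Ci, !Cmod_R, !Rabs_pos_eq by lra. ring. }
rewrite Cmod_mult, Cmod_inv by apply twopii_neq0. rewrite Em, Cmod_mult, Cmod_pow.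
assert (Hd : 0 < rho - Cmod (w - c)%C) by lra.
assert (B : Cmod (CInt (fun t => phi t * ((/ (circ c rho t - c)) ^ N * / (circ c rho t - w)))%C 0
  (2 * PI)) <= M * ((/ rho) ^ N * / (rho - Cmod (w - c)%C)) * Rabs (2 * PI - 0)).
{ apply CInt_bound; [apply contI_forall, Cr|].
  intros t Ht. rewrite !Cmod_mult, Cmod_pow.
  rewrite !Cmod_inv by (apply Cminus_eq_contra, circ_ne; auto).
  rewrite circ_dist by lra.
  apply Rmult_le_compat; auto; try apply Cmod_ge_0.
  - apply Rmult_le_pos; [apply pow_le; left; apply Rinv_0_lt_compat; lra|].
    left; apply Rinv_0_lt_compat. assert (K := circ_far' w t Hw). lra.
  - apply Hb; auto.
  - apply Rmult_le_compat_l; [apply pow_le; left; apply Rinv_0_lt_compat; lra|].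
    apply Rinv_le_contravar; auto. apply circ_far'; auto. }
rewrite Rminus_0_r, (Rabs_pos_eq (2 * PI)) in B by lra.
assert (Hp : 0 <= Cmod (w - c)%C ^ N) by (apply pow_le, Cmod_ge_0).
eapply Rle_trans.
- apply Rmult_le_compat_l; [left; apply Rinv_0_lt_compat; lra|].
  apply Rmult_le_compat_l; [exact Hp|exact B].
- right. unfold Rdiv. rewrite Rpow_mult_distr. field. lra.
Qed.
End LocalTheory.

Lemma C_derive_n_zero f c d : (forall w, Cmod (w - c)%C < d -> f w = RtoC 0) ->
  forall k w, Cmod (w - c)%C < d -> C_derive_n k f w = RtoC 0.
Proof.
intros H k. induction k; intros w Hw; [apply H; auto|].
change (C_derive_n (S k) f w) with (C_derive (C_derive_n k f) w).
apply C_derive_cder. apply (cder_ext_loc (fun _ => RtoC 0) _ _ _ (d - Cmod (w - c)%C));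
  [lra| |apply cder_const].
intros u Hu. symmetry. apply IHk. replace (u - c)%C with ((u - w) + (w - c))%C by ring.
eapply Rle_lt_trans; [apply Cmod_triangle|]. lra.
Qed.

Lemma Csum_zero u N : (forall n, (n < N)%nat -> u n = RtoC 0) -> Csum u N = RtoC 0.
Proof. intros H. induction N; [reflexivity|]. rewrite Csum_S, IHN, H by auto. ring. Qed.

Definition hol_all (f : C -> C) := forall z, exists l, cder f z l.

Lemma hol_all_square f c r : hol_all f -> hol_on (square c r) f.
Proof. intros H z _; apply H. Qed.

(** All Taylor coefficients of f at c vanish, and the Taylor remainder on a disc about c
    of radius larger than the distance to w tends to 0. *)
Theorem identity_entire f c d : hol_all f -> 0 < d -> (forall w, Cmod (w - c)%C < d ->
  f w = RtoC 0) ->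
  forall w, f w = RtoC 0.
Proof.
intros Hf Hd H0 w. set (m := Cmod (w - c)%C). assert (Hm : 0 <= m) by apply Cmod_ge_0.
destruct (taylor_bound f c (2 * m + 2) (2 * m + 1) (hol_all_square f c _ Hf)) as [M [HM HT]];
  [lra|].
apply Cmod_eq_0. apply Rle_antisym; [|apply Cmod_ge_0].
assert (L : is_lim_seq (fun N => M / (2 * m + 1 - m) * (m / (2 * m + 1)) ^ N) 0).
{ replace (Finite 0) with (Rbar_mult (M / (2 * m + 1 - m)) 0) by (simpl; f_equal; ring).
  apply is_lim_seq_scal_l, is_lim_seq_geom.
  assert (0 <= m / (2 * m + 1)) by (apply Rmult_le_pos; auto; left; apply Rinv_0_lt_compat; lra).
  rewrite Rabs_pos_eq by auto. apply Rmult_lt_reg_r with (2 * m + 1); [lra|]. unfold Rdiv.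
    rewrite Rmult_assoc, Rinv_l by lra. lra. }
apply (is_lim_seq_le (fun _ => Cmod (f w)) _ (Cmod (f w)) 0) with (3 := L);
  [|apply is_lim_seq_const].
intros N. specialize (HT N w). fold m in HT.
rewrite Csum_zero in HT.
- replace (f w - 0)%C with (f w) in HT by ring. apply HT. lra.
- intros n _. rewrite (C_derive_n_zero f c d H0).
  + unfold Cdiv; ring.
  + rewrite Cmod_sub_self; lra.
Qed.

(** Cauchy's formula passes to the limit, and Cauchy integrals of continuous functions
    are holomorphic. *)
Lemma entire_limit (fn : nat -> C -> C) f : (forall n, hol_all (fn n)) ->
  (forall rho eps, 0 < eps -> exists n, forall z, Cmod z <= rho -> Cmod (fn n z - f z)%C <= eps) ->
  hol_all f.
Proof.
intros Hn Hu z.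
assert (Cf : forall w, @cont CT f w).
{ intros w. apply ccont_eps. intros eps He. destruct (Hu (Cmod w + 1) (eps / 4)) as [n Hn']; [lra|].
  destruct (Hn n w) as [l Hl]. apply cder_cont in Hl.
  destruct (proj1 (ccont_eps _ _) Hl (eps / 4)) as [d [Hd Hd']]; [lra|].
  exists (Rmin d 1). split; [apply Rmin_glb_lt; lra|]. intros u Hu'.
  assert (A1 := Rlt_le_trans _ _ _ Hu' (Rmin_l _ _)). assert (A2 := Rlt_le_trans _ _ _ Hu' (Rmin_r
    _ _)).
  assert (Hu1 : Cmod u <= Cmod w + 1).
  { replace u with (w + (u - w))%C by ring. eapply Rle_trans; [apply Cmod_triangle|]. lra. }
  assert (B1 := Hn' u Hu1). assert (B2 := Hn' w ltac:(lra)). specialize (Hd' u A1).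
  replace (f u - f w)%C with (- (fn n u - f u) + ((fn n u - fn n w) + (fn n w - f w)))%C by ring.
  eapply Rle_lt_trans; [apply Cmod_triangle|]. rewrite Cmod_opp.
  eapply Rle_lt_trans; [apply Rplus_le_compat_l, Cmod_triangle|]. lra. }
set (rho := Cmod z + 1). assert (Hrho : 0 < rho) by (unfold rho; generalize (Cmod_ge_0 z); lra).
assert (Cphi : forall t, rcont (fun t => f (circ 0 rho t) * dcirc rho t)%C t).
{ intros t. apply rcont_mult; [|apply rcont_dcirc].
  apply (rcont_comp f); [apply Cf|apply rcont_circ]. }
assert (Hz : Cmod (z - 0)%C < rho) by (replace (z - 0)%C with z by ring; unfold rho; lra).
assert (E : forall w, Cmod (w - 0)%C < rho -> cauchy_int f 0 rho 0 w = (2 * PI * Ci * f w)%C).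
{ intros w Hw. apply Ceq_minus. apply Cmod_eq_0. apply Rle_antisym; [|apply Cmod_ge_0].
  assert (HPI := PI_RGT_0). set (d := rho - Cmod (w - 0)%C) in *.
    assert (Hd : 0 < d) by (unfold d; lra).
  set (B := rho * / d * (2 * PI) + 2 * PI).
  assert (HB : 0 < B). { unfold B. assert (0 < / d) by (apply Rinv_0_lt_compat; auto).
    assert (K1 : 0 < rho * / d) by (apply Rmult_lt_0_compat; auto).
    assert (K2 : 0 < rho * / d * (2 * PI)) by (apply Rmult_lt_0_compat; [exact K1|lra]). lra. }
  apply Rnot_lt_le. intros Hpos.
  set (X := Cmod (cauchy_int f 0 rho 0 w - 2 * PI * Ci * f w)%C) in *.
  destruct (Hu rho (X / (2 * B))) as [n Hn']; [apply Rdiv_lt_0_compat; lra|].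
  assert (En := cauchy_formula (fn n) 0 (rho + 1) rho w (hol_all_square _ _ _ (Hn n)) ltac:(lra)
    Hw).
  assert (Cphin : forall t, rcont (fun t => fn n (circ 0 rho t) * dcirc rho t)%C t).
  { intros t. apply rcont_mult; [|apply rcont_dcirc].
    apply (rcont_comp (fn n)); [|apply rcont_circ]. destruct (Hn n (circ 0 rho t)) as [l Hl].
      apply (cder_cont _ _ _ Hl). }
  assert (Hne : forall t, circ 0 rho t <> w).
  { intros t Eq. assert (K := circ_far 0 rho t w Hrho). rewrite Eq in K.
    rewrite Cmod_sub_self in K. lra. }
  assert (D : Cmod (cauchy_int (fn n) 0 rho 0 w - cauchy_int f 0 rho 0 w)%C <= X / (2 * B) * (rho *
    / d) * Rabs (2 * PI - 0)).
  { unfold cauchy_int, kernel. rewrite <- CInt_minus.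
    - apply CInt_bound.
      + apply contI_forall. intros t. apply rcont_minus; apply (kernel_cont _ _); auto;
        apply rcont_circ.
      + intros t _. rewrite Cpow_1_r.
        replace (fn n (circ 0 rho t) * dcirc rho t * / (circ 0 rho t - w) - f (circ 0 rho t) *
          dcirc rho t * / (circ 0 rho t - w))%C
         with ((fn n (circ 0 rho t) - f (circ 0 rho t)) * (dcirc rho t * / (circ 0 rho t - w)))%C
           by ring.
        rewrite Cmod_mult. apply Rmult_le_compat; try apply Cmod_ge_0.
        * apply Hn'. replace (circ 0 rho t) with (circ 0 rho t - 0)%C by ring.
          rewrite circ_dist by lra. lra.
        * rewrite Cmod_mult. apply Rmult_le_compat; try apply Cmod_ge_0.
          -- unfold dcirc. rewrite !Cmod_mult, Cmod_Ci, Cmod_R, Cmod_Cexp, Rabs_pos_eq by lra.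
            simpl.
             replace (0 * t - 1 * 0) with 0 by ring. rewrite exp_0. lra.
          -- rewrite Cmod_inv by (apply Cminus_eq_contra; auto).
             apply Rinv_le_contravar; auto. apply circ_far; auto.
    - apply contI_forall. intros t. apply (kernel_cont _ _); auto; apply rcont_circ.
    - apply contI_forall. intros t. apply (kernel_cont _ _); auto; apply rcont_circ. }
  rewrite Rminus_0_r, (Rabs_pos_eq (2 * PI)) in D by lra.
  assert (Hw' : Cmod w <= rho) by (replace w with (w - 0)%C by ring; lra).
  specialize (Hn' w Hw').
  assert (T : X <= Cmod (cauchy_int (fn n) 0 rho 0 w - cauchy_int f 0 rho 0 w)%C + 2 * PI * Cmod
    (fn n w - f w)%C).
  { unfold X. replace (cauchy_int f 0 rho 0 w - 2 * PI * Ci * f w)%C with (- (cauchy_int (fn n) 0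
    rho 0 w - cauchy_int f 0 rho 0 w) + (2 * PI * Ci) * (fn n w - f w))%C by (rewrite En; ring).
    eapply Rle_trans; [apply Cmod_triangle|]. rewrite Cmod_opp, Cmod_mult.
    rewrite !Cmod_mult, Cmod_Ci, !Cmod_R, !Rabs_pos_eq by lra. lra. }
  assert (T2 : X <= X / (2 * B) * B).
  { unfold B at 2. eapply Rle_trans; [exact T|]. rewrite Rmult_plus_distr_l.
    apply Rplus_le_compat; [lra|]. rewrite Rmult_comm. apply Rmult_le_compat_r; lra. }
  replace (X / (2 * B) * B) with (X / 2) in T2 by (field; lra). lra. }
eexists. apply (cder_ext_loc (fun w => / (2 * PI * Ci) * cauchy_int f 0 rho 0 w)%C f z _ (rho -
  Cmod (z - 0)%C)); [lra| |].
- intros w Hw. rewrite E.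
  + field. repeat split; first [apply Ci_nz|apply RtoC_neq0; generalize PI_RGT_0; lra].
  + replace (w - 0)%C with ((w - z) + (z - 0))%C by ring. eapply Rle_lt_trans;
    [apply Cmod_triangle|]. lra.
- apply cder_scal. apply (kernel_derive _ _ 0 (2 * PI) Cphi (rcont_circ 0 rho) 0 z (rho - Cmod (z -
  0)%C)); [lra|].
  intros t. apply circ_far; auto.
Qed.

(** * Improper integrals and integrals depending on a parameter *)

Lemma is_RInt_exp M d a b : d <> 0 -> is_RInt (fun x => M * exp (- (d * x))) a b (M / d * (exp (-
  (d * a)) - exp (- (d * b)))).
Proof.
intros Hd.
replace (M / d * (exp (- (d * a)) - exp (- (d * b)))) with (minus (- (M / d) * exp (- (d * b))) (-
  (M / d) * exp (- (d * a)))).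
2:{ unfold minus, plus, opp; simpl. ring. }
apply (is_RInt_derive (V := R_CompleteNormedModule) (fun x => - (M / d) * exp (- (d * x)))).
- intros x _. auto_derive; [auto|]. field. auto.
- intros x _. smooth.
Qed.

(** The integral of f over [0, oo) converges to l. *)
Definition is_lim_int (f : R -> C) (l : C) : Prop :=
  forall eps, 0 < eps -> exists X, forall b, X <= b -> Cmod (CInt f 0 b - l)%C <= eps.

(** The rate is kept because it supplies uniformity in parameters later on. *)
Lemma improper_exists f M d X0 : (forall x, rcont f x) -> 0 < d -> 0 <= M -> 0 <= X0 ->
  (forall x, X0 <= x -> Cmod (f x) <= M * exp (- (d * x))) ->
  exists l, forall b, X0 <= b -> Cmod (CInt f 0 b - l)%C <= M / d * exp (- (d * b)).
Proof.
intros Hc Hd HM HX Hb.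
assert (D : forall b b', X0 <= b -> b <= b' -> Cmod (CInt f 0 b' - CInt f 0 b)%C <= M / d * exp (-
  (d * b))).
{ intros b b' H1 H2.
  rewrite <- (CInt_Chasles f 0 b b') by (apply contI_forall; auto).
  replace (CInt f 0 b + CInt f b b' - CInt f 0 b)%C with (CInt f b b') by ring.
  eapply Rle_trans; [apply (CInt_le f (fun x => M * exp (- (d * x))) b b' H2)|].
  - apply contI_forall; auto.
  - intros t Ht. apply Hb. lra.
  - eexists; apply is_RInt_exp; lra.
  - rewrite (is_RInt_unique _ _ _ _ (is_RInt_exp M d b b' ltac:(lra))).
    apply Rmult_le_compat_l; [unfold Rdiv; apply Rmult_le_pos; auto; left; apply Rinv_0_lt_compat;
      auto|].
    generalize (exp_pos (- (d * b'))); lra. }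
assert (Z : forall eps, 0 < eps -> exists X, X0 <= X /\ M / d * exp (- (d * X)) < eps).
{ intros eps He. set (Q := M / d + 1).
  assert (HQ0 : 0 <= M / d) by (unfold Rdiv; apply Rmult_le_pos; auto; left;
    apply Rinv_0_lt_compat; auto).
  set (X := Rmax X0 (- ln (eps / Q) / d)).
  exists X. split; [apply Rmax_l|].
  assert (HX1 : - ln (eps / Q) / d <= X) by apply Rmax_r.
  assert (HQ : 0 < eps / Q) by (apply Rdiv_lt_0_compat; unfold Q; lra).
  assert (E : exp (- (d * X)) <= eps / Q).
  { rewrite <- (exp_ln (eps / Q)) by auto. apply exp_le.
    assert (d * (- ln (eps / Q) / d) <= d * X) by (apply Rmult_le_compat_l; lra).
    replace (d * (- ln (eps / Q) / d)) with (- ln (eps / Q)) in H by (field; lra). lra. }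
  apply Rle_lt_trans with (M / d * (eps / Q)); [apply Rmult_le_compat_l; auto|].
  replace eps with (Q * (eps / Q)) at 2 by (unfold Q; field; lra).
  apply Rmult_lt_compat_r; auto. unfold Q; lra. }
destruct (proj1 (filterlim_locally_cauchy (U := C_R_CompleteNormedModule) (F := Rbar_locally
  p_infty) (fun b => CInt f 0 b))) as [l Hl].
{ intros eps. destruct (Z (eps / 2)) as [X [HXX HX2]]; [generalize (cond_pos eps); lra|].
  exists (fun b => X < b). split; [exists X; auto|].
  intros u v Hu Hv. apply ballC_CT.
  replace (CInt f 0 v - CInt f 0 u)%C with ((CInt f 0 v - CInt f 0 X) + - (CInt f 0 u - CInt f 0
    X))%C by ring.
  eapply Rle_lt_trans; [apply Cmod_triangle|]. rewrite Cmod_opp.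
  assert (A1 := D X u HXX ltac:(lra)). assert (A2 := D X v HXX ltac:(lra)). lra. }
exists l. intros b Hbb.
apply Rnot_lt_le. intros Hlt.
set (eps := (Cmod (CInt f 0 b - l)%C - M / d * exp (- (d * b))) / 4).
assert (He : 0 < eps) by (unfold eps; lra).
destruct (proj1 (filterlim_locally (U := C_R_NormedModule) _ l) Hl (mkposreal eps He)) as [Y HY].
set (b' := Rmax (Y + 1) b).
assert (Hb1 : Y < b') by (unfold b'; generalize (Rmax_l (Y + 1) b); lra).
assert (Hb2 : b <= b') by apply Rmax_r.
specialize (HY b' Hb1). destruct HY as [H1 H2].
assert (K : Cmod (CInt f 0 b' - l)%C < 2 * eps).
{ eapply Rle_lt_trans; [apply Cmod_le_sum|].
  assert (K1 : Rabs (Re (CInt f 0 b' - l)%C) < eps) by exact H1.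
  assert (K2 : Rabs (Im (CInt f 0 b' - l)%C) < eps) by exact H2. lra. }
assert (K2 := D b b' Hbb Hb2).
assert (T : Cmod (CInt f 0 b - l)%C <= Cmod (CInt f 0 b' - CInt f 0 b)%C + Cmod (CInt f 0 b' -
  l)%C).
{ replace (CInt f 0 b - l)%C with (- (CInt f 0 b' - CInt f 0 b) + (CInt f 0 b' - l))%C by ring.
  eapply Rle_trans; [apply Cmod_triangle|]. rewrite Cmod_opp. lra. }
unfold eps in *. lra.
Qed.

Lemma exp_small C d eps : 0 < d -> 0 < eps -> exists X, 0 <= X /\ forall b, X <= b ->
  C * exp (- (d * b)) <= eps.
Proof.
intros Hd He. set (Q := Rabs C + 1).
assert (HQ0 : 0 < Q) by (unfold Q; generalize (Rabs_pos C); lra).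
assert (HQ : 0 < eps / Q) by (apply Rdiv_lt_0_compat; auto).
exists (Rmax 0 (- ln (eps / Q) / d)). split; [apply Rmax_l|]. intros b Hb.
assert (H1 : - ln (eps / Q) / d <= b) by (eapply Rle_trans; [apply Rmax_r|exact Hb]).
assert (E : exp (- (d * b)) <= eps / Q).
{ rewrite <- (exp_ln (eps / Q)) by auto. apply exp_le.
  assert (d * (- ln (eps / Q) / d) <= d * b) by (apply Rmult_le_compat_l; lra).
  replace (d * (- ln (eps / Q) / d)) with (- ln (eps / Q)) in H by (field; lra). lra. }
apply Rle_trans with (Q * (eps / Q)).
- apply Rle_trans with (Q * exp (- (d * b))).
  + apply Rmult_le_compat_r; [left; apply exp_pos|]. unfold Q. generalize (Rle_abs C); lra.
  + apply Rmult_le_compat_l; lra.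
- right. field. lra.
Qed.

Lemma improper_lim f M d X0 : (forall x, rcont f x) -> 0 < d -> 0 <= M -> 0 <= X0 ->
  (forall x, X0 <= x -> Cmod (f x) <= M * exp (- (d * x))) ->
  exists l, is_lim_int f l /\ forall b, X0 <= b -> Cmod (CInt f 0 b - l)%C <= M / d * exp (- (d *
    b)).
Proof.
intros Hc Hd HM HX Hb. destruct (improper_exists f M d X0 Hc Hd HM HX Hb) as [l Hl].
exists l. split; auto. intros eps He.
destruct (exp_small (M / d) d eps Hd He) as [X [HX0 HX1]].
exists (Rmax X X0). intros b Hb'.
eapply Rle_trans; [apply Hl|apply HX1]; (eapply Rle_trans; [|exact Hb']);
  [apply Rmax_r|apply Rmax_l].
Qed.

(** Integration over [a,b] makes Phi a holomorphic function of z. Continuity in x is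
    part of the notion so that it is stable under sums. *)
Definition param_hol (a b : R) (Phi : R -> C -> C) : Prop :=
  (forall z, contI (fun x => Phi x z) a b) /\ hol_all (fun z => CInt (fun x => Phi x z) a b).

Lemma hol_all_ext f g : (forall z, f z = g z) -> hol_all f -> hol_all g.
Proof. intros E H z. destruct (H z) as [l Hl]. exists l. apply (cder_ext f); auto. Qed.

Lemma param_ext a b Phi Psi : (forall x z, Phi x z = Psi x z) -> param_hol a b Phi ->
  param_hol a b Psi.
Proof.
intros E [H1 H2]. split.
- intros z x Hx. apply (@cont_ext R_UniformSpace (fun x => Phi x z)); auto. apply H1; auto.
- apply (hol_all_ext (fun z => CInt (fun x => Phi x z) a b)); auto.
  intros z. apply CInt_ext. auto.
Qed.

Lemma param_plus a b Phi Psi : param_hol a b Phi -> param_hol a b Psi ->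
  param_hol a b (fun x z => Phi x z + Psi x z)%C.
Proof.
intros [H1 H2] [K1 K2]. split.
- intros z x Hx. apply rcont_plus; [apply H1|apply K1]; auto.
- apply (hol_all_ext (fun z => CInt (fun x => Phi x z) a b + CInt (fun x => Psi x z) a b)%C).
  + intros z. symmetry. apply CInt_plus; auto.
  + intros z. destruct (H2 z) as [l Hl], (K2 z) as [m Hm]. eexists. apply cder_plus; eauto.
Qed.

Lemma param_monomial a b c m k : contI c a b -> param_hol a b (fun x z => c x * (k * z) ^ m)%C.
Proof.
intros Hc. split.
- intros z x Hx. apply rcont_mult; [apply Hc; auto|apply cont_const].
- apply (hol_all_ext (fun z => CInt c a b * (k * z) ^ m)%C).
  + intros z. rewrite Cmult_comm. rewrite <- CInt_scal by auto. apply CInt_ext. intros x _. ring.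
  + intros z. eexists. apply cder_scal. apply (cder_comp (fun w => w ^ m)%C (fun w => k * w)%C).
    * apply cder_pow.
    * apply cder_scal, cder_id.
Qed.

Lemma param_zero a b : param_hol a b (fun _ _ => RtoC 0).
Proof.
split; [intros z x _; apply cont_const|]. intros z. exists (RtoC 0).
apply (cder_ext (fun _ => CInt (fun _ => RtoC 0) a b)); [auto|apply cder_const].
Qed.

Lemma param_Csum a b (Phi : nat -> R -> C -> C) N : (forall n, param_hol a b (Phi n)) ->
  param_hol a b (fun x z => Csum (fun n => Phi n x z) N).
Proof.
intros H. induction N; [apply param_zero|].
apply (param_ext a b (fun x z => Csum (fun n => Phi n x z) N + Phi N x z)%C).
- intros x z. symmetry. apply (Csum_S (fun n => Phi n x z)).
- apply param_plus; auto.
Qed.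

(** The only transcendental dependence on z in the integrands is of this form; the
    second-order remainder of the exponential, bounded uniformly in x, justifies
    differentiation under the integral. *)
Lemma param_exp a b c s : contI c a b -> contI s a b -> param_hol a b (fun x z => c x * Cexp (s x *
  z))%C.
Proof.
intros Hc Hs.
assert (Cx : forall z, contI (fun x => c x * Cexp (s x * z))%C a b).
{ intros z x Hx. apply rcont_mult; [apply Hc; auto|].
  apply rcont_Cexp. apply rcont_mult; [apply Hs; auto|apply cont_const]. }
split; auto.
intros z.
destruct (contI_bounded _ a b (Cx z)) as [M [HM Hb]].
destruct (contI_bounded _ a b Hs) as [S [HS Hb']].
assert (Cd : contI (fun x => s x * (c x * Cexp (s x * z)))%C a b).
{ intros x Hx. apply rcont_mult; [apply Hs; auto|apply Cx; auto]. }
exists (CInt (fun x => s x * (c x * Cexp (s x * z)))%C a b).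
apply cder_eps. intros eps He.
set (B := M * (S * S * exp S) * Rabs (b - a) + 1).
assert (HB0 : 0 <= M * (S * S * exp S) * Rabs (b - a)).
{ apply Rmult_le_pos; [|apply Rabs_pos]. apply Rmult_le_pos; [lra|].
  apply Rmult_le_pos; [nra|left; apply exp_pos]. }
assert (HB : 0 < B) by (unfold B; lra).
exists (Rmin 1 (eps / B)). split; [apply Rmin_glb_lt; [lra|apply Rdiv_lt_0_compat; auto]|].
intros w Hw. assert (H1 := Rlt_le_trans _ _ _ Hw (Rmin_l _ _)).
  assert (H2 := Rlt_le_trans _ _ _ Hw (Rmin_r _ _)).
set (h := (w - z)%C) in *.
assert (E : (CInt (fun x => c x * Cexp (s x * w)) a b - CInt (fun x => c x * Cexp (s x * z)) a b -
  CInt (fun x => s x * (c x * Cexp (s x * z))) a b * h =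
  CInt (fun x => (c x * Cexp (s x * w) - c x * Cexp (s x * z)) - h * (s x * (c x * Cexp (s x *
    z)))) a b)%C).
{ rewrite CInt_minus. rewrite CInt_minus by auto. rewrite CInt_scal by auto. ring.
  - intros x Hx. apply rcont_minus; [apply (Cx w); auto|apply (Cx z); auto].
  - intros x Hx. apply rcont_mult; [apply cont_const|apply Cd; auto]. }
rewrite E.
assert (Hh := Cmod_ge_0 h).
eapply Rle_trans; [apply (CInt_bound _ a b (M * (S * S * exp S) * (Cmod h * Cmod h)))|].
- intros x Hx. apply rcont_minus.
  + apply rcont_minus; [apply (Cx w); auto|apply (Cx z); auto].
  + apply rcont_mult; [apply cont_const|apply Cd; auto].
- intros x Hx.
  replace (c x * Cexp (s x * w) - c x * Cexp (s x * z) - h * (s x * (c x * Cexp (s x * z))))%C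
    with ((c x * Cexp (s x * z)) * Cexp_rem 2 (s x * h))%C.
  2:{ unfold Cexp_rem. rewrite !Csum_S, Csum_0. simpl.
      replace (s x * w)%C with (s x * z + s x * h)%C by (unfold h; ring). rewrite Cexp_plus.
        field. }
  rewrite Cmod_mult. rewrite Rmult_assoc.
  apply Rmult_le_compat; try apply Cmod_ge_0; [apply Hb; auto|].
  eapply Rle_trans; [apply Cexp_rem_bound|]. rewrite Cmod_mult.
  specialize (Hb' x Hx). assert (Hs0 := Cmod_ge_0 (s x)).
  assert (P1 : Cmod (s x) * Cmod h <= S * Cmod h) by (apply Rmult_le_compat_r; auto).
  assert (P2 : Cmod (s x) * Cmod h <= S) by nra.
  assert (P3 : 0 <= Cmod (s x) * Cmod h) by nra.
  simpl. rewrite Rmult_1_r.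
  replace (S * S * exp S * (Cmod h * Cmod h)) with ((S * Cmod h) * (S * Cmod h) * exp S) by ring.
  apply Rmult_le_compat; [nra|left; apply exp_pos| |apply exp_le; auto].
  apply Rmult_le_compat; auto.
- replace (M * (S * S * exp S) * (Cmod h * Cmod h) * Rabs (b - a)) with ((M * (S * S * exp S) *
  Rabs (b - a)) * Cmod h * Cmod h) by ring.
  apply Rmult_le_compat_r; auto.
  assert (H3 : B * Cmod h <= eps).
  { replace eps with (B * (eps / B)) by (field; lra). apply Rmult_le_compat_l; lra. }
  unfold B in H3. lra.
Qed.

(** * The integrand in the logarithmic variable *)

Lemma Csum_scal k u N : (k * Csum u N)%C = Csum (fun n => k * u n)%C N.
Proof. induction N; [rewrite !Csum_0; ring|]. rewrite !Csum_S, <- IHN. ring. Qed.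

Lemma Csum_minus u v N : (Csum u N - Csum v N)%C = Csum (fun n => u n - v n)%C N.
Proof. induction N; [rewrite !Csum_0; ring|]. rewrite !Csum_S, <- IHN. ring. Qed.

Lemma Csum_mult u v N : (Csum u N * Csum v N)%C = Csum (fun m => Csum (fun n => u m * v n)%C N) N.
Proof.
rewrite Cmult_comm, Csum_scal. apply Csum_ext. intros m _. rewrite Cmult_comm. apply Csum_scal.
Qed.

Lemma Csum_le u B N : (forall n, (n < N)%nat -> Cmod (u n) <= B) -> Cmod (Csum u N) <= INR N * B.
Proof.
intros H. induction N.
- rewrite Csum_0, Cmod_0. simpl. lra.
- rewrite Csum_S, S_INR. eapply Rle_trans; [apply Cmod_triangle|].
  assert (K1 := H N ltac:(lia)). assert (K2 := IHN ltac:(intros; apply H; lia)). lra.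
Qed.

Lemma finite_bound (u : nat -> nat -> R) K : exists D, 0 <= D /\ forall m n, (m < K)%nat ->
  (n < K)%nat -> u m n <= D.
Proof.
assert (H1 : forall (v : nat -> R) N, exists D, 0 <= D /\ forall n, (n < N)%nat -> v n <= D).
{ intros v N. induction N as [|N [D [HD H]]]; [exists 0; split; [lra|intros; lia]|].
  exists (Rmax D (v N)). split; [eapply Rle_trans; [exact HD|apply Rmax_l]|].
  intros n Hn. destruct (Nat.eq_dec n N) as [->|Hne]; [apply Rmax_r|].
  eapply Rle_trans; [apply H; lia|apply Rmax_l]. }
assert (H2 : forall m, exists D, forall n, (n < K)%nat -> u m n <= D).
{ intros m. destruct (H1 (u m) K) as [D [_ H]]. exists D; auto. }
assert (H3 : forall N, exists D, 0 <= D /\ forall m n, (m < N)%nat -> (n < K)%nat -> u m n <= D).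
{ induction N as [|N [D [HD H]]]; [exists 0; split; [lra|intros; lia]|].
  destruct (H2 N) as [D' H'].
  exists (Rmax D D'). split; [eapply Rle_trans; [exact HD|apply Rmax_l]|].
  intros m n Hm Hn. destruct (Nat.eq_dec m N) as [->|Hne].
  - eapply Rle_trans; [apply H'; auto|apply Rmax_r].
  - eapply Rle_trans; [apply H; [lia|auto]|apply Rmax_l]. }
apply H3.
Qed.

Lemma finite_gap (u : nat -> nat -> R) K : exists d, 0 < d /\ forall m n, (m < K)%nat ->
  (n < K)%nat -> 0 < u m n -> d <= u m n.
Proof.
destruct (finite_bound (fun m n => / u m n) K) as [D [HD H]].
exists (/ (D + 1)). split; [apply Rinv_0_lt_compat; lra|].
intros m n Hm Hn Hu. rewrite <- (Rinv_inv (u m n)).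
assert (0 < / u m n) by (apply Rinv_0_lt_compat; auto).
apply Rinv_le_contravar; [auto|]. specialize (H m n Hm Hn). simpl in H. lra.
Qed.

Lemma Cpower_pos t w : 0 < t -> Cpower (RtoC t) w = Cexp (w * RtoC (ln t))%C.
Proof.
intros Ht. unfold Cpower, Clog, Carg.
rewrite Cmod_R, (Rabs_pos_eq t) by lra. simpl Re; simpl Im.
destruct (Rle_dec 0 0); [|lra].
replace (t / t) with 1 by (field; lra). rewrite acos_1. reflexivity.
Qed.

Lemma exp_pow_INR x n : exp x ^ n = exp (INR n * x).
Proof.
induction n; [simpl; rewrite Rmult_0_l, exp_0; reflexivity|].
rewrite S_INR. replace ((INR n + 1) * x) with (x + INR n * x) by ring. rewrite exp_plus, <- IHn.
  reflexivity.
Qed.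

Lemma exp_pow_le x m K : 0 <= x -> (m <= K)%nat -> x ^ m <= exp (INR K * x).
Proof.
intros Hx Hm. apply Rle_trans with ((1 + x) ^ m); [apply pow_incr; lra|].
apply Rle_trans with (exp x ^ m).
- apply pow_incr. split; [lra|]. rewrite Rplus_comm.
  destruct (Req_dec x 0) as [->|H]; [rewrite exp_0; lra|]. generalize (exp_ineq1 x H). lra.
- rewrite exp_pow_INR. apply exp_le.
  apply Rmult_le_compat_r; auto. apply le_INR; auto.
Qed.

(** Beyond X the term s exp(alpha x) exceeds (p + q) exp x, which exceeds the rest. *)
Lemma growth_bound p q s alpha : 0 <= p -> 0 <= q -> 0 < s -> 1 < alpha ->
  exists M, 0 <= M /\ forall x, 0 <= x -> p * x + q * exp x - s * exp (alpha * x) <= M.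
Proof.
intros Hp Hq Hs Ha.
set (X := Rmax 0 (ln ((p + q + 1) / s) / (alpha - 1))).
exists ((p + q) * exp X). split; [apply Rmult_le_pos; [lra|left; apply exp_pos]|].
intros x Hx.
assert (Hxe : x <= exp x).
{ destruct (Req_dec x 0) as [->|H]; [left; apply exp_pos|]. generalize (exp_ineq1 x H). lra. }
assert (Hpe := exp_pos x). assert (Hpa := exp_pos (alpha * x)).
destruct (Rle_dec x X) as [L|L].
- assert (exp x <= exp X) by (apply exp_le; auto).
  assert (p * x <= p * exp X) by (apply Rmult_le_compat_l; lra).
  assert (q * exp x <= q * exp X) by (apply Rmult_le_compat_l; lra).
  assert (0 <= s * exp (alpha * x)) by nra. lra.
- assert (H0 : 0 < (p + q + 1) / s) by (apply Rdiv_lt_0_compat; lra).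
  assert (H1 : (p + q + 1) / s <= exp ((alpha - 1) * x)).
  { rewrite <- (exp_ln ((p + q + 1) / s)) by auto. apply exp_le.
    assert (ln ((p + q + 1) / s) / (alpha - 1) <= x) by (apply Rnot_le_lt in L; left;
      eapply Rle_lt_trans; [apply Rmax_r|exact L]).
    replace (ln ((p + q + 1) / s)) with ((alpha - 1) * (ln ((p + q + 1) / s) / (alpha - 1))) by
      (field; lra).
    apply Rmult_le_compat_l; lra. }
  assert (H2 : (p + q) * exp x <= s * exp (alpha * x)).
  { replace (alpha * x) with (x + (alpha - 1) * x) by ring. rewrite exp_plus.
    replace (s * (exp x * exp ((alpha - 1) * x))) with (s * exp ((alpha - 1) * x) * exp x) by ring.
    apply Rmult_le_compat_r; [lra|].
    assert (s * ((p + q + 1) / s) <= s * exp ((alpha - 1) * x)) by (apply Rmult_le_compat_l; lra).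
    replace (s * ((p + q + 1) / s)) with (p + q + 1) in H by (field; lra). lra. }
  assert (p * x <= p * exp x) by (apply Rmult_le_compat_l; lra).
  assert (0 <= (p + q) * exp X) by (apply Rmult_le_pos; [lra|left; apply exp_pos]). lra.
Qed.

Lemma rcont_comp_real (G : R -> C) (g : R -> R) t : rcont G (g t) -> continuous g t ->
  rcont (fun s => G (g s)) t.
Proof. intros H1 H2. exact (@continuous_comp R_UniformSpace R_UniformSpace CT g G t H2 H1). Qed.

(** A function on (0, oo) inherits continuity from its pull-back under the exponential. *)
Lemma rcont_of_log (f G : R -> C) : (forall x, rcont G x) ->
  (forall x, (RtoC (exp x) * f (exp x))%C = G x) -> forall t, 0 < t -> rcont f t.
Proof.
intros HG E t Ht.
apply (@cont_ext_loc R_UniformSpace (fun t => RtoC (/ t) * G (ln t))%C).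
- exists (mkposreal t Ht). intros s Hs.
  assert (Hs' : Rabs (s - t) < t) by exact Hs. apply Rabs_def2 in Hs'.
  rewrite <- E, exp_ln by lra. rewrite Cmult_assoc, <- RtoC_mult, Rinv_l by lra. ring.
- apply rcont_mult.
  + apply cont_RtoC. smooth.
  + apply rcont_comp_real; [apply HG|]. smooth.
Qed.

Lemma continuous_exp_R x : continuous exp x.
Proof. smooth. Qed.

(** Substitution t = exp x. *)
Lemma RInt_gen_log_infty (f G : R -> C) l : (forall x, rcont G x) ->
  (forall x, (RtoC (exp x) * f (exp x))%C = G x) -> is_lim_int G l ->
  @is_RInt_gen C_R_NormedModule f (at_point 1) (Rbar_locally p_infty) l.
Proof.
intros HG E Hl. assert (Hf := rcont_of_log f G HG E).
intros P [eps HP].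
assert (He : 0 < eps / 2) by (generalize (cond_pos eps); lra).
destruct (Hl _ He) as [X HX].
exists (fun a => a = 1) (fun b => exp (Rmax X 0) < b); [reflexivity|exists (exp (Rmax X 0)); auto|].
intros a b -> Hb. exists (CInt f 1 b). split.
- apply CInt_correct. intros t Ht. apply Hf.
  assert (1 <= exp (Rmax X 0)) by (rewrite <- exp_0; apply exp_le, Rmax_r).
  rewrite Rmin_left in Ht by lra. lra.
- apply HP. apply ballC_CT.
  assert (Hb0 : 0 < b) by (eapply Rlt_trans; [apply exp_pos|exact Hb]).
  assert (Hlb : Rmax X 0 <= ln b) by (rewrite <- (ln_exp (Rmax X 0)); left; apply ln_increasing;
    [apply exp_pos|auto]).
  replace (CInt f 1 b) with (CInt G 0 (ln b)).
  + apply Rle_lt_trans with (eps / 2); [|lra]. apply HX. eapply Rle_trans; [apply Rmax_l|exact Hlb].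
  + rewrite <- (exp_ln b) at 2 by auto. rewrite <- exp_0.
    rewrite (CInt_comp f exp exp).
    * apply CInt_ext. intros x _. symmetry; apply E.
    * intros x _. apply Hf, exp_pos.
    * intros x _. split; [auto_derive; [auto|ring]|apply continuous_exp_R].
Qed.

(** Substitution t = exp (- x). *)
Lemma RInt_gen_log_zero (f G : R -> C) l : (forall x, rcont G x) ->
  (forall x, (RtoC (exp (- x)) * f (exp (- x)))%C = G x) -> is_lim_int G l ->
  @is_RInt_gen C_R_NormedModule f (at_right 0) (at_point 1) l.
Proof.
intros HG E Hl.
assert (Hf : forall t, 0 < t -> rcont f t).
{ apply (rcont_of_log f (fun x => G (- x))).
  - intros x. apply rcont_comp_real; [apply HG|]. smooth.
  - intros x. rewrite <- E, Ropp_involutive. reflexivity. }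
intros P [eps HP].
assert (He : 0 < eps / 2) by (generalize (cond_pos eps); lra).
destruct (Hl _ He) as [X HX].
set (e := exp (- Rmax X 0)). assert (He0 : 0 < e) by apply exp_pos.
assert (He1 : e <= 1) by (unfold e; rewrite <- exp_0; apply exp_le; generalize (Rmax_r X 0); lra).
exists (fun a => 0 < a < e) (fun b => b = 1); [|reflexivity|].
{ exists (mkposreal e He0). intros y Hy Hy0. assert (Hy' : Rabs (y - 0) < e) by exact Hy.
  apply Rabs_def2 in Hy'. lra. }
intros a b Ha ->. exists (CInt f a 1). split.
- apply CInt_correct. intros t Ht. apply Hf.
  rewrite Rmin_left in Ht by lra. lra.
- apply HP. apply ballC_CT.
  assert (Hlb : Rmax X 0 <= - ln a).
  { assert (ln a < - Rmax X 0); [|lra]. rewrite <- (ln_exp (- Rmax X 0)).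
    apply ln_increasing; [lra|]. apply Ha. }
  replace (CInt f a 1) with (CInt G 0 (- ln a)).
  + apply Rle_lt_trans with (eps / 2); [|lra]. apply HX. eapply Rle_trans; [apply Rmax_l|exact Hlb].
  + assert (Ea : a = exp (- (- ln a))) by (rewrite Ropp_involutive, exp_ln by lra; auto).
    rewrite Ea at 2. replace 1 with (exp (- 0)) by (rewrite Ropp_0; apply exp_0).
    rewrite (CInt_comp f (fun x => exp (- x)) (fun x => - exp (- x))).
    * symmetry. rewrite (CInt_ext _ (fun x => - (1) * G x)%C).
      -- rewrite CInt_scal by (apply contI_forall; auto). rewrite (CInt_swap G 0 (- ln a)) by
        (apply contI_forall; auto). ring.
      -- intros x _. rewrite <- E. rewrite RtoC_opp. ring.
    * intros x _. apply Hf, exp_pos.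
    * intros x _. split; [auto_derive; [auto|ring]|]. smooth.
Qed.

Section Decomposition.
Variables (alpha : R) (beta : C).
Hypothesis Halpha : 1 < alpha.

(** This is t^beta exp(i t^alpha - i z t) dt in the variable v = log t. It is entire in
    v, and Im v is the argument of t. *)
Definition log_integrand (z v : C) : C :=
  Cexp ((beta + 1) * v + Ci * Cexp (RtoC alpha * v) - Ci * z * Cexp v)%C.

Lemma log_integrand_hol z : hol_all (log_integrand z).
Proof.
intros v. eexists. unfold log_integrand.
apply (cder_comp Cexp (fun v => (beta + 1) * v + Ci * Cexp (RtoC alpha * v) - Ci * z * Cexp v)%C);
  [apply cder_Cexp|].
apply cder_minus; [apply cder_plus|].
- apply cder_scal, cder_id.
- apply cder_scal. apply (cder_comp Cexp (fun v => RtoC alpha * v)%C);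
  [apply cder_Cexp|apply cder_scal, cder_id].
- apply cder_scal, cder_Cexp.
Qed.

Lemma log_integrand_cont z v : @cont CT (log_integrand z) v.
Proof. destruct (log_integrand_hol z v) as [l Hl]. apply (cder_cont _ _ _ Hl). Qed.

Lemma log_integrand_mod z x y : Cmod (log_integrand z (x, y)) =
  exp ((Re beta + 1) * x - Im beta * y - exp (alpha * x) * sin (alpha * y) + exp x * (Im z * cos y
    + Re z * sin y)).
Proof.
unfold log_integrand. rewrite Cmod_Cexp. f_equal.
unfold Cexp. destruct beta as [b1 b2], z as [z1 z2]. simpl.
replace (alpha * x - 0 * y) with (alpha * x) by ring. replace (alpha * y + 0 * x) with (alpha * y)
  by ring. ring.
Qed.

Lemma tail_log z x : (RtoC (exp x) * tail_integrand alpha beta z (exp x))%C = log_integrand z (RtoC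
  x).
Proof.
unfold tail_integrand, phase, log_integrand. rewrite Cpower_pos by apply exp_pos. rewrite ln_exp.
rewrite <- !Cexp_R, <- !Cexp_plus. f_equal.
unfold Rpower. rewrite ln_exp. rewrite <- !Cexp_R. rewrite RtoC_mult. ring.
Qed.

(** The regularised integrand near t = 0 in the variable x = - log t. *)
Definition reg_log (z : C) (x : R) : C :=
  (log_integrand z (RtoC (- x)) - singular_sum alpha beta (fun m n =>
     taylor_coef z m n * Cexp ((beta + 1 + RtoC (INR n * alpha + INR m)) * RtoC (- x))))%C.

Lemma singular_sum_scal c u : (c * singular_sum alpha beta u)%C = singular_sum alpha beta (fun m n
  => c * u m n)%C.
Proof.
unfold singular_sum. rewrite Csum_scal. apply Csum_ext. intros m _.
rewrite Csum_scal. apply Csum_ext. intros n _. destruct (Rle_dec _ _); ring.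
Qed.

Lemma singular_sum_ext u v : (forall m n, u m n = v m n) -> singular_sum alpha beta u =
  singular_sum alpha beta v.
Proof.
intros H. unfold singular_sum. apply Csum_ext. intros m _. apply Csum_ext. intros n _. rewrite H.
  reflexivity.
Qed.

Lemma reg_log_eq z x : (RtoC (exp (- x)) * regularized_integrand alpha beta z (exp (- x)))%C =
  reg_log z x.
Proof.
unfold regularized_integrand, reg_log. rewrite <- tail_log. unfold tail_integrand.
set (P := Cpower (RtoC (exp (- x))) beta).
replace (RtoC (exp (- x)) * (P * (phase alpha z (exp (- x)) - singular_sum alpha beta (fun m n =>
  taylor_coef z m n * RtoC (Rpower (exp (- x)) (INR n * alpha + INR m))))))%C
  with (RtoC (exp (- x)) * (P * phase alpha z (exp (- x))) - (RtoC (exp (- x)) * P) * singular_sum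
    alpha beta (fun m n => taylor_coef z m n * RtoC (Rpower (exp (- x)) (INR n * alpha + INR
    m))))%C by ring.
f_equal. f_equal. rewrite singular_sum_scal. apply singular_sum_ext. intros m n.
unfold P. rewrite Cpower_pos by apply exp_pos. unfold Rpower. rewrite ln_exp.
replace (taylor_coef z m n * Cexp ((beta + 1 + RtoC (INR n * alpha + INR m)) * RtoC (- x)))%C
 with (Cexp (RtoC (- x)) * Cexp (beta * RtoC (- x)) * (taylor_coef z m n * Cexp (RtoC (INR n *
   alpha + INR m) * RtoC (- x))))%C.
- rewrite <- RtoC_mult, !Cexp_R. reflexivity.
- replace ((beta + 1 + RtoC (INR n * alpha + INR m)) * RtoC (- x))%C with (RtoC (- x) + beta * RtoC
  (- x) + RtoC (INR n * alpha + INR m) * RtoC (- x))%C by ring.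
  rewrite !Cexp_plus. ring.
Qed.
End Decomposition.

(** * The finite part at the origin *)

Section RegularPart.
Variables (alpha : R) (beta : C).
Hypothesis Halpha : 1 < alpha.
Let K := Z.to_nat (up (-1 - Re beta)).
Let M0 := -1 - Re beta.

(** Taylor remainders of order K in t are of smaller order than t^(-1 - Re beta), hence
    integrable against t^beta. *)
Lemma K_gt : M0 < INR K.
Proof.
unfold K, M0. destruct (archimed (-1 - Re beta)) as [H1 H2].
destruct (Z_le_gt_dec 0 (up (-1 - Re beta))) as [Hz|Hz].
- rewrite INR_IZR_INZ, Z2Nat.id by auto. lra.
- apply Rlt_le_trans with 0; [|apply pos_INR].
  assert (IZR (up (-1 - Re beta)) < 0) by (apply IZR_lt; lia). lra.
Qed.

Lemma singular_sum_bound u B : (forall m n, (m < K)%nat -> (n < K)%nat -> Cmod (u m n) <= B) ->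
  0 <= B ->
  Cmod (singular_sum alpha beta u) <= INR K * (INR K * B).
Proof.
intros H HB. unfold singular_sum. fold K. apply Csum_le. intros m Hm. apply Csum_le. intros n Hn.
destruct (Rle_dec _ _); [auto|]. rewrite Cmod_0. auto.
Qed.

Lemma taylor_coef_mod z m n : Cmod (taylor_coef z m n) <= Cmod z ^ m.
Proof.
unfold taylor_coef. rewrite RtoC_mult.
assert (H1 := INR_fact_lt_0 n). assert (H2 := INR_fact_lt_0 m).
rewrite Cmod_div, !Cmod_mult, !Cmod_pow, Cmod_opp, Cmod_mult, Cmod_Ci, !Cmod_R,
  !Rabs_pos_eq by (try (apply Cmult_neq_0; apply RtoC_fact_neq0); lra).
rewrite pow1, !Rmult_1_l.
assert (F : forall k, 1 <= INR (fact k)) by (intros k; apply (le_INR 1); apply lt_O_fact).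
assert (1 <= INR (fact n) * INR (fact m)) by (specialize (F n) as F1; specialize (F m) as F2; nra).
apply Rmult_le_reg_r with (INR (fact n) * INR (fact m)); [lra|].
unfold Rdiv. rewrite Rmult_assoc, Rinv_l by lra.
apply Rmult_le_compat_l; [apply pow_le, Cmod_ge_0|lra].
Qed.

(** Polynomials in z of degree below K, bounded by an exponential to match the other
    pieces. *)
Lemma singular_taylor_bound (d : nat -> nat -> C) : exists D, 0 <= D /\ forall z,
  Cmod (singular_sum alpha beta (fun m n => taylor_coef z m n * d m n)%C) <= D * exp (INR K * Cmod
    z).
Proof.
destruct (finite_bound (fun m n => Cmod (d m n)) K) as [D [HD H]].
exists (INR K * (INR K * D)). split.
{ repeat apply Rmult_le_pos; auto; apply pos_INR. }
intros z. rewrite !Rmult_assoc.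
apply singular_sum_bound; [|apply Rmult_le_pos; [auto|left; apply exp_pos]].
intros m n Hm Hn. rewrite Cmod_mult, Rmult_comm.
apply Rmult_le_compat; try apply Cmod_ge_0; [apply H; auto|].
eapply Rle_trans; [apply taylor_coef_mod|]. apply exp_pow_le; [apply Cmod_ge_0|lia].
Qed.

Lemma Rpower_le_base x a b : 0 < x <= 1 -> b <= a -> Rpower x a <= Rpower x b.
Proof.
intros [H0 H1] Hab. unfold Rpower. apply exp_le.
assert (ln x <= 0) by (rewrite <- ln_1; apply ln_le; lra). nra.
Qed.

(** Multiply out the two exponential series truncated at order K. The terms not
    subtracted have exponents above -1 - Re beta, by a positive gap as they are finitely
    many; the remainders carry a factor t^K. Every bound grows at most exponentially in
    the modulus of z. *)
Lemma regular_estimate : exists d C0 C1, 0 < d /\ 0 <= C0 /\ 0 <= C1 /\ forall z t, 0 < t <= 1 ->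
  Cmod (phase alpha z t - singular_sum alpha beta (fun m n =>
      taylor_coef z m n * RtoC (Rpower t (INR n * alpha + INR m))))%C
  <= C0 * exp (C1 * Cmod z) * Rpower t (M0 + d).
Proof.
destruct (finite_gap (fun m n => INR m + INR n * alpha - M0) K) as [d0 [Hd0 Hgap]].
set (d := Rmin d0 (INR K - M0)).
assert (HK := K_gt).
assert (Hd : 0 < d) by (apply Rmin_glb_lt; lra).
assert (Hd1 : d <= d0) by apply Rmin_l. assert (Hd2 : d <= INR K - M0) by apply Rmin_r.
exists d, (INR K * (INR K * 1) + (exp 1 + 2 * exp 1)), (INR K + 1).
assert (HKp := pos_INR K). assert (He1 := exp_pos 1).
split; [auto|split; [nra|split; [lra|]]].
intros z t Ht.
set (a := (Ci * RtoC (Rpower t alpha))%C). set (b := (- (Ci * z) * RtoC t)%C).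
assert (Hma : Cmod a <= t).
{ unfold a. rewrite Cmod_mult, Cmod_Ci, Cmod_R, Rabs_pos_eq by (left; apply exp_pos).
  rewrite Rmult_1_l. rewrite <- (Rpower_1 t) at 2 by lra. apply Rpower_le_base; lra. }
assert (Hmb : Cmod b = Cmod z * t).
{ unfold b. rewrite Cmod_mult, Cmod_opp, Cmod_mult, Cmod_Ci, Cmod_R, Rabs_pos_eq by lra. ring. }
assert (Hz := Cmod_ge_0 z).
set (Sa := Csum (fun n => a ^ n / RtoC (INR (fact n)))%C K).
set (Sb := Csum (fun n => b ^ n / RtoC (INR (fact n)))%C K).
assert (Eph : phase alpha z t = (Cexp a * Cexp b)%C).
{ unfold phase. rewrite <- Cexp_plus. f_equal. unfold a, b. ring. }
assert (ESS : (Sb * Sa = Csum (fun m => Csum (fun n => taylor_coef z m n * RtoC (Rpower t (INR n *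
  alpha + INR m))) K) K)%C).
{ unfold Sa, Sb. rewrite Csum_mult. apply Csum_ext. intros m _. apply Csum_ext. intros n _.
  unfold taylor_coef, a, b. rewrite !Cpow_mult_l.
  rewrite Rpower_plus.
  replace (Rpower t (INR n * alpha)) with (Rpower t alpha ^ n).
  2:{ rewrite <- Rpower_pow by apply exp_pos. rewrite Rpower_mult. f_equal; ring. }
  rewrite Rpower_pow by lra. rewrite !RtoC_mult, !RtoC_pow. field. split; apply RtoC_fact_neq0. }
assert (Esplit : (phase alpha z t - singular_sum alpha beta (fun m n => taylor_coef z m n * RtoC
  (Rpower t (INR n * alpha + INR m)))
  = Csum (fun m => Csum (fun n => if Rle_dec (INR m + INR n * alpha + Re beta) (-1) then 0 else
    taylor_coef z m n * RtoC (Rpower t (INR n * alpha + INR m))) K) K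
    + (Cexp_rem K a * Cexp b + Sa * Cexp_rem K b))%C).
{ replace (Csum (fun m => Csum (fun n => if Rle_dec (INR m + INR n * alpha + Re beta) (-1) then 0
  else taylor_coef z m n * RtoC (Rpower t (INR n * alpha + INR m))) K) K)%C
   with (Sb * Sa - singular_sum alpha beta (fun m n => taylor_coef z m n * RtoC (Rpower t (INR n *
     alpha + INR m))))%C.
  - rewrite Eph. unfold Cexp_rem. fold Sa Sb. ring.
  - rewrite ESS. unfold singular_sum. fold K. rewrite Csum_minus. apply Csum_ext. intros m _.
    rewrite Csum_minus. apply Csum_ext. intros n _. destruct (Rle_dec _ _); ring. }
rewrite Esplit. clear Esplit.
set (T := Rpower t (M0 + d)). assert (HT : 0 < T) by apply exp_pos.
set (X := exp (INR K * Cmod z)). set (Y := exp (Cmod z)).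
assert (HX : 0 < X) by apply exp_pos. assert (HY : 1 <= Y) by (unfold Y; rewrite <- exp_0;
  apply exp_le; auto).
assert (EXY : exp ((INR K + 1) * Cmod z) = X * Y) by (unfold X, Y; rewrite <- exp_plus; f_equal;
  ring).
assert (HX1 : 1 <= X) by (unfold X; rewrite <- exp_0; apply exp_le; nra).
assert (HtK : t ^ K <= T).
{ rewrite <- Rpower_pow by lra. apply Rpower_le_base; lra. }
assert (HtK0 : 0 <= t ^ K) by (apply pow_le; lra).
assert (B1 : Cmod (Csum (fun m => Csum (fun n => if Rle_dec (INR m + INR n * alpha + Re beta) (-1)
  then 0 else taylor_coef z m n * RtoC (Rpower t (INR n * alpha + INR m)))%C K) K) <= INR K * (INR
  K * (X * T))).
{ apply Csum_le. intros m Hm. apply Csum_le. intros n Hn. destruct (Rle_dec _ _) as [L|L].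
  - rewrite Cmod_0. nra.
  - rewrite Cmod_mult, Cmod_R, Rabs_pos_eq by (left; apply exp_pos).
    apply Rmult_le_compat; [apply Cmod_ge_0|left; apply exp_pos| |].
    + eapply Rle_trans; [apply taylor_coef_mod|]. apply exp_pow_le; [auto|lia].
    + apply Rpower_le_base; auto. apply Rnot_le_lt in L.
      assert (G := Hgap m n Hm Hn ltac:(unfold M0; lra)). simpl in G. lra. }
assert (Ra : Cmod (Cexp_rem K a) <= T * exp 1).
{ eapply Rle_trans; [apply Cexp_rem_bound|]. apply Rmult_le_compat; [apply pow_le, Cmod_ge_0|left;
  apply exp_pos| |apply exp_le; lra].
  eapply Rle_trans; [|exact HtK]. apply pow_incr. split; [apply Cmod_ge_0|auto]. }
assert (Rb : Cmod (Cexp_rem K b) <= X * T * Y).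
{ eapply Rle_trans; [apply Cexp_rem_bound|]. rewrite Hmb, Rpow_mult_distr.
  apply Rmult_le_compat; [apply Rmult_le_pos; [apply pow_le; auto|auto]|left;
    apply exp_pos| |apply exp_le; nra].
  apply Rmult_le_compat; auto; [apply pow_le; auto|]. apply exp_pow_le; auto. }
assert (Eb : Cmod (Cexp b) <= Y).
{ rewrite Cmod_Cexp. apply exp_le. apply Rle_trans with (Cmod b).
  - eapply Rle_trans; [apply Rle_abs|apply re_le_Cmod].
  - rewrite Hmb. nra. }
assert (Sab : Cmod Sa <= 2 * exp 1).
{ replace Sa with (Cexp a + - Cexp_rem K a)%C by (unfold Cexp_rem; fold Sa; ring).
  eapply Rle_trans; [apply Cmod_triangle|]. rewrite Cmod_opp.
  assert (Cmod (Cexp a) <= exp 1).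
  { rewrite Cmod_Cexp. apply exp_le. apply Rle_trans with (Cmod a); [|lra].
    eapply Rle_trans; [apply Rle_abs|apply re_le_Cmod]. }
  assert (Cmod (Cexp_rem K a) <= 1 * exp 1); [|lra].
  eapply Rle_trans; [apply Cexp_rem_bound|]. apply Rmult_le_compat; [apply pow_le, Cmod_ge_0|left;
    apply exp_pos| |apply exp_le; lra].
  rewrite <- (pow1 K). apply pow_incr. split; [apply Cmod_ge_0|lra]. }
eapply Rle_trans; [apply Cmod_triangle|].
eapply Rle_trans; [apply Rplus_le_compat; [exact B1|apply Cmod_triangle]|].
rewrite !Cmod_mult, EXY.
assert (P1 : Cmod (Cexp_rem K a) * Cmod (Cexp b) <= T * exp 1 * Y) by (apply Rmult_le_compat;
  auto; apply Cmod_ge_0).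
assert (P2 : Cmod Sa * Cmod (Cexp_rem K b) <= 2 * exp 1 * (X * T * Y)) by (apply Rmult_le_compat;
  auto; apply Cmod_ge_0).
assert (P3 : T * exp 1 * Y <= exp 1 * (X * Y) * T).
{ replace (exp 1 * (X * Y) * T) with (T * exp 1 * Y * X) by ring.
  rewrite <- (Rmult_1_r (T * exp 1 * Y)) at 1. apply Rmult_le_compat_l; auto.
  apply Rmult_le_pos; [|lra]. left; apply Rmult_lt_0_compat; lra. }
assert (P4 : INR K * (INR K * (X * T)) <= INR K * (INR K * 1) * (X * Y) * T).
{ replace (INR K * (INR K * 1) * (X * Y) * T) with (INR K * (INR K * (X * T)) * Y) by ring.
  rewrite <- (Rmult_1_r (INR K * (INR K * (X * T)))) at 1. apply Rmult_le_compat_l; auto.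
  apply Rmult_le_pos; auto. apply Rmult_le_pos; auto. left; apply Rmult_lt_0_compat; auto. }
replace (2 * exp 1 * (X * T * Y)) with (2 * exp 1 * (X * Y) * T) in P2 by ring.
lra.
Qed.

Lemma reg_log_bound : exists d C0 C1, 0 < d /\ 0 <= C0 /\ 0 <= C1 /\ forall z x, 0 <= x ->
  Cmod (reg_log alpha beta z x) <= C0 * exp (C1 * Cmod z) * exp (- (d * x)).
Proof.
destruct regular_estimate as [d [C0 [C1 [Hd [HC0 [HC1 H]]]]]].
exists d, C0, C1. repeat split; auto. intros z x Hx.
assert (Ht : 0 < exp (- x) <= 1) by (split; [apply exp_pos|rewrite <- exp_0; apply exp_le; lra]).
rewrite <- reg_log_eq. unfold regularized_integrand. rewrite !Cmod_mult.
specialize (H z _ Ht).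
rewrite Cmod_R, Rabs_pos_eq by (left; apply exp_pos).
rewrite Cpower_pos by apply exp_pos. rewrite Cmod_Cexp, ln_exp.
rewrite re_scal_r.
assert (HR : Rpower (exp (- x)) (M0 + d) = exp ((M0 + d) * - x)) by (unfold Rpower;
  rewrite ln_exp; reflexivity). rewrite HR in H.
apply Rle_trans with (exp (- x) * (exp (Re beta * - x) * (C0 * exp (C1 * Cmod z) * exp ((M0 + d) *
  - x)))).
- apply Rmult_le_compat_l; [left; apply exp_pos|]. apply Rmult_le_compat_l; [left;
  apply exp_pos|]. exact H.
- right. replace (- (d * x)) with (- x + (Re beta * - x + (M0 + d) * - x)) by (unfold M0; ring).
  rewrite !exp_plus. ring.
Qed.

Lemma rcont_log_integrand z x y : rcont (fun s => log_integrand alpha beta z (s, y)) x.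
Proof. apply rcont_hor. apply log_integrand_cont. Qed.

Lemma rcont_reg_log z x : rcont (reg_log alpha beta z) x.
Proof.
unfold reg_log. apply rcont_minus.
- apply (rcont_comp_real (fun s => log_integrand alpha beta z (RtoC s)) (fun x => - x));
  [apply rcont_log_integrand|].
  smooth.
- unfold singular_sum. fold K.
  assert (CS : forall (g : nat -> R -> C) N, (forall n, rcont (g n) x) ->
    rcont (fun s => Csum (fun n => g n s) N) x).
  { intros g N H. induction N; [apply cont_const|].
    apply (@cont_ext R_UniformSpace (fun s => Csum (fun n => g n s) N + g N s)%C); [intros;
      symmetry; apply (Csum_S (fun n => g n t))|].
    apply rcont_plus; auto. apply H. }
  apply CS. intros m. apply CS. intros n. destruct (Rle_dec _ _); [|apply cont_const].
  apply rcont_mult; [apply cont_const|]. apply rcont_Cexp.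
  apply rcont_mult; [apply cont_const|].
  apply cont_RtoC. smooth.
Qed.

Lemma param_log_integrand a b y : param_hol a b (fun x z => log_integrand alpha beta z (x, y)).
Proof.
apply (param_ext a b (fun x z => Cexp ((beta + 1) * (x, y) + Ci * Cexp (RtoC alpha * (x,
  y))) * Cexp ((- Ci * Cexp (x, y)) * z))%C).
- intros x z. unfold log_integrand. rewrite <- Cexp_plus. f_equal. ring.
- apply param_exp; intros x _.
  + apply (rcont_hor (fun v => Cexp ((beta + 1) * v + Ci * Cexp (RtoC alpha * v)))%C). cont_tac.
  + apply (rcont_hor (fun v => - Ci * Cexp v)%C). cont_tac.
Qed.

Lemma param_log_integrand_ver a b x : param_hol a b (fun y z => log_integrand alpha beta z (x, y)).
Proof.
apply (param_ext a b (fun y z => Cexp ((beta + 1) * (x, y) + Ci * Cexp (RtoC alpha * (x,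
  y))) * Cexp ((- Ci * Cexp (x, y)) * z))%C).
- intros y z. unfold log_integrand. rewrite <- Cexp_plus. f_equal. ring.
- apply param_exp; intros y _.
  + apply (rcont_ver (fun v => Cexp ((beta + 1) * v + Ci * Cexp (RtoC alpha * v)))%C). cont_tac.
  + apply (rcont_ver (fun v => - Ci * Cexp v)%C). cont_tac.
Qed.

(** The subtracted terms are polynomial in z, the rest is an exponential in z. *)
Lemma param_reg_log a b : param_hol a b (fun x z => reg_log alpha beta z x).
Proof.
apply (param_ext a b (fun x z => Cexp ((beta + 1) * RtoC (- x) + Ci * Cexp (RtoC alpha * RtoC (-
  x))) * Cexp ((- Ci * Cexp (RtoC (- x))) * z)
  + Csum (fun m => Csum (fun n => if Rle_dec (INR m + INR n * alpha + Re beta) (-1)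
      then (- (Ci ^ n / RtoC (INR (fact n) * INR (fact m))) * Cexp ((beta + 1 + RtoC (INR n * alpha
        + INR m)) * RtoC (- x))) * ((- Ci) * z) ^ m else 0) K) K)%C).
- intros x z. unfold reg_log, singular_sum. fold K. unfold Cminus at 1. f_equal.
  + unfold log_integrand. rewrite <- Cexp_plus. f_equal. ring.
  + transitivity ((- (1)) * Csum (fun m : nat =>
   Csum (fun n : nat =>
      if Rle_dec (INR m + INR n * alpha + Re beta) (-1)
      then (taylor_coef z m n * Cexp ((beta + 1 + RtoC (INR n * alpha + INR m)%R) * RtoC (- x)))%C
      else RtoC 0) K) K)%C; [|ring].
    rewrite Csum_scal. apply Csum_ext. intros m _. rewrite Csum_scal. apply Csum_ext. intros n _.
    destruct (Rle_dec _ _); [|ring]. unfold taylor_coef. replace (- (Ci * z))%C with (- Ci * z)%C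
      by ring. unfold Cdiv. ring.
- assert (Cn : forall t, rcont (fun x => RtoC (- x)) t).
  { intros t. apply cont_RtoC. smooth. }
  apply param_plus.
  + apply param_exp; intros x _; specialize (Cn x); unfold rcont in *; cont_tac.
  + apply param_Csum. intros m. apply param_Csum. intros n. destruct (Rle_dec _ _);
    [|apply param_zero].
    apply (param_monomial a b (fun x => - (Ci ^ n / RtoC (INR (fact n) * INR (fact m))) * Cexp
      ((beta + 1 + RtoC (INR n * alpha + INR m)%R) * RtoC (- x)))%C m (- Ci)%C).
    intros x _; specialize (Cn x); unfold rcont in *; cont_tac.
Qed.

(** The boundary terms of the finite part. *)
Definition residual_sum (z : C) : C := singular_sum alpha beta (fun m n =>
  if Ceq_dec (exponent alpha beta m n) (RtoC 0) then RtoC 0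
  else taylor_coef z m n / exponent alpha beta m n)%C.

Lemma residual_hol : hol_all residual_sum.
Proof.
assert (HS : forall (g : nat -> C -> C) N, (forall n, hol_all (g n)) ->
  hol_all (fun z => Csum (fun n => g n z) N)).
{ intros g N H. induction N as [|N IH].
  - intros z. exists (RtoC 0). apply (cder_const (RtoC 0)).
  - apply (hol_all_ext (fun z => Csum (fun n => g n z) N + g N z)%C); [intros; symmetry;
    apply (Csum_S (fun n => g n z))|].
    intros z. destruct (IH z) as [l Hl], (H N z) as [m Hm]. eexists. apply cder_plus; eauto. }
unfold residual_sum, singular_sum. fold K. apply HS. intros m. apply HS. intros n.
destruct (Rle_dec _ _); [|intros z; eexists; apply cder_const].
destruct (Ceq_dec _ _); [intros z; eexists; apply cder_const|].
intros z. eexists.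
apply (cder_ext (fun z => (Ci ^ n / RtoC (INR (fact n) * INR (fact m)) / exponent alpha beta m n) *
  (- Ci * z) ^ m)%C).
- intros w. unfold taylor_coef. replace (- (Ci * w))%C with (- Ci * w)%C by ring. unfold Cdiv. ring.
- apply cder_scal. apply (cder_comp (fun w => w ^ m)%C (fun w => - Ci * w)%C);
  [apply cder_pow|apply cder_scal, cder_id].
Qed.

Lemma residual_bound : exists D, 0 <= D /\ forall z, Cmod (residual_sum z) <= D * exp (INR K * Cmod
  z).
Proof.
destruct (singular_taylor_bound (fun m n => if Ceq_dec (exponent alpha beta m n) (RtoC 0) then RtoC
  0 else / exponent alpha beta m n)%C) as [D [HD H]].
exists D. split; auto. intros z. unfold residual_sum.
rewrite (singular_sum_ext alpha beta _ (fun m n => taylor_coef z m n * (if Ceq_dec (exponent alpha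
  beta m n) (RtoC 0) then RtoC 0 else / exponent alpha beta m n))%C); [apply H|].
intros m n. destruct (Ceq_dec _ _); [ring|reflexivity].
Qed.
End RegularPart.

(** * Analytic continuation by rotating the contour *)

Lemma cos_ge_1_minus y : 0 <= y -> 1 - y <= cos y.
Proof.
intros [Hy|<-]; [|rewrite cos_0; lra].
destruct (MVT_cor2 cos (fun x => - sin x) 0 y Hy) as [c [Hc _]].
{ intros c _. apply derivable_pt_lim_cos. }
rewrite cos_0 in Hc. generalize (SIN_bound c). nra.
Qed.

(** The mean value theorem; cos decreases on [0, PI]. *)
Lemma sin_ge_cos_mul v v0 : 0 <= v <= v0 -> v0 <= PI -> cos v0 * v <= sin v.
Proof.
intros [[Hv|<-] Hv0] Hpi; [|rewrite sin_0; lra].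
destruct (MVT_cor2 sin cos 0 v Hv) as [c [Hc Hc']].
{ intros c _. apply derivable_pt_lim_sin. }
rewrite sin_0, !Rminus_0_r in Hc. rewrite Hc. apply Rmult_le_compat_r; [lra|].
  apply cos_decr_1; lra.
Qed.

(** By sin u = 2 sin (u/2) cos (u/2), where u/2 stays in an interval on which cos is
    bounded below by k > 0. *)
Lemma sin_linear_lower u0 : 0 < u0 < PI -> exists k, 0 < k /\ forall u, 0 <= u <= u0 ->
  k * u <= sin u.
Proof.
intros Hu0. set (k := cos (u0 / 2)).
assert (Hk : 0 < k) by (apply cos_gt_0; lra).
exists (k * k). split; [nra|]. intros u Hu.
replace u with (2 * (u / 2)) at 2 by field. rewrite sin_2a.
assert (H1 : k * (u / 2) <= sin (u / 2)) by (apply sin_ge_cos_mul; lra).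
assert (H2 : k <= cos (u / 2)) by (apply cos_decr_1; lra).
assert (H3 : 0 <= k * (u / 2)) by nra.
assert (k * (u / 2) * k <= sin (u / 2) * cos (u / 2)) by (apply Rmult_le_compat; lra). nra.
Qed.

Lemma lim_int_gen f l : (forall x, rcont f x) -> is_lim_int f l ->
  @is_RInt_gen C_R_NormedModule f (at_point 0) (Rbar_locally p_infty) l.
Proof.
intros Hf Hl P [eps HP].
assert (He : 0 < eps / 2) by (generalize (cond_pos eps); lra).
destruct (Hl _ He) as [X HX].
exists (fun a => a = 0) (fun b => X < b); [reflexivity|exists X; auto|].
intros a b -> Hb. exists (CInt f 0 b). split.
- apply CInt_correct. apply contI_forall; auto.
- apply HP. apply ballC_CT. apply Rle_lt_trans with (eps / 2); [|lra]. apply HX. lra.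
Qed.

Definition lim_int (f : R -> C) : C :=
  @RInt_gen C_R_CompleteNormedModule f (at_point 0) (Rbar_locally p_infty).

Lemma lim_int_unique f l : (forall x, rcont f x) -> is_lim_int f l -> lim_int f = l.
Proof.
intros Hf Hl. unfold lim_int. apply (@is_RInt_gen_unique C_R_CompleteNormedModule);
  [apply Proper_StrongProper, at_point_filter|apply Proper_StrongProper, Rbar_locally_filter|].
apply lim_int_gen; auto.
Qed.

Section Continuation.
Variables (alpha : R) (beta : C).
Hypothesis Halpha : 1 < alpha.
Let L := log_integrand alpha beta.

(** On the line Im v = chi the exponent contains - exp(alpha x) sin(alpha chi) with a
    positive sine, which dominates all other terms, uniformly for z in a disc. *)
Lemma ray_decay chi rho : 0 < chi -> alpha * chi < PI -> 0 <= rho -> exists M, 0 <= M /\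
  forall z x, Cmod z <= rho -> 0 <= x -> Cmod (L z (x, chi)) <= M * exp (- (1 * x)).
Proof.
intros Hchi Hpi Hrho.
assert (Hs : 0 < sin (alpha * chi)) by (apply sin_gt_0; nra).
destruct (growth_bound (Rabs (Re beta + 1) + 1) (2 * rho) (sin (alpha * chi)) alpha) as [M [HM
  HG]]; try lra.
{ generalize (Rabs_pos (Re beta + 1)); lra. }
exists (exp (Rabs (Im beta) * chi + M)). split; [left; apply exp_pos|].
intros z x Hz Hx. unfold L. rewrite log_integrand_mod, <- exp_plus. apply exp_le.
specialize (HG x Hx).
assert (H1 : (Re beta + 1) * x <= Rabs (Re beta + 1) * x) by (apply Rmult_le_compat_r;
  [auto|apply Rle_abs]).
assert (H2 : - Im beta * chi <= Rabs (Im beta) * chi).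
{ apply Rmult_le_compat_r; [lra|]. rewrite <- Rabs_Ropp. apply Rle_abs. }
assert (H3 : exp x * (Im z * cos chi + Re z * sin chi) <= 2 * rho * exp x).
{ rewrite Rmult_comm. apply Rmult_le_compat_r; [left; apply exp_pos|].
  assert (A1 := re_le_Cmod z). assert (A2 := im_le_Cmod z).
  assert (A3 := COS_bound chi). assert (A4 := SIN_bound chi).
  assert (Im z * cos chi <= rho).
  { eapply Rle_trans; [apply Rle_abs|]. rewrite Rabs_mult. assert (Rabs (cos chi) <= 1) by (apply
    Rabs_le; lra).
    assert (0 <= Rabs (Im z)) by apply Rabs_pos. assert (0 <= Rabs (cos chi)) by apply Rabs_pos.
      nra. }
  assert (Re z * sin chi <= rho).
  { eapply Rle_trans; [apply Rle_abs|]. rewrite Rabs_mult. assert (Rabs (sin chi) <= 1) by (apply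
    Rabs_le; lra).
    assert (0 <= Rabs (Re z)) by apply Rabs_pos. assert (0 <= Rabs (sin chi)) by apply Rabs_pos.
      nra. }
  lra. }
lra.
Qed.

Lemma ray_lim chi z : 0 < chi -> alpha * chi < PI ->
  is_lim_int (fun x => L z (x, chi)) (lim_int (fun x => L z (x, chi))).
Proof.
intros H1 H2. destruct (ray_decay chi (Cmod z) H1 H2 (Cmod_ge_0 z)) as [M [HM HB]].
destruct (improper_lim (fun x => L z (x, chi)) M 1 0) as [l [Hl _]]; try lra.
- intros x; apply rcont_log_integrand.
- intros x Hx. apply HB; lra.
- rewrite (lim_int_unique _ l); auto. intros x; apply rcont_log_integrand.
Qed.

Lemma linear_exp_bound p s : 0 <= p -> 0 < s -> exists M, 0 <= M /\ forall x, 0 <= x ->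
  p * x - s * exp x <= M.
Proof.
intros Hp Hs. destruct (growth_bound (2 * p) 0 s 2) as [M [HM H]]; try lra.
exists M. split; auto. intros x Hx. specialize (H (x / 2) ltac:(lra)).
replace (2 * (x / 2)) with x in H by field. lra.
Qed.

(** The vertical side at abscissa b. At y = 0 the term exp(b) Im z < 0 gives the decay;
    away from it the loss exp(b) (Im z cos y + Re z sin y - Im z) is at most linear in y
    and is absorbed by exp(alpha b) sin(alpha y), which is at least linear in y with a
    larger coefficient once b is large. *)
Lemma far_side_decay chi z : 0 < chi -> alpha * chi < PI -> Im z < 0 ->
  exists M X, 0 <= M /\ forall b y, X <= b -> 0 <= y <= chi ->
    Cmod (L z (b, y)) <= M * exp (- (1 * b)).
Proof.
intros Hchi Hpi Hz.
destruct (sin_linear_lower (alpha * chi)) as [k [Hk Hsin]]; [split; nra|].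
destruct (linear_exp_bound (Rabs (Re beta + 1) + 1) (- Im z)) as [M [HM HG]];
  [generalize (Rabs_pos (Re beta + 1)); lra|lra|].
(* For exp((alpha - 1) b) >= q the term exp(alpha b) sin(alpha y) absorbs the part of
    exp(b) (Im z cos y + Re z sin y) that is linear in y. *)
set (q := (- Im z + Rabs (Re z)) / (k * alpha)).
assert (Hka : 0 < k * alpha) by nra.
assert (Hq : 0 < q). { apply Rdiv_lt_0_compat; [generalize (Rabs_pos (Re z)); lra|auto]. }
exists (exp (Rabs (Im beta) * chi + M)), (Rmax 0 (ln q / (alpha - 1))).
split; [left; apply exp_pos|]. intros b y Hb Hy.
assert (Hb0 : 0 <= b) by (eapply Rle_trans; [apply Rmax_l|exact Hb]).
assert (Hb1 : ln q / (alpha - 1) <= b) by (eapply Rle_trans; [apply Rmax_r|exact Hb]).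
unfold L. rewrite log_integrand_mod, <- exp_plus. apply exp_le.
specialize (HG b Hb0).
assert (H1 : (Re beta + 1) * b <= Rabs (Re beta + 1) * b) by (apply Rmult_le_compat_r;
  [auto|apply Rle_abs]).
assert (H2 : - Im beta * y <= Rabs (Im beta) * chi).
{ apply Rle_trans with (Rabs (Im beta) * y).
  - apply Rmult_le_compat_r; [lra|]. rewrite <- Rabs_Ropp. apply Rle_abs.
  - apply Rmult_le_compat_l; [apply Rabs_pos|lra]. }
assert (Heb := exp_pos b).
assert (H3 : Im z * cos y + Re z * sin y <= Im z + (- Im z + Rabs (Re z)) * y).
{ assert (C1 := cos_ge_1_minus y ltac:(lra)).
  assert (S1 : Rabs (sin y) <= y).
  { rewrite Rabs_pos_eq by (apply sin_ge_0; nra). destruct Hy as [[Hy|<-] _]; [left;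
    apply sin_lt_x; auto|rewrite sin_0; lra]. }
  assert (Re z * sin y <= Rabs (Re z) * y).
  { eapply Rle_trans; [apply Rle_abs|]. rewrite Rabs_mult. apply Rmult_le_compat_l;
    [apply Rabs_pos|auto]. }
  nra. }
assert (H4 : k * (alpha * y) <= sin (alpha * y)) by (apply Hsin; split; nra).
assert (H5 : q <= exp ((alpha - 1) * b)).
{ rewrite <- (exp_ln q) by auto. apply exp_le.
  replace (ln q) with ((alpha - 1) * (ln q / (alpha - 1))) by (field; lra).
    apply Rmult_le_compat_l; lra. }
assert (H6 : exp (alpha * b) = exp b * exp ((alpha - 1) * b)) by (rewrite <- exp_plus; f_equal;
  ring).
assert (H7 : exp b * ((- Im z + Rabs (Re z)) * y) <= exp (alpha * b) * sin (alpha * y)).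
{ apply Rle_trans with (exp (alpha * b) * (k * (alpha * y))); [|apply Rmult_le_compat_l; [left;
  apply exp_pos|auto]].
  rewrite H6. replace (exp b * exp ((alpha - 1) * b) * (k * (alpha * y))) with (exp b * ((exp
    ((alpha - 1) * b) * (k * alpha)) * y)) by ring.
  apply Rmult_le_compat_l; [lra|]. apply Rmult_le_compat_r; [lra|].
  apply Rle_trans with (q * (k * alpha)); [right; unfold q; field; lra|].
    apply Rmult_le_compat_r; lra. }
assert (H8 : exp b * (Im z * cos y + Re z * sin y) <= exp b * (Im z + (- Im z + Rabs (Re z)) * y))
  by (apply Rmult_le_compat_l; lra).
lra.
Qed.

(** [goursat] on the rectangle [0,b] x [0,chi], then b to infinity: the right side
    disappears by [far_side_decay], the left side is the arc in the variable t. *)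
Lemma tail_rotation chi z : 0 < chi -> alpha * chi < PI -> Im z < 0 ->
  is_lim_int (fun x => L z (RtoC x))
    (Ci * CInt (fun y => L z (0, y)%R) 0 chi + lim_int (fun x => L z (x, chi)))%C.
Proof.
intros Hchi Hpi Hz eps He.
destruct (far_side_decay chi z Hchi Hpi Hz) as [M [X [HM HF]]].
destruct (ray_lim chi z Hchi Hpi (eps / 2)) as [X1 HX1]; [lra|].
destruct (exp_small (M * chi) 1 (eps / 2)) as [X2 [_ HX2]]; [lra|lra|].
exists (Rmax X (Rmax X1 X2)). intros b Hb.
assert (Hb0 : X <= b) by (eapply Rle_trans; [apply Rmax_l|exact Hb]).
assert (Hb1 : X1 <= b) by (eapply Rle_trans; [apply Rmax_l|eapply Rle_trans;
  [apply Rmax_r|exact Hb]]).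
assert (Hb2 : X2 <= b) by (eapply Rle_trans; [apply Rmax_r|eapply Rle_trans;
  [apply Rmax_r|exact Hb]]).
assert (G := goursat (L z) 0 b 0 chi (fun x y _ _ => log_integrand_hol alpha beta z (x, y))).
unfold rect_int in G.
specialize (HX1 b Hb1). specialize (HX2 b Hb2).
set (I0 := CInt (fun s => L z (s, 0)) 0 b) in *.
change (CInt (fun x => L z (RtoC x)) 0 b) with I0.
set (I1 := CInt (fun s => L z (b, s)) 0 chi) in *.
set (I2 := CInt (fun s => L z (s, chi)) 0 b) in *.
set (I3 := CInt (fun s => L z (0, s)) 0 chi) in *.
set (l := lim_int (fun x => L z (x, chi))) in *.
replace (I0 - (Ci * I3 + l))%C with ((I2 - l) + - (Ci * I1))%C.
2:{ replace (I0 - (Ci * I3 + l))%C with ((I0 + Ci * I1 - I2 - Ci * I3) + ((I2 - l) + - (Ci *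
  I1)))%C by ring. rewrite G. ring. }
eapply Rle_trans; [apply Cmod_triangle|]. rewrite Cmod_opp, Cmod_mult, Cmod_Ci, Rmult_1_l.
assert (B : Cmod I1 <= M * exp (- (1 * b)) * Rabs (chi - 0)).
{ apply CInt_bound.
  - intros y _. apply rcont_ver. apply log_integrand_cont.
  - intros y. rewrite Rmin_left, Rmax_right by lra. intros Hy. apply HF; auto. }
rewrite Rminus_0_r, (Rabs_pos_eq chi) in B by lra.
replace (M * exp (- (1 * b)) * chi) with (M * chi * exp (- (1 * b))) in B by ring. lra.
Qed.

Definition regular_integral (z : C) : C :=
  @RInt_gen C_R_CompleteNormedModule (regularized_integrand alpha beta z) (at_right 0) (at_point 1).

(** A uniform rate of convergence, needed both for the holomorphy of the limit and, at b
    = 0, for its size. *)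
Lemma regular_integral_spec : exists d C0 C1, 0 < d /\ 0 <= C0 /\ 0 <= C1 /\
  forall z b, 0 <= b -> Cmod (CInt (reg_log alpha beta z) 0 b - regular_integral z)%C <= C0 * exp
    (C1 * Cmod z) * exp (- (d * b)).
Proof.
destruct (reg_log_bound alpha beta Halpha) as [d [C0 [C1 [Hd [HC0 [HC1 H]]]]]].
exists d, (C0 / d), C1.
split; [auto|split; [unfold Rdiv; apply Rmult_le_pos; [auto|left; apply Rinv_0_lt_compat;
  auto]|split; [auto|]]].
intros z b Hb.
destruct (improper_lim (reg_log alpha beta z) (C0 * exp (C1 * Cmod z)) d 0) as [l [Hl Hl']];
  try lra.
- intros x; apply rcont_reg_log.
- apply Rmult_le_pos; [auto|left; apply exp_pos].
- intros x Hx; apply H; auto.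
- assert (E : regular_integral z = l).
  { unfold regular_integral. apply (@is_RInt_gen_unique C_R_CompleteNormedModule);
    [apply Proper_StrongProper, at_right_proper_filter|apply Proper_StrongProper, at_point_filter|].
    apply (RInt_gen_log_zero _ (reg_log alpha beta z)); auto; [intros x;
      apply rcont_reg_log|intros x; apply reg_log_eq]. }
  rewrite E. eapply Rle_trans; [apply Hl'; auto|]. right. field. lra.
Qed.

Definition arc_integral (chi : R) (z : C) : C := (Ci * CInt (fun y => L z (0, y)%R) 0 chi)%C.

(** On the arc sin(alpha y) >= 0, so the factor exp(i t^alpha) is bounded by 1 and only
    exp(- i z t) grows. *)
Lemma arc_bound : exists C0, 0 <= C0 /\ forall chi z, 0 < chi -> alpha * chi < PI ->
  Cmod (arc_integral chi z) <= C0 * exp (2 * Cmod z).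
Proof.
assert (HP := PI_RGT_0).
exists (exp (Rabs (Re beta + 1) + Rabs (Im beta) * PI) * PI).
split; [apply Rmult_le_pos; [left; apply exp_pos|lra]|].
intros chi z Hchi Hpi. unfold arc_integral. rewrite Cmod_mult, Cmod_Ci, Rmult_1_l.
eapply Rle_trans; [apply (CInt_bound _ _ _ (exp (Rabs (Re beta + 1) + Rabs (Im beta) * PI) * exp (2
  * Cmod z)))|].
- intros y _. apply rcont_ver. apply log_integrand_cont.
- intros y. rewrite Rmin_left, Rmax_right by lra. intros Hy.
  unfold L. rewrite log_integrand_mod, <- exp_plus. apply exp_le.
  rewrite !Rmult_0_r, exp_0, !Rmult_1_l.
  assert (S0 : 0 <= sin (alpha * y)) by (apply sin_ge_0; nra).
  assert (A1 := re_le_Cmod z). assert (A2 := im_le_Cmod z).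
  assert (A3 := COS_bound y). assert (A4 := SIN_bound y).
  assert (Im z * cos y <= Cmod z).
  { eapply Rle_trans; [apply Rle_abs|]. rewrite Rabs_mult. assert (Rabs (cos y) <= 1) by (apply
    Rabs_le; lra).
    assert (0 <= Rabs (Im z)) by apply Rabs_pos. assert (0 <= Rabs (cos y)) by apply Rabs_pos.
      nra. }
  assert (Re z * sin y <= Cmod z).
  { eapply Rle_trans; [apply Rle_abs|]. rewrite Rabs_mult. assert (Rabs (sin y) <= 1) by (apply
    Rabs_le; lra).
    assert (0 <= Rabs (Re z)) by apply Rabs_pos. assert (0 <= Rabs (sin y)) by apply Rabs_pos.
      nra. }
  assert (H2 : - Im beta * y <= Rabs (Im beta) * PI).
  { apply Rle_trans with (Rabs (Im beta) * y).
    - apply Rmult_le_compat_r; [lra|]. rewrite <- Rabs_Ropp. apply Rle_abs.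
    - apply Rmult_le_compat_l; [apply Rabs_pos|nra]. }
  assert (0 <= Rabs (Re beta + 1)) by apply Rabs_pos. lra.
- rewrite Rminus_0_r, (Rabs_pos_eq chi) by lra.
  assert (chi <= PI) by nra.
  assert (0 < exp (Rabs (Re beta + 1) + Rabs (Im beta) * PI)) by apply exp_pos.
  assert (0 < exp (2 * Cmod z)) by apply exp_pos.
  replace (exp (Rabs (Re beta + 1) + Rabs (Im beta) * PI) * PI * exp (2 * Cmod z)) with
   (exp (Rabs (Re beta + 1) + Rabs (Im beta) * PI) * exp (2 * Cmod z) * PI) by ring.
  apply Rmult_le_compat_l; [left; apply Rmult_lt_0_compat; auto|auto].
Qed.

(** The right-hand side of the contour rotation; it makes sense for every z. *)
Definition continuation (chi : R) (z : C) : C :=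
  (regular_integral z + residual_sum alpha beta z + arc_integral chi z + lim_int (fun x => L z (x,
    chi)))%C.

(** It is the locally uniform limit of the same expression with the two improper
    integrals truncated at n. *)
Lemma continuation_entire chi : 0 < chi -> alpha * chi < PI -> hol_all (continuation chi).
Proof.
intros Hchi Hpi.
apply (entire_limit (fun n z => CInt (reg_log alpha beta z) 0 (INR n) + residual_sum alpha beta z +
  arc_integral chi z + CInt (fun x => L z (x, chi)) 0 (INR n))%C).
- intros n z.
  destruct (proj2 (param_reg_log alpha beta 0 (INR n)) z) as [l1 H1].
  destruct (residual_hol alpha beta z) as [l2 H2].
  destruct (proj2 (param_log_integrand_ver alpha beta 0 chi 0) z) as [l3 H3].
  destruct (proj2 (param_log_integrand alpha beta 0 (INR n) chi) z) as [l4 H4].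
  eexists. apply cder_plus; [apply cder_plus; [apply cder_plus|]|].
  + exact H1.
  + exact H2.
  + apply cder_scal. exact H3.
  + exact H4.
- intros rho eps He.
  destruct regular_integral_spec as [d [C0 [C1 [Hd [HC0 [HC1 HA]]]]]].
  assert (Hr : 0 <= Rmax 0 rho) by apply Rmax_l.
  destruct (ray_decay chi (Rmax 0 rho) Hchi Hpi Hr) as [M [HM HB]].
  destruct (exp_small (C0 * exp (C1 * Rmax 0 rho)) d (eps / 2)) as [X1 [HX10 HX1]]; [auto|lra|].
  destruct (exp_small (M / 1) 1 (eps / 2)) as [X2 [HX20 HX2]]; [lra|lra|].
  destruct (archimed (Rmax X1 X2)) as [Har _].
  assert (Hmx : 0 <= Rmax X1 X2) by (eapply Rle_trans; [exact HX10|apply Rmax_l]).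
  assert (Hup : (0 <= up (Rmax X1 X2))%Z) by (apply le_IZR; lra).
  exists (Z.to_nat (up (Rmax X1 X2))). intros z Hz.
  set (n := Z.to_nat (up (Rmax X1 X2))).
  assert (Hn : Rmax X1 X2 <= INR n) by (unfold n; rewrite INR_IZR_INZ, Z2Nat.id by auto; lra).
  assert (Hn1 : X1 <= INR n) by (eapply Rle_trans; [apply Rmax_l|exact Hn]).
  assert (Hn2 : X2 <= INR n) by (eapply Rle_trans; [apply Rmax_r|exact Hn]).
  assert (Hz' : Cmod z <= Rmax 0 rho) by (eapply Rle_trans; [exact Hz|apply Rmax_r]).
  unfold continuation.
  match goal with |- Cmod ?T <= _ => replace T with ((CInt (reg_log alpha beta z) 0 (INR n) -
    regular_integral z) + (CInt (fun x => L z (x, chi)) 0 (INR n) - lim_int (fun x => L z (x,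
    chi))))%C by ring end.
  eapply Rle_trans; [apply Cmod_triangle|].
  assert (E1 : Cmod (CInt (reg_log alpha beta z) 0 (INR n) - regular_integral z)%C <= eps / 2).
  { eapply Rle_trans; [apply HA; apply pos_INR|]. eapply Rle_trans; [|apply (HX1 (INR n) Hn1)].
    apply Rmult_le_compat_r; [left; apply exp_pos|]. apply Rmult_le_compat_l; auto. apply exp_le.
      apply Rmult_le_compat_l; auto. }
  assert (E2 : Cmod (CInt (fun x => L z (x, chi)) 0 (INR n) - lim_int (fun x => L z (x,
    chi)))%C <= eps / 2).
  { destruct (improper_lim (fun x => L z (x, chi)) M 1 0) as [l [Hl Hl']]; try lra.
    - intros x; apply rcont_log_integrand.
    - intros x Hx. apply HB; auto.
    - rewrite (lim_int_unique _ l) by (auto; intros x; apply rcont_log_integrand).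
      eapply Rle_trans; [apply Hl'; apply pos_INR|]. apply HX2; auto. }
  lra.
Qed.

Lemma finite_part_continuation chi z : 0 < chi -> alpha * chi < PI -> Im z < 0 ->
  finite_part_integral alpha beta z = continuation chi z.
Proof.
intros Hchi Hpi Hz. unfold finite_part_integral, continuation.
assert (T : @RInt_gen C_R_CompleteNormedModule (tail_integrand alpha beta z) (at_point 1)
  (Rbar_locally p_infty)
   = (arc_integral chi z + lim_int (fun x => L z (x, chi)))%C).
{ apply (@is_RInt_gen_unique C_R_CompleteNormedModule); [apply Proper_StrongProper,
  at_point_filter|apply Proper_StrongProper, Rbar_locally_filter|].
  apply (RInt_gen_log_infty _ (fun x => L z (RtoC x))).
  - intros x. apply rcont_log_integrand.
  - intros x. apply tail_log.
  - apply tail_rotation; auto. }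
rewrite T. fold (regular_integral z). fold (residual_sum alpha beta z). ring.
Qed.

(** F and the continuation agree in the lower half-plane, hence everywhere. The
    constants do not depend on the angle chi, which will vary with theta. *)
Theorem extension_decomposition F : is_entire_extension alpha beta F ->
  exists C0 C1, 0 <= C0 /\ 0 <= C1 /\ forall chi z, 0 < chi -> alpha * chi < PI ->
    Cmod (F z - lim_int (fun x => L z (x, chi)))%C <= C0 * exp (C1 * Cmod z).
Proof.
intros [HF HFz].
destruct regular_integral_spec as [d [A0 [A1 [Hd [HA0 [HA1 HA]]]]]].
destruct (residual_bound alpha beta) as [B0 [HB0 HB]].
destruct arc_bound as [D0 [HD0 HD]].
set (B1 := INR (Z.to_nat (up (-1 - Re beta)))) in *.
assert (HB1 : 0 <= B1) by apply pos_INR.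
exists (A0 + B0 + D0), (A1 + B1 + 2). split; [lra|split; [lra|]].
intros chi z Hchi Hpi.
assert (E : F z = continuation chi z).
{ apply Ceq_minus.
  (* The unit disc about - i lies in the lower half-plane. *)
  apply (identity_entire (fun z => F z - continuation chi z)%C (- Ci)%C 1).
  - intros w. destruct (proj1 (hol_cder F w) (HF w)) as [l Hl].
    destruct (continuation_entire chi Hchi Hpi w) as [m Hm]. eexists. apply cder_minus; eauto.
  - lra.
  - intros w Hw. rewrite HFz, (finite_part_continuation chi) by
      (auto; assert (K := im_le_Cmod (w - - Ci)%C);
       change (Im (w - - Ci)%C) with (Im w + - - 1) in K; assert (K2 := Rle_abs (Im w + - - 1));
         lra).
    ring. }
rewrite E. unfold continuation.
match goal with |- Cmod ?T <= _ => replace T with (regular_integral z + residual_sum alpha beta z +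
  arc_integral chi z)%C by ring end.
eapply Rle_trans; [apply Cmod_triangle|]. eapply Rle_trans; [apply Rplus_le_compat_r,
  Cmod_triangle|].
assert (Hz := Cmod_ge_0 z).
assert (X1 : Cmod (regular_integral z) <= A0 * exp (A1 * Cmod z)).
{ specialize (HA z 0 (Rle_refl 0)). rewrite CInt_point, Rmult_0_r, Ropp_0, exp_0, Rmult_1_r in HA.
  rewrite <- Cmod_opp. replace (- regular_integral z)%C with (0 - regular_integral z)%C by ring.
    exact HA. }
assert (X2 := HB z). assert (X3 := HD chi z Hchi Hpi).
assert (M1 : exp (A1 * Cmod z) <= exp ((A1 + B1 + 2) * Cmod z)) by (apply exp_le,
  Rmult_le_compat_r; lra).
assert (M2 : exp (B1 * Cmod z) <= exp ((A1 + B1 + 2) * Cmod z)) by (apply exp_le,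
  Rmult_le_compat_r; lra).
assert (M3 : exp (2 * Cmod z) <= exp ((A1 + B1 + 2) * Cmod z)) by (apply exp_le,
  Rmult_le_compat_r; lra).
assert (N1 : A0 * exp (A1 * Cmod z) <= A0 * exp ((A1 + B1 + 2) * Cmod z)) by (apply
  Rmult_le_compat_l; auto).
assert (N2 : B0 * exp (B1 * Cmod z) <= B0 * exp ((A1 + B1 + 2) * Cmod z)) by (apply
  Rmult_le_compat_l; auto).
assert (N3 : D0 * exp (2 * Cmod z) <= D0 * exp ((A1 + B1 + 2) * Cmod z)) by (apply
  Rmult_le_compat_l; auto).
lra.
Qed.
End Continuation.

(** * Gaussian moments and half-integer values of Gamma *)

Definition gauss_moment (n : nat) (v : R) : R := v ^ (2 * n) * exp (- (v * v)).
(** Half of Gamma(n + 1/2), truncated at x. *)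
Definition gauss_int (n : nat) (x : R) : R := RInt (gauss_moment n) 0 x.

Lemma gauss_moment_cont n v : continuous (gauss_moment n) v.
Proof. unfold gauss_moment. smooth. Qed.

Lemma gauss_int_derive n x : is_derive (gauss_int n) x (gauss_moment n x).
Proof.
apply (is_derive_RInt (V := R_CompleteNormedModule) (gauss_moment n) (gauss_int n) 0 x).
- apply filter_forall. intros y. apply (RInt_correct (V := R_CompleteNormedModule)),
  (ex_RInt_continuous (V := R_CompleteNormedModule)).
  intros; apply gauss_moment_cont.
- apply gauss_moment_cont.
Qed.

Lemma gauss_int_0 n : gauss_int n 0 = 0.
Proof. apply (RInt_point (V := R_CompleteNormedModule)). Qed.

Lemma gauss_moment_le n v : 0 <= v -> gauss_moment n v <= exp ((2 * INR n + 1) ^ 2 / 4) * exp (- (1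
  * v)).
Proof.
intros Hv. unfold gauss_moment.
apply Rle_trans with (exp (INR (2 * n) * v) * exp (- (v * v))).
- apply Rmult_le_compat_r; [left; apply exp_pos|]. apply exp_pow_le; auto.
- rewrite <- !exp_plus. apply exp_le. rewrite mult_INR. simpl INR.
  assert (0 <= (v - (2 * INR n + 1) / 2) ^ 2) by apply pow2_ge_0. simpl in *. lra.
Qed.

Lemma gauss_moment_pos n v : 0 <= v -> 0 <= gauss_moment n v.
Proof. intros. apply Rmult_le_pos; [apply pow_le; auto|left; apply exp_pos]. Qed.

Lemma gauss_int_CInt n x : CInt (fun v => RtoC (gauss_moment n v)) 0 x = RtoC (gauss_int n x).
Proof.
apply CInt_unique, is_CInt_R. apply (RInt_correct (V := R_CompleteNormedModule)),
  (ex_RInt_continuous (V := R_CompleteNormedModule)).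
intros; apply gauss_moment_cont.
Qed.

(** The Gaussian weight is below any exponential one, which gives the simple rate exp (-
    x). *)
Lemma gauss_int_limit n : exists l C, 0 <= C /\ forall x, 0 <= x ->
  Rabs (gauss_int n x - l) <= C * exp (- x).
Proof.
set (C := exp ((2 * INR n + 1) ^ 2 / 4)).
assert (HC : 0 < C) by apply exp_pos.
destruct (improper_lim (fun v => RtoC (gauss_moment n v)) C 1 0) as [l [_ Hl]]; try lra.
- intros x. apply cont_RtoC. apply gauss_moment_cont.
- intros x Hx. rewrite Cmod_R, Rabs_pos_eq by (apply gauss_moment_pos; auto).
  apply gauss_moment_le; auto.
- exists (Re l), C. split; [lra|]. intros x Hx. specialize (Hl x Hx). rewrite gauss_int_CInt in Hl.
  eapply Rle_trans; [|eapply Rle_trans; [exact Hl|]].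
  + apply (re_le_Cmod (RtoC (gauss_int n x) - l)%C).
  + right. rewrite Rmult_1_l. field.
Qed.

Lemma Rpower_half_odd n t : 0 < t -> Rpower t (INR n + 1 / 2 - 1) = sqrt t ^ (2 * n) / sqrt t.
Proof.
intros Ht. assert (Hs : 0 < sqrt t) by (apply sqrt_lt_R0; auto).
replace (INR n + 1 / 2 - 1) with (INR n + - / 2) by field.
rewrite Rpower_plus, Rpower_Ropp, Rpower_sqrt, Rpower_pow by auto.
rewrite pow_mult. simpl (sqrt t ^ 2). rewrite Rmult_1_r, sqrt_sqrt by lra. reflexivity.
Qed.

(** The substitution t = v^2 in Euler's integral. Since t^(n - 1/2) is unbounded at 0
    for n = 0, both ends are handled as limits. *)
Lemma Gamma_half n : exists C, 0 <= C /\ forall x, 0 <= x -> Rabs (2 * gauss_int n x - Gamma (INR n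
  + 1 / 2)) <= C * exp (- x).
Proof.
destruct (gauss_int_limit n) as [l [C [HC Hl]]].
assert (E : Gamma (INR n + 1 / 2) = 2 * l).
{ unfold Gamma. apply (@is_RInt_gen_unique R_CompleteNormedModule);
   [apply Proper_StrongProper, at_right_proper_filter|apply Proper_StrongProper,
     Rbar_locally_filter|].
  assert (I : forall a b, 0 < a -> 0 < b -> is_RInt (fun t => Rpower t (INR n + 1 / 2 - 1) * exp (-
    t)) a b (2 * gauss_int n (sqrt b) - 2 * gauss_int n (sqrt a))).
  { intros a b Ha Hb. assert (Hm : 0 < Rmin a b) by (apply Rmin_glb_lt; auto).
    apply (is_RInt_derive (V := R_CompleteNormedModule) (fun t => 2 * gauss_int n (sqrt t))).
    - intros t Ht. assert (Ht0 : 0 < t) by lra. assert (Hs : 0 < sqrt t) by (apply sqrt_lt_R0;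
      auto).
      rewrite Rpower_half_odd by auto.
      replace (sqrt t ^ (2 * n) / sqrt t * exp (- t)) with (2 * (/ (2 * sqrt t) * gauss_moment n
        (sqrt t))).
      2:{ unfold gauss_moment. rewrite sqrt_sqrt by lra. field. lra. }
      apply is_derive_scal.
      apply (is_derive_comp (gauss_int n) sqrt t (gauss_moment n (sqrt t)) (/ (2 * sqrt t))).
      + apply gauss_int_derive.
      + apply is_derive_Reals. apply derivable_pt_lim_sqrt. auto.
    - intros t Ht. unfold Rpower. smooth. }
  intros P [eps HP].
  assert (Hc : continuous (gauss_int n) 0) by (apply (ex_derive_continuous (V := R_NormedModule));
    eexists; apply gauss_int_derive).
  assert (He : 0 < eps / 4) by (generalize (cond_pos eps); lra).
  destruct (proj1 (filterlim_locally (U := R_UniformSpace) _ _) Hc (mkposreal _ He)) as [d Hd].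
  destruct (exp_small C 1 (eps / 8)) as [X [HX0 HX]]; [lra|lra|].
  assert (Hdp := cond_pos d).
  exists (fun a => 0 < a < d * d) (fun b => X * X < b).
  - assert (Hdd : 0 < d * d) by nra. exists (mkposreal _ Hdd). intros y Hy Hy0.
    assert (Hy' : Rabs (y - 0) < d * d) by exact Hy. apply Rabs_def2 in Hy'. lra.
  - exists (X * X). auto.
  - intros a b Ha Hb. simpl fst; simpl snd.
    assert (Hb0 : 0 < b) by nra.
    exists (2 * gauss_int n (sqrt b) - 2 * gauss_int n (sqrt a)). split; [apply I; lra|].
    apply HP.
    assert (Hsa : sqrt a < d). { rewrite <- (sqrt_square d) by lra. apply sqrt_lt_1; lra. }
    assert (Hsb : X <= sqrt b). { rewrite <- (sqrt_square X) by lra. apply sqrt_le_1; nra. }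
    assert (Ba : Rabs (gauss_int n (sqrt a)) < eps / 4).
    { assert (K : ball (gauss_int n 0) (eps / 4) (gauss_int n (sqrt a))).
      { apply Hd. change (Rabs (sqrt a - 0) < d). rewrite Rminus_0_r,
        Rabs_pos_eq by apply sqrt_pos. auto. }
      rewrite gauss_int_0 in K. replace (gauss_int n (sqrt a)) with (gauss_int n (sqrt a) - 0) by
        ring. exact K. }
    assert (Bb := Hl (sqrt b) (sqrt_pos b)). assert (Bb' := HX (sqrt b) Hsb).
      rewrite Rmult_1_l in Bb'.
    change (Rabs (2 * gauss_int n (sqrt b) - 2 * gauss_int n (sqrt a) - 2 * l) < eps).
    replace (2 * gauss_int n (sqrt b) - 2 * gauss_int n (sqrt a) - 2 * l) with (2 * (gauss_int n
      (sqrt b) - l) + - (2 * gauss_int n (sqrt a))) by ring.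
    eapply Rle_lt_trans; [apply Rabs_triang|]. rewrite Rabs_Ropp, !Rabs_mult,
      (Rabs_pos_eq 2) by lra. lra. }
exists (2 * C). split; [lra|]. intros x Hx. rewrite E.
replace (2 * gauss_int n x - 2 * l) with (2 * (gauss_int n x - l)) by ring.
rewrite Rabs_mult, (Rabs_pos_eq 2) by lra. specialize (Hl x Hx). lra.
Qed.

(** The sum S x of the square of the Gaussian integral over [0,x] and of the integral H
    x of exp(- x^2 (1 + t^2)) / (1 + t^2) over [0,1] has derivative 0. It equals PI/4 at
    x = 0, where H is an arctangent, while H tends to 0 at infinity. *)
Lemma Gamma_one_half : Gamma (1 / 2) = sqrt PI.
Proof.
set (H := fun x => RInt (fun t => exp (- (x * x) * (1 + t * t)) / (1 + t * t)) 0 1).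
assert (Pt : forall t, 0 < 1 + t * t) by (intros t; nra).
assert (dH : forall x, is_derive H x (RInt (fun t => - 2 * x * exp (- (x * x) * (1 + t * t))) 0 1)).
{ intros x. unfold H.
  replace (RInt (fun t => - 2 * x * exp (- (x * x) * (1 + t * t))) 0 1) with
   (RInt (fun t => Derive (fun u => exp (- (u * u) * (1 + t * t)) / (1 + t * t)) x) 0 1).
  2:{ apply RInt_ext. intros t _. apply is_derive_unique. specialize (Pt t). auto_derive; [lra|].
    field. lra. }
  apply is_derive_RInt_param.
  - apply filter_forall. intros y t _. specialize (Pt t). auto_derive. lra.
  - intros t _.
    apply continuity_2d_pt_ext with (fun u v => - 2 * u * exp (- (u * u) * (1 + v * v))).
    { intros u v. symmetry. apply is_derive_unique. specialize (Pt v). auto_derive; [lra|]. field.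
      lra. }
    apply continuity_2d_pt_mult.
    + apply continuity_2d_pt_mult; [apply continuity_2d_pt_const|apply continuity_2d_pt_id1].
    + apply continuity_1d_2d_pt_comp; [apply derivable_continuous_pt, derivable_pt_exp|].
      apply continuity_2d_pt_mult.
      * apply continuity_2d_pt_opp. apply continuity_2d_pt_mult; apply continuity_2d_pt_id1.
      * apply continuity_2d_pt_plus; [apply continuity_2d_pt_const|].
        apply continuity_2d_pt_mult; apply continuity_2d_pt_id2.
  - apply filter_forall. intros y. apply (ex_RInt_continuous (V := R_CompleteNormedModule)).
    intros t _.
    apply (ex_derive_continuous (V := R_NormedModule)). specialize (Pt t). auto_derive. lra. }
assert (dHe : forall x, is_derive H x (- (2 * exp (- (x * x)) * gauss_int 0 x))).
{ intros x.
  replace (- (2 * exp (- (x * x)) * gauss_int 0 x)) with (RInt (fun t => - 2 * x * exp (- (x * x) *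
    (1 + t * t))) 0 1); [apply dH|].
  unfold gauss_int.
  assert (E : RInt (gauss_moment 0) 0 x = RInt (fun t => x * gauss_moment 0 (x * t)) 0 1).
  { symmetry. assert (K := RInt_comp_lin (V := R_CompleteNormedModule) (gauss_moment 0) x 0 0 1).
    assert (E0 : x * 0 + 0 = 0) by (clear; match goal with |- @eq _ ?a ?b => change (@eq R a b)
      end; ring). assert (E1 : x * 1 + 0 = x) by (clear; match goal with |- @eq _ ?a ?b => change
      (@eq R a b) end; ring). rewrite E0, E1 in K. rewrite <- K.
    - apply RInt_ext. intros t _. unfold scal; simpl; unfold mult; simpl. f_equal. f_equal. ring.
    - apply (ex_RInt_continuous (V := R_CompleteNormedModule)). intros; apply gauss_moment_cont. }
  rewrite E.
  replace (- (2 * exp (- (x * x)) * RInt (fun t => x * gauss_moment 0 (x * t)) 0 1)) with (scal (-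
    (2 * exp (- (x * x)))) (RInt (fun t => x * gauss_moment 0 (x * t)) 0 1)).
  2:{ unfold scal; simpl; unfold mult; simpl. ring. }
  rewrite <- (RInt_scal (V := R_CompleteNormedModule)).
  - apply RInt_ext. intros t _. unfold gauss_moment, scal; simpl; unfold mult; simpl.
    replace (- (x * x) * (1 + t * t)) with (- (x * x) + - (x * t * (x * t))) by ring.
      rewrite exp_plus. ring.
  - apply (ex_RInt_continuous (V := R_CompleteNormedModule)). intros t _.
    unfold gauss_moment. smooth. }
set (S := fun x => H x + gauss_int 0 x * gauss_int 0 x).
assert (dS : forall x, is_derive S x 0).
{ intros x. unfold S.
  replace 0 with (plus (- (2 * exp (- (x * x)) * gauss_int 0 x)) (plus (mult (gauss_moment 0 x)
    (gauss_int 0 x)) (mult (gauss_int 0 x) (gauss_moment 0 x)))).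
  2:{ unfold plus, mult, gauss_moment; simpl. ring. }
  apply (is_derive_plus (V := R_NormedModule)); [apply dHe|].
  apply (is_derive_mult (K := R_AbsRing)); [apply gauss_int_derive|apply gauss_int_derive|intros;
    apply Rmult_comm]. }
assert (S0 : S 0 = PI / 4).
{ unfold S, H. rewrite gauss_int_0. replace (0 * 0) with 0 by ring. rewrite Rplus_0_r.
  rewrite (RInt_ext _ (fun t => / (1 + t ^ 2))).
  2:{ intros t _. specialize (Pt t). assert (E0 : exp (- 0 * (1 + t * t)) = 1) by (replace (- 0 *
    (1 + t * t)) with 0 by ring; apply exp_0). rewrite E0. match goal with |- @eq _ ?a ?b => change
    (@eq R a b) end. field. replace (t ^ 2) with (t * t) by ring; lra. }
  replace (PI / 4) with (minus (atan 1) (atan 0)).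
  2:{ rewrite atan_1, atan_0. unfold minus, plus, opp; simpl. ring. }
  apply (is_RInt_unique (V := R_CompleteNormedModule)).
  apply (is_RInt_derive (V := R_CompleteNormedModule)).
  - intros t _. apply is_derive_Reals. apply derivable_pt_lim_atan.
  - intros t _. apply (ex_derive_continuous (V := R_NormedModule)). specialize (Pt t).
    auto_derive. replace (t * (t * 1)) with (t * t) by ring. lra. }
assert (Sx : forall x, 0 <= x -> S x = PI / 4).
{ intros x [Hx|<-]; auto. rewrite <- S0.
  destruct (MVT_cor2 S (fun _ => 0) 0 x Hx) as [c [Hc _]].
  { intros c _. apply is_derive_Reals, dS. }
  lra. }
assert (HH : forall x, 0 <= x -> 0 <= H x <= exp (- (x * x))).
{ intros x Hx. unfold H.
  assert (Ex : ex_RInt (fun t => exp (- (x * x) * (1 + t * t)) / (1 + t * t)) 0 1).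
  { apply (ex_RInt_continuous (V := R_CompleteNormedModule)). intros t _.
    apply (ex_derive_continuous (V := R_NormedModule)). specialize (Pt t). auto_derive. lra. }
  split.
  - apply RInt_ge_0; auto; [lra|]. intros t _. apply Rlt_le, Rdiv_lt_0_compat;
    [apply exp_pos|apply Pt].
  - replace (exp (- (x * x))) with (RInt (fun _ => exp (- (x * x))) 0 1).
    2:{ rewrite (RInt_const (V := R_CompleteNormedModule)). unfold scal; simpl; unfold mult;
      simpl. ring. }
    apply RInt_le; auto; [lra|apply (ex_RInt_const (V := R_NormedModule))|].
    intros t _. specialize (Pt t). apply Rle_trans with (exp (- (x * x) * (1 + t * t))).
    + apply Rmult_le_reg_r with (1 + t * t); auto. unfold Rdiv. rewrite Rmult_assoc, Rinv_l by lra.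
      apply Rmult_le_compat_l; [left; apply exp_pos|nra].
    + apply exp_le. nra. }
destruct (Gamma_half 0) as [C [HC HG]]. simpl INR in HG. rewrite Rplus_0_l in HG.
set (g := Gamma (1 / 2)) in *.
assert (Hg2 : g * g = PI).
{ apply Rminus_diag_uniq. apply Rabs_eq_0. apply Rle_antisym; [|apply Rabs_pos].
  apply Rnot_lt_le. intros Hp. set (e := Rabs (g * g - PI)) in *.
  set (B := 4 + C * (2 * Rabs g + C)).
  assert (HB : 0 < B) by (unfold B; generalize (Rabs_pos g); nra).
  destruct (exp_small B 1 (e / 2)) as [X [HX0 HX]]; [lra|lra|].
  set (x := Rmax X 1). assert (Hx1 : 1 <= x) by apply Rmax_r. specialize (HX x (Rmax_l _ _)).
    rewrite Rmult_1_l in HX.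
  assert (K := Sx x ltac:(lra)). unfold S in K. destruct (HH x ltac:(lra)) as [K1 K2].
  specialize (HG x ltac:(lra)). set (G := 2 * gauss_int 0 x) in *.
  assert (Ee : 0 < exp (- x) <= 1) by (split; [apply exp_pos|rewrite <- exp_0; apply exp_le; lra]).
  assert (K3 : exp (- (x * x)) <= exp (- x)) by (apply exp_le; nra).
  assert (K4 : g * g - PI = (g - G) * (g + G) + (G * G - PI)) by ring.
  assert (K5 : G * G - PI = - (4 * H x)) by (unfold G; lra).
  assert (K6 : Rabs (g - G) <= C * exp (- x)) by (rewrite <- Rabs_Ropp, Ropp_minus_distr; exact HG).
  assert (K7 : Rabs (g + G) <= 2 * Rabs g + C).
  { replace (g + G) with (2 * g + (G - g)) by ring. eapply Rle_trans; [apply Rabs_triang|].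
    rewrite Rabs_mult, (Rabs_pos_eq 2) by lra.
    assert (C * exp (- x) <= C * 1) by (apply Rmult_le_compat_l; lra). lra. }
  assert (K8 : e <= B * exp (- x)); [|lra].
  unfold e. rewrite K4, K5. eapply Rle_trans; [apply Rabs_triang|].
    rewrite Rabs_mult, Rabs_Ropp, (Rabs_pos_eq (4 * H x)) by lra.
  unfold B. rewrite Rmult_plus_distr_r, Rplus_comm. apply Rplus_le_compat; [lra|].
  replace (C * (2 * Rabs g + C) * exp (- x)) with (C * exp (- x) * (2 * Rabs g + C)) by ring.
  apply Rmult_le_compat; auto; apply Rabs_pos. }
assert (Hg : 0 <= g).
{ apply Rnot_lt_le. intros Hn.
  destruct (exp_small C 1 (- g / 2)) as [X [HX0 HX]]; [lra|lra|].
  specialize (HX X (Rle_refl _)). rewrite Rmult_1_l in HX. specialize (HG X HX0).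
  assert (0 <= gauss_int 0 X).
  { apply RInt_ge_0; auto.
    - apply (ex_RInt_continuous (V := R_CompleteNormedModule)). intros; apply gauss_moment_cont.
    - intros; apply gauss_moment_pos; lra. }
  generalize (Rle_abs (2 * gauss_int 0 X - g)). lra. }
rewrite <- Hg2. symmetry. apply sqrt_square; auto.
Qed.

(** * Laplace's method at a quadratic maximum *)

Lemma pow_exp_bound m d : 0 < d -> exists C, 0 <= C /\ forall x, 0 <= x ->
  x ^ m * exp (- (d * x)) <= C.
Proof.
intros Hd. set (k := INR (S m)). assert (Hk : 0 < k) by (apply lt_0_INR; lia).
exists ((k / d) ^ m). split; [apply pow_le; left; apply Rdiv_lt_0_compat; auto|].
intros x Hx.
assert (Hy : 0 <= d * x / k) by (apply Rmult_le_pos; [nra|left; apply Rinv_0_lt_compat; auto]).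
assert (H := exp_pow_le (d * x / k) m (S m) Hy ltac:(lia)). fold k in H.
replace (k * (d * x / k)) with (d * x) in H by (field; lra).
assert (E : x ^ m = (k / d) ^ m * (d * x / k) ^ m) by (rewrite <- Rpow_mult_distr; f_equal; field;
  lra).
rewrite E, Rmult_assoc. rewrite <- (Rmult_1_r ((k / d) ^ m)) at 2.
apply Rmult_le_compat_l; [apply pow_le; left; apply Rdiv_lt_0_compat; auto|].
rewrite exp_Ropp. apply Rmult_le_reg_r with (exp (d * x)); [apply exp_pos|].
rewrite Rmult_assoc, Rinv_l by (apply Rgt_not_eq, exp_pos). lra.
Qed.

Definition cis (x : R) : C := Cexp (Ci * RtoC x)%C.

Lemma Cmod_cis x : Cmod (cis x) = 1.
Proof. unfold cis. rewrite Cmod_Cexp. simpl. replace (0 * x - 1 * 0) with 0 by ring. apply exp_0.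
  Qed.

Lemma cis_neq0 x : cis x <> RtoC 0.
Proof. apply Cexp_neq0. Qed.

Lemma cis_plus x y : cis (x + y) = (cis x * cis y)%C.
Proof. unfold cis. rewrite <- Cexp_plus. f_equal. rewrite RtoC_plus. ring. Qed.

Lemma cis_0 : cis 0 = RtoC 1.
Proof. unfold cis. rewrite Cmult_0_r. apply Cexp_0. Qed.

Lemma Re_cis x : Re (cis x) = cos x.
Proof. unfold cis. rewrite Cexp_Ci. reflexivity. Qed.

Lemma cis_neg_PI2 : cis (- (PI / 2)) = (- Ci)%C.
Proof. unfold cis. rewrite Cexp_Ci, cos_neg, sin_neg, cos_PI2, sin_PI2.
  apply injective_projections; simpl; ring. Qed.

Definition gauss_fun (n : nat) (v : C) : C := (v ^ (2 * n) * Cexp (- (v * v)))%C.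

Lemma gauss_fun_hol n : hol_all (gauss_fun n).
Proof.
intros v. eexists. apply cder_mult; [apply cder_pow|].
apply (cder_comp Cexp (fun v => - (v * v))%C); [apply cder_Cexp|].
apply (cder_ext (fun v => (- (1)) * (v * v))%C); [intros; ring|].
apply cder_scal. apply cder_mult; apply cder_id.
Qed.

Lemma gauss_fun_cont n v : @cont CT (gauss_fun n) v.
Proof. destruct (gauss_fun_hol n v) as [l Hl]. apply (cder_cont _ _ _ Hl). Qed.

Lemma gauss_fun_R n x : gauss_fun n (RtoC x) = RtoC (gauss_moment n x).
Proof.
unfold gauss_fun, gauss_moment. rewrite RtoC_mult, RtoC_pow, <- Cexp_R. f_equal. f_equal.
rewrite RtoC_opp, RtoC_mult. reflexivity.
Qed.

Lemma cos_between eta t : Rabs eta <= PI / 2 -> 0 <= t <= 1 -> cos eta <= cos (eta * t).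
Proof.
intros H Ht.
assert (W : forall e, 0 <= e <= PI / 2 -> cos e <= cos (e * t)).
{ intros e He. assert (HP := PI_RGT_0). apply cos_decr_1; nra. }
destruct (Rle_dec 0 eta) as [P|P].
- rewrite Rabs_pos_eq in H by auto. apply W; lra.
- rewrite Rabs_left in H by lra. rewrite <- (cos_neg eta), <- (cos_neg (eta * t)).
  replace (- (eta * t)) with (- eta * t) by ring. apply W; lra.
Qed.

(** The integral is, up to the factor s^(2n+1), the integral of the entire function
    v^(2n) exp(- v^2) over the segment from 0 to d s. The segment is rotated to the real
    axis through the angle eta/2 with the help of a primitive; on the connecting arc of
    radius X = d sqrt(lam) the integrand is O(exp(- c0 X^2)) up to powers of X, because
    cos does not drop below cos eta >= c0. *)
Lemma gauss_complex n c0 d : 0 < c0 -> 0 < d -> exists C, 0 <= C /\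
  forall lam eta, 1 <= lam -> Rabs eta <= PI / 2 -> c0 <= cos eta ->
  let s := (RtoC (sqrt lam) * cis (eta / 2))%C in
  Cmod (2 * CInt (fun u => RtoC (u ^ (2 * n)) * Cexp (- (RtoC lam * cis eta * RtoC (u * u)))) 0 d
        - RtoC (Gamma (INR n + 1 / 2)) * (/ s) ^ (S (2 * n)))%C <= C * exp (- (d * sqrt lam)).
Proof.
intros Hc0 Hd.
destruct (Gamma_half n) as [C1 [HC1 HG]].
assert (HPI := PI_RGT_0).
set (m := INR (S (2 * n))).
set (C2 := exp ((m + 1) ^ 2 / (4 * c0))).
assert (HC2 : 0 < C2) by apply exp_pos.
exists (C1 + PI / 2 * C2). split; [nra|].
intros lam eta Hlam Heta Hcos s.
assert (Hsl : 1 <= sqrt lam) by (rewrite <- sqrt_1; apply sqrt_le_1; lra).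
set (X := d * sqrt lam). assert (HX : 0 < X) by (apply Rmult_lt_0_compat; lra).
assert (Hs0 : s <> RtoC 0).
{ apply Cmult_neq_0; [|apply cis_neq0]. apply RtoC_neq0; lra. }
assert (Hms : Cmod s = sqrt lam) by (unfold s; rewrite Cmod_mult, Cmod_cis, Cmod_R,
  Rabs_pos_eq by lra; ring).
assert (Hss : (s * s = RtoC lam * cis eta)%C).
{ unfold s. replace (RtoC lam) with (RtoC (sqrt lam) * RtoC (sqrt lam))%C by (rewrite <- RtoC_mult,
  sqrt_sqrt by lra; reflexivity).
  replace eta with (eta / 2 + eta / 2) at 3 by field. rewrite cis_plus. ring. }
destruct (primitive_exists (gauss_fun n) 0 (X + 1)) as [P HP].
{ lra. }
{ intros; apply gauss_fun_cont. }
{ apply (goursat_except (gauss_fun n) 0 (X + 1) 0).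
  - split; simpl; rewrite Rminus_0_r, Rabs_R0; lra.
  - intros; apply gauss_fun_cont.
  - intros z _; apply gauss_fun_hol. }
assert (Sin : forall z, Cmod z <= X -> square 0 (X + 1) z).
{ intros z Hz. apply disc_in_square. replace (z - 0)%C with z by ring. lra. }
assert (E1 : (P (RtoC d * s) - P 0 = s ^ (S (2 * n)) * CInt (fun u => RtoC (u ^ (2 * n)) * Cexp (-
  (RtoC lam * cis eta * RtoC (u * u)))) 0 d)%C).
{ rewrite <- CInt_scal.
  - rewrite (CInt_ext _ (fun u => gauss_fun n (0 + RtoC u * s) * s)%C).
    + rewrite (CInt_FTC (fun u => P (0 + RtoC u * s)%C)).
      * f_equal; [|f_equal]; f_equal; ring.
      * intros u Hu. rewrite Rmin_left, Rmax_right in Hu by lra.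
        apply (rder_comp P (fun u => 0 + RtoC u * s)%C); [|apply rder_lin]. apply HP, Sin.
        rewrite Cplus_0_l, Cmod_mult, Hms, Cmod_R, Rabs_pos_eq by lra. unfold X.
          apply Rmult_le_compat_r; lra.
      * intros u _. apply rcont_mult; [|apply cont_const].
        apply (rcont_comp (gauss_fun n)); [apply gauss_fun_cont|apply rcont_lin].
    + intros u _. unfold gauss_fun. rewrite Cplus_0_l. rewrite <- Hss, RtoC_pow, RtoC_mult.
      rewrite Cpow_S, Cpow_mult_l. replace (RtoC u * s * (RtoC u * s))%C with (s * s * (RtoC u *
        RtoC u))%C by ring. ring.
  - intros u _. apply rcont_mult.
    + apply cont_RtoC. smooth.
    + apply rcont_Cexp. apply rcont_opp. apply rcont_mult; [apply cont_const|].
      apply cont_RtoC. smooth. }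
assert (E2 : (P (RtoC X) - P 0)%C = RtoC (gauss_int n X)).
{ rewrite <- gauss_int_CInt. symmetry. rewrite (CInt_ext _ (fun v => gauss_fun n (RtoC v) * 1)%C)
  by (intros; rewrite gauss_fun_R; ring).
  apply (CInt_FTC (fun v => P (RtoC v))).
  - intros v Hv. rewrite Rmin_left, Rmax_right in Hv by lra. apply rder_comp; [|apply rder_RtoC].
    apply HP, Sin.
    rewrite Cmod_R, Rabs_pos_eq by lra. lra.
  - intros v _. apply rcont_mult; [|apply cont_const].
    apply (rcont_comp (gauss_fun n)); [apply gauss_fun_cont|apply rcont_RtoC]. }
(* The arc from X to d s, on which Re v^2 = X^2 cos(eta t) with 0 <= t <= 1. *)
assert (E3 : Cmod (P (RtoC d * s) - P (RtoC X))%C <= PI / 4 * (X ^ (S (2 * n)) * exp (- (c0 * (X *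
  X))))).
{ set (g := fun t => (RtoC X * Cexp (Ci * RtoC (eta / 2) * RtoC t))%C).
  set (dg := fun t => (Ci * RtoC (eta / 2) * g t)%C).
  assert (Hg : forall t, rder g t (dg t)).
  { intros t. unfold g, dg. eapply rder_eq.
    - apply (rder_comp (fun w => RtoC X * Cexp (Ci * RtoC (eta / 2) * w))%C RtoC).
      + apply cder_scal. apply (cder_comp Cexp (fun w => Ci * RtoC (eta / 2) * w)%C);
        [apply cder_Cexp|apply cder_scal, cder_id].
      + apply rder_RtoC.
    - unfold g. ring. }
  assert (Cg : forall t, rcont g t) by (intros t; apply (rder_cont _ _ _ (Hg t))).
  assert (Eg : forall t, g t = (RtoC X * cis (eta / 2 * t))%C).
  { intros t. unfold g, cis. f_equal. f_equal. rewrite RtoC_mult. ring. }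
  assert (Mg : forall t, Cmod (g t) = X).
  { intros t. rewrite Eg, Cmod_mult, Cmod_cis, Cmod_R, Rabs_pos_eq by lra. ring. }
  assert (I : CInt (fun t => gauss_fun n (g t) * dg t)%C 0 1 = (P (RtoC d * s) - P (RtoC X))%C).
  { rewrite (CInt_FTC (fun t => P (g t))).
    - assert (G1 : g 1 = (RtoC d * s)%C) by (rewrite Eg; unfold s, X;
      rewrite RtoC_mult, Rmult_1_r; ring).
      assert (G0 : g 0 = RtoC X) by (rewrite Eg, Rmult_0_r, cis_0; ring).
      rewrite G1, G0. reflexivity.
    - intros t _. apply rder_comp; [apply HP, Sin; rewrite Mg; lra|apply Hg].
    - intros t _. apply rcont_mult.
      + apply (rcont_comp (gauss_fun n)); [apply gauss_fun_cont|apply Cg].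
      + apply rcont_mult; [apply cont_const|apply Cg]. }
  rewrite <- I.
  eapply Rle_trans; [apply (CInt_bound _ 0 1 (PI / 4 * (X ^ (S (2 * n)) * exp (- (c0 * (X *
    X))))))|].
  - intros t _. apply rcont_mult.
    + apply (rcont_comp (gauss_fun n)); [apply gauss_fun_cont|apply Cg].
    + apply rcont_mult; [apply cont_const|apply Cg].
  - intros t Ht. rewrite Rmin_left, Rmax_right in Ht by lra.
    unfold gauss_fun, dg. rewrite !Cmod_mult, Cmod_pow, Mg, Cmod_Ci, Cmod_R, Cmod_Cexp.
    assert (Er : Re (- (g t * g t))%C = - (X * X * cos (eta * t))).
    { rewrite Eg. replace (RtoC X * cis (eta / 2 * t) * (RtoC X * cis (eta / 2 * t)))%C with (RtoC
      (X * X) * (cis (eta / 2 * t) * cis (eta / 2 * t)))%C by (rewrite RtoC_mult; ring).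
      rewrite <- cis_plus. replace (eta / 2 * t + eta / 2 * t) with (eta * t) by field.
      rewrite re_opp, re_scal_l, Re_cis. reflexivity. }
    rewrite Er.
    assert (Hc := cos_between eta t Heta Ht).
    assert (Hex : exp (- (X * X * cos (eta * t))) <= exp (- (c0 * (X * X)))) by (apply exp_le; nra).
    assert (Ha : Rabs (eta / 2) <= PI / 4) by (unfold Rdiv; rewrite Rabs_mult,
      (Rabs_pos_eq (/ 2)) by lra; lra).
    simpl (X ^ S (2 * n)).
    assert (Hxp : 0 <= X ^ (2 * n)) by (apply pow_le; lra).
    replace (X ^ (2 * n) * exp (- (X * X * cos (eta * t))) * (1 * Rabs (eta / 2) * X)) with (Rabs
      (eta / 2) * (X * X ^ (2 * n) * exp (- (X * X * cos (eta * t))))) by ring.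
    apply Rmult_le_compat; [apply Rabs_pos|apply Rmult_le_pos; [apply Rmult_le_pos;
      [lra|apply pow_le; lra]|left; apply exp_pos]|auto|].
    apply Rmult_le_compat_l; [apply Rmult_le_pos; [lra|apply pow_le; lra]|auto].
  - rewrite Rminus_0_r, Rabs_R1. lra. }
assert (E4 : X ^ (S (2 * n)) * exp (- (c0 * (X * X))) <= C2 * exp (- X)).
{ apply Rle_trans with (exp (m * X) * exp (- (c0 * (X * X)))).
  - apply Rmult_le_compat_r; [left; apply exp_pos|]. apply exp_pow_le; [lra|lia].
  - unfold C2. rewrite <- !exp_plus. apply exp_le.
    assert (0 <= c0 * (X - (m + 1) / (2 * c0)) ^ 2) by (apply Rmult_le_pos; [lra|apply pow2_ge_0]).
    replace (c0 * (X - (m + 1) / (2 * c0)) ^ 2) with (c0 * (X * X) - (m + 1) * X + (m + 1) ^ 2 / (4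
      * c0)) in H by (field; lra). lra. }
set (J := CInt (fun u => (RtoC (u ^ (2 * n)) * Cexp (- (RtoC lam * cis eta * RtoC (u * u))))%C) 0
  d) in *.
assert (Hsn : (s ^ S (2 * n))%C <> RtoC 0) by (apply Cpow_nz; auto).
rewrite Cpow_inv by auto.
replace (2 * J - RtoC (Gamma (INR n + 1 / 2)) * / s ^ S (2 * n))%C with
  ((2 * (s ^ S (2 * n) * J) - RtoC (Gamma (INR n + 1 / 2))) / s ^ S (2 * n))%C by (field; auto).
rewrite Cmod_div by auto. rewrite Cmod_pow, Hms.
assert (Hp1 : 1 <= sqrt lam ^ S (2 * n)) by (apply pow_R1_Rle; auto).
apply Rle_trans with (Cmod (2 * (s ^ S (2 * n) * J) - RtoC (Gamma (INR n + 1 / 2)))%C).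
{ unfold Rdiv. rewrite <- (Rmult_1_r (Cmod _)) at 2. apply Rmult_le_compat_l; [apply Cmod_ge_0|].
  rewrite <- Rinv_1. apply Rinv_le_contravar; lra. }
rewrite <- E1.
replace (2 * (P (RtoC d * s) - P 0) - RtoC (Gamma (INR n + 1 / 2)))%C with
  (RtoC (2 * gauss_int n X - Gamma (INR n + 1 / 2)) + 2 * (P (RtoC d * s) - P (RtoC X)))%C.
2:{ rewrite RtoC_minus, RtoC_mult, <- E2. ring. }
eapply Rle_trans; [apply Cmod_triangle|]. rewrite Cmod_mult, !Cmod_R, (Rabs_pos_eq 2) by lra.
specialize (HG X ltac:(lra)). fold X.
assert (K : PI / 4 * (X ^ S (2 * n) * exp (- (c0 * (X * X)))) <= PI / 4 * (C2 * exp (- X))) by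
  (apply Rmult_le_compat_l; lra).
rewrite Rmult_plus_distr_r. lra.
Qed.

Lemma CInt_sym g d : 0 <= d -> (forall u, - d <= u <= d -> rcont g u) ->
  CInt g (- d) d = CInt (fun u => g u + g (- u)%R)%C 0 d.
Proof.
intros Hd Hg.
assert (C1 : contI g 0 d) by (intros u Hu; rewrite Rmin_left, Rmax_right in Hu by lra; apply Hg;
  lra).
assert (C2 : contI g (- d) 0) by (intros u Hu; rewrite Rmin_left, Rmax_right in Hu by lra;
  apply Hg; lra).
assert (C3 : contI (fun u => g (- u)) 0 d).
{ intros u Hu; rewrite Rmin_left, Rmax_right in Hu by lra. apply (rcont_comp_real g (fun u => -
  u)); [apply Hg; lra|].
  smooth. }
rewrite CInt_plus by auto. rewrite <- (CInt_Chasles g (- d) 0 d) by auto. rewrite Cplus_comm.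
  f_equal.
assert (E : CInt g (- 0) (- d) = CInt (fun u => RtoC (- (1)) * g (- u)%R)%C 0 d).
{ apply (CInt_comp g (fun u => - u) (fun _ => - (1))).
  - intros u Hu. rewrite Rmin_left, Rmax_right in Hu by lra. apply Hg; lra.
  - intros u _. split; [auto_derive; [auto|ring]|apply continuous_const]. }
rewrite Ropp_0 in E. rewrite CInt_scal in E by auto.
rewrite (CInt_swap g (- d) 0) in E by auto.
replace (CInt g (- d) 0) with (RtoC (- (1)) * (- CInt g (- d) 0))%C by (rewrite RtoC_opp; ring).
rewrite E, RtoC_opp. ring.
Qed.

Lemma Csum_even_part (a : nat -> C) (u : C) N :
  (Csum (fun k => a k * u ^ k) (2 * N) + Csum (fun k => a k * (- u) ^ k) (2 * N) = 2 * Csum (fun n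
    => a (2 * n)%nat * u ^ (2 * n)) N)%C.
Proof.
induction N; [rewrite !Csum_0; ring|].
replace (2 * S N)%nat with (S (S (2 * N))) by lia.
rewrite !Csum_S.
assert (E1 : ((- u) ^ (2 * N) = u ^ (2 * N))%C).
{ rewrite !Cpow_mult_r. f_equal. simpl. ring. }
assert (E2 : ((- u) ^ S (2 * N) = - u ^ S (2 * N))%C) by (rewrite !Cpow_S, E1; ring).
rewrite E1, E2.
match goal with |- (?A + ?B + ?C0 + (?D + ?E + ?F))%C = _ => replace (A + B + C0 + (D + E + F))%C
  with ((A + D) + 2 * B)%C by ring end.
rewrite IHN. ring.
Qed.

Lemma CInt_Csum (g : nat -> R -> C) a b N : (forall n, contI (g n) a b) ->
  CInt (fun u => Csum (fun n => g n u) N) a b = Csum (fun n => CInt (g n) a b) N.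
Proof.
intros H. induction N.
- rewrite Csum_0. rewrite (CInt_ext _ (fun _ => RtoC 0)); [rewrite CInt_const; ring|]. reflexivity.
- rewrite Csum_S, <- IHN. rewrite <- CInt_plus.
  + apply CInt_ext. intros u _. apply (Csum_S (fun n => g n u)).
  + assert (CS : forall M t, Rmin a b <= t <= Rmax a b -> rcont (fun s => Csum (fun n => g n s) M)
    t).
    { intros M t Ht. induction M; [apply cont_const|].
      apply (@cont_ext R_UniformSpace (fun s => Csum (fun n => g n s) M + g M s)%C); [intros s;
        symmetry; apply (Csum_S (fun n => g n s))|].
      apply rcont_plus; auto. apply H; auto. }
    intros t Ht. apply CS; auto.
  + apply H.
Qed.

(** Scaling u by sqrt(c0 lam). *)
Lemma gauss_remainder N c0 d : 0 < c0 -> 0 < d -> exists C, 0 <= C /\ forall lam, 1 <= lam ->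
  sqrt lam * RInt (fun u => u ^ (2 * N) * exp (- (c0 * lam * (u * u)))) 0 d <= C * (/ lam) ^ N.
Proof.
intros Hc0 Hd.
destruct (gauss_int_limit N) as [l [C1 [HC1 HG]]].
set (k := sqrt c0). assert (Hk : 0 < k) by (apply sqrt_lt_R0; auto).
exists ((Rabs l + C1) * (/ k) ^ (2 * N + 1)). split.
{ apply Rmult_le_pos; [generalize (Rabs_pos l); lra|]. apply pow_le.
  left; apply Rinv_0_lt_compat; auto. }
intros lam Hlam.
assert (Hsl : 1 <= sqrt lam) by (rewrite <- sqrt_1; apply sqrt_le_1; lra).
set (q := k * sqrt lam). assert (Hq : 0 < q) by (apply Rmult_lt_0_compat; lra).
assert (Eq : q * q = c0 * lam).
{ unfold q. replace (k * sqrt lam * (k * sqrt lam)) with ((k * k) * (sqrt lam * sqrt lam)) by ring.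
  unfold k. rewrite !sqrt_sqrt by lra. reflexivity. }
assert (E : RInt (fun u => u ^ (2 * N) * exp (- (c0 * lam * (u * u)))) 0 d = (/ q) ^ (2 * N + 1) *
  gauss_int N (q * d)).
{ unfold gauss_int.
  assert (K := RInt_comp_lin (V := R_CompleteNormedModule) (gauss_moment N) q 0 0 d).
  assert (E0 : q * 0 + 0 = 0) by ring. assert (E1 : q * d + 0 = q * d) by ring.
  rewrite E0, E1 in K. rewrite <- K.
  2:{ apply (ex_RInt_continuous (V := R_CompleteNormedModule)). intros; apply gauss_moment_cont. }
  symmetry.
  transitivity (scal ((/ q) ^ (2 * N + 1)) (RInt (fun y => scal q (gauss_moment N (q * y + 0))) 0
    d)); [reflexivity|].
  rewrite <- (RInt_scal (V := R_CompleteNormedModule)).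
  - apply RInt_ext. intros u _. unfold gauss_moment. generalize (2 * N)%nat. intros p.
    unfold scal; simpl; unfold mult; simpl.
    rewrite Rplus_0_r. rewrite Rpow_mult_distr. replace (q * u * (q * u)) with (c0 * lam * (u * u))
      by (rewrite <- Eq; ring).
    rewrite (pow_add (/ q)), pow_1, pow_inv. match goal with |- @eq _ ?a ?b => change (@eq R a b)
      end. field. split; [|apply pow_nonzero]; lra.
  - apply (ex_RInt_continuous (V := R_CompleteNormedModule)). intros u _.
    unfold gauss_moment, scal; simpl; unfold mult; simpl. smooth. }
rewrite E.
assert (B : gauss_int N (q * d) <= Rabs l + C1).
{ assert (Hqd : 0 <= q * d) by nra. specialize (HG (q * d) Hqd).
  assert (exp (- (q * d)) <= 1) by (rewrite <- exp_0; apply exp_le; lra).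
  assert (H1 := Rle_abs (gauss_int N (q * d) - l)). assert (H2 := Rle_abs l).
  assert (C1 * exp (- (q * d)) <= C1 * 1) by (apply Rmult_le_compat_l; lra). lra. }
replace ((Rabs l + C1) * (/ k) ^ (2 * N + 1) * (/ lam) ^ N) with (sqrt lam * ((/ q) ^ (2 * N + 1) *
  (Rabs l + C1))).
- apply Rmult_le_compat_l; [lra|]. apply Rmult_le_compat_l; [apply pow_le; left;
  apply Rinv_0_lt_compat; auto|auto].
- unfold q. rewrite Rinv_mult, Rpow_mult_distr.
  replace (/ lam) with (/ sqrt lam * / sqrt lam) by (rewrite <- Rinv_mult, sqrt_sqrt by lra;
    reflexivity).
  assert (Hv : sqrt lam * / sqrt lam = 1) by (apply Rinv_r; lra).
  set (v := / sqrt lam) in *. replace (2 * N + 1)%nat with (S (N + N)) by lia.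
  rewrite Rpow_mult_distr, <- (tech_pow_Rmult v), (pow_add v).
  transitivity ((sqrt lam * v) * ((/ k) ^ S (N + N) * (v ^ N * v ^ N) * (Rabs l + C1))); [ring|].
    rewrite Hv. ring.
Qed.

(** On the symmetric interval the odd Taylor terms of K cancel; the even ones give
    Gaussian moments by [gauss_complex], and the Taylor remainder of order 2N
    contributes lam^(-N). *)
Lemma laplace_symmetric K r d N c0 : hol_on (square 0 r) K -> 0 < d < r -> 0 < c0 ->
  exists C, 0 <= C /\
  forall lam eta, 1 <= lam -> Rabs eta <= PI / 2 -> c0 <= cos eta ->
  Cmod (RtoC (sqrt lam) * cis (eta / 2) * CInt (fun u => K (RtoC u) * Cexp (- (RtoC lam * cis eta *
    RtoC (u * u)))) (- d) d
   - Csum (fun n => RtoC (Gamma (INR n + 1 / 2)) * (C_derive_n (2 * n) K 0 / RtoC (INR (fact (2 *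
     n)))) * (/ (RtoC lam * cis eta)) ^ n) N)%C
  <= C * (/ lam) ^ N.
Proof.
intros HK Hd Hc0.
set (rho := (d + r) / 2).
destruct (taylor_bound K 0 r rho HK) as [M [HM HT]]; [unfold rho; lra|].
set (a := fun k => (C_derive_n k K 0 / RtoC (INR (fact k)))%C) in *.
set (M1 := M / (rho - d) * (/ rho) ^ (2 * N)).
assert (Hrho : 0 < rho) by (unfold rho; lra).
assert (HM1 : 0 <= M1).
{ apply Rmult_le_pos; [left; apply Rdiv_lt_0_compat; unfold rho; lra|apply pow_le; left;
  apply Rinv_0_lt_compat; auto]. }
assert (HT' : forall w, Cmod w <= d -> Cmod (K w - Csum (fun k => a k * w ^ k) (2 * N))%C <= M1 *
  Cmod w ^ (2 * N)).
{ intros w Hw. assert (Hwr : Cmod (w - 0)%C < rho) by (replace (w - 0)%C with w by ring;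
  unfold rho; lra).
  specialize (HT (2 * N)%nat w Hwr).
  replace (w - 0)%C with w in * by ring. eapply Rle_trans; [exact HT|].
  unfold M1. unfold Rdiv at 2. rewrite Rpow_mult_distr.
  assert (Hi : / (rho - Cmod w) <= / (rho - d)) by (apply Rinv_le_contravar; unfold rho in *; lra).
  replace (M / (rho - d) * (/ rho) ^ (2 * N) * Cmod w ^ (2 * N)) with (M / (rho - d) * (Cmod w ^ (2
    * N) * (/ rho) ^ (2 * N))) by ring.
  apply Rmult_le_compat_r.
  - apply Rmult_le_pos; apply pow_le; [apply Cmod_ge_0|left; apply Rinv_0_lt_compat; auto].
  - unfold Rdiv. apply Rmult_le_compat_l; lra. }
(* One constant for the errors of the finitely many moments n < N. *)
assert (HCn : exists Cn, 0 <= Cn /\ forall n lam eta, (n < N)%nat -> 1 <= lam ->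
  Rabs eta <= PI / 2 -> c0 <= cos eta ->
  Cmod (a (2 * n)%nat * (2 * CInt (fun u => RtoC (u ^ (2 * n)) * Cexp (- (RtoC lam * cis eta * RtoC
    (u * u)))) 0 d
        - RtoC (Gamma (INR n + 1 / 2)) * (/ (RtoC (sqrt lam) * cis (eta / 2))) ^ (S (2 * n))))%C <=
          Cn * exp (- (d * sqrt lam))).
{ clear HT HT' M1 HM1. induction N as [|N' [Cn [HCn0 HCn]]].
  - exists 0. split; [lra|intros; lia].
  - destruct (gauss_complex N' c0 d Hc0 (proj1 Hd)) as [C2 [HC2 HG]].
    exists (Cn + Cmod (a (2 * N')%nat) * C2).
    assert (Hp : 0 <= Cmod (a (2 * N')%nat) * C2) by (apply Rmult_le_pos; [apply Cmod_ge_0|auto]).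
    split; [lra|]. intros n lam eta Hn H1 H2 H3. assert (He := exp_pos (- (d * sqrt lam))).
    rewrite Rmult_plus_distr_r. destruct (Nat.eq_dec n N') as [->|Hne].
    + rewrite Cmod_mult. specialize (HG lam eta H1 H2 H3). cbv zeta in HG.
      assert (Cmod (a (2 * N')%nat) * Cmod (2 * CInt (fun u => RtoC (u ^ (2 * N')) * Cexp (- (RtoC
        lam * cis eta * RtoC (u * u)))) 0 d
        - RtoC (Gamma (INR N' + 1 / 2)) * (/ (RtoC (sqrt lam) * cis (eta / 2))) ^ (S (2 * N')))%C
          <= Cmod (a (2 * N')%nat) * (C2 * exp (- (d * sqrt lam)))) by (apply Rmult_le_compat_l;
          [apply Cmod_ge_0|auto]).
      assert (0 <= Cn * exp (- (d * sqrt lam))) by (apply Rmult_le_pos; lra). lra.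
    + specialize (HCn n lam eta ltac:(lia) H1 H2 H3).
      assert (0 <= Cmod (a (2 * N')%nat) * C2 * exp (- (d * sqrt lam))) by (apply Rmult_le_pos;
        lra). lra. }
destruct HCn as [Cn [HCn0 HCn]].
destruct (pow_exp_bound (2 * N + 1) d (proj1 Hd)) as [C3 [HC3 HP]].
destruct (gauss_remainder N c0 d Hc0 (proj1 Hd)) as [C4 [HC4 HR]].
exists (INR N * Cn * C3 + 2 * M1 * C4). split.
{ assert (0 <= INR N * Cn * C3) by (apply Rmult_le_pos; [apply Rmult_le_pos;
  [apply pos_INR|auto]|auto]).
  assert (0 <= 2 * M1 * C4) by (apply Rmult_le_pos; lra). lra. }
intros lam eta Hlam Heta Hcos.
assert (Hsl : 1 <= sqrt lam) by (rewrite <- sqrt_1; apply sqrt_le_1; lra).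
set (s := (RtoC (sqrt lam) * cis (eta / 2))%C).
assert (Hs0 : s <> RtoC 0).
{ apply Cmult_neq_0; [|apply cis_neq0]. apply RtoC_neq0; lra. }
assert (Hms : Cmod s = sqrt lam) by (unfold s; rewrite Cmod_mult, Cmod_cis, Cmod_R,
  Rabs_pos_eq by lra; ring).
assert (Hss : (s * s = RtoC lam * cis eta)%C).
{ unfold s. replace (RtoC lam) with (RtoC (sqrt lam) * RtoC (sqrt lam))%C by (rewrite <- RtoC_mult,
  sqrt_sqrt by lra; reflexivity).
  replace eta with (eta / 2 + eta / 2) at 3 by field. rewrite cis_plus. ring. }
set (mu := (RtoC lam * cis eta)%C) in *.
set (E := fun u => Cexp (- (mu * RtoC (u * u)))%C).
assert (CE : forall u, rcont E u).
{ intros u. apply rcont_Cexp. apply rcont_opp. apply rcont_mult; [apply cont_const|].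
  apply cont_RtoC. smooth. }
assert (CK : forall u, - d <= u <= d -> rcont (fun u => K (RtoC u)) u).
{ intros u Hu. apply (rcont_comp K); [|apply rcont_RtoC].
  apply (hol_cont _ _ _ HK). apply disc_in_square. replace (RtoC u - 0)%C with (RtoC u) by ring.
    rewrite Cmod_R. apply Rabs_def1; lra. }
assert (Cm : forall n u, rcont (fun u => RtoC (u ^ (2 * n)) * E u)%C u).
{ intros n u. apply rcont_mult; [|apply CE].
  apply cont_RtoC. smooth. }
assert (ME : forall u, Cmod (E u) <= exp (- (c0 * lam * (u * u)))).
{ intros u. unfold E, mu. rewrite Cmod_Cexp. apply exp_le.
  replace (RtoC lam * cis eta * RtoC (u * u))%C with (RtoC (lam * (u * u)) * cis eta)%C by (rewrite
    RtoC_mult; ring).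
  rewrite re_opp, re_scal_l, Re_cis. assert (0 <= lam * (u * u)) by nra. nra. }
change (fun u : R => (K (RtoC u) * Cexp (- (mu * RtoC (u * u))))%C) with (fun u => (K (RtoC u) * E
  u)%C).
rewrite (CInt_sym (fun u => K (RtoC u) * E u)%C d); [|lra|].
2:{ intros u Hu. apply rcont_mult; [apply CK; auto|apply CE]. }
(* Folding the interval leaves the even part of K; R0 is its Taylor remainder. *)
set (R0 := fun u => (K (RtoC u) + K (RtoC (- u)) - 2 * Csum (fun n => a (2 * n)%nat * RtoC u ^ (2 *
  n)) N)%C).
assert (BR0 : forall u, 0 <= u <= d -> Cmod (R0 u) <= 2 * M1 * u ^ (2 * N)).
{ intros u Hu. unfold R0. rewrite <- (Csum_even_part a). rewrite RtoC_opp.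
  match goal with |- Cmod ?X <= _ => replace X with ((K (RtoC u) - Csum (fun k => a k * RtoC u ^ k)
    (2 * N)) + (K (- RtoC u) - Csum (fun k => a k * (- RtoC u) ^ k) (2 * N)))%C by ring end.
  assert (Hm1 : Cmod (RtoC u) = u) by (rewrite Cmod_R, Rabs_pos_eq; lra).
  eapply Rle_trans; [apply Cmod_triangle|].
  assert (A1 := HT' (RtoC u) ltac:(lra)). assert (A2 := HT' (- RtoC u)%C ltac:(rewrite Cmod_opp;
    lra)).
  rewrite Cmod_opp in A2. rewrite Hm1 in A1, A2. lra. }
assert (CR0 : contI (fun u => R0 u * E u)%C 0 d).
{ intros u Hu. rewrite Rmin_left, Rmax_right in Hu by lra. apply rcont_mult; [|apply CE].
  apply rcont_minus; [apply rcont_plus|].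
  - apply CK; lra.
  - apply (rcont_comp_real (fun u => K (RtoC u)) (fun u => - u)); [apply CK; lra|].
    smooth.
  - apply rcont_mult; [apply cont_const|].
    generalize N. intros N'. induction N' as [|N' IH]; [apply cont_const|].
    apply (@cont_ext R_UniformSpace (fun u => Csum (fun n => a (2 * n)%nat * RtoC u ^ (2 * n)) N' +
      a (2 * N')%nat * RtoC u ^ (2 * N'))%C).
    + intros t. symmetry. apply (Csum_S (fun n => a (2 * n)%nat * RtoC t ^ (2 * n))%C).
    + apply rcont_plus; [exact IH|]. apply rcont_mult; [apply cont_const|].
      apply rcont_pow. apply rcont_RtoC. }
assert (Cs : forall n, contI (fun u => a (2 * n)%nat * 2 * (RtoC (u ^ (2 * n)) * E u))%C 0 d).
{ intros n u _. apply rcont_mult; [apply cont_const|apply Cm]. }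
assert (Split : CInt (fun u => K (RtoC u) * E u + K (RtoC (- u)) * E (- u)%R)%C 0 d =
  (Csum (fun n => a (2 * n)%nat * 2 * CInt (fun u => RtoC (u ^ (2 * n)) * E u) 0 d) N + CInt (fun u
    => R0 u * E u) 0 d)%C).
{ rewrite (Csum_ext _ (fun n => CInt (fun u => a (2 * n)%nat * 2 * (RtoC (u ^ (2 * n)) * E u))%C 0
  d)).
  2:{ intros n _. symmetry. apply CInt_scal. apply contI_forall, Cm. }
  rewrite <- CInt_Csum by auto. rewrite <- CInt_plus; auto.
  - apply CInt_ext. intros u _. unfold R0.
    replace (E (- u)) with (E u) by (unfold E; do 4 f_equal; ring).
    rewrite (Csum_ext _ (fun n => (2 * E u) * (a (2 * n)%nat * RtoC u ^ (2 * n)))%C).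
    2:{ intros n _. rewrite RtoC_pow. ring. }
    rewrite <- Csum_scal. ring.
  - assert (CS : forall M' t, rcont (fun u => Csum (fun n => a (2 * n)%nat * 2 * (RtoC (u ^ (2 *
    n)) * E u))%C M') t).
    { intros M' t. induction M' as [|M' IH]; [apply cont_const|].
      apply (@cont_ext R_UniformSpace (fun u => Csum (fun n => a (2 * n)%nat * 2 * (RtoC (u ^ (2 *
        n)) * E u)) M' + a (2 * M')%nat * 2 * (RtoC (u ^ (2 * M')) * E u))%C).
      + intros v. symmetry. apply (Csum_S (fun n => a (2 * n)%nat * 2 * (RtoC (v ^ (2 * n)) * E
        v))%C).
      + apply rcont_plus; [exact IH|]. apply rcont_mult; [apply cont_const|apply Cm]. }
    intros t _. apply CS. }
rewrite Split.
assert (Hmun : forall n, ((/ mu) ^ n = s * (/ s) ^ S (2 * n))%C).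
{ intros n. rewrite Cpow_S, Cpow_mult_r. replace ((/ s) ^ 2)%C with (/ mu)%C; [field; auto|].
  rewrite <- Hss. simpl. field. auto. }
match goal with |- Cmod ?X <= _ => replace X with
  (s * Csum (fun n => a (2 * n)%nat * (2 * CInt (fun u => RtoC (u ^ (2 * n)) * E u) 0 d - RtoC
    (Gamma (INR n + 1 / 2)) * (/ s) ^ S (2 * n))) N
   + s * CInt (fun u => R0 u * E u) 0 d)%C end.
2:{ rewrite (Csum_ext (fun n => RtoC (Gamma (INR n + 1 / 2)) * a (2 * n)%nat * (/ mu) ^ n)%C
      (fun n => s * (a (2 * n)%nat * (RtoC (Gamma (INR n + 1 / 2)) * (/ s) ^ S (2 * n))))%C).
    2:{ intros n _. rewrite Hmun. ring. }
    rewrite <- Csum_scal.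
    rewrite (Csum_ext (fun n => a (2 * n)%nat * (2 * CInt (fun u => RtoC (u ^ (2 * n)) * E u) 0 d -
      RtoC (Gamma (INR n + 1 / 2)) * (/ s) ^ S (2 * n)))%C
      (fun n => a (2 * n)%nat * 2 * CInt (fun u => RtoC (u ^ (2 * n)) * E u) 0 d - a (2 * n)%nat *
        (RtoC (Gamma (INR n + 1 / 2)) * (/ s) ^ S (2 * n)))%C).
    2:{ intros n _. ring. }
    rewrite <- Csum_minus. ring. }
eapply Rle_trans; [apply Cmod_triangle|]. rewrite !Cmod_mult, Hms.
rewrite Rmult_plus_distr_r. apply Rplus_le_compat.
- assert (B : Cmod (Csum (fun n => a (2 * n)%nat * (2 * CInt (fun u => RtoC (u ^ (2 * n)) * E u) 0
  d - RtoC (Gamma (INR n + 1 / 2)) * (/ s) ^ S (2 * n)))%C N) <= INR N * (Cn * exp (- (d * sqrt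
  lam)))).
  { apply Csum_le. intros n Hn. apply (HCn n lam eta); auto. }
  assert (HPl := HP (sqrt lam) ltac:(lra)).
  apply Rle_trans with (sqrt lam * (INR N * (Cn * exp (- (d * sqrt lam)))));
    [apply Rmult_le_compat_l; lra|].
  assert (Hl : (/ lam) ^ N = / (sqrt lam ^ (2 * N))).
  { rewrite pow_inv, pow_mult. simpl (_ ^ 2). rewrite Rmult_1_r, sqrt_sqrt by lra. reflexivity. }
  rewrite Hl. assert (Hpp : 0 < sqrt lam ^ (2 * N)) by (apply pow_lt; lra).
  apply Rmult_le_reg_r with (sqrt lam ^ (2 * N)); auto.
  rewrite Rmult_assoc with (r2 := / sqrt lam ^ (2 * N)), Rinv_l by lra.
  rewrite pow_add, pow_1 in HPl.
  replace (sqrt lam * (INR N * (Cn * exp (- (d * sqrt lam)))) * sqrt lam ^ (2 * N)) with (INR N *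
    Cn * (sqrt lam ^ (2 * N) * sqrt lam * exp (- (d * sqrt lam)))) by ring.
  rewrite Rmult_1_r. apply Rmult_le_compat_l; auto. apply Rmult_le_pos; auto. apply pos_INR.
- assert (Exr : ex_RInt (fun u => u ^ (2 * N) * exp (- (c0 * lam * (u * u)))) 0 d).
  { apply (ex_RInt_continuous (V := R_CompleteNormedModule)). intros u _. smooth. }
  assert (B : Cmod (CInt (fun u => R0 u * E u)%C 0 d) <= RInt (fun u => scal (2 * M1) (u ^ (2 * N)
    * exp (- (c0 * lam * (u * u))))) 0 d).
  { apply CInt_le; auto; [lra| |].
    - intros u Hu. rewrite Cmod_mult. unfold scal; simpl; unfold mult; simpl.
      rewrite <- Rmult_assoc. apply Rmult_le_compat; try apply Cmod_ge_0; [apply BR0;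
        auto|apply ME].
    - apply (ex_RInt_scal (V := R_NormedModule)). exact Exr. }
  rewrite (RInt_scal (V := R_CompleteNormedModule)) in B by exact Exr.
  unfold scal in B; simpl in B; unfold mult in B; simpl in B.
  specialize (HR lam Hlam).
  apply Rle_trans with (2 * M1 * (C4 * (/ lam) ^ N)); [|lra].
  apply Rle_trans with (2 * M1 * (sqrt lam * RInt (fun u => u ^ (2 * N) * exp (- (c0 * lam * (u *
    u)))) 0 d)).
  + eapply Rle_trans; [apply Rmult_le_compat_l; [lra|exact B]|]. right. simpl. ring.
  + apply Rmult_le_compat_l; lra.
Qed.

(** * The principal logarithm in the right half-plane *)

Lemma C_eta (z : C) : z = (Re z, Im z).
Proof. destruct z; reflexivity. Qed.

Lemma Cexp_cart v : Cexp v = (exp (Re v) * cos (Im v), exp (Re v) * sin (Im v)).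
Proof. unfold Cexp, Cmult, RtoC; simpl. f_equal; ring. Qed.

Lemma Clog_Cexp v : - PI < Im v <= PI -> Clog (Cexp v) = v.
Proof.
intros Hv. unfold Clog. rewrite Cmod_Cexp, ln_exp. rewrite (C_eta v) at 3. f_equal.
unfold Carg. rewrite Cmod_Cexp. rewrite Cexp_cart. simpl Re; simpl Im.
assert (He := exp_pos (Re v)).
replace (exp (Re v) * cos (Im v) / exp (Re v)) with (cos (Im v)) by (field; lra).
change (Re v) with (fst v) in *. change (Im v) with (snd v) in *.
destruct (Rle_dec 0 (exp (fst v) * sin (snd v))) as [H|H].
- destruct (Rle_dec 0 (snd v)) as [P|P]; [apply acos_cos; lra|].
  exfalso. assert (sin (snd v) < 0) by (apply sin_lt_0_var; lra). nra.
- destruct (Rle_dec 0 (snd v)) as [P|P].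
  + exfalso. apply H. apply Rmult_le_pos; [lra|apply sin_ge_0; lra].
  + rewrite <- cos_neg, acos_cos by lra. ring.
Qed.

Lemma Cmod_xy x y : 0 < x -> Cmod (x, y) = x * sqrt (1 + (y / x) ^ 2).
Proof.
intros Hx. unfold Cmod; simpl fst; simpl snd.
replace (x ^ 2 + y ^ 2) with ((x * x) * (1 + (y / x) ^ 2)) by (field; lra).
rewrite sqrt_mult_alt by nra. rewrite sqrt_square by lra. reflexivity.
Qed.

(** The arctangent formula for the argument, which is smooth in z, in place of the
    arccosine. *)
Lemma right_half_plane_exp z : 0 < Re z -> exists v, z = Cexp v /\ - (PI / 2) < Im v < PI / 2 /\ v
  = (ln (Cmod z), atan (Im z / Re z)).
Proof.
destruct z as [x y]. simpl Re; simpl Im. intros Hx.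
exists (ln (Cmod (x, y)), atan (y / x)). split; [|split; [simpl; generalize (atan_bound (y / x));
  lra|reflexivity]].
assert (Hs : 0 < sqrt (1 + (y / x) ^ 2)) by (apply sqrt_lt_R0; generalize (pow2_ge_0 (y / x)); lra).
rewrite Cexp_cart. simpl Re; simpl Im.
rewrite exp_ln by (rewrite Cmod_xy by auto; nra).
rewrite cos_atan, sin_atan, Cmod_xy by auto.
replace (Rsqr (y / x)) with ((y / x) ^ 2) by (unfold Rsqr; ring).
f_equal; field; try split; lra.
Qed.

Lemma Clog_right z : 0 < Re z -> Clog z = (ln (Cmod z), atan (Im z / Re z)).
Proof.
intros Hz. destruct (right_half_plane_exp z Hz) as [v [E [Hv Ev]]].
rewrite <- Ev. rewrite E. apply Clog_Cexp. generalize PI_RGT_0; lra.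
Qed.

Lemma Cexp_Clog z : 0 < Re z -> Cexp (Clog z) = z.
Proof.
intros Hz. destruct (right_half_plane_exp z Hz) as [v [E [Hv Ev]]].
rewrite Clog_right by auto. rewrite <- Ev. auto.
Qed.

Lemma Clog_cont z : 0 < Re z -> @cont CT Clog z.
Proof.
intros Hz.
apply (@cont_ext_loc CT (fun z => (ln (Cmod z), atan (Im z / Re z)))).
- assert (Hd : 0 < Re z) by auto. exists (mkposreal _ Hd). intros w Hw.
  assert (Hw' : Cmod (w - z)%C < Re z) by exact Hw.
  symmetry. apply Clog_right.
  assert (K := re_le_Cmod (w - z)%C). change (Re (w - z)%C) with (Re w - Re z) in K.
  generalize (Rle_abs (- (Re w - Re z))). rewrite Rabs_Ropp. lra.
- assert (Cre : @continuous CT R_UniformSpace (fun w : C => Re w) z) by apply (@cont_re CT (fun w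
  => w)), cont_id.
  assert (Cim : @continuous CT R_UniformSpace (fun w : C => Im w) z) by apply (@cont_im CT (fun w
    => w)), cont_id.
  assert (Hm : 0 < Cmod z) by (eapply Rlt_le_trans; [exact Hz|eapply Rle_trans;
    [apply Rle_abs|apply re_le_Cmod]]).
  apply (@cont_pair CT).
  + apply (@continuous_comp CT R_UniformSpace R_UniformSpace Cmod ln).
    * exact (@filterlim_norm C_AbsRing (AbsRing_NormedModule C_AbsRing) z).
    * smooth.
  + apply (@continuous_comp CT R_UniformSpace R_UniformSpace (fun w : C => Im w / Re w) atan).
    * apply (@continuous_mult CT R_AbsRing); [exact Cim|].
      apply (@continuous_comp CT R_UniformSpace R_UniformSpace (fun w : C => Re w) Rinv);
        [exact Cre|].
      smooth.
    * apply continuity_pt_filterlim, derivable_continuous_pt, derivable_pt_atan.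
Qed.

(** The Caratheodory quotient of f is nonzero and continuous at g z0, so its reciprocal
    is a quotient for g. *)
Lemma cder_inverse f g z0 l d : 0 < d -> cder f (g z0) l -> l <> RtoC 0 -> @cont CT g z0 ->
  (forall z, Cmod (z - z0)%C < d -> f (g z) = z) -> cder g z0 (/ l)%C.
Proof.
intros Hd [p [Hc [Hp H]]] Hl Hg Hfg.
assert (CQ : @cont CT (fun z => p (g z)) z0) by (apply (@cont_comp CT p g); auto).
assert (CP : @cont CT (fun z => / p (g z))%C z0).
{ apply (@cont_inv CT); [rewrite Hp; auto|exact CQ]. }
apply cder_eps. intros eps He.
destruct (proj1 (ccont_eps _ _) CP eps He) as [d1 [Hd1 H1]].
destruct (proj1 (ccont_eps _ _) CQ (Cmod l)) as [d2 [Hd2 H2]]; [apply Cmod_gt_0; auto|].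
exists (Rmin d (Rmin d1 d2)). split; [repeat apply Rmin_glb_lt; auto|].
intros z Hz.
assert (Z0 := Rlt_le_trans _ _ _ Hz (Rmin_l _ _)).
assert (Z1 := Rlt_le_trans _ _ _ (Rlt_le_trans _ _ _ Hz (Rmin_r _ _)) (Rmin_l _ _)).
assert (Z2 := Rlt_le_trans _ _ _ (Rlt_le_trans _ _ _ Hz (Rmin_r _ _)) (Rmin_r _ _)).
specialize (H1 z Z1). specialize (H2 z Z2). rewrite Hp in H2.
assert (Hne : p (g z) <> RtoC 0).
{ intros E. rewrite E in H2. replace (0 - l)%C with (- l)%C in H2 by ring. rewrite Cmod_opp in H2.
  lra. }
assert (E := H (g z)). rewrite !Hfg in E by (auto; rewrite Cmod_sub_self; auto).
replace (g z - g z0 - / l * (z - z0))%C with ((/ p (g z) - / p (g z0)) * (z - z0))%C.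
2:{ rewrite Hp, E. field. auto. }
rewrite Cmod_mult. apply Rmult_le_compat_r; [apply Cmod_ge_0|]. lra.
Qed.

Lemma Re_near z w : Cmod (w - z)%C < Re z -> 0 < Re w.
Proof.
intros Hw. assert (K := re_le_Cmod (w - z)%C). change (Re (w - z)%C) with (Re w - Re z) in K.
generalize (Rle_abs (- (Re w - Re z))). rewrite Rabs_Ropp. lra.
Qed.

Lemma cder_Clog z : 0 < Re z -> cder Clog z (/ z)%C.
Proof.
intros Hz. apply (cder_inverse Cexp Clog z z (Re z)); auto.
- eapply cder_eq; [apply cder_Cexp|]. apply Cexp_Clog; auto.
- intros ->. simpl in Hz. lra.
- apply Clog_cont; auto.
- intros w Hw. apply Cexp_Clog. apply (Re_near z); auto.
Qed.

Lemma cder_Cpower z a : 0 < Re z -> cder (fun z => Cpower z a) z (a * Cpower z a / z)%C.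
Proof.
intros Hz. unfold Cpower. eapply cder_eq.
- apply (cder_comp Cexp (fun z => a * Clog z)%C); [apply cder_Cexp|apply cder_scal, cder_Clog;
  auto].
- unfold Cdiv. ring.
Qed.

(** No branch cut is crossed since the arguments add up to less than PI in modulus. *)
Lemma Cpower_rotate t w a : Rabs t < PI / 2 -> 0 < Re w -> Cpower (cis t * w)%C a = (Cexp (a * (Ci
  * RtoC t)) * Cpower w a)%C.
Proof.
intros Ht Hw. unfold Cpower, cis.
rewrite <- (Cexp_Clog w Hw) at 1. rewrite <- Cexp_plus.
assert (HP := PI_RGT_0). apply Rabs_def2 in Ht.
rewrite Clog_Cexp.
- rewrite <- Cexp_plus. f_equal. ring.
- rewrite Clog_right by auto. simpl. generalize (atan_bound (Im w / Re w)). simpl. lra.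
Qed.

Lemma locally_disc (z : C) (P : C -> Prop) : @locally C_UniformSpace z P ->
  exists d, 0 < d /\ forall w, Cmod (w - z)%C < d -> P w.
Proof.
intros [d Hd]. exists d. split; [apply cond_pos|]. intros w Hw. apply Hd, ballC_CT, Hw.
Qed.

(** * The real branch of the square root *)

(** The function rho - rho^alpha on the positive half-line in the variable y = log rho;
    its maximum is at [log_crit]. *)
Definition profile (alpha y : R) : R := exp y - exp (alpha * y).
Definition log_crit (alpha : R) : R := - (1 / (alpha - 1)) * ln alpha.

Lemma profile_derive alpha y : derivable_pt_lim (profile alpha) y (exp y * (1 - alpha * exp ((alpha
  - 1) * y))).
Proof.
apply is_derive_Reals. unfold profile. auto_derive; [auto|].
replace (alpha * y) with (y + (alpha - 1) * y) by ring. rewrite exp_plus. ring.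
Qed.

Lemma log_crit_spec alpha : 1 < alpha -> alpha * exp ((alpha - 1) * log_crit alpha) = 1.
Proof.
intros Ha. unfold log_crit. replace ((alpha - 1) * (- (1 / (alpha - 1)) * ln alpha)) with (- ln
  alpha) by (field; lra).
rewrite exp_Ropp, exp_ln by lra. field. lra.
Qed.

Lemma profile_increasing alpha y1 y2 : 1 < alpha -> y1 <= y2 <= log_crit alpha ->
  profile alpha y1 <= profile alpha y2.
Proof.
intros Ha [[H12| ->] H2]; [|lra].
destruct (MVT_cor2 (profile alpha) (fun y => exp y * (1 - alpha * exp ((alpha - 1) * y))) y1 y2
  H12) as [c [Hc Hc']].
{ intros c _. apply profile_derive. }
assert (0 <= exp c * (1 - alpha * exp ((alpha - 1) * c))); [|nra].
apply Rmult_le_pos; [left; apply exp_pos|]. assert (K := log_crit_spec alpha Ha).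
assert (exp ((alpha - 1) * c) <= exp ((alpha - 1) * log_crit alpha)) by (apply exp_le,
  Rmult_le_compat_l; lra). nra.
Qed.

Lemma profile_decreasing alpha y1 y2 : 1 < alpha -> log_crit alpha <= y1 <= y2 ->
  profile alpha y2 <= profile alpha y1.
Proof.
intros Ha [H2 [H12| ->]]; [|lra].
destruct (MVT_cor2 (profile alpha) (fun y => exp y * (1 - alpha * exp ((alpha - 1) * y))) y1 y2
  H12) as [c [Hc Hc']].
{ intros c _. apply profile_derive. }
assert (exp c * (1 - alpha * exp ((alpha - 1) * c)) <= 0); [|nra].
assert (exp ((alpha - 1) * log_crit alpha) <= exp ((alpha - 1) * c)) by (apply exp_le,
  Rmult_le_compat_l; lra).
assert (K := log_crit_spec alpha Ha). assert (0 < exp c) by apply exp_pos.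
assert (1 - alpha * exp ((alpha - 1) * c) <= 0) by nra. nra.
Qed.

Lemma profile_max alpha y : 1 < alpha -> profile alpha y <= profile alpha (log_crit alpha).
Proof.
intros Ha. destruct (Rle_dec y (log_crit alpha)); [apply profile_increasing;
  lra|apply profile_decreasing; lra].
Qed.

(** The function h for phi = 0; every other h is a rotation of it. *)
Definition h0 (alpha : R) (z : C) : C := (z - Cpower z (RtoC alpha))%C.

Lemma h0_exp alpha y : h0 alpha (RtoC (exp y)) = RtoC (profile alpha y).
Proof.
unfold h0, profile. rewrite Cpower_pos by apply exp_pos. rewrite ln_exp, <- RtoC_mult, Cexp_R,
  <- RtoC_minus. reflexivity.
Qed.

Lemma cder_h0 alpha z : 0 < Re z -> cder (h0 alpha) z (1 - RtoC alpha * Cpower z (RtoC alpha) /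
  z)%C.
Proof. intros Hz. apply cder_minus; [apply cder_id|apply cder_Cpower; auto]. Qed.

(** On the disc of radius d about rho0 = exp (log_crit alpha), q is the square root of
    h0 rho0 - h0 that increases along the real axis, and p is its inverse. *)
Record real_branch (alpha : R) (q p : C -> C) (d : R) : Prop := {
  rb_d : 0 < d < exp (log_crit alpha);
  rb_hol : forall z, Cmod (z - RtoC (exp (log_crit alpha)))%C < d -> exists l, cder q z l;
  rb_sq : forall z, Cmod (z - RtoC (exp (log_crit alpha)))%C < d ->
    (q z * q z = h0 alpha (RtoC (exp (log_crit alpha))) - h0 alpha z)%C;
  rb_incr : forall r1 r2, exp (log_crit alpha) - d < r1 -> r1 < r2 ->
    r2 < exp (log_crit alpha) + d ->
    Re (q (RtoC r1)) < Re (q (RtoC r2));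
  rb_phol : forall w, Cmod w < d -> exists l, cder p w l;
  rb_pq : forall z, Cmod (z - RtoC (exp (log_crit alpha)))%C < d -> p (q z) = z;
  rb_qp : forall w, Cmod w < d -> q (p w) = w }.

Section RealBranch.
Variables (alpha : R) (beta : C) (q p : C -> C) (d : R).
Hypothesis Halpha : 1 < alpha.
Hypothesis HB : real_branch alpha q p d.
Let y0 := log_crit alpha.
Let rho0 := exp y0.

Lemma rho0_pos : 0 < rho0. Proof. apply exp_pos. Qed.

Lemma center_in : Cmod (RtoC rho0 - RtoC rho0)%C < d.
Proof. rewrite Cmod_sub_self. apply (rb_d _ _ _ _ HB). Qed.

Lemma near_right z : Cmod (z - RtoC rho0)%C < d -> 0 < Re z.
Proof. intros H. apply (Re_near (RtoC rho0)). simpl. assert (K := rb_d _ _ _ _ HB).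
  unfold rho0, y0 in *. lra. Qed.

Lemma q_center : q (RtoC rho0) = RtoC 0.
Proof.
assert (K := rb_sq _ _ _ _ HB _ center_in). unfold rho0, y0 in *.
destruct (Ceq_dec (q (RtoC (exp (log_crit alpha)))) (RtoC 0)) as [E|E]; auto.
exfalso. apply (Cmult_neq_0 _ _ E E). rewrite K. ring.
Qed.

Lemma p_center : p (RtoC 0) = RtoC rho0.
Proof. rewrite <- q_center. apply (rb_pq _ _ _ _ HB). apply center_in. Qed.

Lemma q_hol_square : hol_on (square (RtoC rho0) (d / 2)) q.
Proof.
intros z [H1 H2]. apply (rb_hol _ _ _ _ HB). eapply Rle_lt_trans; [apply Cmod_le_sum|].
change (Re (z - RtoC (exp (log_crit alpha)))%C) with (Re z - Re (RtoC rho0)).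
  change (Im (z - RtoC (exp (log_crit alpha)))%C) with (Im z - Im (RtoC rho0)).
assert (K := rb_d _ _ _ _ HB). lra.
Qed.

Lemma q_deriv z : Cmod (z - RtoC rho0)%C < d / 4 ->
  cder q z (C_derive q z) /\ exists m, cder (C_derive q) z m.
Proof.
intros Hz. assert (K := rb_d _ _ _ _ HB).
assert (Hr : 0 < d / 4 < d / 2) by lra.
destruct (derive_n_cauchy_int q (RtoC rho0) (d / 2) (d / 4) q_hol_square Hr 0 z Hz) as [_ D0].
destruct (derive_n_cauchy_int q (RtoC rho0) (d / 2) (d / 4) q_hol_square Hr 1 z Hz) as [_ D1].
split; [exact D0|]. eexists; exact D1.
Qed.

Lemma q_small : exists e, 0 < e < d / 4 /\ forall z, Cmod (z - RtoC rho0)%C < e -> Cmod (q z) < d.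
Proof.
assert (K := rb_d _ _ _ _ HB).
destruct (rb_hol _ _ _ _ HB _ center_in) as [l Hl]. apply cder_cont in Hl.
destruct (proj1 (ccont_eps _ _) Hl d (proj1 K)) as [e [He H]].
exists (Rmin e (d / 8)). split.
- split; [apply Rmin_glb_lt; lra|]. eapply Rle_lt_trans; [apply Rmin_r|lra].
- intros z Hz. assert (Hz1 := Rlt_le_trans _ _ _ Hz (Rmin_l _ _)).
  specialize (H z Hz1). fold y0 rho0 in H. rewrite q_center in H.
    replace (q z - 0)%C with (q z) in H by ring. exact H.
Qed.

(** By the chain rule for p (q z) = z. *)
Lemma q_deriv_neq0 : exists e, 0 < e < d / 4 /\ (forall z, Cmod (z - RtoC rho0)%C < e ->
  Cmod (q z) < d) /\
  forall z, Cmod (z - RtoC rho0)%C < e -> C_derive q z <> RtoC 0.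
Proof.
destruct q_small as [e [He H]]. exists e. split; auto. split; auto.
intros z Hz E. destruct (q_deriv z) as [D _]; [lra|]. rewrite E in D.
destruct (rb_phol _ _ _ _ HB (q z) (H z Hz)) as [l Hl].
assert (D2 := cder_comp p q z l 0 Hl D).
assert (K := rb_d _ _ _ _ HB).
assert (D3 : cder (fun w => p (q w)) z 1).
{ apply (cder_ext_loc (fun w => w) _ _ _ (d - Cmod (z - RtoC rho0)%C)); [lra| |apply cder_id].
  intros w Hw. symmetry. apply (rb_pq _ _ _ _ HB).
  replace (w - RtoC (exp (log_crit alpha)))%C with ((w - z) + (z - RtoC rho0))%C by (unfold rho0,
    y0; ring).
  eapply Rle_lt_trans; [apply Cmod_triangle|]. lra. }
assert (X := cder_unique _ _ _ _ D2 D3). rewrite Cmult_0_r in X. apply C1_nz. symmetry; exact X.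
Qed.

Lemma rho0_pow : Cpower (RtoC rho0) (RtoC alpha) = RtoC (rho0 / alpha).
Proof.
rewrite Cpower_pos by apply rho0_pos. unfold rho0. rewrite ln_exp, <- RtoC_mult, Cexp_R. f_equal.
replace (alpha * y0) with (y0 + (alpha - 1) * y0) by ring. rewrite exp_plus.
assert (K := log_crit_spec alpha Halpha). fold y0 in K.
replace (exp ((alpha - 1) * y0)) with (/ alpha); [reflexivity|].
apply Rmult_eq_reg_l with alpha; [|lra]. rewrite K. field. lra.
Qed.

(** Differentiating q^2 = h0 rho0 - h0 twice at the critical point gives 2 q'^2 = -
    h0''. *)
Lemma q_slope_sq : (C_derive q (RtoC rho0) * C_derive q (RtoC rho0) = RtoC ((alpha - 1) / (2 *
  rho0)))%C.
Proof.
assert (K := rb_d _ _ _ _ HB). assert (Hp := rho0_pos).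
assert (Hc4 : Cmod (RtoC rho0 - RtoC rho0)%C < d / 4) by (rewrite Cmod_sub_self; lra).
assert (E : forall z, Cmod (z - RtoC rho0)%C < d / 4 -> (2 * (q z * C_derive q z) = RtoC alpha *
  (Cpower z (RtoC alpha) * / z) - 1)%C).
{ intros z Hz. destruct (q_deriv z Hz) as [D _]. assert (Hz0 : 0 < Re z) by (apply near_right; lra).
  assert (D1 := cder_mult q q z _ _ D D).
  assert (D2 : cder (fun w => q w * q w)%C z (0 - (1 - RtoC alpha * Cpower z (RtoC alpha) / z))%C).
  { apply (cder_ext_loc (fun w => h0 alpha (RtoC rho0) - h0 alpha w)%C _ _ _ (d - Cmod (z - RtoC
    rho0)%C)); [lra| |].
    - intros w Hw. symmetry. apply (rb_sq _ _ _ _ HB).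
      replace (w - RtoC (exp (log_crit alpha)))%C with ((w - z) + (z - RtoC rho0))%C by (unfold
        rho0, y0; ring).
      eapply Rle_lt_trans; [apply Cmod_triangle|]. lra.
    - apply cder_minus; [apply cder_const|apply cder_h0; auto]. }
  assert (X := cder_unique _ _ _ _ D1 D2).
  replace (2 * (q z * C_derive q z))%C with (C_derive q z * q z + q z * C_derive q z)%C by ring.
    rewrite X. unfold Cdiv. ring. }
destruct (q_deriv _ Hc4) as [D0 [m D1]].
assert (L := cder_scal 2 _ _ _ (cder_mult q (C_derive q) _ _ _ D0 D1)).
assert (Hr0 : RtoC rho0 <> RtoC 0) by (apply RtoC_neq0; lra).
assert (R1 : cder (fun z => 2 * (q z * C_derive q z))%C (RtoC rho0)
   (RtoC alpha * ((RtoC alpha * Cpower (RtoC rho0) (RtoC alpha) / RtoC rho0) * / RtoC rho0 + Cpower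
     (RtoC rho0) (RtoC alpha) * (- / (RtoC rho0 * RtoC rho0))) - 0)%C).
{ apply (cder_ext_loc (fun z => RtoC alpha * (Cpower z (RtoC alpha) * / z) - 1)%C _ _ _ (d / 4));
  [lra| |].
  - intros w Hw. symmetry. apply E; auto.
  - apply cder_minus; [|apply cder_const]. apply cder_scal.
    apply (cder_mult (fun z => Cpower z (RtoC alpha)) Cinv); [apply (cder_Cpower (RtoC rho0) (RtoC
      alpha)); simpl; auto|apply cder_inv; auto]. }
assert (X := cder_unique _ _ _ _ L R1). cbv beta in X.
rewrite q_center, rho0_pow in X.
assert (Ha0 : RtoC alpha <> RtoC 0) by (apply RtoC_neq0; lra).
replace (C_derive q (RtoC rho0) * C_derive q (RtoC rho0))%C with (/ 2 * (2 * (C_derive q (RtoC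
  rho0) * C_derive q (RtoC rho0) + 0 * m)))%C by (field).
rewrite X. rewrite !RtoC_div by (try lra). rewrite RtoC_mult, RtoC_minus. field. repeat split; auto.
Qed.

(** The square root is the nonnegative one because q increases along the real axis. *)
Lemma q_slope : C_derive q (RtoC rho0) = RtoC (sqrt ((alpha - 1) / (2 * rho0))).
Proof.
assert (Hp := rho0_pos). assert (K := rb_d _ _ _ _ HB).
set (s := (alpha - 1) / (2 * rho0)). assert (Hs : 0 < s) by (apply Rdiv_lt_0_compat; lra).
assert (E := q_slope_sq). fold s in E.
assert (Hc4 : Cmod (RtoC rho0 - RtoC rho0)%C < d / 4) by (rewrite Cmod_sub_self; lra).
destruct (q_deriv _ Hc4) as [D _].
set (l := C_derive q (RtoC rho0)) in *.
assert (Hre : 0 <= Re l).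
{ apply Rnot_lt_le. intros Hn.
  destruct (proj1 (cder_eps _ _ _) D (- Re l / 2)) as [e [He H]]; [lra|].
  set (t := Rmin (e / 2) (d / 2)). assert (Ht : 0 < t) by (apply Rmin_glb_lt; lra).
  assert (Ht1 : t <= e / 2) by apply Rmin_l. assert (Ht2 : t <= d / 2) by apply Rmin_r.
  assert (I := rb_incr _ _ _ _ HB rho0 (rho0 + t) ltac:(unfold rho0, y0 in *;
    lra) ltac:(lra) ltac:(unfold rho0, y0 in *; lra)).
  assert (Ed : (RtoC (rho0 + t) - RtoC rho0)%C = RtoC t) by (rewrite RtoC_plus; ring).
  specialize (H (RtoC (rho0 + t))). rewrite Ed, Cmod_R, Rabs_pos_eq in H by lra.
    specialize (H ltac:(lra)).
  rewrite q_center in I, H. simpl (Re (RtoC 0)) in I.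
  assert (A := re_le_Cmod (q (RtoC (rho0 + t)) - RtoC 0 - l * RtoC t)%C).
  replace (Re (q (RtoC (rho0 + t)) - RtoC 0 - l * RtoC t)%C) with (Re (q (RtoC (rho0 + t))) - Re l
    * t) in A.
  - generalize (Rle_abs (Re (q (RtoC (rho0 + t))) - Re l * t)). nra.
  - unfold Cminus. rewrite !re_plus, !re_opp, re_scal_r. simpl. ring. }
destruct l as [x y]. simpl in Hre.
assert (E1 : x * x - y * y = s) by (apply (f_equal fst) in E; simpl in E; exact E).
assert (E2 : x * y + y * x = 0) by (apply (f_equal snd) in E; simpl in E; exact E).
assert (Hy : y = 0).
{ destruct (Req_dec x 0) as [->|Hx]; [nra|]. apply Rmult_eq_reg_l with x; auto. lra. }
subst y. unfold RtoC. f_equal. symmetry. apply sqrt_lem_1; nra.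
Qed.

(** The square of q is nonnegative there, rho0 being a maximum. *)
Lemma q_real y : Cmod (RtoC (exp y) - RtoC rho0)%C < d -> q (RtoC (exp y)) = RtoC (Re (q (RtoC (exp
  y)))) /\
  Re (q (RtoC (exp y))) * Re (q (RtoC (exp y))) = profile alpha y0 - profile alpha y.
Proof.
intros Hy. assert (E := rb_sq _ _ _ _ HB _ Hy). fold y0 in E.
rewrite !h0_exp, <- RtoC_minus in E.
assert (Hg := profile_max alpha y Halpha). fold y0 in Hg.
destruct (q (RtoC (exp y))) as [a b]. simpl.
assert (E1 : a * a - b * b = profile alpha y0 - profile alpha y) by (apply (f_equal fst) in E;
  simpl in E; exact E).
assert (E2 : a * b + b * a = 0) by (apply (f_equal snd) in E; simpl in E; exact E).
assert (Hb : b = 0).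
{ destruct (Req_dec a 0) as [->|Ha]; [nra|]. apply Rmult_eq_reg_l with a; auto. lra. }
subst b. split; [reflexivity|lra].
Qed.

(** The density s^beta ds in the variable w = q s, that is s = p w and ds = dw / q'(p
    w). *)
Definition amplitude (w : C) : C := (Cpower (p w) beta / C_derive q (p w))%C.

Lemma amplitude_hol : exists r, 0 < r /\ hol_on (square (RtoC 0) r) amplitude.
Proof.
destruct q_deriv_neq0 as [e [He [He1 He2]]]. assert (K := rb_d _ _ _ _ HB).
assert (H0 : Cmod (RtoC 0) < d) by (rewrite Cmod_0; lra).
destruct (rb_phol _ _ _ _ HB _ H0) as [l0 Hl0]. apply cder_cont in Hl0.
destruct (proj1 (ccont_eps _ _) Hl0 e (proj1 He)) as [d1 [Hd1 H1]].
exists (Rmin (d / 2) (d1 / 2)). split; [apply Rmin_glb_lt; lra|].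
intros w [Hw1 Hw2].
assert (Hw : Cmod w < d /\ Cmod w < d1).
{ simpl in Hw1, Hw2. rewrite Rminus_0_r in Hw1, Hw2.
  generalize (Cmod_le_sum w) (Rmin_l (d / 2) (d1 / 2)) (Rmin_r (d / 2) (d1 / 2)). lra. }
assert (Hpw : Cmod (p w - RtoC rho0)%C < e).
{ rewrite <- p_center. apply H1. replace (w - 0)%C with w by ring. apply Hw. }
destruct (rb_phol _ _ _ _ HB w (proj1 Hw)) as [l Hl].
destruct (q_deriv (p w)) as [_ [m Hm]]; [lra|].
eexists. unfold amplitude, Cdiv. apply cder_mult.
- apply (cder_comp (fun z => Cpower z beta) p); [apply cder_Cpower, near_right; lra|exact Hl].
- apply (cder_comp Cinv (fun w => C_derive q (p w))); [apply cder_inv; apply He2; auto|].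
  apply (cder_comp (C_derive q) p); [exact Hm|exact Hl].
Qed.

Lemma amplitude_0 : amplitude (RtoC 0) = (Cexp (beta * RtoC y0) / RtoC (sqrt ((alpha - 1) / (2 *
  rho0))))%C.
Proof.
unfold amplitude. rewrite p_center, q_slope, Cpower_pos by apply rho0_pos. unfold rho0 at 1.
  rewrite ln_exp. reflexivity.
Qed.

(** The change of variables u = q (exp y). By the intermediate value theorem the
    interval [y1,y2] can be chosen so that its image is symmetric about 0 and as small
    as required. *)
Lemma real_substitution r0 : 0 < r0 -> exists (delta y1 y2 : R) (u du : R -> R),
  0 < delta < r0 /\ y1 < y0 < y2 /\ u y1 = - delta /\ u y2 = delta /\
  forall y, y1 <= y <= y2 -> is_derive u y (du y) /\ continuous du y /\ - delta <= u y <= delta /\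
    u y * u y = profile alpha y0 - profile alpha y /\
    (amplitude (RtoC (u y)) * RtoC (du y) = Cexp ((beta + 1) * RtoC y))%C.
Proof.
intros Hr0.
destruct q_deriv_neq0 as [e [He [He1 He2]]]. assert (K := rb_d _ _ _ _ HB). assert (Hp := rho0_pos).
set (u := fun y => Re (q (RtoC (exp y)))).
set (du := fun y => Re (C_derive q (RtoC (exp y)) * RtoC (exp y))%C).
assert (Hex : exists t, 0 < t /\ forall y, Rabs (y - y0) <= t ->
  Cmod (RtoC (exp y) - RtoC rho0)%C < e).
{ assert (C := continuous_exp_R y0).
  destruct (proj1 (filterlim_locally (U := R_UniformSpace) exp (exp y0)) C (mkposreal e (proj1
    He))) as [t Ht].
  exists (t / 2). assert (Htp := cond_pos t). split; [lra|]. intros y Hy.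
    rewrite <- RtoC_minus, Cmod_R.
  apply Ht. change (Rabs (y - y0) < t). lra. }
destruct Hex as [t [Ht Hnear]].
assert (Hu0 : u y0 = 0) by (unfold u; fold rho0; rewrite q_center; reflexivity).
assert (Hmon : forall a b, Rabs (a - y0) <= t -> Rabs (b - y0) <= t -> a < b -> u a < u b).
{ intros a b Ha Hb Hab. assert (Na := Hnear a Ha). assert (Nb := Hnear b Hb).
  rewrite <- RtoC_minus, Cmod_R in Na, Nb. apply Rabs_def2 in Na, Nb.
  apply (rb_incr _ _ _ _ HB); fold y0; fold rho0; [lra|apply exp_increasing; auto|lra]. }
assert (Hder : forall y, Rabs (y - y0) <= t -> is_derive u y (du y)).
{ intros y Hy. destruct (q_deriv (RtoC (exp y))) as [D _]; [generalize (Hnear y Hy); lra|].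
  assert (R1 : rder (fun s => q (RtoC (exp s))) y (C_derive q (RtoC (exp y)) * RtoC (exp y))%C).
  { apply (rder_ext (fun s => q (Cexp (RtoC s)))); [intros s; rewrite Cexp_R; reflexivity|].
    apply (rder_comp q (fun s => Cexp (RtoC s))); [rewrite Cexp_R; exact D|].
    eapply rder_eq; [apply (rder_comp Cexp RtoC); [apply cder_Cexp|apply rder_RtoC]|].
      rewrite Cexp_R. ring. }
  unfold du. clear D. revert R1. generalize (C_derive q (RtoC (exp y))). intros l R1.
  split; [apply (is_linear_scal_l (K := R_AbsRing) (V := R_NormedModule))|].
  intros x Hx. assert (Hx' : y = x) by (apply (is_filter_lim_locally_unique (V := R_NormedModule));
    exact Hx). subst x.
  intros eps. destruct (proj1 (rder_eps _ _ _) R1 eps (cond_pos eps)) as [dd [Hdd HH]].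
  exists (mkposreal dd Hdd). intros s Hs. specialize (HH s Hs).
  eapply Rle_trans; [|exact HH].
  eapply Rle_trans; [|apply re_le_Cmod]. right.
  unfold norm, minus, plus, opp, scal; simpl. unfold abs, mult; simpl. f_equal.
  unfold u. destruct (q (RtoC (exp s))), (q (RtoC (exp y))), l. simpl. ring. }
assert (Hdc : forall y, Rabs (y - y0) <= t -> continuous du y).
{ intros y Hy. destruct (q_deriv (RtoC (exp y))) as [_ [m D]]; [generalize (Hnear y Hy); lra|].
  apply cder_cont in D. apply (@cont_re R_UniformSpace (fun y => C_derive q (RtoC (exp y)) * RtoC
    (exp y))%C).
  assert (Ce : @cont R_UniformSpace (fun y => RtoC (exp y)) y) by (apply cont_RtoC,
    continuous_exp_R).
  apply rcont_mult; [|exact Ce].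
  apply (rcont_comp (C_derive q) (fun y => RtoC (exp y))); [exact D|exact Ce]. }
assert (Hcu : forall y, Rabs (y - y0) <= t -> continuity_pt u y).
{ intros y Hy. apply continuity_pt_filterlim. apply (ex_derive_continuous (V := R_NormedModule)).
  exists (du y). auto. }
assert (Ht0 : forall a, - t <= a <= t -> Rabs (y0 + a - y0) <= t) by (intros a Ha; apply Rabs_le;
  lra).
assert (Um : u (y0 - t) < 0).
{ rewrite <- Hu0. apply Hmon; [apply (Ht0 (- t)); lra|rewrite Rminus_diag, Rabs_R0; lra|lra]. }
assert (Up : 0 < u (y0 + t)).
{ rewrite <- Hu0. apply Hmon; [rewrite Rminus_diag, Rabs_R0; lra|apply (Ht0 t); lra|lra]. }
(* Both values - delta and delta are attained on [y0 - t, y0 + t]. *)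
set (delta := Rmin (r0 / 2) (Rmin (- u (y0 - t)) (u (y0 + t)))).
assert (Hd0 : 0 < delta) by (repeat apply Rmin_glb_lt; lra).
assert (Hd1 : delta <= r0 / 2) by apply Rmin_l.
assert (Hd2 : delta <= - u (y0 - t)) by (eapply Rle_trans; [apply Rmin_r|apply Rmin_l]).
assert (Hd3 : delta <= u (y0 + t)) by (eapply Rle_trans; [apply Rmin_r|apply Rmin_r]).
assert (Ivt : forall c, u (y0 - t) <= c <= u (y0 + t) -> exists y,
  y0 - t <= y <= y0 + t /\ u y = c).
{ intros c Hc. destruct (Ranalysis5.f_interv_is_interv u (y0 - t) (y0 + t) c) as [y [Hy Hyc]];
  [lra|exact Hc| |].
  - intros a Ha. apply Hcu. apply Rabs_le; lra.
  - exists y. auto. }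
destruct (Ivt (- delta)) as [y1 [Hy1 Eu1]]; [lra|]. destruct (Ivt delta) as [y2 [Hy2 Eu2]]; [lra|].
assert (Ry : forall y, y0 - t <= y <= y0 + t -> Rabs (y - y0) <= t) by (intros; apply Rabs_le; lra).
assert (Mon' : forall a b, y0 - t <= a <= y0 + t -> y0 - t <= b <= y0 + t -> a <= b -> u a <= u b).
{ intros a b Ha Hb [Hab| ->]; [left; apply Hmon; auto|lra]. }
assert (L1 : y1 < y0).
{ apply Rnot_le_lt. intros Hle. assert (X := Mon' y0 y1 ltac:(lra) Hy1 Hle). lra. }
assert (L2 : y0 < y2).
{ apply Rnot_le_lt. intros Hle. assert (X := Mon' y2 y0 Hy2 ltac:(lra) Hle). lra. }
exists delta, y1, y2, u, du. split; [lra|]. split; [lra|]. split; [auto|]. split; [auto|].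
intros y Hy. assert (Hyt : Rabs (y - y0) <= t) by (apply Ry; lra).
assert (N := Hnear y Hyt).
destruct (q_real y) as [Q1 Q2]; [lra|].
split; [auto|]. split; [auto|]. split; [|split; [exact Q2|]].
- rewrite <- Eu2 at 2. rewrite <- Eu1. split; apply Mon'; lra.
- change (RtoC (u y)) with (RtoC (Re (q (RtoC (exp y))))). rewrite <- Q1. unfold amplitude.
  rewrite (rb_pq _ _ _ _ HB) by (fold y0; fold rho0; lra).
  assert (Hreal : RtoC (du y) = (C_derive q (RtoC (exp y)) * RtoC (exp y))%C).
  { unfold du.
    assert (Hz : Im (C_derive q (RtoC (exp y)) * RtoC (exp y))%C = 0); [|unfold RtoC at 1;
      rewrite <- Hz; symmetry; apply C_eta].
    (* q is real on the real axis, so its derivative there is real. *)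
    rewrite im_scal_r. apply Rmult_eq_0_compat_r.
    destruct (q_deriv (RtoC (exp y))) as [D _]; [lra|].
    set (l := C_derive q (RtoC (exp y))) in *.
    apply Rabs_eq_0. apply Rle_antisym; [|apply Rabs_pos]. apply Rnot_lt_le. intros Hpos.
    destruct (proj1 (cder_eps _ _ _) D (Rabs (Im l) / 2)) as [dd [Hdd HH]]; [lra|].
    assert (Cx := continuous_exp_R y).
    set (m := Rmin (dd / 2) ((e - Cmod (RtoC (exp y) - RtoC rho0)%C) / 2)).
    assert (Hm : 0 < m) by (apply Rmin_glb_lt; lra).
    assert (Hm1 : m <= dd / 2) by apply Rmin_l. assert (Hm2 : m <= (e - Cmod (RtoC (exp y) - RtoC
      rho0)%C) / 2) by apply Rmin_r.
    assert (Hey := exp_pos y). assert (Hmy : 0 < exp y + m) by lra.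
    assert (Ed : (RtoC (exp y + m) - RtoC (exp y))%C = RtoC m) by (rewrite RtoC_plus; ring).
    specialize (HH (RtoC (exp y + m))). rewrite Ed, Cmod_R, Rabs_pos_eq in HH by lra.
      specialize (HH ltac:(lra)).
    assert (N2 : Cmod (RtoC (exp y + m) - RtoC rho0)%C < d).
    { replace (RtoC (exp y + m) - RtoC rho0)%C with (RtoC m + (RtoC (exp y) - RtoC rho0))%C by
      (rewrite RtoC_plus; ring).
      eapply Rle_lt_trans; [apply Cmod_triangle|]. rewrite Cmod_R, Rabs_pos_eq by lra. lra. }
    rewrite <- (exp_ln (exp y + m) Hmy) in N2. destruct (q_real _ N2) as [Q3 _].
      rewrite exp_ln in Q3 by auto.
    assert (A := im_le_Cmod (q (RtoC (exp y + m)) - q (RtoC (exp y)) - l * RtoC m)%C).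
    replace (Im (q (RtoC (exp y + m)) - q (RtoC (exp y)) - l * RtoC m)%C) with (- (Im l * m)) in A.
    - rewrite Rabs_Ropp, Rabs_mult, (Rabs_pos_eq m) in A by lra. nra.
    - rewrite Q1, Q3. unfold Cminus. rewrite !im_plus, !im_opp, im_scal_r. simpl. ring. }
  rewrite Hreal. rewrite Cpower_pos by apply exp_pos. rewrite ln_exp.
  replace ((beta + 1) * RtoC y)%C with (beta * RtoC y + RtoC y)%C by ring.
    rewrite Cexp_plus, Cexp_R.
  field. apply He2. exact N.
Qed.
End RealBranch.

(** * Reduction of all angles to one *)

(** The argument of zeta0. *)
Definition ray_angle (alpha theta : R) : R := kappa alpha * phi alpha theta.

Lemma eta2_phi alpha theta : 1 < alpha -> eta2 alpha theta = phi alpha theta + ray_angle alpha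
  theta /\ eta2 alpha theta = alpha * ray_angle alpha theta.
Proof. intros Ha. unfold eta2, ray_angle, kappa, phi. split; field; lra. Qed.

Lemma ray_angle_theta alpha theta : 1 < alpha -> ray_angle alpha theta = kappa alpha * theta - PI /
  (2 * alpha).
Proof. intros Ha. unfold ray_angle, kappa, phi. field; lra. Qed.

Lemma angles alpha theta : 1 < alpha -> 0 < theta < PI - PI / alpha ->
  Rabs (ray_angle alpha theta) < PI / 2 /\ Rabs (eta2 alpha theta) < PI / 2.
Proof.
intros Ha [H1 H2]. assert (HP := PI_RGT_0).
assert (E2 : eta2 alpha theta = alpha * ray_angle alpha theta) by (apply eta2_phi; auto).
assert (B : Rabs (eta2 alpha theta) < PI / 2).
{ unfold eta2.
  assert (A1 : 0 < alpha / (alpha - 1)) by (apply Rdiv_lt_0_compat; lra).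
  assert (A2 : alpha / (alpha - 1) * theta < alpha / (alpha - 1) * (PI - PI / alpha)) by (apply
    Rmult_lt_compat_l; auto).
  replace (alpha / (alpha - 1) * (PI - PI / alpha)) with PI in A2 by (field; lra).
  assert (A3 : 0 < alpha / (alpha - 1) * theta) by (apply Rmult_lt_0_compat; auto).
  apply Rabs_def1; lra. }
split; auto. rewrite E2, Rabs_mult, (Rabs_pos_eq alpha) in B by lra.
assert (0 <= Rabs (ray_angle alpha theta)) by apply Rabs_pos. nra.
Qed.

Lemma ray_cis alpha theta r : ray alpha theta r = (RtoC r * cis (ray_angle alpha theta))%C.
Proof. reflexivity. Qed.

Lemma crit_radius alpha : Rpower alpha (- kappa alpha) = exp (log_crit alpha).
Proof. reflexivity. Qed.

Lemma zeta0_cis alpha theta : zeta0 alpha theta = (cis (ray_angle alpha theta) * RtoC (exp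
  (log_crit alpha)))%C.
Proof. unfold zeta0. rewrite ray_cis, crit_radius. ring. Qed.

(** Both terms of h scale in the same way, since phi + kappa phi = alpha kappa phi =
    eta2. *)
Lemma h_rotate alpha theta w : 1 < alpha -> 0 < theta < PI - PI / alpha -> 0 < Re w ->
  h alpha theta (cis (ray_angle alpha theta) * w)%C = (cis (eta2 alpha theta) * h0 alpha w)%C.
Proof.
intros Ha Hth Hw. destruct (angles alpha theta Ha Hth) as [Ht _].
  destruct (eta2_phi alpha theta Ha) as [E1 E2].
unfold h, h0. rewrite Cpower_rotate by auto.
replace (RtoC alpha * (Ci * RtoC (ray_angle alpha theta)))%C with (Ci * RtoC (alpha * ray_angle
  alpha theta))%C by (rewrite RtoC_mult; ring).
change (Cexp (Ci * RtoC (phi alpha theta)))%C with (cis (phi alpha theta)).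
  change (Cexp (Ci * RtoC (alpha * ray_angle alpha theta)))%C with (cis (alpha * ray_angle alpha
  theta)).
rewrite <- E2. rewrite Cmult_assoc, <- cis_plus, <- E1. ring.
Qed.

(** The local hypotheses on psi and its inverse, on discs of one common radius. *)
Record branch_data (alpha theta : R) (psi pinv : C -> C) (d : R) : Prop := {
  bd_d : 0 < d < exp (log_crit alpha);
  bd_hol : forall z, Cmod (z - zeta0 alpha theta)%C < d -> exists l, cder psi z l;
  bd_sq : forall z, Cmod (z - zeta0 alpha theta)%C < d -> (psi z * psi z = h alpha theta z - h
    alpha theta (zeta0 alpha theta))%C;
  bd_incr : forall r1 r2, exp (log_crit alpha) - d < r1 -> r1 < r2 ->
    r2 < exp (log_crit alpha) + d ->
    Im (psi (ray alpha theta r1)) < Im (psi (ray alpha theta r2));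
  bd_phol : forall w, Cmod w < d -> exists l, cder pinv w l;
  bd_pq : forall z, Cmod (z - zeta0 alpha theta)%C < d -> pinv (psi z) = z;
  bd_qp : forall w, Cmod w < d -> psi (pinv w) = w }.

Lemma branch_data_exists alpha theta psi pinv : is_sqrt_branch alpha theta psi ->
  is_local_inverse alpha theta psi pinv ->
  exists d, branch_data alpha theta psi pinv d.
Proof.
intros [A1 [A2 [eps A3]]] [B1 [B2 B3]].
destruct (locally_disc _ _ A1) as [d1 [Hd1 H1]].
destruct (locally_disc _ _ A2) as [d2 [Hd2 H2]].
destruct (locally_disc _ _ B1) as [d3 [Hd3 H3]].
destruct (locally_disc _ _ B2) as [d4 [Hd4 H4]].
destruct (locally_disc _ _ B3) as [d5 [Hd5 H5]].
assert (He := cond_pos eps). assert (Hx := exp_pos (log_crit alpha)).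
assert (Hmin : exists d, 0 < d /\ d <= d1 /\ d <= d2 /\ d <= d3 /\ d <= d4 /\ d <= d5 /\ d <= eps
  /\ d <= exp (log_crit alpha) / 2).
{ exists (Rmin d1 (Rmin d2 (Rmin d3 (Rmin d4 (Rmin d5 (Rmin eps (exp (log_crit alpha) / 2))))))).
  split; [repeat apply Rmin_glb_lt; lra|].
  unfold Rmin. repeat destruct (Rle_dec _ _); repeat split; lra. }
destruct Hmin as [d [Hd [L1 [L2 [L3 [L4 [L5 [L6 L7]]]]]]]].
exists d. constructor.
- lra.
- intros z Hz. apply hol_cder. apply H1. lra.
- intros z Hz. apply H2. lra.
- intros r1 r2 R1 R12 R2. apply A3; rewrite ?crit_radius; lra.
- intros w Hw. apply hol_cder. apply H3. replace (w - 0)%C with w by ring. lra.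
- intros z Hz. apply H4. lra.
- intros w Hw. apply H5. replace (w - 0)%C with w by ring. lra.
Qed.

(** At this angle phi = 0 and h is h0. *)
Definition theta_base (alpha : R) : R := PI / 2 - PI / (2 * alpha).

Lemma theta_base_range alpha : 1 < alpha -> 0 < theta_base alpha < PI - PI / alpha.
Proof.
intros Ha. assert (HP := PI_RGT_0). unfold theta_base.
replace (PI / 2 - PI / (2 * alpha)) with ((PI - PI / alpha) / 2) by (field; lra).
assert (0 < PI - PI / alpha); [|lra].
replace (PI - PI / alpha) with (PI * ((alpha - 1) / alpha)) by (field; lra).
apply Rmult_lt_0_compat; [lra|apply Rdiv_lt_0_compat; lra].
Qed.

Lemma ray_angle_base alpha : 1 < alpha -> ray_angle alpha (theta_base alpha) = 0.
Proof. intros Ha. unfold ray_angle, phi, theta_base. ring. Qed.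

(** Dividing by i turns increasing imaginary parts into increasing real parts and the
    square h - h zeta0 into its negative. *)
Lemma base_branch alpha psi pinv d : 1 < alpha -> branch_data alpha (theta_base alpha) psi pinv d ->
  real_branch alpha (fun z => - Ci * psi z)%C (fun w => pinv (Ci * w)%C) d.
Proof.
intros Ha HB.
assert (Ez : zeta0 alpha (theta_base alpha) = RtoC (exp (log_crit alpha))).
{ rewrite zeta0_cis, ray_angle_base, cis_0 by auto. ring. }
assert (Eh : forall w, 0 < Re w -> h alpha (theta_base alpha) w = h0 alpha w).
{ intros w Hw. assert (K := h_rotate alpha (theta_base alpha) w Ha (theta_base_range alpha Ha) Hw).
  assert (E2 : eta2 alpha (theta_base alpha) = 0) by (rewrite (proj2 (eta2_phi alpha (theta_base
    alpha) Ha)), ray_angle_base by auto; ring).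
  rewrite E2, ray_angle_base, cis_0, !Cmult_1_l in K by auto. exact K. }
assert (Dd := bd_d _ _ _ _ _ HB).
constructor.
- exact Dd.
- intros z Hz. rewrite <- Ez in Hz. destruct (bd_hol _ _ _ _ _ HB z Hz) as [l Hl]. eexists.
  apply cder_scal. exact Hl.
- intros z Hz. assert (Hz' := Hz). rewrite <- Ez in Hz'. assert (K := bd_sq _ _ _ _ _ HB z Hz').
  rewrite Ez in K.
  rewrite !Eh in K; [|simpl; apply exp_pos|apply (Re_near (RtoC (exp (log_crit alpha)))); simpl;
    lra].
  replace (- Ci * psi z * (- Ci * psi z))%C with (Ci * Ci * (psi z * psi z))%C by ring. rewrite K.
  replace (Ci * Ci)%C with (RtoC (-1)) by (apply injective_projections; simpl; ring).
  ring.
- intros r1 r2 R1 R12 R2. assert (K := bd_incr _ _ _ _ _ HB r1 r2 R1 R12 R2).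
  rewrite !ray_cis, ray_angle_base, cis_0, !Cmult_1_r in K by auto.
  assert (E : forall z, Re (- Ci * z)%C = Im z) by (intros [x y]; simpl; ring).
  rewrite !E. exact K.
- intros w Hw. destruct (bd_phol _ _ _ _ _ HB (Ci * w)%C) as [l Hl].
  { rewrite Cmod_mult, Cmod_Ci. lra. }
  eexists. apply (cder_comp pinv (fun w => Ci * w)%C); [exact Hl|apply cder_scal, cder_id].
- intros z Hz. rewrite <- Ez in Hz.
  replace (Ci * (- Ci * psi z))%C with (psi z); [apply (bd_pq _ _ _ _ _ HB); auto|].
  replace (Ci * (- Ci * psi z))%C with (- (Ci * Ci) * psi z)%C by ring.
  replace (Ci * Ci)%C with (RtoC (-1)) by (apply injective_projections; simpl; ring). ring.
- intros w Hw. rewrite (bd_qp _ _ _ _ _ HB).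
  + replace (- Ci * (Ci * w))%C with (- (Ci * Ci) * w)%C by ring.
    replace (Ci * Ci)%C with (RtoC (-1)) by (apply injective_projections; simpl; ring). ring.
  + rewrite Cmod_mult, Cmod_Ci. lra.
Qed.

Section Transfer.
Variables (alpha : R) (beta : C) (q p : C -> C) (d : R).
Hypothesis Halpha : 1 < alpha.
Hypothesis HB : real_branch alpha q p d.
Variables (theta : R) (psi pinv : C -> C) (d' : R).
Hypothesis Hth : 0 < theta < PI - PI / alpha.
Hypothesis HD : branch_data alpha theta psi pinv d'.
Let rho0 := exp (log_crit alpha).
Let t := ray_angle alpha theta.
Let eta := eta2 alpha theta.

Lemma rot_dist w v : Cmod (cis t * w - cis t * v)%C = Cmod (w - v)%C.
Proof. replace (cis t * w - cis t * v)%C with (cis t * (w - v))%C by ring.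
  rewrite Cmod_mult, Cmod_cis. ring. Qed.

(** Both sides are square roots D and E of the same function vanishing at rho0. With D =
    pD (w - rho0) and E = pE (w - rho0), the product (pD - pE) (pD + pE) is zero near
    rho0, so the slopes agree up to sign. The slope of E has positive imaginary part, as
    the modulus of eta/2 is below PI/4, and that of D has nonnegative imaginary part by
    monotonicity; so pD + pE does not vanish near rho0 and pD = pE. *)
Lemma psi_from_q : exists e, 0 < e /\ forall w, Cmod (w - RtoC rho0)%C < e ->
  psi (cis t * w)%C = (Ci * cis (eta / 2) * q w)%C.
Proof.
assert (Dd := rb_d _ _ _ _ HB). assert (Dd' := bd_d _ _ _ _ _ HD).
destruct (angles alpha theta Halpha Hth) as [Ht Heta]. fold t in Ht. fold eta in Heta.
assert (Ez : zeta0 alpha theta = (cis t * RtoC rho0)%C) by apply zeta0_cis.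
set (D := fun w => psi (cis t * w)%C). set (E := fun w => (Ci * cis (eta / 2) * q w)%C).
set (m := Rmin d d'). assert (Hm : 0 < m) by (apply Rmin_glb_lt; lra).
assert (Hm1 : m <= d) by apply Rmin_l. assert (Hm2 : m <= d') by apply Rmin_r.
assert (Hc : Cmod (RtoC rho0 - RtoC rho0)%C < m) by (rewrite Cmod_sub_self; auto).
assert (Sq2 : forall w, Cmod (w - RtoC rho0)%C < m -> (D w * D w = E w * E w)%C).
{ intros w Hw. unfold D, E.
  assert (Hr : 0 < Re w) by (apply (Re_near (RtoC rho0)); simpl; unfold rho0 in *; lra).
  rewrite (bd_sq _ _ _ _ _ HD) by (rewrite Ez, rot_dist; lra).
  rewrite Ez. unfold t. rewrite !h_rotate by (auto; simpl; apply exp_pos). fold eta.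
  replace (Ci * cis (eta / 2) * q w * (Ci * cis (eta / 2) * q w))%C with ((Ci * Ci) * (cis (eta /
    2) * cis (eta / 2)) * (q w * q w))%C by ring.
  rewrite (rb_sq _ _ _ _ HB) by (fold rho0; lra).
  rewrite <- cis_plus. replace (eta / 2 + eta / 2) with eta by field.
  replace (Ci * Ci)%C with (RtoC (-1)) by (apply injective_projections; simpl; ring). unfold rho0.
    ring. }
assert (Q0 := q_center alpha q p d HB).
fold rho0 in Q0.
assert (E0 : E (RtoC rho0) = RtoC 0) by (unfold E; rewrite Q0; ring).
assert (D0 : D (RtoC rho0) = RtoC 0).
{ destruct (Ceq_dec (D (RtoC rho0)) (RtoC 0)) as [X|X]; auto. exfalso.
  apply (Cmult_neq_0 _ _ X X). rewrite Sq2, E0 by auto. ring. }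
assert (cD : exists l, cder D (RtoC rho0) l).
{ destruct (bd_hol _ _ _ _ _ HD (cis t * RtoC rho0)%C) as [l Hl]; [rewrite Ez, rot_dist; lra|].
  eexists. apply (cder_comp psi (fun w => cis t * w)%C); [exact Hl|apply cder_scal, cder_id]. }
set (s := sqrt ((alpha - 1) / (2 * rho0))).
assert (Hs : 0 < s) by (apply sqrt_lt_R0, Rdiv_lt_0_compat; [lra|generalize (exp_pos (log_crit
  alpha)); unfold rho0; lra]).
assert (cE : cder E (RtoC rho0) (Ci * cis (eta / 2) * RtoC s)%C).
{ apply cder_scal. destruct (q_deriv alpha q p d HB (RtoC rho0)) as [Dq _].
  - fold rho0. rewrite Cmod_sub_self; lra.
  - eapply cder_eq; [exact Dq|]. apply (q_slope alpha q p d Halpha HB). }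
destruct cD as [lD [pD [CpD [PD HpD]]]]. destruct cE as [pE [CpE [PE HpE]]].
assert (Slope : forall w, Cmod (w - RtoC rho0)%C < m -> w <> RtoC rho0 ->
  ((pD w - pE w) * (pD w + pE w) = 0)%C).
{ intros w Hw Hne. assert (X := Sq2 w Hw). assert (Y1 := HpD w). assert (Y2 := HpE w).
  rewrite D0 in Y1. rewrite E0 in Y2.
  replace (D w - 0)%C with (D w) in Y1 by ring. replace (E w - 0)%C with (E w) in Y2 by ring.
    rewrite Y1, Y2 in X.
  assert (Hn : (w - RtoC rho0)%C <> RtoC 0) by (apply Cminus_eq_contra; auto).
  replace ((pD w - pE w) * (pD w + pE w))%C with ((pD w * (w - RtoC rho0) * (pD w * (w - RtoC
    rho0)) - pE w * (w - RtoC rho0) * (pE w * (w - RtoC rho0))) / ((w - RtoC rho0) * (w - RtoC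
    rho0)))%C by (field; auto).
  rewrite X. field; auto. }
assert (CS : @cont CT (fun w => (pD w - pE w) * (pD w + pE w))%C (RtoC rho0)) by cont_tac.
assert (Seq : ((pD (RtoC rho0) - pE (RtoC rho0)) * (pD (RtoC rho0) + pE (RtoC rho0)) = 0)%C).
{ apply Cmod_eq_0. apply Rle_antisym; [|apply Cmod_ge_0]. apply Rnot_lt_le. intros Hpos.
  destruct (proj1 (ccont_eps _ _) CS _ Hpos) as [e [He H]].
  set (x := Rmin (e / 2) (m / 2)). assert (Hx : 0 < x) by (apply Rmin_glb_lt; lra).
  assert (Hx1 : x <= e / 2) by apply Rmin_l. assert (Hx2 : x <= m / 2) by apply Rmin_r.
  assert (Ed : (RtoC (rho0 + x) - RtoC rho0)%C = RtoC x) by (rewrite RtoC_plus; ring).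
  specialize (H (RtoC (rho0 + x))). rewrite Ed, Cmod_R, Rabs_pos_eq in H by lra.
    specialize (H ltac:(lra)).
  rewrite Slope in H.
  - match type of H with Cmod (?A - ?B)%C < _ => replace (A - B)%C with (- B)%C in H by ring end.
    rewrite Cmod_opp in H. lra.
  - rewrite Ed, Cmod_R, Rabs_pos_eq; lra.
  - intros X. apply RtoC_inj in X. lra. }
assert (Hcos : 0 < cos (eta / 2)).
{ apply Rabs_def2 in Heta. apply cos_gt_0; lra. }
assert (ImE : Im (pE (RtoC rho0)) = s * cos (eta / 2)).
{ rewrite PE. rewrite im_scal_r. rewrite <- Re_cis. destruct (cis (eta / 2)) as [x y]. simpl.
  ring. }
assert (ImD : 0 <= Im (pD (RtoC rho0))).
{ apply Rnot_lt_le. intros Hn.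
  destruct (proj1 (ccont_eps _ _) CpD (- Im (pD (RtoC rho0)))) as [e [He H]]; [lra|].
  set (x := Rmin (e / 2) (m / 2)). assert (Hx : 0 < x) by (apply Rmin_glb_lt; lra).
  assert (Hx1 : x <= e / 2) by apply Rmin_l. assert (Hx2 : x <= m / 2) by apply Rmin_r.
  assert (Ed : (RtoC (rho0 + x) - RtoC rho0)%C = RtoC x) by (rewrite RtoC_plus; ring).
  specialize (H (RtoC (rho0 + x))). rewrite Ed, Cmod_R, Rabs_pos_eq in H by lra.
    specialize (H ltac:(lra)).
  assert (K := bd_incr _ _ _ _ _ HD rho0 (rho0 + x) ltac:(unfold rho0 in *;
    lra) ltac:(lra) ltac:(unfold rho0 in *; lra)).
  rewrite !ray_cis in K. fold t in K. rewrite (Cmult_comm (RtoC rho0)),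
    (Cmult_comm (RtoC (rho0 + x))) in K.
  change (psi (cis t * RtoC rho0)%C) with (D (RtoC rho0)) in K.
    change (psi (cis t * RtoC (rho0 + x))%C) with (D (RtoC (rho0 + x))) in K.
  rewrite D0 in K. assert (Y := HpD (RtoC (rho0 + x))). rewrite D0, Ed in Y.
  replace (D (RtoC (rho0 + x)) - 0)%C with (D (RtoC (rho0 + x))) in Y by ring.
    rewrite Y, im_scal_r in K. change (Im (RtoC 0)) with 0 in K.
  assert (Kp : 0 < Im (pD (RtoC (rho0 + x)))) by (apply Rmult_lt_reg_r with x;
    [auto|rewrite Rmult_0_l; exact K]).
  assert (A := im_le_Cmod (pD (RtoC (rho0 + x)) - pD (RtoC rho0))%C).
  unfold Cminus in A. rewrite im_plus, im_opp in A.
  generalize (Rle_abs (Im (pD (RtoC (rho0 + x))) + - Im (pD (RtoC rho0)))). unfold Cminus in H.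
    lra. }
assert (Eq : pD (RtoC rho0) = pE (RtoC rho0)).
{ destruct (Ceq_dec (pD (RtoC rho0) - pE (RtoC rho0))%C (RtoC 0)) as [X|X]; [apply Ceq_minus;
  auto|].
  destruct (Ceq_dec (pD (RtoC rho0) + pE (RtoC rho0))%C (RtoC 0)) as [Y|Y].
  - exfalso. assert (Z : Im (pD (RtoC rho0) + pE (RtoC rho0))%C = 0) by (rewrite Y; reflexivity).
    rewrite im_plus, ImE in Z. nra.
  - exfalso. apply (Cmult_neq_0 _ _ X Y). exact Seq. }
assert (CP : @cont CT (fun w => pD w + pE w)%C (RtoC rho0)) by cont_tac.
assert (Hne : 0 < Cmod (pD (RtoC rho0) + pE (RtoC rho0))%C).
{ apply Cmod_gt_0. intros Y. assert (Z : Im (pD (RtoC rho0) + pE (RtoC rho0))%C = 0) by (rewrite Y;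
  reflexivity).
  rewrite im_plus, ImE in Z. nra. }
destruct (proj1 (ccont_eps _ _) CP _ Hne) as [e [He H]].
exists (Rmin e m). split; [apply Rmin_glb_lt; auto|].
intros w Hw. assert (Hw1 := Rlt_le_trans _ _ _ Hw (Rmin_l _ _)).
  assert (Hw2 := Rlt_le_trans _ _ _ Hw (Rmin_r _ _)).
change (D w = E w).
destruct (Ceq_dec w (RtoC rho0)) as [->|Hn]; [rewrite D0, E0; reflexivity|].
assert (X := Slope w Hw2 Hn). specialize (H w Hw1).
assert (Y : (pD w + pE w)%C <> RtoC 0).
{ intros Y. rewrite Y in H. match type of H with Cmod (?A - ?B)%C < _ => replace (A - B)%C with (-
  B)%C in H by ring end.
  rewrite Cmod_opp in H. lra. }
assert (Z : (pD w - pE w)%C = RtoC 0).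
{ destruct (Ceq_dec (pD w - pE w)%C (RtoC 0)); auto. exfalso. apply (Cmult_neq_0 _ _ n Y X). }
apply Ceq_minus in Z.
assert (Y1 := HpD w). assert (Y2 := HpE w). rewrite D0 in Y1. rewrite E0 in Y2.
replace (D w) with (D w - 0)%C by ring. replace (E w) with (E w - 0)%C by ring. rewrite Y1, Y2, Z.
  reflexivity.
Qed.

(** The factor that zeta^b d zeta acquires under zeta = e^(i kappa phi) w, divided by
    the factor i e^(i eta2 / 2) between psi and q. *)
Definition rot_factor (b : C) (th : R) : C :=
  (Cexp (b * (Ci * RtoC (ray_angle alpha th))) * cis (ray_angle alpha th) * (- Ci * cis (- (eta2
    alpha th / 2))))%C.

Let k := (- Ci * cis (- (eta / 2)))%C.

Lemma k_mod : Cmod k = 1.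
Proof. unfold k. rewrite Cmod_mult, Cmod_opp, Cmod_Ci, Cmod_cis. ring. Qed.

Lemma cis_cancel x : (cis x * cis (- x) = 1)%C.
Proof. rewrite <- cis_plus, Rplus_opp_r. apply cis_0. Qed.

(** The change of variables zeta = e^(i kappa phi) w in the density of the pairing. *)
Lemma density_transfer : exists e, 0 < e /\ forall w, Cmod w < e ->
  (Cpower (pinv w) beta / C_derive psi (pinv w) = rot_factor beta theta * amplitude beta q p (k *
    w))%C.
Proof.
assert (Dd := rb_d _ _ _ _ HB). assert (Dd' := bd_d _ _ _ _ _ HD).
destruct (angles alpha theta Halpha Hth) as [Ht Heta]. fold t in Ht.
assert (Ez : zeta0 alpha theta = (cis t * RtoC rho0)%C) by apply zeta0_cis.
destruct psi_from_q as [e1 [He1 H1]].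
destruct (q_deriv_neq0 alpha q p d HB) as [e2 [He2 [_ Hq2]]]. fold rho0 in Hq2.
set (m := Rmin e1 (Rmin e2 d')).
assert (Hm : 0 < m) by (repeat apply Rmin_glb_lt; lra).
assert (Hm1 : m <= e1) by apply Rmin_l.
assert (Hm2 : m <= e2) by (eapply Rle_trans; [apply Rmin_r|apply Rmin_l]).
assert (Hm3 : m <= d') by (eapply Rle_trans; [apply Rmin_r|apply Rmin_r]).
assert (H0 : Cmod (RtoC 0) < d) by (rewrite Cmod_0; lra).
destruct (rb_phol _ _ _ _ HB _ H0) as [l0 Hl0]. apply cder_cont in Hl0.
destruct (proj1 (ccont_eps _ _) Hl0 m Hm) as [e3 [He3 H3]].
exists (Rmin e3 d). split; [apply Rmin_glb_lt; lra|].
intros w Hw. assert (Hw1 := Rlt_le_trans _ _ _ Hw (Rmin_l _ _)).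
  assert (Hw2 := Rlt_le_trans _ _ _ Hw (Rmin_r _ _)).
set (u := (k * w)%C). assert (Hu : Cmod u = Cmod w) by (unfold u; rewrite Cmod_mult, k_mod; ring).
set (v := p u).
assert (Hv : Cmod (v - RtoC rho0)%C < m).
{ unfold v, rho0. rewrite <- (p_center alpha q p d HB). apply H3.
  replace (u - 0)%C with u by ring. lra. }
assert (Hpsi : psi (cis t * v)%C = w).
{ rewrite H1 by lra. unfold v. rewrite (rb_qp _ _ _ _ HB) by lra. unfold u, k.
  replace (Ci * cis (eta / 2) * (- Ci * cis (- (eta / 2)) * w))%C with (- (Ci * Ci) * (cis (eta /
    2) * cis (- (eta / 2))) * w)%C by ring.
  rewrite cis_cancel. replace (Ci * Ci)%C with (RtoC (-1)) by (apply injective_projections; simpl;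
    ring). ring. }
assert (Hpinv : pinv w = (cis t * v)%C).
{ rewrite <- Hpsi. apply (bd_pq _ _ _ _ _ HD). rewrite Ez, rot_dist. lra. }
assert (Hder : C_derive psi (cis t * v)%C = (Ci * cis (eta / 2) * (C_derive q v * cis (- t)))%C).
{ apply C_derive_cder.
  apply (cder_ext_loc (fun z => Ci * cis (eta / 2) * q (cis (- t) * z))%C _ _ _ (e1 - Cmod (v -
    RtoC rho0)%C)); [lra| |].
  - intros z Hz. rewrite <- H1.
    + f_equal. rewrite Cmult_assoc, cis_cancel. ring.
    + replace (cis (- t) * z - RtoC rho0)%C with (cis (- t) * (z - cis t * v) + (v - RtoC rho0))%C.
      * eapply Rle_lt_trans; [apply Cmod_triangle|]. rewrite Cmod_mult, Cmod_cis. lra.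
      * assert (X := cis_cancel t). replace (cis (- t) * (z - cis t * v))%C with (cis (- t) * z -
        cis t * cis (- t) * v)%C by ring. rewrite X. ring.
  - apply cder_scal. eapply cder_eq.
    + apply (cder_comp q (fun z => cis (- t) * z)%C).
      * rewrite Cmult_assoc, (Cmult_comm (cis (- t))), cis_cancel, Cmult_1_l.
        apply (q_deriv alpha q p d HB). fold rho0. lra.
      * apply cder_scal, cder_id.
    + ring. }
rewrite Hpinv, Hder. rewrite Cpower_rotate by (auto; apply (near_right alpha q p d HB); fold rho0;
  lra).
unfold rot_factor, amplitude. fold t. fold eta. fold u. fold v.
assert (Hq : C_derive q v <> RtoC 0) by (apply Hq2; lra).
assert (Ei : forall x, cis (- x) = (/ cis x)%C) by (intros x; unfold cis; rewrite <- Cexp_opp;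
  f_equal; rewrite RtoC_opp; ring).
rewrite !Ei. assert (Hi : (- Ci)%C = (/ Ci)%C) by (rewrite Ci_inv; reflexivity). rewrite Hi.
field. repeat split; auto; try apply cis_neq0; apply Ci_nz.
Qed.

Lemma C_derive_n_rotate K r c f e : hol_on (square (RtoC 0) r) K -> 0 < r -> 0 < e ->
  (forall w, Cmod w < e -> f w = (c * K (k * w))%C) ->
  forall m w, Cmod w < Rmin e (r / 2) -> C_derive_n m f w = (c * k ^ m * C_derive_n m K (k * w))%C.
Proof.
intros HK Hr He Hf m. induction m as [|m IH]; intros w Hw.
- simpl C_derive_n. rewrite Hf by (eapply Rlt_le_trans; [exact Hw|apply Rmin_l]). simpl. ring.
- change (C_derive_n (S m) f w) with (C_derive (C_derive_n m f) w).
  apply C_derive_cder.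
  apply (cder_ext_loc (fun u => c * k ^ m * C_derive_n m K (k * u))%C _ _ _ (Rmin e (r / 2) - Cmod
    w)); [lra| |].
  + intros u Hu. symmetry. apply IH. replace u with ((u - w) + w)%C by ring.
    eapply Rle_lt_trans; [apply Cmod_triangle|]. lra.
  + assert (Hkw : Cmod (k * w - 0)%C < r / 2).
    { replace (k * w - 0)%C with (k * w)%C by ring. rewrite Cmod_mult, k_mod, Rmult_1_l.
      eapply Rlt_le_trans; [exact Hw|apply Rmin_r]. }
    destruct (derive_n_cauchy_int K (RtoC 0) r (r / 2) HK ltac:(lra) m (k * w)%C Hkw) as [_ D].
    eapply cder_eq; [apply cder_scal; apply (cder_comp (C_derive_n m K) (fun u => k * u)%C);
      [exact D|apply cder_scal, cder_id]|].
    rewrite Cpow_S. ring.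
Qed.

(** The 2n derivatives contribute k^(2n) = (-1)^n e^(- i n eta2). *)
Lemma delta_pairing_transfer n : delta_pairing beta psi pinv n =
  (rot_factor beta theta * (RtoC ((-1) ^ n) * (/ cis eta) ^ n) * C_derive_n (2 * n) (amplitude beta
    q p) 0)%C.
Proof.
destruct (amplitude_hol alpha beta q p d HB) as [r [Hr HK]].
destruct density_transfer as [e [He Hd]].
unfold delta_pairing.
rewrite (C_derive_n_rotate (amplitude beta q p) r (rot_factor beta theta) _ e HK Hr He Hd).
- rewrite Cmult_0_r. f_equal. f_equal. rewrite Cpow_mult_r, RtoC_pow, <- Cpow_mult_l. f_equal.
  unfold k. simpl.
  replace (- Ci * cis (- (eta / 2)) * (- Ci * cis (- (eta / 2)) * 1))%C with (Ci * Ci * (cis (-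
    (eta / 2)) * cis (- (eta / 2))))%C by ring.
  rewrite <- cis_plus. replace (- (eta / 2) + - (eta / 2)) with (- eta) by field.
  replace (Ci * Ci)%C with (RtoC (-1)) by (apply injective_projections; simpl; ring).
  f_equal. unfold cis. rewrite <- Cexp_opp. f_equal. rewrite RtoC_opp. ring.
- rewrite Cmod_0. apply Rmin_glb_lt; lra.
Qed.
End Transfer.

(** * The saddle-point expansion *)

(** With l = log R and exp (nu l) the large parameter: terms of exponential type in R
    are beaten by exp(- s R^nu), with any power of R^nu to spare. *)
Lemma negligible p q s nu N : 0 <= q -> 0 < s -> 1 < nu -> exists M, 0 <= M /\ forall l, 0 <= l ->
  exp (p * l + q * exp l - s * exp (nu * l)) <= M * (/ exp (nu * l)) ^ N.
Proof.
intros Hq Hs Hnu.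
destruct (growth_bound (Rabs (p + INR N * nu)) q s nu (Rabs_pos _) Hq Hs Hnu) as [M [HM HG]].
exists (exp M). split; [left; apply exp_pos|]. intros l Hl. specialize (HG l Hl).
rewrite <- exp_Ropp, exp_pow_INR, <- exp_plus. apply exp_le.
assert ((p + INR N * nu) * l <= Rabs (p + INR N * nu) * l) by (apply Rmult_le_compat_r;
  [auto|apply Rle_abs]).
lra.
Qed.

Lemma CInt_shift f c a b : (forall x, rcont f x) -> CInt f (c + a) (c + b) = CInt (fun y => f (c +
  y)) a b.
Proof.
intros Hf. rewrite (CInt_comp f (fun y => c + y) (fun _ => 1)).
- apply CInt_ext. intros; ring.
- intros; apply Hf.
- intros y _. split; [auto_derive; [auto|ring]|apply continuous_const].
Qed.

(** This is s^beta exp(lam e^(i eta) (g s - g rho0)) ds in the variable y = log s, where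
    g s = s - s^alpha. *)
Definition laplace_integrand (alpha : R) (beta : C) (lam eta y : R) : C :=
  Cexp ((beta + 1) * RtoC y + RtoC lam * cis eta * RtoC (profile alpha y - profile alpha (log_crit
    alpha)))%C.

Lemma laplace_integrand_cont alpha beta lam eta y : rcont (laplace_integrand alpha beta lam eta) y.
Proof.
apply rcont_Cexp. apply rcont_plus.
- apply rcont_mult; [apply cont_const|apply rcont_RtoC].
- apply rcont_mult; [apply cont_const|].
  apply cont_RtoC. unfold profile. smooth.
Qed.

Lemma laplace_integrand_mod alpha beta lam eta y :
  Cmod (laplace_integrand alpha beta lam eta y) = exp ((Re beta + 1) * y + lam * cos eta * (profile
    alpha y - profile alpha (log_crit alpha))).
Proof.
unfold laplace_integrand. rewrite Cmod_Cexp. f_equal.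
rewrite re_plus. rewrite !re_scal_r, re_scal_l, Re_cis, re_plus. simpl. ring.
Qed.

(** R^(alpha/(alpha-1)) for l = log R. *)
Definition large_param (alpha l : R) : R := exp (alpha / (alpha - 1) * l).

(** With x = kappa log R + y and the angle kappa theta, both t^alpha and z t are
    multiples of R^(alpha/(alpha-1)), with equal phases. *)
Lemma log_integrand_on_ray alpha beta theta r y : 1 < alpha -> 0 < r ->
  let l := ln r in
  log_integrand alpha beta (RtoC r * cis theta)%C (kappa alpha * l + y, kappa alpha * theta)%R =
  (Cexp ((beta + 1) * (RtoC (kappa alpha * l) + Ci * RtoC (kappa alpha * theta))
     + cis (eta2 alpha theta) * RtoC (large_param alpha l * profile alpha (log_crit alpha)))
   * laplace_integrand alpha beta (large_param alpha l) (eta2 alpha theta) y)%C.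
Proof.
intros Ha Hr l. set (k := kappa alpha). set (chi := k * theta). set (x := k * l + y).
unfold log_integrand, laplace_integrand. rewrite <- Cexp_plus. f_equal.
assert (Ek : k = 1 / (alpha - 1)) by reflexivity.
assert (Epair : (x, chi) = (RtoC x + Ci * RtoC chi)%C) by (apply injective_projections; simpl;
  ring).
assert (Eang : eta2 alpha theta = alpha * chi + - (PI / 2)) by (unfold eta2, chi; rewrite Ek;
  field; lra).
assert (Eang2 : eta2 alpha theta = theta + chi + - (PI / 2)) by (unfold eta2, chi; rewrite Ek;
  field; lra).
assert (E1 : (Ci * Cexp (RtoC alpha * (x, chi)) = - cis (eta2 alpha theta) * RtoC (exp (alpha *
  x)))%C).
{ rewrite Eang, cis_plus, cis_neg_PI2, Epair.
  replace (RtoC alpha * (RtoC x + Ci * RtoC chi))%C with (RtoC (alpha * x) + Ci * RtoC (alpha *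
    chi))%C by (rewrite !RtoC_mult; ring).
  rewrite Cexp_plus, Cexp_R. unfold cis. ring. }
assert (E2 : (Ci * (RtoC r * cis theta) * Cexp (x, chi) = - cis (eta2 alpha theta) * RtoC (r * exp
  x))%C).
{ rewrite Eang2, !cis_plus, cis_neg_PI2, Epair. rewrite Cexp_plus, Cexp_R, RtoC_mult.
  fold (cis chi). ring. }
rewrite E1, E2, Epair.
assert (E3 : r * exp x = large_param alpha l * exp y).
{ unfold large_param. rewrite <- (exp_ln r Hr) at 1. fold l. rewrite <- !exp_plus. f_equal.
  unfold x. rewrite Ek. field. lra. }
assert (E4 : exp (alpha * x) = large_param alpha l * exp (alpha * y)).
{ unfold large_param. rewrite <- exp_plus. f_equal. unfold x. rewrite Ek. field. lra. }
rewrite E3, E4. unfold x. rewrite !RtoC_mult. unfold profile. rewrite !RtoC_minus, RtoC_plus.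
  rewrite !RtoC_mult. ring.
Qed.

Section Laplace.
Variables (alpha : R) (beta : C) (q p : C -> C) (d : R).
Hypothesis Halpha : 1 < alpha.
Hypothesis HB : real_branch alpha q p d.
Let K := amplitude beta q p.
Let nu := alpha / (alpha - 1).

Lemma nu_gt1 : 1 < nu.
Proof. unfold nu. apply Rmult_lt_reg_r with (alpha - 1); [lra|]. unfold Rdiv.
  rewrite Rmult_assoc, Rinv_l by lra. lra. Qed.

Definition laplace_sum (lam eta : R) (N : nat) : C :=
  Csum (fun n => RtoC (Gamma (INR n + 1 / 2)) * (C_derive_n (2 * n) K 0 / RtoC (INR (fact (2 *
    n)))) * (/ (RtoC lam * cis eta)) ^ n)%C N.

(** The interval [y1,y2] around the maximum contributes the whole series by
    [laplace_symmetric]; on both remaining parts the profile stays below its maximum by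
    g1 > 0, so they are exponentially small in the large parameter. The lower limit -
    kappa l is the starting point |t| = 1 of the ray. All constants depend on eta only
    through the lower bound c0 of cos eta. *)
Lemma laplace_expansion c0 N : 0 < c0 -> exists C l0 Y, 0 <= C /\ 0 <= l0 /\
  forall l eta b, l0 <= l -> Rabs eta <= PI / 2 -> c0 <= cos eta -> Y <= b ->
  Cmod (RtoC (sqrt (large_param alpha l)) * cis (eta / 2) *
          CInt (laplace_integrand alpha beta (large_param alpha l) eta) (- (kappa alpha * l)) b
        - laplace_sum (large_param alpha l) eta N)%C <= C * (/ large_param alpha l) ^ N.
Proof.
intros Hc0.
destruct (amplitude_hol alpha beta q p d HB) as [r0 [Hr0 HK]].
destruct (real_substitution alpha beta q p d Halpha HB r0 Hr0) as [delta [y1 [y2 [u [du [Hdelta [Hy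
  [Eu1 [Eu2 Hsub]]]]]]]]].
set (y0 := log_crit alpha) in *. set (G0 := profile alpha y0).
destruct (laplace_symmetric K r0 delta N c0 HK Hdelta Hc0) as [Cm [HCm Hmid]].
assert (Hk : 0 < kappa alpha) by (unfold kappa; apply Rdiv_lt_0_compat; lra).
assert (Hnu := nu_gt1).
assert (Hg : G0 - profile alpha y1 = delta * delta).
{ destruct (Hsub y1 ltac:(lra)) as [_ [_ [_ [X _]]]]. rewrite Eu1 in X. unfold G0. lra. }
assert (Hg2 : G0 - profile alpha y2 = delta * delta).
{ destruct (Hsub y2 ltac:(lra)) as [_ [_ [_ [X _]]]]. rewrite Eu2 in X. unfold G0. lra. }
set (g1 := delta * delta) in *. assert (Hg1 : 0 < g1) by (unfold g1; nra).
set (A := Rabs (Re beta + 1)). assert (HA : 0 <= A) by apply Rabs_pos.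
destruct (negligible (nu / 2 + (A + 1) * kappa alpha) 0 (c0 * g1) nu N) as [M1 [HM1 HL1]];
  [lra|nra|auto|].
destruct (negligible (nu / 2) 0 (c0 * g1) nu N) as [M2 [HM2 HL2]]; [lra|nra|auto|].
destruct (growth_bound (A + 1) (c0 * exp y2) (c0 * exp (alpha * y2)) alpha) as [M3 [HM3 HG3]];
  [lra|apply Rmult_le_pos; [lra|left; apply exp_pos]|apply Rmult_lt_0_compat;
  [auto|apply exp_pos]|auto|].
set (B1 := exp ((A + 1) * Rabs y1)).
set (B2 := exp (A * Rabs y2 - c0 * G0 + M3 + c0 * g1)).
assert (HB1 : 0 < B1) by apply exp_pos. assert (HB2 : 0 < B2) by apply exp_pos.
exists (Cm + B1 * M1 + B2 * M2), (Rmax 0 (- y1 / kappa alpha)), y2.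
split; [|split; [apply Rmax_l|]].
{ assert (0 <= B1 * M1) by (apply Rmult_le_pos; lra). assert (0 <= B2 * M2) by (apply Rmult_le_pos;
  lra). lra. }
intros l eta b Hl Heta Hcos Hb.
assert (Hl0 : 0 <= l) by (eapply Rle_trans; [apply Rmax_l|exact Hl]).
assert (Hl1 : - (kappa alpha * l) <= y1).
{ assert (X : - y1 / kappa alpha <= l) by (eapply Rle_trans; [apply Rmax_r|exact Hl]).
  assert (Y : kappa alpha * (- y1 / kappa alpha) <= kappa alpha * l) by (apply Rmult_le_compat_l;
    lra).
  replace (kappa alpha * (- y1 / kappa alpha)) with (- y1) in Y by (field; lra). lra. }
set (lam := large_param alpha l).
assert (Elam : lam = exp (nu * l)) by reflexivity.
assert (Hlam : 1 <= lam) by (rewrite Elam, <- exp_0; apply exp_le; nra).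
assert (Hsl : sqrt lam = exp (nu / 2 * l)).
{ apply sqrt_lem_1; [lra|left; apply exp_pos|]. rewrite <- exp_plus, Elam. f_equal. field. }
specialize (HL1 l Hl0). specialize (HL2 l Hl0). rewrite <- Elam in HL1, HL2.
set (f := laplace_integrand alpha beta lam eta).
assert (Cf : forall y, rcont f y) by (intros y; apply laplace_integrand_cont).
assert (Split : CInt f (- (kappa alpha * l)) b = (CInt f (- (kappa alpha * l)) y1 + CInt f y1 y2 +
  CInt f y2 b)%C).
{ rewrite (CInt_Chasles f _ y1 y2) by (apply contI_forall; auto).
  rewrite CInt_Chasles by (apply contI_forall; auto). reflexivity. }
(* Left of y1 the integrand is small and the interval has length O(l). *)
assert (BL : Cmod (CInt f (- (kappa alpha * l)) y1) <= B1 * exp ((A + 1) * kappa alpha * l - c0 *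
  g1 * lam)).
{ eapply Rle_trans; [apply (CInt_bound _ _ _ (exp (A * (kappa alpha * l + Rabs y1) - c0 * g1 *
  lam))); [apply contI_forall; auto|]|].
  - intros y. rewrite Rmin_left, Rmax_right by lra. intros Hyy. unfold f.
    rewrite laplace_integrand_mod. fold y0. fold G0. apply exp_le.
    assert (X1 : (Re beta + 1) * y <= A * (kappa alpha * l + Rabs y1)).
    { eapply Rle_trans; [apply Rle_abs|]. rewrite Rabs_mult. apply Rmult_le_compat_l; [auto|].
      assert (0 <= kappa alpha * l) by nra. assert (Z := Rle_abs y1). assert (Z0 := Rabs_pos y1).
        apply Rabs_le. lra. }
    assert (X2 : profile alpha y <= profile alpha y1) by (apply profile_increasing; fold y0; lra).
    assert (X3 : lam * cos eta * (profile alpha y - G0) <= lam * c0 * (- g1)); [|lra].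
    assert (lam * c0 <= lam * cos eta) by (apply Rmult_le_compat_l; lra).
    assert (0 <= lam * c0) by (apply Rmult_le_pos; lra). nra.
  - assert (X : Rabs (y1 - - (kappa alpha * l)) <= exp (kappa alpha * l + Rabs y1)).
    { rewrite Rabs_pos_eq by lra. assert (Z := Rle_abs y1). assert (Z0 := Rabs_pos y1).
      assert (0 <= kappa alpha * l) by nra.
      destruct (Req_dec (kappa alpha * l + Rabs y1) 0) as [E|E]; [rewrite E, exp_0; lra|].
        generalize (exp_ineq1 _ E). lra. }
    eapply Rle_trans; [apply Rmult_le_compat_l; [left; apply exp_pos|exact X]|].
    unfold B1. rewrite <- !exp_plus. apply exp_le. right. ring. }
(* Right of y2 one unit of the large parameter is set aside to ensure convergence at
    infinity; the other lam - 1 units give the smallness. *)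
assert (BR : Cmod (CInt f y2 b) <= B2 * exp (- (c0 * g1 * lam))).
{ set (Q := exp (A * Rabs y2 - c0 * G0 + M3 + c0 * g1 + y2 - c0 * g1 * lam)).
  assert (HQ : 0 < Q) by apply exp_pos.
  eapply Rle_trans; [apply (CInt_le f (fun y => Q * exp (- (1 * y)))); [auto|apply contI_forall;
    auto| |eexists; apply is_RInt_exp; lra]|].
  - intros y Hyy. unfold f. rewrite laplace_integrand_mod. fold y0. fold G0. unfold Q.
    rewrite <- exp_plus. apply exp_le.
    assert (X1 : (Re beta + 1) * y <= A * Rabs y2 + A * (y - y2)).
    { eapply Rle_trans; [apply Rle_abs|]. rewrite Rabs_mult. fold A. rewrite <- Rmult_plus_distr_l.
      apply Rmult_le_compat_l; [auto|]. replace y with (y2 + (y - y2)) at 1 by ring.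
      eapply Rle_trans; [apply Rabs_triang|]. rewrite (Rabs_pos_eq (y - y2)) by lra. lra. }
    assert (X2 : profile alpha y <= profile alpha y2) by (apply profile_decreasing; fold y0; lra).
    assert (X3 : lam * cos eta * (profile alpha y - G0) <= c0 * (lam - 1) * (- g1) + c0 * (profile
      alpha y - G0)).
    { assert (T1 : lam * c0 <= lam * cos eta) by (apply Rmult_le_compat_l; lra).
      assert (T2 : lam * cos eta * (profile alpha y - G0) <= lam * c0 * (profile alpha y - G0)) by
        nra.
      assert (T3 : c0 * (lam - 1) * (profile alpha y - G0) <= c0 * (lam - 1) * (- g1)).
      { apply Rmult_le_compat_l; [apply Rmult_le_pos; lra|lra]. }
      lra. }
    specialize (HG3 (y - y2) ltac:(lra)).
    assert (Y1 : exp y2 * exp (y - y2) = exp y) by (rewrite <- exp_plus; f_equal; ring).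
    assert (Y2 : exp (alpha * y2) * exp (alpha * (y - y2)) = exp (alpha * y)) by (rewrite <-
      exp_plus; f_equal; ring).
    rewrite !Rmult_assoc, Y1, Y2 in HG3. unfold profile at 1 in X3.
    assert (X4 : c0 * (profile alpha y - G0) = c0 * exp y - c0 * exp (alpha * y) - c0 * G0) by
      (unfold profile; ring).
    assert (X5 : c0 * (exp y - exp (alpha * y) - G0) = c0 * exp y - c0 * exp (alpha * y) - c0 * G0)
      by ring.
    fold (profile alpha y) in X3. lra.
  - rewrite (is_RInt_unique _ _ _ _ (is_RInt_exp Q 1 y2 b ltac:(lra))).
    apply Rle_trans with (Q * exp (- y2)).
    + rewrite !Rmult_1_l. unfold Rdiv. rewrite Rinv_1, Rmult_1_r. apply Rmult_le_compat_l; [lra|].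
      generalize (exp_pos (- b)); lra.
    + unfold Q, B2. rewrite <- !exp_plus. apply exp_le. lra. }
(* The part near the maximum, in the variable u of [real_substitution]. *)
assert (BM : CInt f y1 y2 = CInt (fun v => K (RtoC v) * Cexp (- (RtoC lam * cis eta * RtoC (v *
  v))))%C (- delta) delta).
{ rewrite <- Eu1, <- Eu2 at 1.
  rewrite (CInt_comp _ u du y1 y2).
  - apply CInt_ext. intros y. rewrite Rmin_left, Rmax_right by lra. intros Hyy.
    destruct (Hsub y ltac:(lra)) as [_ [_ [_ [Z1 Z2]]]].
    unfold f, laplace_integrand. fold y0. fold G0. rewrite Z1. rewrite Cexp_plus. fold K in Z2.
      rewrite <- Z2.
    replace (RtoC lam * cis eta * RtoC (profile alpha y - G0))%C with (- (RtoC lam * cis eta * RtoC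
      (profile alpha y0 - profile alpha y)))%C by (unfold G0; rewrite !RtoC_minus; ring).
    ring.
  - intros y. rewrite Rmin_left, Rmax_right by lra. intros Hyy.
    destruct (Hsub y ltac:(lra)) as [_ [_ [Z _]]].
    apply rcont_mult.
    + apply (rcont_comp K); [|apply rcont_RtoC]. apply (hol_cont _ _ _ HK).
      apply disc_in_square. replace (RtoC (u y) - 0)%C with (RtoC (u y)) by ring. rewrite Cmod_R.
        apply Rabs_def1; lra.
    + apply rcont_Cexp. apply rcont_opp. apply rcont_mult; [apply cont_const|].
      apply cont_RtoC. smooth.
  - intros y. rewrite Rmin_left, Rmax_right by lra. intros Hyy.
    destruct (Hsub y ltac:(lra)) as [Z1 [Z2 _]]. auto. }
specialize (Hmid lam eta Hlam Heta Hcos). rewrite <- BM in Hmid.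
  fold (laplace_sum lam eta N) in Hmid.
rewrite Split.
match goal with |- Cmod ?X <= _ => replace X with
 ((RtoC (sqrt lam) * cis (eta / 2) * CInt f y1 y2 - laplace_sum lam eta N) + RtoC (sqrt lam) * cis
   (eta / 2) * (CInt f (- (kappa alpha * l)) y1 + CInt f y2 b))%C by ring end.
eapply Rle_trans; [apply Cmod_triangle|].
rewrite (Cmod_mult (RtoC (sqrt lam) * cis (eta / 2))), (Cmod_mult (RtoC (sqrt lam))), Cmod_cis,
  Cmod_R, Rabs_pos_eq by apply sqrt_pos.
rewrite Rmult_1_r.
assert (T := Cmod_triangle (CInt f (- (kappa alpha * l)) y1) (CInt f y2 b)).
assert (S1 : sqrt lam * Cmod (CInt f (- (kappa alpha * l)) y1) <= B1 * M1 * (/ lam) ^ N).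
{ apply Rle_trans with (sqrt lam * (B1 * exp ((A + 1) * kappa alpha * l - c0 * g1 * lam)));
  [apply Rmult_le_compat_l; [apply sqrt_pos|auto]|].
  rewrite Hsl. replace (exp (nu / 2 * l) * (B1 * exp ((A + 1) * kappa alpha * l - c0 * g1 * lam)))
    with (B1 * (exp (nu / 2 * l) * exp ((A + 1) * kappa alpha * l - c0 * g1 * lam))) by ring.
  rewrite <- exp_plus, (Rmult_assoc B1 M1). apply Rmult_le_compat_l; [lra|].
  eapply Rle_trans; [|exact HL1]. apply exp_le. right. ring. }
assert (S2 : sqrt lam * Cmod (CInt f y2 b) <= B2 * M2 * (/ lam) ^ N).
{ apply Rle_trans with (sqrt lam * (B2 * exp (- (c0 * g1 * lam)))); [apply Rmult_le_compat_l;
  [apply sqrt_pos|auto]|].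
  rewrite Hsl. replace (exp (nu / 2 * l) * (B2 * exp (- (c0 * g1 * lam)))) with (B2 * (exp (nu / 2
    * l) * exp (- (c0 * g1 * lam)))) by ring.
  rewrite <- exp_plus, (Rmult_assoc B2 M2). apply Rmult_le_compat_l; [lra|].
  eapply Rle_trans; [|exact HL2]. apply exp_le. right. ring. }
assert (S3 : sqrt lam * Cmod (CInt f (- (kappa alpha * l)) y1 + CInt f y2 b)%C <= sqrt lam * (Cmod
  (CInt f (- (kappa alpha * l)) y1) + Cmod (CInt f y2 b))) by (apply Rmult_le_compat_l;
  [apply sqrt_pos|auto]).
lra.
Qed.
End Laplace.

(** * Comparison with the stated prefactors *)

Lemma profile_crit_value alpha : 1 < alpha -> profile alpha (log_crit alpha) = Rpower alpha (- (1 /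
  (alpha - 1))) * (1 - 1 / alpha).
Proof.
intros Ha. change (Rpower alpha (- (1 / (alpha - 1)))) with (exp (log_crit alpha)). unfold profile.
replace (alpha * log_crit alpha) with (log_crit alpha + (alpha - 1) * log_crit alpha) by ring.
  rewrite exp_plus.
assert (K := log_crit_spec alpha Ha).
replace (exp ((alpha - 1) * log_crit alpha)) with (/ alpha).
- field. lra.
- apply Rmult_eq_reg_l with alpha; [|lra]. rewrite K. field. lra.
Qed.

Lemma profile_crit_pos alpha : 1 < alpha -> 0 < profile alpha (log_crit alpha).
Proof.
intros Ha. rewrite profile_crit_value by auto. apply Rmult_lt_0_compat; [apply exp_pos|].
assert (1 / alpha < 1); [|lra]. apply Rmult_lt_reg_r with alpha; [lra|]. unfold Rdiv.
  rewrite Rmult_assoc, Rinv_l by lra. lra.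
Qed.

(** The factor pulled out of the integrand on the ray in [log_integrand_on_ray]. *)
Definition saddle_factor (alpha : R) (beta : C) (theta l : R) : C :=
  Cexp ((beta + 1) * (RtoC (kappa alpha * l) + Ci * RtoC (kappa alpha * theta))
     + cis (eta2 alpha theta) * RtoC (large_param alpha l * profile alpha (log_crit alpha)))%C.

Lemma saddle_factor_mod alpha beta theta l : Cmod (saddle_factor alpha beta theta l) =
  exp ((Re beta + 1) * (kappa alpha * l) - Im beta * (kappa alpha * theta) + cos (eta2 alpha theta)
    * (large_param alpha l * profile alpha (log_crit alpha))).
Proof.
unfold saddle_factor. rewrite Cmod_Cexp. f_equal. rewrite re_plus, re_scal_r, Re_cis.
  destruct beta as [b1 b2]. simpl. ring.
Qed.

Lemma sqrt_large_param alpha l : sqrt (large_param alpha l) = exp (alpha / (alpha - 1) / 2 * l).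
Proof.
unfold large_param. apply sqrt_lem_1; [left; apply exp_pos|left; apply exp_pos|].
rewrite <- exp_plus. f_equal. set (x := alpha / (alpha - 1)). field.
Qed.

Lemma large_param_Rpower alpha r : large_param alpha (ln r) = Rpower r (alpha / (alpha - 1)).
Proof. reflexivity. Qed.

(** The stated prefactor differs from the saddle factor by the constant of the pairings
    and by the Gaussian width sqrt(lam e^(i eta2)). *)
Lemma prefactor_saddle alpha beta theta r : 1 < alpha -> 0 < r ->
  (series_prefactor alpha beta theta r * rot_factor alpha beta theta * (RtoC (sqrt (large_param
    alpha (ln r))) * cis (eta2 alpha theta / 2)))%C
  = saddle_factor alpha beta theta (ln r).
Proof.
intros Ha Hr. set (l := ln r).
unfold series_prefactor, growth_factor, rot_factor, saddle_factor.
rewrite Cpower_pos by auto. fold l. rewrite sqrt_large_param, <- Cexp_R.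
rewrite <- cis_neg_PI2. change (Cexp (Ci * RtoC (eta2 alpha theta)))%C with (cis (eta2 alpha
  theta)).
rewrite <- (profile_crit_value alpha Ha), <- large_param_Rpower. fold l.
rewrite (Rmult_comm (profile alpha (log_crit alpha))).
set (gam := (cis (eta2 alpha theta) * RtoC (large_param alpha l * profile alpha (log_crit
  alpha)))%C).
set (t := ray_angle alpha theta).
assert (Et : t = kappa alpha * theta - PI / (2 * alpha)) by (apply ray_angle_theta; auto).
unfold cis. rewrite <- !Cexp_plus. f_equal.
set (e2 := RtoC (eta2 alpha theta / 2)). rewrite (RtoC_opp (eta2 alpha theta / 2)). fold e2.
rewrite (RtoC_opp (PI / 2)).
assert (Ek : kappa alpha = / (alpha - 1)) by (unfold kappa; field; lra).
replace (RtoC (kappa alpha * theta)) with (RtoC t + RtoC (PI / (2 * alpha)))%C by (rewrite <-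
  RtoC_plus; f_equal; rewrite Et; ring).
assert (Ha1 : RtoC (alpha - 1) <> RtoC 0) by (apply RtoC_neq0; lra).
assert (E1 : (((beta + 1 - RtoC (alpha / 2)) / RtoC (alpha - 1)) * RtoC l + RtoC (alpha / (alpha -
  1) / 2 * l) = (beta + 1) * RtoC (kappa alpha * l))%C).
{ rewrite Ek. rewrite !RtoC_mult, !RtoC_div, RtoC_inv by lra. field. auto. }
transitivity ((beta + 1) * RtoC (kappa alpha * l) + (beta + 1) * (Ci * (RtoC t + RtoC (PI / (2 *
  alpha)))) + gam)%C; [rewrite <- E1; ring|ring].
Qed.

(** The sign (-1)^n of the series cancels the sign in the pairing. *)
Lemma series_term_saddle alpha beta q p d theta psi pinv d' r n : 1 < alpha ->
  real_branch alpha q p d ->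
  0 < theta < PI - PI / alpha -> branch_data alpha theta psi pinv d' -> 0 < r ->
  series_term alpha beta psi pinv r n = (rot_factor alpha beta theta *
   (RtoC (Gamma (INR n + 1 / 2)) * (C_derive_n (2 * n) (amplitude beta q p) 0 / RtoC (INR (fact (2
     * n))))
     * (/ (RtoC (large_param alpha (ln r)) * cis (eta2 alpha theta))) ^ n))%C.
Proof.
intros Ha HB Hth HD Hr. unfold series_term.
rewrite (delta_pairing_transfer alpha beta q p d Ha HB theta psi pinv d' Hth HD).
assert (El : Rpower r (INR n * alpha / (alpha - 1)) = large_param alpha (ln r) ^ n).
{ unfold large_param. rewrite exp_pow_INR. unfold Rpower. f_equal. field. lra. }
rewrite El. set (lam := large_param alpha (ln r)).
assert (Hl : 0 < lam) by apply exp_pos.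
assert (Hl0 : RtoC lam <> RtoC 0) by (apply RtoC_neq0; lra).
assert (Hem := cis_neq0 (eta2 alpha theta)).
assert (S1 : (RtoC ((-1) ^ n) * RtoC ((-1) ^ n) = 1)%C).
{ rewrite <- RtoC_mult, <- Rpow_mult_distr. replace (-1 * -1) with 1 by ring. rewrite pow1.
  reflexivity. }
rewrite !RtoC_mult, RtoC_pow.
rewrite !Cpow_inv by (auto; apply Cmult_neq_0; auto). rewrite Cpow_mult_l.
transitivity ((RtoC ((-1) ^ n) * RtoC ((-1) ^ n)) * (rot_factor alpha beta theta *
  (RtoC (Gamma (INR n + 1 / 2)) * (C_derive_n (2 * n) (amplitude beta q p) 0 / RtoC (INR (fact (2 *
    n)))) * / (RtoC lam ^ n * cis (eta2 alpha theta) ^ n))))%C; [|rewrite S1; ring].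
rewrite !RtoC_pow.
field. repeat split; try apply Cpow_nz; auto. apply RtoC_fact_neq0.
Qed.

(** The value of the amplitude at 0 and Gamma(1/2) = sqrt(PI); eta1 collects all phases. *)
Lemma first_order_saddle alpha beta q p d theta psi pinv d' r : 1 < alpha ->
  real_branch alpha q p d ->
  0 < theta < PI - PI / alpha -> branch_data alpha theta psi pinv d' -> 0 < r ->
  first_order alpha beta theta r = (series_prefactor alpha beta theta r * series_term alpha beta
    psi pinv r 0)%C.
Proof.
intros Ha HB Hth HD Hr.
rewrite (series_term_saddle alpha beta q p d theta psi pinv d' r 0 Ha HB Hth HD Hr).
simpl INR. rewrite Rplus_0_l, Gamma_one_half. simpl C_derive_n.
  rewrite (amplitude_0 alpha beta q p d Ha HB).
unfold first_order, series_prefactor.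
set (gr := growth_factor alpha beta theta r).
assert (HPI := PI_RGT_0).
set (y0 := log_crit alpha). set (rho0 := exp y0). assert (Hrho : 0 < rho0) by apply exp_pos.
assert (Es : sqrt PI / sqrt ((alpha - 1) / (2 * rho0)) = sqrt (2 * PI / (alpha - 1)) * exp (y0 /
  2)).
{ assert (Hq : 0 < (alpha - 1) / (2 * rho0)) by (apply Rdiv_lt_0_compat; lra).
  rewrite <- sqrt_div by lra.
  replace (exp (y0 / 2)) with (sqrt rho0).
  - rewrite <- sqrt_mult_alt by (left; apply Rdiv_lt_0_compat; lra). f_equal. field. lra.
  - apply sqrt_lem_1; [lra|left; apply exp_pos|]. unfold rho0. rewrite <- exp_plus. f_equal.
    field. }
assert (Hsq0 : sqrt ((alpha - 1) / (2 * rho0)) <> 0).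
{ apply Rgt_not_eq, sqrt_lt_R0, Rdiv_lt_0_compat; lra. }
assert (Ek : kappa alpha = / (alpha - 1)) by (unfold kappa; field; lra).
assert (Ha1 : RtoC (alpha - 1) <> RtoC 0) by (apply RtoC_neq0; lra).
assert (Ecp : Cpower (RtoC alpha) ((- RtoC (1 / 2) - beta) / RtoC (alpha - 1)) = (Cexp (beta * RtoC
  y0) * RtoC (exp (y0 / 2)))%C).
{ rewrite Cpower_pos by lra. rewrite <- Cexp_R, <- Cexp_plus. f_equal.
  unfold y0, log_crit. replace (- (1 / (alpha - 1)) * ln alpha / 2) with (- (1 / 2) * (/ (alpha -
    1) * ln alpha)) by (field; lra).
  replace (- (1 / (alpha - 1)) * ln alpha) with (- (/ (alpha - 1) * ln alpha)) by (field; lra).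
  rewrite (RtoC_mult (- (1/2))), !RtoC_opp, RtoC_mult, RtoC_inv by lra. field. auto. }
rewrite Ecp.
assert (Eph : Cexp (Ci * eta1 alpha beta theta)%C = (Cexp (Ci * ((beta + 1) * RtoC (PI / (2 *
  alpha)) + RtoC (PI / 2))) * rot_factor alpha beta theta)%C).
{ unfold rot_factor. rewrite <- cis_neg_PI2. unfold cis. rewrite <- !Cexp_plus. f_equal.
  set (t := ray_angle alpha theta).
  assert (Et : t = kappa alpha * theta - PI / (2 * alpha)) by (apply ray_angle_theta; auto).
  unfold eta1.
  assert (Eeta : eta2 alpha theta / 2 = kappa alpha * theta * (alpha / 2) - PI / 4) by (unfold
    eta2, kappa; field; lra).
  rewrite Eeta.
  replace (RtoC (PI / (2 * alpha))) with (RtoC (kappa alpha * theta) - RtoC t)%C by (rewrite <-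
    RtoC_minus; f_equal; rewrite Et; ring).
  rewrite (RtoC_opp (PI / 2)), (RtoC_opp (kappa alpha * theta * (alpha / 2) - PI / 4)),
    (RtoC_minus (kappa alpha * theta * (alpha / 2))).
  rewrite !RtoC_mult, Ek, RtoC_inv by lra. rewrite (RtoC_div alpha 2) by lra. field. auto. }
rewrite Eph.
replace (fact (2 * 0)) with 1%nat by reflexivity. simpl (RtoC (INR 1)).
replace (RtoC (sqrt (2 * PI / (alpha - 1))) ) with (RtoC (sqrt PI / sqrt ((alpha - 1) / (2 *
  rho0))) * RtoC (/ exp (y0 / 2)))%C.
2:{ rewrite <- RtoC_mult, Es. f_equal. field. apply Rgt_not_eq, exp_pos. }
assert (He : exp (y0 / 2) <> 0) by (apply Rgt_not_eq, exp_pos).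
rewrite (RtoC_div (sqrt PI)) by auto. rewrite (RtoC_inv (exp (y0 / 2))) by auto.
assert (He' : RtoC (exp (y0 / 2)) <> RtoC 0) by (apply RtoC_neq0; auto).
assert (Hs' : RtoC (sqrt ((alpha - 1) / (2 * rho0))) <> RtoC 0) by (apply RtoC_neq0; auto).
simpl (_ ^ 0)%C. field. auto.
Qed.

(** Bounds uniform in theta, above and below, transfer errors between the two
    normalisations. *)
Lemma rot_factor_bounds alpha beta theta : 1 < alpha -> 0 < theta < PI - PI / alpha ->
  exp (- (Rabs (Im beta) * (PI / 2))) <= Cmod (rot_factor alpha beta theta) <= exp (Rabs (Im beta)
    * (PI / 2)).
Proof.
intros Ha Hth. destruct (angles alpha theta Ha Hth) as [Ht _].
unfold rot_factor. rewrite !Cmod_mult, !Cmod_cis, Cmod_opp, Cmod_Ci, !Rmult_1_r, Cmod_Cexp.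
assert (E : Re (beta * (Ci * RtoC (ray_angle alpha theta)))%C = - (Im beta * ray_angle alpha
  theta)) by (destruct beta; simpl; ring).
rewrite E.
assert (B : Rabs (Im beta * ray_angle alpha theta) <= Rabs (Im beta) * (PI / 2)).
{ rewrite Rabs_mult. apply Rmult_le_compat_l; [apply Rabs_pos|lra]. }
assert (B1 := Rle_abs (Im beta * ray_angle alpha theta)). assert (B2 := Rle_abs (- (Im beta *
  ray_angle alpha theta))). rewrite Rabs_Ropp in B2.
split; apply exp_le; lra.
Qed.

(** cos eta2 = sin(alpha/(alpha-1) theta), and on [a,b] the argument stays in a compact
    part of (0, PI). *)
Lemma eta2_uniform alpha a b : 1 < alpha -> 0 < a -> a <= b -> b < PI - PI / alpha ->
  exists c0, 0 < c0 /\ forall theta, a <= theta <= b -> c0 <= cos (eta2 alpha theta).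
Proof.
intros Ha H1 H2 H3. set (nu := alpha / (alpha - 1)).
assert (Hnu : 0 < nu) by (apply Rdiv_lt_0_compat; lra).
assert (Hb : nu * b < PI).
{ apply Rlt_le_trans with (nu * (PI - PI / alpha)); [apply Rmult_lt_compat_l; auto|]. right.
  unfold nu. field. lra. }
destruct (sin_linear_lower (nu * b)) as [k [Hk Hs]]; [split; nra|].
exists (k * (nu * a)). split; [apply Rmult_lt_0_compat; [auto|apply Rmult_lt_0_compat; auto]|].
intros theta Hth. unfold eta2. fold nu.
replace (nu * theta - PI / 2) with (- (PI / 2 - nu * theta)) by ring. rewrite cos_neg, cos_shift.
eapply Rle_trans; [|apply Hs; split; nra]. apply Rmult_le_compat_l; [lra|].
  apply Rmult_le_compat_l; lra.
Qed.

(** The integral over the ray is the limit of the integrals in [laplace_expansion] as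
    the upper end tends to infinity; the remaining part of F is of exponential type in
    R, and negligible after division by the saddle factor. *)
Lemma normalised_expansion alpha beta F q p d a b N : 1 < alpha ->
  is_entire_extension alpha beta F ->
  real_branch alpha q p d -> 0 < a -> a <= b -> b < PI - PI / alpha ->
  exists M R0, 0 <= M /\ 1 <= R0 /\ forall theta r, a <= theta <= b -> R0 <= r ->
  Cmod (RtoC (sqrt (large_param alpha (ln r))) * cis (eta2 alpha theta / 2) *
          (F (RtoC r * cis theta) / saddle_factor alpha beta theta (ln r))
        - laplace_sum beta q p (large_param alpha (ln r)) (eta2 alpha theta) N)%C <= M * (/
          large_param alpha (ln r)) ^ N.
Proof.
intros Ha HF HB H1 H2 H3. assert (HPI := PI_RGT_0).
destruct (eta2_uniform alpha a b Ha H1 H2 H3) as [c0 [Hc0 Hcos]].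
destruct (extension_decomposition alpha beta Ha F HF) as [C0 [C1 [HC0 [HC1 HD]]]].
destruct (laplace_expansion alpha beta q p d Ha HB c0 N Hc0) as [C [l0 [Y [HC [Hl0 HL]]]]].
set (nu := alpha / (alpha - 1)). assert (Hnu : 1 < nu) by (apply nu_gt1; auto).
assert (HG := profile_crit_pos alpha Ha). set (G0 := profile alpha (log_crit alpha)) in *.
assert (Hk : 0 < kappa alpha) by (unfold kappa; apply Rdiv_lt_0_compat; lra).
destruct (negligible (nu / 2 - (Re beta + 1) * kappa alpha) C1 (c0 * G0) nu N HC1) as [M1 [HM1
  HN]]; [nra|auto|].
set (B := C0 * exp (Rabs (Im beta) * (kappa alpha * b))).
assert (HBp : 0 <= B) by (apply Rmult_le_pos; [auto|left; apply exp_pos]).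
exists (C + B * M1), (exp l0).
split; [assert (0 <= B * M1) by (apply Rmult_le_pos; auto); lra|].
split; [rewrite <- exp_0; apply exp_le; auto|].
intros theta r Hth Hr.
assert (Hr0 : 0 < r) by (eapply Rlt_le_trans; [apply exp_pos|exact Hr]).
set (l := ln r).
assert (Hl : l0 <= l) by (unfold l; rewrite <- (ln_exp l0); apply ln_le; [apply exp_pos|auto]).
assert (Hl' : 0 <= l) by lra.
set (lam := large_param alpha l). set (eta := eta2 alpha theta).
assert (Hthr : 0 < theta < PI - PI / alpha) by lra.
destruct (angles alpha theta Ha Hthr) as [_ Heta]. fold eta in Heta.
set (chi := kappa alpha * theta).
assert (Hchi : 0 < chi) by (apply Rmult_lt_0_compat; lra).
assert (Hachi : alpha * chi < PI).
{ unfold chi, kappa. apply Rlt_le_trans with (nu * (PI - PI / alpha)).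
  - replace (alpha * (1 / (alpha - 1) * theta)) with (nu * theta) by (unfold nu; field; lra).
    apply Rmult_lt_compat_l; lra.
  - right. unfold nu. field. lra. }
set (z := (RtoC r * cis theta)%C).
set (f := fun x => log_integrand alpha beta z (x, chi)).
assert (Cf : forall x, rcont f x) by (intros x; apply rcont_log_integrand).
assert (HI := ray_lim alpha beta Ha chi z Hchi Hachi).
specialize (HD chi z Hchi Hachi).
set (I := lim_int (fun x => log_integrand alpha beta z (x, chi))) in *.
set (P := saddle_factor alpha beta theta l).
assert (HP : P <> RtoC 0) by apply Cexp_neq0.
assert (HPm : 0 < Cmod P) by (apply Cmod_gt_0; auto).
set (w := (RtoC (sqrt lam) * cis (eta / 2))%C).
assert (Hw : Cmod w = sqrt lam) by (unfold w; rewrite Cmod_mult, Cmod_cis, Cmod_R,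
  Rabs_pos_eq by apply sqrt_pos; ring).
assert (Hsl : 0 <= sqrt lam) by apply sqrt_pos.
assert (HJ : forall y, CInt f 0 (kappa alpha * l + y) = (P * CInt (laplace_integrand alpha beta lam
  eta) (- (kappa alpha * l)) y)%C).
{ intros y. rewrite <- CInt_scal by (apply contI_forall; intros; apply laplace_integrand_cont).
  replace 0 with (kappa alpha * l + - (kappa alpha * l)) at 1 by ring. rewrite CInt_shift by auto.
  apply CInt_ext. intros s _. apply (log_integrand_on_ray alpha beta theta r s Ha Hr0). }
assert (Main : Cmod (w * (I / P) - laplace_sum beta q p lam eta N)%C <= C * (/ lam) ^ N).
{ apply Rnot_lt_le. intros Hlt.
  set (gap := Cmod (w * (I / P) - laplace_sum beta q p lam eta N)%C - C * (/ lam) ^ N) in *.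
  assert (Hgap : 0 < gap) by (unfold gap; lra).
  destruct (HI (gap / 2 * Cmod P / (sqrt lam + 1))) as [X HX].
  { apply Rdiv_lt_0_compat; [nra|lra]. }
  set (y := Rmax Y (X - kappa alpha * l)).
  assert (Hy1 : Y <= y) by apply Rmax_l. assert (Hy2 : X <= kappa alpha * l + y) by (generalize
    (Rmax_r Y (X - kappa alpha * l)); unfold y; lra).
  specialize (HX _ Hy2). fold f in HX. rewrite HJ in HX.
  assert (HLy := HL l eta y Hl (Rlt_le _ _ Heta) (Hcos theta Hth) Hy1). fold lam w in HLy.
  set (J := CInt (laplace_integrand alpha beta lam eta) (- (kappa alpha * l)) y) in *.
  assert (T : Cmod (w * (I / P) - laplace_sum beta q p lam eta N)%C <= Cmod (w * J - laplace_sum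
    beta q p lam eta N)%C + sqrt lam * (Cmod (P * J - I)%C / Cmod P)).
  { replace (w * (I / P) - laplace_sum beta q p lam eta N)%C with ((w * J - laplace_sum beta q p
    lam eta N) + - (w * ((P * J - I) / P)))%C by (field; auto).
    eapply Rle_trans; [apply Cmod_triangle|]. rewrite Cmod_opp, Cmod_mult, Hw, Cmod_div by auto.
      lra. }
  assert (T2 : sqrt lam * (Cmod (P * J - I)%C / Cmod P) <= gap / 2).
  { apply Rle_trans with (sqrt lam * (gap / 2 / (sqrt lam + 1))).
    - apply Rmult_le_compat_l; auto. apply Rmult_le_reg_r with (Cmod P); auto. unfold Rdiv at 1.
      rewrite Rmult_assoc, Rinv_l by lra.
      rewrite Rmult_1_r. eapply Rle_trans; [exact HX|]. right. field. lra.
    - apply Rmult_le_reg_r with (sqrt lam + 1); [lra|].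
      replace (sqrt lam * (gap / 2 / (sqrt lam + 1)) * (sqrt lam + 1)) with (sqrt lam * (gap / 2))
        by (field; lra). nra. }
  unfold gap in *. lra. }
assert (Hz : Cmod z = exp l) by (unfold z, l; rewrite Cmod_mult, Cmod_cis, Cmod_R, Rabs_pos_eq,
  exp_ln by lra; ring).
assert (Err : Cmod (w * ((F z - I) / P))%C <= B * M1 * (/ lam) ^ N).
{ rewrite Cmod_mult, Hw, Cmod_div by auto.
  assert (EP : Cmod P = exp ((Re beta + 1) * (kappa alpha * l) - Im beta * chi + cos eta * (lam *
    G0))) by apply saddle_factor_mod.
  rewrite Hz in HD. unfold lam at 1. rewrite sqrt_large_param. fold nu.
  apply Rle_trans with (exp (nu / 2 * l) * (C0 * exp (C1 * exp l) / Cmod P)).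
  { apply Rmult_le_compat_l; [left; apply exp_pos|]. apply Rmult_le_compat_r; [left;
    apply Rinv_0_lt_compat; auto|exact HD]. }
  rewrite EP. unfold Rdiv at 2. rewrite <- exp_Ropp. unfold B.
  replace (exp (nu / 2 * l) * (C0 * exp (C1 * exp l) * exp (- ((Re beta + 1) * (kappa alpha * l) -
    Im beta * chi + cos eta * (lam * G0)))))
   with (C0 * (exp (nu / 2 * l) * (exp (C1 * exp l) * exp (- ((Re beta + 1) * (kappa alpha * l) -
     Im beta * chi + cos eta * (lam * G0)))))) by ring.
  rewrite !(Rmult_assoc C0). apply Rmult_le_compat_l; auto. rewrite <- !exp_plus.
  specialize (HN l Hl'). change (exp (nu * l)) with lam in HN.
  apply Rle_trans with (exp (Rabs (Im beta) * (kappa alpha * b)) * exp ((nu / 2 - (Re beta + 1) *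
    kappa alpha) * l + C1 * exp l - c0 * G0 * lam)).
  - rewrite <- exp_plus. apply exp_le.
    assert (X1 : Im beta * chi <= Rabs (Im beta) * (kappa alpha * b)).
    { apply Rle_trans with (Rabs (Im beta) * chi); [apply Rmult_le_compat_r; [lra|apply Rle_abs]|].
      apply Rmult_le_compat_l; [apply Rabs_pos|]. unfold chi. apply Rmult_le_compat_l; lra. }
    assert (X2 : c0 * (lam * G0) <= cos eta * (lam * G0)).
    { apply Rmult_le_compat_r; [|apply Hcos; auto]. apply Rmult_le_pos; [left; apply exp_pos|lra]. }
    lra.
  - rewrite (Rmult_assoc (exp (Rabs (Im beta) * (kappa alpha * b))) M1).
    apply Rmult_le_compat_l; [left; apply exp_pos|exact HN]. }
replace (w * (F z / P) - laplace_sum beta q p lam eta N)%C with ((w * (I / P) - laplace_sum beta q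
  p lam eta N) + w * ((F z - I) / P))%C by (field; auto).
eapply Rle_trans; [apply Cmod_triangle|]. lra.
Qed.

Theorem mainTheorem3 (alpha : R) (beta : C) (F : C -> C)
    (psi psi_inv : R -> C -> C)
    (halpha : 1 < alpha)
    (hF : is_entire_extension alpha beta F)
    (hpsi : forall theta : R, 0 < theta < PI - PI / alpha ->
       is_sqrt_branch alpha theta (psi theta) /\
       is_local_inverse alpha theta (psi theta) (psi_inv theta)) :
  forall a b : R, 0 < a -> a <= b -> b < PI - PI / alpha ->
    (forall N : nat, exists M R0 : R, 0 < R0 /\
       forall theta r : R, a <= theta <= b -> R0 <= r ->
         Cmod (F (RtoC r * Cexp (Ci * RtoC theta))
                 / series_prefactor alpha beta theta r
               - Csum (series_term alpha beta (psi theta) (psi_inv theta) r) N)%C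
         <= M * Rpower r (- (INR N * alpha / (alpha - 1))))
    /\
    (forall eps : R, 0 < eps -> exists R0 : R, 0 < R0 /\
       forall theta r : R, a <= theta <= b -> R0 <= r ->
         Cmod (F (RtoC r * Cexp (Ci * RtoC theta))
                 / first_order alpha beta theta r - 1)%C < eps).
Proof.
intros a b H1 H2 H3.
(* The branch psi at the base angle supplies the real branch used for all theta. *)
destruct (hpsi (theta_base alpha) (theta_base_range alpha halpha)) as [S1 S2].
destruct (branch_data_exists _ _ _ _ S1 S2) as [d HD0].
assert (HB := base_branch alpha _ _ d halpha HD0).
set (q := fun z => (- Ci * psi (theta_base alpha) z)%C) in *.
set (p := fun w => psi_inv (theta_base alpha) (Ci * w)%C) in *.
set (rb := exp (Rabs (Im beta) * (PI / 2))).
assert (Hrb : 0 < rb) by apply exp_pos.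
assert (Part1 : forall N : nat, exists M R0 : R, 0 <= M /\ 0 < R0 /\
       forall theta r : R, a <= theta <= b -> R0 <= r ->
         Cmod (F (RtoC r * Cexp (Ci * RtoC theta))
                 / series_prefactor alpha beta theta r
               - Csum (series_term alpha beta (psi theta) (psi_inv theta) r) N)%C
         <= M * Rpower r (- (INR N * alpha / (alpha - 1)))).
{ intros N.
  destruct (normalised_expansion alpha beta F q p d a b N halpha hF HB H1 H2 H3) as [M [R0 [HM [HR0
    HE]]]].
  exists (rb * M), R0. split; [apply Rmult_le_pos; lra|]. split; [lra|].
  intros theta r Hth Hr. assert (Hr0 : 0 < r) by lra.
  assert (Hthr : 0 < theta < PI - PI / alpha) by lra.
  destruct (hpsi theta Hthr) as [T1 T2]. destruct (branch_data_exists _ _ _ _ T1 T2) as [d' HD].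
  specialize (HE theta r Hth Hr).
  assert (Epre := prefactor_saddle alpha beta theta r halpha Hr0).
  assert (Hn := rot_factor_bounds alpha beta theta halpha Hthr). fold rb in Hn.
  set (c := rot_factor alpha beta theta) in *. set (P := saddle_factor alpha beta theta (ln r)) in
    *.
  assert (HP : P <> RtoC 0) by apply Cexp_neq0.
  set (w := (RtoC (sqrt (large_param alpha (ln r))) * cis (eta2 alpha theta / 2))%C) in *.
  set (pre := series_prefactor alpha beta theta r) in *.
  assert (Hpre : pre <> RtoC 0) by (intros X; apply HP; rewrite <- Epre, X; ring).
  assert (Hw0 : w <> RtoC 0) by (intros X; apply HP; rewrite <- Epre, X; ring).
  assert (Hc0 : c <> RtoC 0) by (intros X; apply HP; rewrite <- Epre, X; ring).
  assert (Esum : Csum (series_term alpha beta (psi theta) (psi_inv theta) r) N = (c * laplace_sum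
    beta q p (large_param alpha (ln r)) (eta2 alpha theta) N)%C).
  { unfold laplace_sum. rewrite Csum_scal. apply Csum_ext. intros n _.
    apply (series_term_saddle alpha beta q p d theta _ _ d' r n halpha HB Hthr HD Hr0). }
  rewrite Esum. fold (cis theta).
  replace (F (RtoC r * cis theta) / pre)%C with (c * (w * (F (RtoC r * cis theta) / P)))%C.
  2:{ rewrite <- Epre. field. auto. }
  match goal with |- Cmod ?X <= _ => replace X with (c * (w * (F (RtoC r * cis theta) / P) -
    laplace_sum beta q p (large_param alpha (ln r)) (eta2 alpha theta) N))%C by ring end.
  rewrite Cmod_mult.
  replace (Rpower r (- (INR N * alpha / (alpha - 1)))) with ((/ large_param alpha (ln r)) ^ N).
  2:{ unfold large_param, Rpower. rewrite <- exp_Ropp, exp_pow_INR. f_equal. field. lra. }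
  rewrite Rmult_assoc. apply Rmult_le_compat; try apply Cmod_ge_0; [apply Hn|exact HE]. }
split.
- intros N. destruct (Part1 N) as [M [R0 [_ H]]]. exists M, R0. exact H.
- intros eps Heps.
  (* The quotient tends to 1 because the first term of the series is bounded below
      uniformly in theta, while the expansion with N = 1 has error O(1/r). *)
  destruct (Part1 1%nat) as [M [R0 [HM [HR0 HE]]]].
  set (nu := alpha / (alpha - 1)). assert (Hnu : 1 < nu) by (apply nu_gt1; auto).
  set (A0 := (Cexp (beta * RtoC (log_crit alpha)) / RtoC (sqrt ((alpha - 1) / (2 * exp (log_crit
    alpha)))))%C).
  assert (HA0 : amplitude beta q p (RtoC 0) = A0) by apply (amplitude_0 alpha beta q p d halpha HB).
  assert (HPI := PI_RGT_0).
  assert (Hs : 0 < sqrt ((alpha - 1) / (2 * exp (log_crit alpha)))).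
  { apply sqrt_lt_R0, Rdiv_lt_0_compat; [lra|]. generalize (exp_pos (log_crit alpha)); lra. }
  assert (HA0n : A0 <> RtoC 0).
  { unfold A0, Cdiv. apply Cmult_neq_0; [apply Cexp_neq0|]. intros X.
    assert (Y : (RtoC (sqrt ((alpha - 1) / (2 * exp (log_crit alpha)))) * / RtoC (sqrt ((alpha - 1)
      / (2 * exp (log_crit alpha)))) = 1)%C).
    { apply Cinv_r. intros Z. apply RtoC_inj in Z. lra. }
    rewrite X, Cmult_0_r in Y. apply C1_nz. symmetry. exact Y. }
  assert (HA0p : 0 < Cmod A0) by (apply Cmod_gt_0; auto).
  set (m0 := exp (- (Rabs (Im beta) * (PI / 2))) * (sqrt PI * Cmod A0)).
  assert (Hsp : 0 < sqrt PI) by (apply sqrt_lt_R0; auto).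
  assert (Hm0 : 0 < m0) by (apply Rmult_lt_0_compat; [apply exp_pos|apply Rmult_lt_0_compat; auto]).
  exists (Rmax R0 (M / (m0 * eps) + 1)). split; [eapply Rlt_le_trans; [exact HR0|apply Rmax_l]|].
  intros theta r Hth Hr.
  assert (Hr1 : R0 <= r) by (eapply Rle_trans; [apply Rmax_l|exact Hr]).
  assert (Hr2 : M / (m0 * eps) + 1 <= r) by (eapply Rle_trans; [apply Rmax_r|exact Hr]).
  assert (Hme : 0 < m0 * eps) by (apply Rmult_lt_0_compat; auto).
  assert (HMe : 0 <= M / (m0 * eps)) by (apply Rmult_le_pos; [auto|left; apply Rinv_0_lt_compat;
    auto]).
  assert (Hr0 : 0 < r) by lra.
  assert (Hthr : 0 < theta < PI - PI / alpha) by lra.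
  destruct (hpsi theta Hthr) as [T1 T2]. destruct (branch_data_exists _ _ _ _ T1 T2) as [d' HD].
  specialize (HE theta r Hth Hr1).
  rewrite (first_order_saddle alpha beta q p d theta _ _ d' r halpha HB Hthr HD Hr0).
  assert (Epre := prefactor_saddle alpha beta theta r halpha Hr0).
  assert (Hn := rot_factor_bounds alpha beta theta halpha Hthr).
  assert (Est := series_term_saddle alpha beta q p d theta _ _ d' r 0 halpha HB Hthr HD Hr0).
  rewrite Csum_S, Csum_0, Cplus_0_l in HE.
  set (t0 := series_term alpha beta (psi theta) (psi_inv theta) r 0) in *.
  assert (Et0 : t0 = (rot_factor alpha beta theta * (RtoC (sqrt PI) * A0))%C).
  { rewrite Est. simpl INR. rewrite Rplus_0_l, Gamma_one_half.
    change (C_derive_n (2 * 0) (amplitude beta q p) 0) with (amplitude beta q p (RtoC 0)).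
    rewrite HA0. change (fact (2 * 0)) with 1%nat. simpl INR. simpl (_ ^ 0)%C. field. }
  assert (Ht0 : m0 <= Cmod t0).
  { rewrite Et0, !Cmod_mult, Cmod_R, (Rabs_pos_eq (sqrt PI)) by lra. unfold m0.
    apply Rmult_le_compat_r; [|apply Hn].
    apply Rmult_le_pos; [lra|apply Cmod_ge_0]. }
  assert (Ht0n : t0 <> RtoC 0) by (apply Cmod_gt_0; lra).
  set (P := saddle_factor alpha beta theta (ln r)) in *.
  assert (HP : P <> RtoC 0) by apply Cexp_neq0.
  set (pre := series_prefactor alpha beta theta r) in *.
  assert (Hpre : pre <> RtoC 0) by (intros X; apply HP; rewrite <- Epre, X; ring).
  match goal with |- Cmod ?X < _ => replace X with ((F (RtoC r * Cexp (Ci * RtoC theta)) / pre -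
    t0) / t0)%C by (field; auto) end.
  rewrite Cmod_div by auto.
  assert (Hrn : Rpower r (- (INR 1 * alpha / (alpha - 1))) <= / r).
  { rewrite Rpower_Ropp. apply Rinv_le_contravar; auto.
    rewrite <- (Rpower_1 r Hr0) at 1. unfold Rpower. apply exp_le.
    assert (0 <= ln r) by (rewrite <- ln_1; apply ln_le; lra).
    apply Rmult_le_compat_r; auto. simpl INR. fold nu. unfold nu in Hnu. unfold Rdiv in *. lra. }
  assert (B1 : Cmod (F (RtoC r * Cexp (Ci * RtoC theta)) / pre - t0)%C <= M * / r).
  { eapply Rle_trans; [exact HE|]. apply Rmult_le_compat_l; auto. }
  assert (B2 : M * / r < m0 * eps).
  { apply Rmult_lt_reg_r with r; auto. rewrite Rmult_assoc, Rinv_l, Rmult_1_r by lra.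
    replace M with (m0 * eps * (M / (m0 * eps))) by (field; split; lra).
      apply Rmult_lt_compat_l; auto. lra. }
  apply Rmult_lt_reg_r with (Cmod t0); [lra|].
  unfold Rdiv. rewrite Rmult_assoc, Rinv_l, Rmult_1_r by lra.
  eapply Rle_lt_trans; [exact B1|]. eapply Rlt_le_trans; [exact B2|].
  rewrite Rmult_comm. apply Rmult_le_compat_l; lra.
Qed.
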